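(* Let $s\in(0,1]$, $l>0$, $p=(-d,-a)$ and $q=(d,a)$ with $d\ge0$ and $a\in(0,l/2)$. Then there exists $\tau\in(1,2]$ such that, for every size function $\sigma(\varepsilon)>0$ satisfying, as $\varepsilon\to0$, $\sigma(\varepsilon)/\varepsilon\le C$ for a fixed $C>0$ and $\varepsilon^\tau/\sigma(\varepsilon)\to 0$, there exist $\varepsilon_0>0$ and a (large) constant $L>0$ such that for every $\varepsilon\in(0,\varepsilon_0)$ the gSQG equation has a travelling-wave solution, $l$-periodic in $x_2$, of the form $\vartheta_\varepsilon(x,t)=\vartheta_{0,\varepsilon}(x-t\mathbf U_\varepsilon)$ with $\mathbf U_\varepsilon\in\mathbb R^2$, where $\vartheta_{0,\varepsilon}\in C^1(\mathbb R^2)$ has the form $$\vartheta_{0,\varepsilon}(x)=\sum_{k\in\mathbb Z}\vartheta_{1,\varepsilon}(x+kl\boldsymbol e_2)-\sum_{k\in\mathbb Z}\vartheta_{2,\varepsilon}(x+kl\boldsymbol e_2),$$ with $\mathrm{supp}(\vartheta_{1,\varepsilon})\subset B_{L\varepsilon}(p)$ and $\mathrm{supp}(\vartheta_{2,\varepsilon})\subset B_{L\sigma(\varepsilon)}(q)$. The travelling speed satisfies $$\mathbf U_\varepsilon=\mathcal C_s\lim_{N\to\infty}\sum_{|k|\le N}\frac{(p-q+kl\boldsymbol e_2)^\perp}{|p-q+kl\boldsymbol e_2|^{4-2s}}+o_\varepsilon(1)\qquad\text{as }\varepsilon\to0.$$ Moreover, in the sense of measures, $$\vartheta_{0,\varepsilon}(x)\rightharpoonup\sum_{k\in\mathbb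 Z}\boldsymbol\delta_{p}(x+kl\boldsymbol e_2)-\sum_{k\in\mathbb Z}\boldsymbol\delta_{q}(x+kl\boldsymbol e_2)\qquad\text{as }\varepsilon\to0.$$
   Context: The generalized surface quasi-geostrophic (gSQG) equation with parameter $0<s\le1$ is $$\partial_t\vartheta+\mathbf v\cdot\nabla\vartheta=0,\qquad \mathbf v=\nabla^\perp\psi,\qquad \psi=(-\Delta)^{-s}\vartheta\qquad\text{in }\mathbb R^2,$$ where $(x_1,x_2)^\perp=(x_2,-x_1)$, $\nabla^\perp=(\partial_{x_2},-\partial_{x_1})$ and $(-\Delta)^{-s}\vartheta(x)=\int_{\mathbb R^2}G_s(x-y)\vartheta(y)\,dy$, with $G_s(x)=\frac1{2\pi}\ln\frac1{|x|}$ if $s=1$ and $G_s(x)=c_s|x|^{2s-2}$, $c_s=\frac{\Gamma(1-s)}{2^{2s}\pi\Gamma(s)}$, if $0<s<1$. The case $s=1$ is the 2D incompressible Euler equation in vorticity form. For functions that are $l$-periodic in $x_2$, the stream function is understood through the periodized kernel $\sum_{k\in\mathbb Z}G_s(x+kl\boldsymbol e_2)$ acting on one period $\mathbb R\times(-l/2,l/2)$, the sum over periods being taken as the limit of the symmetric partial sums $|k|\le N$ of the combined contribution of the positive and negative vortices. A function $\vartheta_0(x-t\mathbf U)$ is a travelling-wave solution when $(\nabla^\perp\psi_0-\mathbf U)\cdot\nabla\vartheta_0=0$ in $\mathbb R^2$, with $\psi_0=(-\Delta)^{-s}\vartheta_0$. Constants: $\mathcal C_s=\frac1{2\pi}$ if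 $s=1$, and $\mathcal C_s=(2-2s)c_s$ if $0<s<1$. $\boldsymbol e_2=(0,1)$; $B_r(z)$ is the open disc of radius $r$ centred at $z$; $\boldsymbol\delta_z$ is the Dirac measure at $z$ (so $\boldsymbol\delta_p(x+kl\boldsymbol e_2)$ is the Dirac measure at $p-kl\boldsymbol e_2$); $o_\varepsilon(1)$ denotes a quantity tending to $0$ as $\varepsilon\to0$. The functions $\vartheta_{1,\varepsilon},\vartheta_{2,\varepsilon}$ belong to $C^1(\mathbb R^2)$. *)

(* Defs.v *)
From HB Require Import structures.
From mathcomp Require Import all_boot all_order all_algebra.
From mathcomp Require Import all_classical all_reals all_analysis.

Set Implicit Arguments.
Unset Strict Implicit.
Unset Printing Implicit Defensive.

Import Order.TTheory GRing.Theory Num.Theory.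
Import numFieldNormedType.Exports.

Local Open Scope classical_set_scope.
Local Open Scope ring_scope.

Section plane.
Context {R : realType}.
Implicit Types (x y z : (R * R)%type) (f : (R * R)%type -> R).

Definition e1 : (R * R)%type := (1, 0).
Definition e2 : (R * R)%type := (0, 1).

Definition perp x : (R * R)%type := (x.2, - x.1).
Definition dotp x y : R := x.1 * y.1 + x.2 * y.2.

(* The library norm on R * R is the sup norm; discs and kernels are Euclidean. *)
Definition enorm x : R := Num.sqrt (dotp x x).
Definition disc (r : R) z : set (R * R) := [set x | enorm (x - z) < r].

Definition supp f : set (R * R) := closure [set x | f x != 0].

Definition grad f x : (R * R)%type := ('D_e1 f x, 'D_e2 f x).

Definition C1 f : Prop :=
  [/\ forall x, derivable f x e1, forall x, derivable f x e2,
      continuous ('D_e1 f) & continuous ('D_e2 f)].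

Definition area := (@lebesgue_measure R \x @lebesgue_measure R)%E.

Definition test_function f : Prop := continuous f /\ compact (supp f).

End plane.

(* Partial sum over the integers k with |k| <= N. *)
Definition symsum (V : nmodType) (F : int -> V) (N : nat) : V :=
  \sum_(i < N.*2.+1) F (i%:Z - N%:Z).

Section gSQG.
Context {R : realType}.
Implicit Types (s l : R) (p q x U : (R * R)%type) (theta : (R * R)%type -> R).

Definition Gamma (z : R) : R :=
  \int[@lebesgue_measure R]_(t in `]0, +oo[) (t `^ (z - 1) * expR (- t)).

Definition c_ s : R := Gamma (1 - s) / (2 `^ (2 * s) * pi * Gamma s).

Definition calC s : R :=
  if s == 1 then (2 * pi)^-1 else (2 - 2 * s) * c_ s.

Definition G_ s x : R :=
  if s == 1 then (2 * pi)^-1 * ln ((enorm x)^-1)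
  else c_ s * enorm x `^ (2 * s - 2).

Definition period l (k : int) : (R * R)%type := (k%:~R * l) *: e2.

Definition strip l : set (R * R) := [set y | - (l / 2) < y.2 < l / 2].

(* psi = (-Delta)^{-s} theta for theta l-periodic in x_2.  The integral is over
   one full period, so each partial sum already combines the positive and the
   negative vortices; only this combination need have a limit as N grows. *)
Definition is_stream s l theta (psi : (R * R)%type -> R) : Prop :=
  (forall x k, (@area R).-integrable (strip l)
     (fun y => (G_ s (x - y + period l k) * theta y)%:E)) /\
  (forall x, symsum (fun k => \int[@area R]_(y in strip l)
      (G_ s (x - y + period l k) * theta y)) N @[N --> \oo] --> psi x).

Definition periodic2 l theta : Prop := forall x, theta (x + l *: e2) = theta x.

(* theta (x - t U) is a travelling-wave solution of the gSQG equation. *)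
Definition travelling_wave s l theta U : Prop :=
  exists psi : (R * R)%type -> R,
    [/\ is_stream s l theta psi,
        forall x, differentiable psi x &
        forall x, dotp (perp (grad psi x) - U) (grad theta x) = 0].

(* For theta of bounded support only finitely many terms are nonzero at each x,
   so the finite-support sum below is the full sum over k. *)
Definition periodize l theta x : R :=
  \sum_(k \in [set: int]) theta (x + period l k).

(* Pairing of the measure sum_k delta_z (x + k l e2) with phi; the k-th term is
   the Dirac mass at z - k l e2.  Finitely many terms are nonzero when phi has
   compact support. *)
Definition dirac_comb l (z : (R * R)%type) (phi : (R * R)%type -> R) : R :=
  \sum_(k \in [set: int]) \int[\d_(z - period l k)]_y phi y.

Definition speed_sum s l p q : nat -> (R * R)%type :=
  symsum (fun k => (enorm (p - q + period l k) `^ (4 - 2 * s))^-1 *: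
                   perp (p - q + period l k)).

End gSQG.

(* Main.v *)
(* With w a vortex of unit scale, the ansatz theta_1 (x) = w ((x - p) / r) / (m r^2) and
   theta_2 (x) = theta_1 (- x), with the same scale r = min (e, sigma e) for both vortices,
   makes the stream function odd.  In the variable y = (x - p) / r it is proportional to
   conv w + field w, where the field of all the other vortices is, up to a constant, the linear
   function of slope 2 m (E / r) S with E = r^(4 - 2 s) and a remainder with Lipschitz constant
   O(E) = O(r^2): the terms k and - k of the lattice sum are paired, which makes it converge
   like the sum of the 1 / k^2.  The linear function is absorbed by the travelling speed U.
   The equation thus asks for a w such that the gradients of w and of
   conv w + Rop w + dotp b are parallel, for a small perturbation Rop and an unknown drift b.
   It is solved near the radial vortex W0 = omega (|y|^2), in the form w = omega (|y|^2 + xi),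
   by a fixed point: xi is chosen such that the level sets of the stream function and
   of |y|^2 + xi coincide.  The linearisation contracts because, on functions odd under a
   reflection, the radial kernel has a strictly positive minorant; the translations, its only
   neutral directions, are compensated by b.  The drift b is O(E), hence a speed O(r) in the
   original variables.  The level sets, not the profile, being the unknown, the vortex inherits the
   C^1 regularity of its stream function. *)
Require Import Defs.
From HB Require Import structures.
From mathcomp Require Import all_boot all_order all_algebra.
From mathcomp Require Import all_classical all_reals all_analysis.
From mathcomp Require Import measurable_realfun.
From mathcomp Require Import zify ring lra.
Set Implicit Arguments.
Unset Strict Implicit.
Unset Printing Implicit Defensive.
Import Order.TTheory GRing.Theory Num.Theory.
Import numFieldNormedType.Exports.
Local Open Scope classical_set_scope.
Local Open Scope ring_scope.

(* lra inspects every hypothesis: the quantified ones are dropped first. *)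
Ltac linarith := repeat match goal with
  | H : forall _, _ |- _ => match type of H with ?P => match type of P with Prop => clear H end end
  end; lra.

(** * Area-preserving maps and integrals over the plane *)

(** For s <= 1/2 the gradient of the kernel is not locally integrable: a derivative of the stream
    function has to fall on the vorticity, and convolution does not turn bounded functions into
    Lipschitz ones. An iteration on the vorticity would lose regularity, so the iterates are only
    bounded and Lipschitz, with constants that the map reproduces, and differentiability is
    recovered once, at the fixed point. In place of a smoothing estimate, [kap] is split into a
    kernel of bounded slope, which turns sup bounds into Lipschitz bounds, and a kernel of small
    mass. Accordingly two states are compared by three numbers: a reflection seminorm a, which
    contracts; a sup bound c for what escapes it; and r for the drift. A large weight K on c pays
    for the passage from c to a. Rotation invariance is used through reflections only, in place of
    Fourier series in the angle. The freedom to relabel level sets is removed by fixing the labels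
    on the ray of [e1], and the translations are removed by an orthogonality condition; the drift is
    chosen so that this condition is preserved. *)

Section measure_preserving.
Context d (X : measurableType d) (R : realType).
Variables (m : {measure set X -> \bar R}) (T : X -> X).
Hypothesis mT : measurable_fun setT T.
Hypothesis pT : forall A, measurable A -> m (T @^-1` A) = m A.

Lemma ge0_integral_preserving (g : X -> \bar R) : measurable_fun setT g ->
  (forall x, (0 <= g x)%E) -> (\int[m]_x g (T x) = \int[m]_x g x)%E.
Proof.
move=> mg g0; have := ge0_integral_pushforward mT m measurableT mg.
rewrite preimage_setT => <-//.
by apply: eq_measure_integral => A mA _; rewrite -[RHS]pT.
Qed.

(** The integrals of the positive and of the negative part are preserved separately in the extended
    reals, so measurability suffices. *)
Lemma Rintegral_preserving (f : X -> R) :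
  measurable_fun setT f -> \int[m]_x f (T x) = \int[m]_x f x.
Proof.
move=> mf; rewrite /Rintegral; congr fine.
have mEf : measurable_fun setT (EFin \o f) by exact/measurable_EFinP.
rewrite integralE [RHS]integralE; congr (_ - _)%E.
- have mp : measurable_fun setT ((EFin \o f)^\+)%E by exact: measurable_funepos.
  by rewrite -(ge0_integral_preserving mp)//; apply: eq_integral => x _; rewrite !funeposE.
- have mn : measurable_fun setT ((EFin \o f)^\-)%E by exact: measurable_funeneg.
  by rewrite -(ge0_integral_preserving mn)//; apply: eq_integral => x _; rewrite !funenegE.
Qed.

Lemma integrable_preserving (f : X -> R) :
  m.-integrable setT (EFin \o f) -> m.-integrable setT (EFin \o (f \o T)).
Proof.
move=> /integrableP[mf foo]; apply/integrableP; split.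
  exact: (measurableT_comp mf mT).
rewrite (@ge0_integral_preserving (fun x => `|(EFin \o f) x|)%E)//.
exact: measurableT_comp.
Qed.

End measure_preserving.

Section measure_scaling.
Context d (X : measurableType d) (R : realType).
Variables (m : {measure set X -> \bar R}) (T : X -> X) (k : R).
Hypothesis mT : measurable_fun setT T.
Hypothesis k0 : 0 <= k.
Hypothesis pT : forall A, measurable A -> m (T @^-1` A) = (k%:E * m A)%E.

Lemma ge0_integral_scaling (g : X -> \bar R) : measurable_fun setT g ->
  (forall x, (0 <= g x)%E) -> (\int[m]_x g (T x) = k%:E * \int[m]_x g x)%E.
Proof.
move=> mg g0; have := ge0_integral_pushforward mT m measurableT mg.
rewrite preimage_setT => <-//.
transitivity (\int[mscale (NngNum k0) m]_x g x)%E; last first.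
  by rewrite ge0_integral_mscale.
by apply: eq_measure_integral => A mA _; exact: pT.
Qed.

Lemma Rintegral_scaling (f : X -> R) : m.-integrable setT (EFin \o f) ->
  \int[m]_x f (T x) = k * \int[m]_x f x.
Proof.
move=> fi; have mEf := measurable_int m fi.
rewrite /Rintegral integralE [in RHS]integralE.
have mp : measurable_fun setT ((EFin \o f)^\+)%E by exact: measurable_funepos.
have mn : measurable_fun setT ((EFin \o f)^\-)%E by exact: measurable_funeneg.
have -> : (\int[m]_x (fun x0 => (f (T x0))%:E)^\+ x = k%:E * \int[m]_x (EFin \o f)^\+ x)%E.
  by rewrite -(ge0_integral_scaling mp)//; apply: eq_integral => x _; rewrite !funeposE.
have -> : (\int[m]_x (fun x0 => (f (T x0))%:E)^\- x = k%:E * \int[m]_x (EFin \o f)^\- x)%E.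
  by rewrite -(ge0_integral_scaling mn)//; apply: eq_integral => x _; rewrite !funenegE.
have fp : (\int[m]_x ((EFin \o f)^\+)%E x)%E \is a fin_num := integrable_pos_fin_num measurableT fi.
have fn : (\int[m]_x ((EFin \o f)^\-)%E x)%E \is a fin_num := integrable_neg_fin_num measurableT fi.
have fineB (a b : \bar R) : a \is a fin_num -> b \is a fin_num ->
    fine (k%:E * a - k%:E * b)%E = k * fine (a - b)%E.
  by case: a b => [a| |] [b| |]//= _ _; rewrite mulrBr.
exact: fineB.
Qed.

End measure_scaling.

Section plane_measure.
Context {R : realType}.
Notation mu := (@area R).
Notation leb := (@lebesgue_measure R).
Notation Q := (measurableTypeR R * measurableTypeR R)%type.

(** The measurable sets are generated by rectangles, so second countability is the point: [U] is the
    union of those products of balls with rational centres and radii 1/(n+1) that it contains. *)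
Lemma open_measurable_plane (U : set (R * R)) : open U -> measurable U.
Proof.
move=> oU.
pose B (q : rat * rat * nat) : set (R * R) :=
  ball (ratr q.1.1 : R) q.2.+1%:R^-1 `*` ball (ratr q.1.2 : R) q.2.+1%:R^-1.
pose I := [set q : rat * rat * nat | B q `<=` U].
have -> : U = \bigcup_(q in I) B q.
  apply/seteqP; split; last by move=> x [q Iq Bx]; exact: Iq.
  move=> [x y] Uxy.
  have := open_nbhs_nbhs (conj oU Uxy).
  move/nbhs_ballP => [e /= e0 be].
  have [n nP] : exists n : nat, n.+1%:R^-1 < e / 2.
    have e20 : 0 < e / 2 by rewrite divr_gt0.
    exists (Num.truncn (e / 2)^-1).
    rewrite -[ltRHS]invrK ltf_pV2 ?posrE ?invr_gt0//.
    exact: truncnS_gt.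
  have n0 : (0 : R) < n.+1%:R^-1 by rewrite invr_gt0.
  have [q1 q1P] : exists q : rat, ball (ratr q : R) n.+1%:R^-1 x.
    have [|r [/= rb [q _ rq]]] := @dense_rat R (ball x n.+1%:R^-1) _ (ball_open _ _).
      by exists x; exact: ballxx.
    by exists q; rewrite rq; apply: ball_sym.
  have [q2 q2P] : exists q : rat, ball (ratr q : R) n.+1%:R^-1 y.
    have [|r [/= rb [q _ rq]]] := @dense_rat R (ball y n.+1%:R^-1) _ (ball_open _ _).
      by exists y; exact: ballxx.
    by exists q; rewrite rq; apply: ball_sym.
  exists (q1, q2, n) => //=.
  move=> [u v] [/= bu bv]; apply: be; split => /=.
    apply: (@le_ball _ _ _ (n.+1%:R^-1 + n.+1%:R^-1)); first by move: nP; move: (n.+1%:R^-1 : R) => z; linarith.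
    by apply: ball_triangle bu; exact: ball_sym.
  apply: (@le_ball _ _ _ (n.+1%:R^-1 + n.+1%:R^-1)); first by move: nP; move: (n.+1%:R^-1 : R) => z; linarith.
  by apply: ball_triangle bv; exact: ball_sym.
rewrite bigcup_mkcond; apply: countable_bigcupT_measurable => [|q].
  exact: countableP.
case: ifP => _ //; apply: measurableX; exact: measurable_ball.
Qed.

Lemma continuous_measurable_plane (f : R * R -> R) :
  continuous f -> measurable_fun setT f.
Proof.
move=> /continuousP cf; apply: (measurability _ (RGenOpens.measurableE R)).
move=> _ [_ [a [b ->] <-]]; rewrite setTI; apply: open_measurable_plane.
exact/cf/interval_open.
Qed.

Definition area_preserving (T : R * R -> R * R) :=
  measurable_fun setT T /\ forall A, measurable A -> mu (T @^-1` A) = mu A.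

Lemma area_preserving_comp S T :
  area_preserving S -> area_preserving T -> area_preserving (S \o T).
Proof.
move=> [mS pS] [mT pT]; split; first exact: measurableT_comp.
move=> A mA; rewrite comp_preimage pT ?pS//.
by rewrite -[X in measurable X]setTI; exact: mS.
Qed.

Lemma lebesgue_measure_shift (c : R) (A : set R) : measurable A ->
  leb ((fun x => x + c) @^-1` A) = leb A.
Proof.
have mf : measurable_fun setT ((fun x => x + c) : R -> measurableTypeR R).
  exact: measurable_funD.
move=> mA; apply/esym.
apply: (@lebesgue_measure_unique R
  (pushforward leb ((fun x => x + c) : R -> measurableTypeR R))) => //= _ [[a b]] _ <-.
rewrite /pushforward.
have -> : (fun x => x + c) @^-1` `]a, b]%classic = `]a - c, b - c]%classic.
  by apply/seteqP; split => x /=; rewrite !in_itv/= ltrBlDr lerBrDr.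
rewrite /= !lebesgue_measure_itv/= !lte_fin ltrD2r -!EFinB.
by have -> : b - c - (a - c) = b - a by ring.
Qed.

(** A product measure is determined by its values on rectangles, and the push-forward of the area by
    [T] has the same ones. *)
Lemma area_preserving_rect T : measurable_fun setT T ->
  (forall A B, measurable A -> measurable B ->
    mu (T @^-1` (A `*` B)) = (leb A * leb B)%E) -> area_preserving T.
Proof.
move=> mT TAB; split => // A mA; apply/esym.
apply: (@product_measure_unique _ _ _ _ _ leb leb (pushforward mu T)) => //.
Qed.

(** Cavalieri's principle: the vertical section over x is only translated, by g x. *)
Lemma area_preserving_shear2 (g : R -> R) : measurable_fun setT g ->
  area_preserving (fun x => (x.1, x.2 + g x.1)).
Proof.
move=> mg; apply: area_preserving_rect.
  apply: measurable_fun_pair => //; apply: measurable_funD => //.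
  exact: measurableT_comp.
move=> A B mA mB; rewrite /area /product_measure1/=.
transitivity (\int[leb]_x (leb B * (\1_A x)%:E))%E; last first.
  rewrite ge0_integralZl//.
    by rewrite integral_indic// setIT muleC.
  by apply/measurable_EFinP; exact: measurable_indic.
apply: eq_integral => x _ /=.
rewrite indicE; case: (boolP (x \in A)) => xA.
  rewrite mule1 -[RHS](lebesgue_measure_shift (g x))//; congr (leb _).
  apply/seteqP; split => y /=; rewrite xsectionE/= ?inE/=; first by case.
  by move=> By; split => //; exact/set_mem.
rewrite mule0; have -> : xsection [set t : R * R | A t.1 /\ B (t.2 + g t.1)] x = set0.
  apply/seteqP; split => y //=; rewrite xsectionE/= ?inE/= => -[Ax _].
  by move: xA; rewrite (mem_set Ax).
exact: measure0.
Qed.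

Lemma area_preserving_swap : area_preserving (fun x => (x.2, x.1)).
Proof.
apply: area_preserving_rect; first exact: measurable_swap.
move=> A B mA mB.
have -> : (fun x : R * R => (x.2, x.1)) @^-1` (A `*` B) = B `*` A.
  by apply/seteqP; split => x/= -[].
by rewrite /area product_measure1E// muleC.
Qed.

Lemma area_preserving_shear1 (g : R -> R) : measurable_fun setT g ->
  area_preserving (fun x => (x.1 + g x.2, x.2)).
Proof.
move=> mg.
exact: (area_preserving_comp (area_preserving_comp area_preserving_swap
  (area_preserving_shear2 mg)) area_preserving_swap).
Qed.

Lemma area_preserving_opp1 : area_preserving (fun x => (- x.1, x.2)).
Proof.
apply: area_preserving_rect.
  by apply: measurable_fun_pair => //; exact: measurableT_comp.
move=> A B mA mB.
have -> : (fun x : R * R => (- x.1, x.2)) @^-1` (A `*` B) = (-%R @^-1` A) `*` B.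
  by apply/seteqP; split => x/= -[].
have mNA : measurable ((-%R : R -> R) @^-1` A).
  by rewrite -[X in measurable X]setTI; exact: oppr_measurable.
rewrite /area product_measure1E//; congr (_ * _)%E.
exact: (@lebesgue_measureN R A mA).
Qed.

Lemma area_preserving_translate (v : R * R) : area_preserving (fun x => x + v).
Proof.
have := area_preserving_comp (@area_preserving_shear1 (cst v.1) (measurable_cst _))
  (@area_preserving_shear2 (cst v.2) (measurable_cst _)).
by congr area_preserving; apply/funext.
Qed.

Lemma area_preserving_opp2 : area_preserving (fun x => (x.1, - x.2)).
Proof.
exact: (area_preserving_comp (area_preserving_comp area_preserving_swap
  area_preserving_opp1) area_preserving_swap).
Qed.

Lemma area_preserving_opp : area_preserving (fun x => - x).
Proof. exact: (area_preserving_comp area_preserving_opp1 area_preserving_opp2). Qed.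

Definition refl (n x : R * R) : R * R := x - (2 * dotp n x) *: n.

(* For n.2 != 0 the rotation refl n \o diag(1, -1) is a product of three shears. *)
Lemma area_preserving_refl n : dotp n n = 1 -> area_preserving (refl n).
Proof.
case: n => n1 n2; rewrite /dotp/= => n11.
have mZ (c : R) : measurable_fun setT (fun x : R => c * x).
  exact: mulrl_measurable.
have [n20|n20] := eqVneq n2 0.
  have := area_preserving_opp1; congr area_preserving; apply/funext => -[x y].
  rewrite /refl /dotp/=; congr pair; rewrite /GRing.scale/=.
    transitivity (x - 2 * (n1 * n1 + n2 * n2) * x); first by rewrite n11; ring.
    by rewrite n20 /GRing.scale/=; ring.
  by rewrite n20 /GRing.scale/=; ring.
have := area_preserving_comp (area_preserving_comp (area_preserving_comp
  (area_preserving_shear1 (mZ (n1 / n2)))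
  (area_preserving_shear2 (mZ (- 2 * n1 * n2))))
  (area_preserving_shear1 (mZ (n1 / n2)))) area_preserving_opp2.
congr area_preserving; apply/funext => -[x y].
rewrite /refl /dotp/=.
have e : n1 * n1 = 1 - n2 * n2 by rewrite -n11; ring.
congr pair => /=.
- rewrite -[LHS](mulfK n20) -[RHS](mulfK n20); congr (_ / _).
  rewrite /GRing.scale/=.
  transitivity (x * n2 - 2 * n1 * n1 * n2 * x - 2 * n1 * n2 * n2 * y
     + (2 * (n1 * n1 + n2 * n2) - 2) * n1 * y); last by rewrite n11; ring.
  by field.
- rewrite /GRing.scale/=.
  transitivity (y - 2 * n1 * n2 * x - 2 * n2 * n2 * y + (2 * (n1 * n1 + n2 * n2) - 2) * y).
    by field.
  by rewrite n11; ring.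
Qed.

(** Uniqueness of the Lebesgue measure gives the factor 1/c on the line, and uniqueness of the
    product measure turns it into 1/c^2 in the plane. *)
Lemma area_scale (c : R) (A : set (R * R)) : 0 < c -> measurable A ->
  mu ((fun x => c *: x) @^-1` A) = ((c ^- 2)%:E * mu A)%E.
Proof.
move=> c0 mA.
have c20 : 0 <= c ^+ 2 by exact: sqr_ge0.
have leb_scale (B : set R) : measurable B ->
    leb ((fun x => c * x) @^-1` B) = ((c^-1)%:E * leb B)%E.
  move=> mB; have ci0 : 0 <= c by exact: ltW.
  have mf : measurable_fun setT ((fun x => c * x) : R -> measurableTypeR R).
    exact: mulrl_measurable.
  suff -> : leb B = mscale (NngNum ci0)
      (pushforward leb ((fun x => c * x) : R -> measurableTypeR R)) B.
    by rewrite /mscale/= muleA -EFinM mulVf ?gt_eqF// mul1e.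
  move=> mf'; apply: (@lebesgue_measure_unique R (mscale (NngNum ci0)
    (pushforward leb ((fun x => c * x) : R -> measurableTypeR R)))) => //= _ [[a b]] _ <-.
  rewrite /mscale/= /pushforward.
  have -> : (fun x => c * x) @^-1` `]a, b]%classic = `]a / c, b / c]%classic.
    by apply/seteqP; split => x /=; rewrite !in_itv/= ltr_pdivrMr// ler_pdivlMr// ![_ * c]mulrC.
  rewrite !lebesgue_measure_itv/= !lte_fin ltr_pM2r ?invr_gt0//.
  case: ifP => _; last by rewrite mule0.
  by rewrite -!EFinB -EFinM -mulrBl mulrC mulfVK ?gt_eqF.
have mS : measurable_fun [set: Q] ((fun x => c *: x) : Q -> Q).
  by apply: measurable_fun_pair; exact: measurable_funM.
suff -> : mu A = mscale (NngNum c20) (pushforward (leb \x leb)%E ((fun x => c *: x) : Q -> Q)) A.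
  rewrite /mscale/= muleA -EFinM mulVf ?mul1e// expf_neq0// gt_eqF//.
move=> mS'; apply: (@product_measure_unique _ _ _ _ _ leb leb (mscale (NngNum c20)
  (pushforward (leb \x leb)%E ((fun x => c *: x) : Q -> Q)))) => // B C mB mC.
transitivity ((c ^+ 2)%:E * (leb \x leb) ((fun x : R * R => c *: x) @^-1` (B `*` C)))%E.
  by [].
have -> : (fun x : R * R => c *: x) @^-1` (B `*` C) =
    ((fun x => c * x) @^-1` B) `*` ((fun x => c * x) @^-1` C).
  by apply/seteqP; split => x/= -[].
have mpre (D : set R) : measurable D -> measurable ((fun x => c * x) @^-1` D).
  by move=> mD; rewrite -[X in measurable X]setTI; exact: mulrl_measurable.
rewrite product_measure1E; [|exact: mpre|exact: mpre].
transitivity ((c ^+ 2)%:E * ((c^-1)%:E * leb B * ((c^-1)%:E * leb C)))%E.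
  by rewrite -leb_scale// -leb_scale.
transitivity ((c ^+ 2)%:E * ((c^-1 * c^-1)%:E * (leb B * leb C)))%E.
  by rewrite (EFinM c^-1 c^-1) muleACA.
rewrite muleA -EFinM.
rewrite (_ : c ^+ 2 * (c^-1 * c^-1) = 1) ?mul1e//.
by field; rewrite gt_eqF.
Qed.

Lemma Rintegral_area_scale (c : R) (f : R * R -> R) : 0 < c ->
  mu.-integrable setT (EFin \o f) ->
  \int[mu]_x f (c *: x) = c ^- 2 * \int[mu]_x f x.
Proof.
move=> c0 fi.
have mS : measurable_fun [set: Q] ((fun x => c *: x) : Q -> Q).
  by apply: measurable_fun_pair; exact: measurable_funM.
have k0 : 0 <= c ^- 2 by rewrite invr_ge0 sqr_ge0.
exact: (@Rintegral_scaling _ Q R (leb \x leb)%E _ _ mS k0 (fun A => @area_scale c A c0) f fi).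
Qed.

Lemma Rintegral_area_preserving T (f : R * R -> R) : area_preserving T ->
  measurable_fun setT f -> \int[mu]_x f (T x) = \int[mu]_x f x.
Proof.
move=> [mT pT] mf.
exact: (@Rintegral_preserving _ Q R (leb \x leb)%E T mT pT f mf).
Qed.

Lemma integrable_area_preserving T (f : R * R -> R) : area_preserving T ->
  mu.-integrable setT (EFin \o f) -> mu.-integrable setT (EFin \o (f \o T)).
Proof.
move=> [mT pT] fi.
exact: (@integrable_preserving _ Q R (leb \x leb)%E T mT pT f fi).
Qed.

End plane_measure.

Section plane_integral.
Context {R : realType}.
Notation mu := (@area R).
Implicit Types f g : R * R -> R.

Definition integ f := mu.-integrable setT (EFin \o f).
(* Locked: otherwise comparing two integrals unfolds the Lebesgue integral. *)
Fact iint_key : unit. Proof. by []. Qed.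
Definition iint : (R * R -> R) -> R :=
  locked_with iint_key (fun f => \int[mu]_z f z).

Lemma iintE f : iint f = \int[mu]_z f z.
Proof. by rewrite /iint unlock. Qed.

Lemma integ_measurable f : integ f -> measurable_fun setT f.
Proof. by move=> /measurable_int/measurable_EFinP. Qed.

Lemma integD f g : integ f -> integ g -> integ (fun z => f z + g z).
Proof. exact: integrableD. Qed.

Lemma integB f g : integ f -> integ g -> integ (fun z => f z - g z).
Proof. exact: integrableB. Qed.

Lemma integZ c f : integ f -> integ (fun z => c * f z).
Proof. exact: integrableZl. Qed.

Lemma integN f : integ f -> integ (fun z => - f z).
Proof. exact: integrableN. Qed.

Lemma integ_norm f : integ f -> integ (fun z => `|f z|).
Proof. exact: integrable_norm. Qed.

Lemma le_integ f g : measurable_fun setT f -> (forall z, `|f z| <= g z) ->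
  integ g -> integ f.
Proof.
move=> mf fg; apply: le_integrable => //; first exact/measurable_EFinP.
by move=> z _ /=; rewrite lee_fin (le_trans (fg z))// ler_norm.
Qed.

Lemma integ_eq f g : (forall z, f z = g z) -> integ f -> integ g.
Proof. by move=> fg; have -> : f = g by exact/funext. Qed.

Lemma eq_iint f g : (forall z, f z = g z) -> iint f = iint g.
Proof. by move=> fg; have -> : f = g by exact/funext. Qed.

Lemma iintD f g : integ f -> integ g -> iint (fun z => f z + g z) = iint f + iint g.
Proof. by rewrite !iintE; exact: RintegralD. Qed.

Lemma iintB f g : integ f -> integ g -> iint (fun z => f z - g z) = iint f - iint g.
Proof. by rewrite !iintE; exact: RintegralB. Qed.

Lemma iintZ c f : integ f -> iint (fun z => c * f z) = c * iint f.
Proof. by rewrite !iintE; exact: RintegralZl. Qed.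

Lemma iintN f : integ f -> iint (fun z => - f z) = - iint f.
Proof.
move=> fi; have := iintZ (-1) fi; rewrite mulN1r => <-.
by apply: eq_iint => z; rewrite mulN1r.
Qed.

Lemma iint0 : iint (fun _ => 0) = 0.
Proof. by rewrite iintE /Rintegral integral0. Qed.

Lemma le_iint f g : integ f -> integ g -> (forall z, f z <= g z) -> iint f <= iint g.
Proof. by move=> fi gi fg; rewrite !iintE; apply: le_Rintegral. Qed.

Lemma iint_ge0 f : (forall z, 0 <= f z) -> 0 <= iint f.
Proof. by move=> f0; rewrite iintE; apply: Rintegral_ge0. Qed.

Lemma norm_iint_le f g : measurable_fun setT f -> (forall z, `|f z| <= g z) ->
  integ g -> `|iint f| <= iint g.
Proof.
move=> mf fg gi; have fi := le_integ mf fg gi.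
apply: le_trans (_ : iint (fun z => `|f z|) <= _).
  by rewrite !iintE; exact: le_normr_Rintegral.
by apply: le_iint => //; exact: integ_norm.
Qed.

Lemma iint_preserving T f : area_preserving T -> measurable_fun setT f ->
  iint (fun z => f (T z)) = iint f.
Proof. by rewrite !iintE; exact: Rintegral_area_preserving. Qed.

Lemma integ_preserving T f : area_preserving T -> integ f -> integ (fun z => f (T z)).
Proof. exact: integrable_area_preserving. Qed.

(** The plane is exhausted by the squares of an exhaustion of the line. This serves Fubini's theorem
    on the product of the plane with itself. *)
Lemma area_sigma_finite : sigma_finite setT (@lebesgue_measure R \x @lebesgue_measure R)%E.
Proof.
have /sigma_finiteP[F [TF ndF Foo]] := sigma_finiteT (@lebesgue_measure R).
exists (fun n => F n `*` F n).
  rewrite -setXTT TF predeqE => -[x y]; split.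
    move=> [/= [n _ Fnx] [k _ Gky]]; exists (maxn n k) => //; split.
    - by move: x Fnx; exact/subsetPset/ndF/leq_maxl.
    - by move: y Gky; exact/subsetPset/ndF/leq_maxr.
  by move=> [n _ []/= ? ?]; split; exists n.
move=> k; have [mF Fk] := Foo k; split; first exact: measurableX.
by rewrite product_measure1E// lte_mul_pinfty// ge0_fin_numE.
Qed.

End plane_integral.

(** * The Euclidean plane and the radial kernel *)

Section euclidean_plane.
Context {R : realType}.
Implicit Types x y z n : (R * R)%type.

Lemma dotpC x y : dotp x y = dotp y x.
Proof. by rewrite /dotp; ring. Qed.
Lemma dotpDl x y z : dotp (x + y) z = dotp x z + dotp y z.
Proof. by rewrite /dotp/=; ring. Qed.
Lemma dotpDr x y z : dotp z (x + y) = dotp z x + dotp z y.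
Proof. by rewrite /dotp/=; ring. Qed.
Lemma dotpNl x z : dotp (- x) z = - dotp x z.
Proof. by rewrite /dotp/=; ring. Qed.
Lemma dotpNr x z : dotp z (- x) = - dotp z x.
Proof. by rewrite /dotp/=; ring. Qed.
Lemma dotpZl (a : R) x z : dotp (a *: x) z = a * dotp x z.
Proof. by rewrite /dotp/= /GRing.scale/=; ring. Qed.
Lemma dotpZr (a : R) x z : dotp z (a *: x) = a * dotp z x.
Proof. by rewrite /dotp/= /GRing.scale/=; ring. Qed.
Lemma dotp0l z : dotp 0 z = 0.
Proof. by rewrite /dotp/= !mul0r addr0. Qed.
Lemma dotp0r z : dotp z 0 = 0.
Proof. by rewrite dotpC dotp0l. Qed.

Definition dotpE := (dotpDl, dotpDr, dotpNl, dotpNr, dotpZl, dotpZr).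

Lemma dotp_ge0 x : 0 <= dotp x x.
Proof. by rewrite /dotp addr_ge0// -expr2 sqr_ge0. Qed.

Lemma enorm_ge0 x : 0 <= enorm x. Proof. exact: sqrtr_ge0. Qed.

Lemma enorm_sqr x : enorm x ^+ 2 = dotp x x.
Proof. by rewrite /enorm sqr_sqrtr// dotp_ge0. Qed.

Lemma enorm0 : enorm (0 : R * R) = 0.
Proof. by rewrite /enorm dotp0l sqrtr0. Qed.

Lemma enormN x : enorm (- x) = enorm x.
Proof. by rewrite /enorm !dotpE opprK. Qed.

Lemma enormZ (a : R) x : enorm (a *: x) = `|a| * enorm x.
Proof.
rewrite /enorm !dotpE mulrA -expr2 sqrtrM ?sqr_ge0//.
by rewrite sqrtr_sqr.
Qed.

Lemma enormBC x y : enorm (x - y) = enorm (y - x).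
Proof. by rewrite -enormN opprB. Qed.

Lemma ler_enorm_sqr x (a : R) : 0 <= a -> (enorm x <= a) = (dotp x x <= a ^+ 2).
Proof. by move=> a0; rewrite -enorm_sqr ler_pXn2r// nnegrE ?enorm_ge0. Qed.

Lemma normr_dotp x y : `|dotp x y| <= enorm x * enorm y.
Proof.
rewrite -(ler_pXn2r (isT : (0 < 2)%N)) ?nnegrE ?mulr_ge0 ?enorm_ge0//.
rewrite exprMn !enorm_sqr real_normK ?num_real// -subr_ge0.
rewrite (_ : _ - _ = (x.1 * y.2 - x.2 * y.1) ^+ 2) ?sqr_ge0//.
by rewrite /dotp; ring.
Qed.

Lemma dotp_le x y : dotp x y <= enorm x * enorm y.
Proof. exact: le_trans (ler_norm _) (normr_dotp _ _). Qed.

Lemma ler_enormD x y : enorm (x + y) <= enorm x + enorm y.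
Proof.
rewrite ler_enorm_sqr ?addr_ge0 ?enorm_ge0// !dotpE sqrrD !enorm_sqr.
by have := dotp_le x y; rewrite (dotpC y x); linarith.
Qed.

Lemma ler_enormB x y : enorm (x - y) <= enorm x + enorm y.
Proof. by rewrite -(enormN y) ler_enormD. Qed.

Lemma ler_enorm_distD z x y : enorm (x - y) <= enorm (x - z) + enorm (z - y).
Proof. by rewrite -(subrKA z x (- y)) ler_enormD. Qed.

Lemma ler_dist_enorm x y : `|enorm x - enorm y| <= enorm (x - y).
Proof.
have h (u v : R * R) : enorm u <= enorm v + enorm (u - v).
  by have := ler_enormD v (u - v); rewrite addrC subrK.
have := h x y; have := h y x; rewrite (enormBC y x) ler_norml => *.
by apply/andP; split; linarith.
Qed.

Lemma normr_fst_le x : `|x.1| <= enorm x.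
Proof.
rewrite -sqrtr_sqr /enorm ler_sqrt ?dotp_ge0// /dotp -expr2 lerDl -expr2.
exact: sqr_ge0.
Qed.

Lemma normr_snd_le x : `|x.2| <= enorm x.
Proof.
rewrite -sqrtr_sqr /enorm ler_sqrt ?dotp_ge0// /dotp addrC -expr2 lerDl -expr2.
exact: sqr_ge0.
Qed.

Lemma enorm_le_coord x : enorm x <= `|x.1| + `|x.2|.
Proof.
rewrite ler_enorm_sqr ?addr_ge0// sqrrD !real_normK ?num_real// /dotp -!expr2.
have : 0 <= `|x.1| * `|x.2| by rewrite mulr_ge0.
linarith.
Qed.

Lemma enorm_eq0 x : (enorm x == 0) = (x == 0).
Proof.
apply/eqP/eqP => [x0|->]; last exact: enorm0.
have := normr_fst_le x; have := normr_snd_le x; rewrite x0 !normr_le0.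
by case: x {x0} => a b /= /eqP-> /eqP->.
Qed.

Lemma dotp_gt0 x : (0 < dotp x x) = (x != 0).
Proof. by rewrite -enorm_eq0 -enorm_sqr lt0r sqr_ge0 andbT sqrf_eq0. Qed.

Lemma dotp_refl n x y : dotp n n = 1 -> dotp (refl n x) (refl n y) = dotp x y.
Proof. by move=> n1; rewrite /refl !dotpE n1 (dotpC x n) ; ring. Qed.

Lemma dotp_n_refl n x : dotp n n = 1 -> dotp n (refl n x) = - dotp n x.
Proof. by move=> n1; rewrite /refl !dotpE n1; ring. Qed.

Lemma reflK n : dotp n n = 1 -> involutive (refl n).
Proof.
move=> n1 x; rewrite {1}/refl dotp_n_refl// /refl mulrN scaleNr opprK.
by rewrite subrK.
Qed.

Lemma reflB n x y : refl n (x - y) = refl n x - refl n y.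
Proof.
rewrite /refl dotpDr dotpNr mulrBr scalerBl !opprB addrACA [RHS]addrACA.
by congr (_ + _); rewrite addrC.
Qed.

Lemma enorm_refl n x : dotp n n = 1 -> enorm (refl n x) = enorm x.
Proof. by move=> n1; rewrite /enorm dotp_refl. Qed.

End euclidean_plane.

(** * The kernel as a function of the squared distance, and its truncation *)

Section kernel_profile.
Context {R : realType}.
Variable s : R.
Hypothesis hs : 0 < s <= 1.
Implicit Types a b c e t u : R.

(* Up to the constant factors of G_ s, the kernel is kap (|x|^2): kap is the
   primitive of - t ^ (s - 2) that makes both cases of G_ s homogeneous. *)
Fact kap_key : unit. Proof. by []. Qed.
Definition kap : R -> R := locked_with kap_key
  (fun t => if s == 1 then - ln t else t `^ (s - 1) / (1 - s)).
Definition dkap : R -> R := locked_with kap_key (fun t => t `^ (s - 2)).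

Lemma kapE t : kap t = if s == 1 then - ln t else t `^ (s - 1) / (1 - s).
Proof. by rewrite /kap unlock. Qed.

Lemma dkapE t : dkap t = t `^ (s - 2).
Proof. by rewrite /dkap unlock. Qed.

Lemma dkap_gt0 t : 0 < t -> 0 < dkap t.
Proof. by move=> t0; rewrite dkapE; exact: powR_gt0. Qed.

Lemma dkap_le t u : 0 < t -> t <= u -> dkap u <= dkap t.
Proof.
move=> t0 tu; have u0 : 0 < u := lt_le_trans t0 tu.
rewrite !dkapE -(opprB 2 s) !powRN lef_pV2 ?posrE ?powR_gt0//.
by case/andP: hs => *; apply: ge0_ler_powR; rewrite ?nnegrE ?(ltW t0) ?(ltW u0)//; linarith.
Qed.

Lemma is_derive_kap t : 0 < t -> is_derive t 1 kap (- dkap t).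
Proof.
move=> t0; rewrite dkapE /kap unlock; have [->|s1] := eqVneq s 1.
  have -> : 1 - 2 = -1 :> R by ring.
  rewrite powR_inv1 ?ltW//.
  exact: is_deriveN (is_derive1_ln t0).
have -> : (fun t => t `^ (s - 1) / (1 - s)) = (fun t => (1 - s)^-1 *: (t `^ (s - 1))).
  by apply/funext => u; rewrite mulrC.
have -> : - t `^ (s - 2) = (1 - s)^-1 *: ((s - 1) * t `^ (s - 1 - 1)).
  rewrite /GRing.scale/= (_ : s - 1 - 1 = s - 2); last by ring.
  by field; rewrite subr_eq0 eq_sym.
exact/is_deriveZ/is_derive1_powR.
Qed.

Lemma MVT_gt0 (f df : R -> R) (a b : R) : 0 < a -> a <= b ->
  (forall x : R, 0 < x -> is_derive x 1 f (df x)) ->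
  exists c, [/\ a <= c, c <= b & f b - f a = df c * (b - a)].
Proof.
move=> a0 ab fdf.
have [| |c] := @MVT_segment R f df a b ab.
- by move=> x; rewrite in_itv/= => /andP[ax _]; exact/fdf/(lt_trans a0).
- apply: derivable_within_continuous => x; rewrite in_itv/= => /andP[ax _].
  by have [] := fdf x (lt_le_trans a0 ax).
by rewrite in_itv/= => /andP[ac cb] e; exists c.
Qed.

Lemma kap_diff_bounds a b : 0 < a -> a <= b ->
  dkap b * (b - a) <= kap a - kap b <= dkap a * (b - a).
Proof.
move=> a0 ab; have [c [ac cb e]] := MVT_gt0 a0 ab is_derive_kap.
rewrite -(opprB (kap b)) e mulNr opprK !ler_wpM2r ?subr_ge0//.
  exact: dkap_le.
by apply: dkap_le => //; exact: lt_le_trans ac.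
Qed.

(** Mean value theorem: the derivative (s - 2) t^(s - 3) has a coefficient of size at most 2 and a
    decreasing power. *)
Lemma dkap_dist a t u : 0 < a -> a <= t -> a <= u ->
  `|dkap t - dkap u| <= 2 * a `^ (s - 3) * `|t - u|.
Proof.
move=> a0; wlog tu : t u / t <= u.
  move=> H ta ua; have [tu|/ltW ut] := leP t u; first exact: H.
  by rewrite distrC (distrC t); apply: H.
move=> ta ua; rewrite distrC (distrC t).
have t0 : 0 < t := lt_le_trans a0 ta.
rewrite !dkapE; have [c [tc cu ->]] := @MVT_gt0 _ (fun x => (s - 2) * x `^ (s - 2 - 1)) _ _ t0 tu
  (fun x x0 => is_derive1_powR (s - 2) x0).
rewrite normrM ler_wpM2r// (_ : s - 2 - 1 = s - 3); last by ring.
have c0 : 0 < c := lt_le_trans t0 tc.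
rewrite normrM ler_pM//.
  by rewrite ltr0_norm; case/andP: hs => *; linarith.
rewrite gtr0_norm ?powR_gt0// -(opprB 3 s) !powRN lef_pV2 ?posrE ?powR_gt0//.
by case/andP: hs => *; apply: ge0_ler_powR; rewrite ?nnegrE ?(ltW a0) ?(ltW c0)//; linarith.
Qed.

Lemma dkap1 : dkap 1 = 1.
Proof. by rewrite dkapE powR1. Qed.

(** Below e the kernel is continued by its tangent line at e. As [kap] is convex and decreasing, so
    is the result; it is finite at 0, lies below [kap], and its slope, minus [dkape], is bounded and
    Lipschitz. *)
Definition kape : R -> R -> R := locked_with kap_key
  (fun e t => if t < e then kap e - dkap e * (t - e) else kap t).
Definition dkape : R -> R -> R := locked_with kap_key (fun e t => dkap (Num.max t e)).

Lemma kapeE e t : kape e t = if t < e then kap e - dkap e * (t - e) else kap t.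
Proof. by rewrite /kape unlock. Qed.

Lemma dkapeE e t : dkape e t = dkap (Num.max t e).
Proof. by rewrite /dkape unlock. Qed.

Lemma kape_id e t : e <= t -> kape e t = kap t.
Proof. by rewrite kapeE leNgt => /negbTE ->. Qed.

Lemma dkape_ge0 e t : 0 < e -> 0 <= dkape e t.
Proof. by move=> e0; rewrite dkapeE; apply/ltW/dkap_gt0; rewrite lt_max e0 orbT. Qed.

Lemma dkape_le e t : 0 < e -> dkape e t <= dkap e.
Proof. by move=> e0; rewrite dkapeE; apply: dkap_le => //; rewrite le_max lexx orbT. Qed.

Lemma dkape_dist e t u : 0 < e ->
  `|dkape e t - dkape e u| <= 2 * e `^ (s - 3) * `|t - u|.
Proof.
move=> e0; rewrite !dkapeE; apply: le_trans (dkap_dist e0 _ _) _; rewrite ?le_max ?lexx ?orbT//.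
rewrite ler_wpM2l ?mulr_ge0 ?powR_ge0//.
rewrite !maxEle; case: (leP t e) => te; case: (leP u e) => ue //.
- by rewrite subrr normr0.
- by rewrite !ltr0_norm; linarith.
- by rewrite !gtr0_norm; linarith.
Qed.

Let kap_taylor e t u : 0 < e -> e <= t -> e <= u ->
  `|kap t - kap u + dkap u * (t - u)| <= 2 * e `^ (s - 3) * `|t - u| ^+ 2.
Proof.
move=> e0 et eu.
have [c [cE ec ctu]] : exists c, [/\ kap t - kap u = - dkap c * (t - u), e <= c &
    `|u - c| <= `|t - u|].
  have [tu|/ltW ut] := leP t u.
    have [c [tc cu E]] := MVT_gt0 (lt_le_trans e0 et) tu is_derive_kap.
    exists c; split; [|exact: le_trans tc|].
      by rewrite -[LHS]opprB E; ring.
    by rewrite distrC ![`|_ - u|]ler0_norm; linarith.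
  have [c [tc cu E]] := MVT_gt0 (lt_le_trans e0 eu) ut is_derive_kap.
  exists c; split => //; [exact: le_trans tc|].
  by rewrite distrC !ger0_norm; linarith.
rewrite cE (_ : _ + _ = (dkap u - dkap c) * (t - u)); last by ring.
rewrite normrM expr2 mulrA ler_wpM2r//.
apply: le_trans (dkap_dist e0 eu ec) _.
by rewrite ler_wpM2l// mulr_ge0// powR_ge0.
Qed.

(** The worst case is t < e <= u: the remainder between e and u and the change of slope between e
    and u each contribute 2, whence 4. *)
Lemma kape_taylor e t u : 0 < e ->
  `|kape e t - kape e u + dkape e u * (t - u)| <= 4 * e `^ (s - 3) * `|t - u| ^+ 2.
Proof.
move=> e0; have p0 : 0 <= e `^ (s - 3) by exact: powR_ge0.
have w : 0 <= e `^ (s - 3) * `|t - u| ^+ 2 by rewrite mulr_ge0.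
rewrite !kapeE dkapeE maxEle; case: (ltP t e) => te; case: (ltP u e) => ue.
- rewrite (ltW ue) (_ : _ + _ = 0) ?normr0 -?mulrA ?mulr_ge0//; ring.
- have -> : (if u <= e then e else u) = u by case: (leP u e) => // ?; apply/le_anti/andP.
  have h1 := kap_taylor e0 (lexx e) ue.
  have h2 := dkap_dist e0 (lexx e) ue.
  rewrite (_ : _ + _ = (kap e - kap u + dkap u * (e - u)) + (dkap e - dkap u) * (e - t)); last by ring.
  have eu : `|e - u| <= `|t - u| by rewrite !ler0_norm; linarith.
  have et : `|e - t| <= `|t - u| by rewrite ger0_norm ?ler0_norm; linarith.
  apply: le_trans (ler_normD _ _) _.
  rewrite (_ : 4 * _ * _ = 2 * e `^ (s - 3) * `|t - u| ^+ 2 + 2 * e `^ (s - 3) * `|t - u| * `|t - u|); last by ring.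
  apply: lerD.
    apply: le_trans h1 _; rewrite ler_wpM2l ?mulr_ge0//.
    by rewrite ler_pXn2r// nnegrE.
  rewrite normrM ler_pM//; apply: le_trans h2 _.
  by rewrite ler_wpM2l// mulr_ge0.
- rewrite (ltW ue) (_ : _ + _ = (kap t - kap e + dkap e * (t - e))); last by ring.
  apply: le_trans (kap_taylor e0 te (lexx e)) _.
  have et : `|t - e| <= `|t - u| by rewrite !ger0_norm; linarith.
  apply: (@le_trans _ _ (2 * e `^ (s - 3) * `|t - u| ^+ 2)); last by rewrite -!mulrA; linarith.
  by rewrite ler_wpM2l ?mulr_ge0// ler_pXn2r// nnegrE.
- have -> : (if u <= e then e else u) = u by case: (leP u e) => // ?; apply/le_anti/andP.
  apply: le_trans (kap_taylor e0 te ue) _.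
  by rewrite -!mulrA; linarith.
Qed.

Lemma kape_dist e t u : 0 < e -> `|kape e t - kape e u| <= dkap e * `|t - u|.
Proof.
move=> e0; wlog tu : t u / t <= u.
  move=> H; have [tu|/ltW ut] := leP t u; first exact: H.
  by rewrite distrC (distrC t); apply: H.
rewrite (distrC t) (@ger0_norm _ (u - t)) ?subr_ge0//.
have D0 := dkap_gt0 e0.
rewrite !kapeE; case: (ltP t e) => te; case: (ltP u e) => ue.
- rewrite ger0_norm; first by rewrite le_eqVlt; apply/orP; left; apply/eqP; ring.
  by have : 0 <= dkap e * (u - t) by [rewrite mulr_ge0 ?subr_ge0// ltW]; linarith.
- have /andP[h1 h2] := kap_diff_bounds e0 ue.
  have h3 : 0 <= dkap e * (e - t) by rewrite mulr_ge0 ?subr_ge0 1?ltW.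
  have h4 : 0 <= dkap u * (u - e).
    by rewrite mulr_ge0 ?subr_ge0// ltW// dkap_gt0// (lt_le_trans e0).
  rewrite ger0_norm; linarith.
- linarith.
- have t0 := lt_le_trans e0 te.
  have /andP[h1 h2] := kap_diff_bounds t0 tu.
  have h4 : 0 <= dkap u * (u - t).
    by rewrite mulr_ge0 ?subr_ge0// ltW// dkap_gt0// (lt_le_trans t0).
  rewrite ger0_norm; last linarith.
  by apply: le_trans h2 _; rewrite ler_wpM2r ?subr_ge0// dkap_le.
Qed.

Lemma kape_bounds e t : 0 < e -> 0 < t -> kape e t <= kap t.
Proof.
move=> e0 t0; rewrite kapeE; case: ifPn => // te.
by have /andP[+ _] := kap_diff_bounds t0 (ltW te); linarith.
Qed.

Lemma kape_ge e t : 0 < e -> t < e -> kap e <= kape e t.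
Proof.
move=> e0 te; rewrite kapeE te lerBrDr gerDl mulr_ge0_le0//.
  exact/ltW/dkap_gt0.
by rewrite subr_le0 ltW.
Qed.

(** An exponent above -1 in t = |x|^2 is what makes the kernel locally integrable in the plane. For
    s = 1 the logarithm is controlled by ln u <= u - 1 at u = t^(-1/2); for s < 1 one may take g =
    s. *)
Lemma kap_growth : exists g C : R, [/\ 0 < g, g < 1, 0 < C &
  forall t, 0 < t -> t <= 1 -> 0 <= kap t - kap 1 <= C * t `^ (g - 1)].
Proof.
have lb t : 0 < t -> t <= 1 -> 0 <= kap t - kap 1.
  move=> t0 t1; have /andP[+ _] := kap_diff_bounds t0 t1.
  by apply: le_trans; rewrite mulr_ge0 ?subr_ge0// ltW// dkap_gt0.
have [s1|s1] := eqVneq s 1.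
  exists 2^-1, 2; split; [linarith|linarith|linarith|] => t t0 t1.
  rewrite lb//= !kapE s1 eqxx ln1 oppr0 subr0.
  have := @le_ln1Dx R (t `^ (2^-1 - 1) - 1).
  rewrite addrCA subrr addr0 ln_powR => h.
  have /h : -1 < t `^ (2^-1 - 1) - 1 by rewrite ltrBrDr addNr powR_gt0.
  linarith.
case/andP: hs => s0; rewrite le_eqVlt (negbTE s1)/= => s_lt1.
exists s, (1 - s)^-1; split => //; first by rewrite invr_gt0 subr_gt0.
move=> t t0 t1; rewrite lb//= !kapE (negbTE s1) powR1 mulrC.
by rewrite lerBlDr lerDl mulr_ge0// invr_ge0 subr_ge0 ltW.
Qed.

(* Homogeneity, up to an additive constant when s = 1. *)
Lemma kap_scale c : 0 < c -> exists k, forall t, 0 < t ->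
  kap (c * t) = c `^ (s - 1) * kap t + k.
Proof.
move=> c0; have [s1|s1] := eqVneq s 1.
  exists (- ln c) => t t0; rewrite !kapE s1 eqxx subrr powRr0 mul1r lnM ?posrE//; ring.
by exists 0 => t t0; rewrite !kapE (negbTE s1) addr0 powRM ?ltW// mulrA.
Qed.

Lemma measurable_kap : measurable_fun setT kap.
Proof.
rewrite /kap unlock.
case: eqP => _; first by apply: measurable_funN; exact: measurable_ln.
apply: measurable_funM => //; exact: measurable_powR.
Qed.

Lemma measurable_kape e : measurable_fun setT (kape e).
Proof.
rewrite /kape unlock.
apply: measurable_fun_ifT; last exact: measurable_kap.
  exact: measurable_fun_ltr.
by apply: measurable_funB => //; apply: measurable_funM => //; exact: measurable_funB.
Qed.

End kernel_profile.

(** * Local integrability of the kernel *)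

Section powR_integrable.
Context {R : realType}.
Notation leb := (@lebesgue_measure R).
Notation mu := (@area R).

(** The primitive x^g / g bounds the integrals over [1/(n+2), 1] by 1/g, and monotone convergence
    fills ]0, 1]. *)
Lemma integrable_powR01 (g : R) : 0 < g ->
  leb.-integrable `]0, 1]%classic (EFin \o (@powR R ^~ (g - 1))).
Proof.
move=> g0; pose f x : R := x `^ (g - 1).
pose a n : R := n.+2%:R^-1.
have a0 n : 0 < a n by rewrite invr_gt0.
have a1 n : a n < 1 by rewrite invf_lt1// ltr1n.
have mf : measurable_fun setT f by exact: measurable_powR.
have bnd n : (\int[leb]_(x in `[a n, 1%R]) (f x)%:E <= (g^-1)%:E)%E.
  have -> : (\int[leb]_(x in `[a n, 1%R]) (f x)%:E = (1%R `^ g / g)%:E - (a n `^ g / g)%:E)%E.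
    have dF (x : R) : 0 < x -> is_derive x 1 (fun x => x `^ g / g) (f x).
      move=> x0; have -> : (fun x : R => x `^ g / g) = (fun x => g^-1 *: x `^ g).
        by apply/funext => u; rewrite mulrC.
      have -> : f x = g^-1 *: (g * x `^ (g - 1)).
        by rewrite /GRing.scale/= mulKf// gt_eqF.
      exact/is_deriveZ/is_derive1_powR.
    have cF (x : R) : 0 < x -> {for x, continuous (fun x => x `^ g / g)}.
      by move=> x0; apply/differentiable_continuous/derivable1_diffP; have [] := dF x x0.
    apply: (@continuous_FTC2 R f (fun x => x `^ g / g)) => //.
    - apply: derivable_within_continuous => x; rewrite in_itv/= => /andP[ax _].
      by have [] := is_derive1_powR (g - 1) (lt_le_trans (a0 n) ax).
    - split.
      + move=> x; rewrite in_itv/= => /andP[ax _].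
        by have [] := dF x (lt_trans (a0 n) ax).
      + exact/cvg_at_right_filter/cF.
      + exact/cvg_at_left_filter/cF.
    - move=> x; rewrite in_itv/= => /andP[ax _].
      by rewrite derive1E; have [_ ->] := dF x (lt_trans (a0 n) ax).
  by rewrite powR1 mul1r -EFinB lee_fin gerBl divr_ge0 ?powR_ge0// ltW.
have U : \bigcup_n `[a n, 1]%classic = `]0, 1]%classic :> set R.
  apply/seteqP; split => x /=.
    by move=> [n _]; rewrite /= !in_itv/= => /andP[ax ->]; rewrite (lt_le_trans (a0 n)).
  rewrite in_itv/= => /andP[x0 x1]; exists (Num.truncn x^-1) => //=.
  rewrite in_itv/= x1 andbT -[leRHS]invrK lef_pV2 ?posrE ?invr_gt0//.
  apply: ltW; apply: lt_trans (truncnS_gt _) _.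
  by rewrite ltr_nat.
apply/integrableP; split.
  by apply/measurable_EFinP; exact: measurable_funS mf.
under eq_integral do rewrite /= ger0_norm ?powR_ge0//.
apply: (@le_lt_trans _ _ (g^-1)%:E); last exact: ltry.
rewrite -U.
have := @ge0_nondecreasing_set_cvg_integral _ (measurableTypeR R) R (fun n => `[a n, 1]%classic) (EFin \o f) leb.
move=> H; have {H} cv : (\int[leb]_(x in `[a i, 1%R]) (EFin \o f) x @[i --> \oo] -->
    \int[leb]_(x in \bigcup_i `[a i, 1%R]%classic) (EFin \o f) x)%E.
  apply: H => //.
  - apply/nondecreasing_seqP => n; rewrite subsetEset => x /=.
    rewrite !in_itv/= => /andP[ax ->]; rewrite andbT (le_trans _ ax)//.
    by rewrite lef_pV2 ?posrE// ler_nat.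
  - by move=> i; apply/measurable_EFinP; exact: measurable_funS mf.
  - by move=> i x _; rewrite lee_fin powR_ge0.
rewrite -(cvg_lim _ cv)//; apply: lime_le; first by apply/cvg_ex; eexists; exact: cv.
by near=> n; exact: bnd.
Unshelve. all: by end_near.
Qed.

Definition powR_sym (g x : R) : R :=
  ((@powR R ^~ (g - 1)) \_ `]0, 1]) x + ((@powR R ^~ (g - 1)) \_ `]0, 1]) (- x).

Lemma integrable_powR_sym (g : R) : 0 < g ->
  leb.-integrable setT (EFin \o powR_sym g).
Proof.
move=> g0.
have i0 : leb.-integrable setT (EFin \o ((@powR R ^~ (g - 1)) \_ `]0, 1])).
  rewrite -restrict_EFin.
  have := integrable_powR01 g0.
  by move/(@integrable_mkcond _ _ R leb _ (EFin \o @powR R ^~ (g - 1)) (measurable_itv _)).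
have mN : measurable_fun setT (-%R : measurableTypeR R -> measurableTypeR R).
  exact: oppr_measurable.
have i1 := @integrable_preserving _ _ R leb _ mN (fun A mA => @lebesgue_measureN R A mA) _ i0.
exact: integrableD i0 i1.
Qed.

Lemma powR_sym_ge0 g x : 0 <= powR_sym g x.
Proof. by rewrite /powR_sym !patchE; do 2 case: ifP; rewrite ?addr_ge0 ?powR_ge0. Qed.

Lemma powR_sym_ge g x : x != 0 -> `|x| <= 1 -> `|x| `^ (g - 1) <= powR_sym g x.
Proof.
move=> x0 x1; have [xneg|xpos] := ltP x 0.
  rewrite /powR_sym ltr0_norm// in x1 *; rewrite !patchE.
  rewrite [X in _ + (if X then _ else _)]mem_set/=; last by rewrite in_itv/= oppr_gt0 xneg.
  by rewrite lerDr; case: ifP; rewrite ?powR_ge0.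
have {}xpos : 0 < x by rewrite lt_neqAle eq_sym x0.
rewrite /powR_sym gtr0_norm// in x1 *; rewrite !patchE.
rewrite [X in (if X then _ else _) + _]mem_set/=; last by rewrite in_itv/= xpos.
by rewrite lerDl; case: ifP; rewrite ?powR_ge0.
Qed.

Lemma integrable_prod (f g : R -> R) :
  leb.-integrable setT (EFin \o f) -> leb.-integrable setT (EFin \o g) ->
  mu.-integrable setT (EFin \o (fun z => f z.1 * g z.2)).
Proof.
move=> /integrableP[mf foo] /integrableP[mg goo].
have mf' : measurable_fun setT f by exact/measurable_EFinP.
have mg' : measurable_fun setT g by exact/measurable_EFinP.
apply/(integrable12ltyP leb leb).
  apply/measurable_EFinP; apply: measurable_funM.
    exact: (measurableT_comp mf' measurable_fst).
  exact: (measurableT_comp mg' measurable_snd).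
rewrite [ltLHS](_ : _ = (\int[leb]_x `|(f x)%:E|) * (\int[leb]_y `|(g y)%:E|))%E.
  apply: lte_mul_pinfty => //; first exact: integral_ge0.
  rewrite ge0_fin_numE//; exact: integral_ge0.
transitivity (\int[leb]_x (`|(f x)%:E| * \int[leb]_y `|(g y)%:E|))%E.
  apply: eq_integral => x _; rewrite -ge0_integralZl//.
  - by apply: eq_integral => y _ /=; rewrite -EFinM normrM.
  - exact: measurableT_comp.
rewrite ge0_integralZr//; first exact: measurableT_comp.
exact: integral_ge0.
Qed.

Lemma measurable_axes :
  measurable ([set z : R * R | z.1 = 0] `|` [set z | z.2 = 0]) /\
  mu ([set z | z.1 = 0] `|` [set z | z.2 = 0]) = 0.
Proof.
have m0 : measurable [set (0 : measurableTypeR R)] by exact: measurable_set1.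
have E1 : [set z : R * R | z.1 = 0] = [set 0] `*` setT by apply/seteqP; split => z /=; [|case].
have E2 : [set z : R * R | z.2 = 0] = setT `*` [set 0] by apply/seteqP; split => z /=; [|case].
have z1 : mu [set z | z.1 = 0] = 0.
  rewrite E1 /area product_measure1E//.
  by have l0 := lebesgue_measure_set1 (0 : R); rewrite [X in (X * _)%E]l0 mul0e.
have z2 : mu [set z | z.2 = 0] = 0.
  rewrite E2 /area product_measure1E//.
  by have l0 := lebesgue_measure_set1 (0 : R); rewrite [X in (_ * X)%E]l0 mule0.
have m1 : measurable [set z : R * R | z.1 = 0] by rewrite E1; exact: measurableX.
have m2 : measurable [set z : R * R | z.2 = 0] by rewrite E2; exact: measurableX.
split; first exact: measurableU.
apply/eqP; rewrite -measure_le0.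
have := @measureU2 _ _ _ mu _ _ m1 m2.
by rewrite [X in (_ <= X + _)%E]z1 [X in (_ <= _ + X)%E]z2 adde0.
Qed.

End powR_integrable.

Section plane_topology.
Context {R : realType}.
Implicit Types x y z : (R * R)%type.

Lemma nbhs_enormP x (A : set (R * R)) :
  nbhs x A <-> exists2 e : R, 0 < e & forall y, enorm (y - x) < e -> A y.
Proof.
split=> [/nbhs_ballP[e /= e0 xA]|[e e0 xA]].
  exists e => // y yx; apply: xA; split => /=.
    by rewrite /ball/= distrC (le_lt_trans (normr_fst_le (y - x))).
  by rewrite /ball/= distrC (le_lt_trans (normr_snd_le (y - x))).
apply/nbhs_ballP; exists (e / 2); first by rewrite /= divr_gt0.
move=> y [/= b1 b2]; apply: xA; apply: le_lt_trans (enorm_le_coord _) _.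
move: b1 b2; rewrite /ball/= distrC => b1; rewrite distrC => b2.
by rewrite [e]splitr ltrD.
Qed.

Lemma near_enorm x (e : R) : 0 < e -> \forall y \near x, enorm (y - x) < e.
Proof. by move=> e0; apply/nbhs_enormP; exists e. Qed.

Definition lip_on (D : set (R * R)) (L : R) (f : R * R -> R) :=
  forall x y, D x -> D y -> `|f x - f y| <= L * enorm (x - y).

Lemma lip_continuous L f : lip_on setT L f -> continuous f.
Proof.
move=> fL x; apply/cvgrPdist_lt => e e0.
have d0 : 0 < e / (`|L| + 1) by rewrite divr_gt0// ltr_wpDl.
near=> y; rewrite distrC; apply: le_lt_trans (fL _ _ I I) _.
have : enorm (y - x) < e / (`|L| + 1) by near: y; exact: near_enorm.
rewrite ltr_pdivlMr ?ltr_wpDl// => h; apply: le_lt_trans h.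
rewrite mulrC ler_wpM2l ?enorm_ge0//.
by rewrite (le_trans (ler_norm _))// lerDl.
Unshelve. all: by end_near.
Qed.

Lemma lip_enorm : lip_on setT 1 (@enorm R).
Proof. by move=> x y _ _; rewrite mul1r ler_dist_enorm. Qed.

Lemma measurable_enorm : measurable_fun setT (@enorm R).
Proof. apply: continuous_measurable_plane; exact: lip_continuous lip_enorm. Qed.

Lemma measurable_nsq : measurable_fun setT (fun z : R * R => dotp z z).
Proof. by apply: measurable_funD; apply: measurable_funM. Qed.

Definition cutoff (B : R) (z : R * R) : R := \1_[set z | enorm z <= B] z.

Lemma measurable_cutoff B : measurable_fun setT (cutoff B).
Proof.
apply: measurable_indic.
rewrite (_ : [set _ | _] = setT `&` (@enorm R) @^-1` `]-oo, B]).
  exact: measurable_enorm.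
by rewrite setTI; apply/seteqP; split => z /=; rewrite in_itv.
Qed.

Lemma cutoffE B z : cutoff B z = ((enorm z <= B)%R)%:R.
Proof.
rewrite /cutoff indicE.
by have -> : (z \in [set z | enorm z <= B]) = (enorm z <= B) by apply/idP/idP; rewrite inE.
Qed.

Lemma cutoff_ge0 B z : 0 <= cutoff B z.
Proof. by rewrite cutoffE. Qed.

End plane_topology.

(** * The kernel has finite mass on discs *)

Section kernel_integrable.
Context {R : realType}.
Variable s : R.
Hypothesis hs : 0 < s <= 1.
Notation leb := (@lebesgue_measure R).
Notation mu := (@area R).
Notation kap := (kap s).
Notation dkap := (dkap s).
Notation kape := (kape s).
Implicit Types e B : R.

Definition locally_integrable_kernel (k : R -> R) := measurable_fun setT k /\
  forall B, mu.-integrable setT (EFin \o (fun z => k (dotp z z) * cutoff B z)).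

Lemma integrable_cutoff B : mu.-integrable setT (EFin \o cutoff B).
Proof.
have i1 : leb.-integrable setT (EFin \o \1_(`[- B, B]%classic : set (measurableTypeR R))).
  exact: integrable_indic_itv.
apply: le_integrable (integrable_prod i1 i1) => //.
  by apply/measurable_EFinP; exact: measurable_cutoff.
move=> z _ /=; rewrite lee_fin cutoffE; case: (leP (enorm z) B) => zB; last by rewrite normr0.
rewrite !indicE !mem_set/= ?mulr1// in_itv/= -ler_norml.
  exact: le_trans (normr_snd_le _) _.
exact: le_trans (normr_fst_le _) _.
Qed.

Lemma nsq_ge_prod (z : R * R) : `|z.1| * `|z.2| <= dotp z z.
Proof.
rewrite /dotp -!expr2 -(real_normK (num_real z.1)) -(real_normK (num_real z.2)).
have := sqr_ge0 (`|z.1| - `|z.2|); rewrite sqrrB.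
have : 0 <= `|z.1| * `|z.2| by rewrite mulr_ge0.
linarith.
Qed.

(** Polar coordinates are avoided by |z.1| |z.2| <= |z|^2: as g - 1 < 0, the bound of [kap_growth]
    is dominated by a product of one-variable functions, off the axes, which are negligible. For |z|
    > 1 the slope of [kap] is at most 1, which gives the term in B^2. *)
Lemma kap_locally_integrable : locally_integrable_kernel kap.
Proof.
split=> [|B]; first exact: measurable_kap.
have [g [C [g0 g1 C0 kapC]]] := kap_growth hs.
have [mN1 mN] := @measurable_axes R.
set N := (X in mu X = _) in mN1 mN.
have mf : measurable_fun setT (EFin \o (fun z : R * R => kap (dotp z z) * cutoff B z)).
  apply/measurable_EFinP; apply: measurable_funM; last exact: measurable_cutoff.
  exact: measurableT_comp (measurable_kap s) (@measurable_nsq R).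
have H := @negligible_integrable _ _ R mu setT N _ mN1 measurableT mf mN.
apply/H => {H}.
pose G (z : R * R) := C * (powR_sym g z.1 * powR_sym g z.2) + (`|kap 1| + B ^+ 2) * cutoff B z.
have iG : mu.-integrable setT (EFin \o G).
  apply: integD; apply: integZ; last exact: integrable_cutoff.
  by apply: integrable_prod; exact: integrable_powR_sym.
apply: (@le_integrable _ _ R mu _ _ _ (EFin \o G)).
- exact: measurableD.
- exact: measurable_funS mf.
- move=> z [_ zN] /=; rewrite lee_fin.
  have {zN}[z1 z2] : z.1 != 0 /\ z.2 != 0.
    by split; apply/eqP => z0; apply: zN; [left|right].
  have p0 : 0 <= C * (powR_sym g z.1 * powR_sym g z.2).
    by rewrite mulr_ge0 ?mulr_ge0 ?powR_sym_ge0// ltW.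
  have zz0 : 0 < dotp z z.
    by rewrite dotp_gt0; apply: contra z1 => /eqP ->.
  rewrite [leRHS]ger0_norm; last first.
    by rewrite addr_ge0// mulr_ge0 ?cutoff_ge0// addr_ge0// sqr_ge0.
  rewrite /G cutoffE; case: (leP (enorm z) B) => zB; last by rewrite !mulr0 normr0 addr0.
  rewrite !mulr1.
  have [zz1|zz1] := leP (dotp z z) 1.
    have /andP[k1 k2] := kapC _ zz0 zz1.
    have : `|kap (dotp z z)| <= `|kap 1| + C * dotp z z `^ (g - 1).
      rewrite -[kap (dotp z z)](subrKC (kap 1)); apply: le_trans (ler_normD _ _) _.
      by rewrite lerD2l ger0_norm.
    have : C * dotp z z `^ (g - 1) <= C * (powR_sym g z.1 * powR_sym g z.2).
      rewrite ler_wpM2l ?(ltW C0)//.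
      have n1 : 0 < `|z.1| by rewrite normr_gt0.
      have n2 : 0 < `|z.2| by rewrite normr_gt0.
      apply: (@le_trans _ _ ((`|z.1| * `|z.2|) `^ (g - 1))).
        rewrite -(opprB 1 g) !powRN lef_pV2 ?posrE ?powR_gt0 ?mulr_gt0//.
        apply: ge0_ler_powR; rewrite ?nnegrE ?subr_ge0 ?(ltW g1) ?(ltW zz0) ?nsq_ge_prod//.
      rewrite powRM//.
      have ez1 : enorm z <= 1 by rewrite ler_enorm_sqr ?expr1n.
      apply: ler_pM; rewrite ?powR_ge0//; apply: powR_sym_ge => //.
        exact: le_trans (normr_fst_le _) _.
      exact: le_trans (normr_snd_le _) _.
    have := sqr_ge0 B; linarith.
  have /andP[k1 k2] := kap_diff_bounds hs ltr01 (ltW zz1).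
  have : `|kap (dotp z z) - kap 1| <= dotp z z - 1.
    rewrite distrC ger0_norm; first by move: k2; rewrite dkap1 mul1r.
    apply: le_trans k1; rewrite mulr_ge0 ?subr_ge0 1?ltW//.
    exact: dkap_gt0.
  have : dotp z z <= B ^+ 2 by rewrite -ler_enorm_sqr// (le_trans (enorm_ge0 z)).
  have := ler_normD (kap 1) (kap (dotp z z) - kap 1); rewrite subrKC.
  linarith.
- by apply: (@integrableS _ _ R mu setT) => //; exact: measurableD.
Qed.

Lemma kape_locally_integrable e : 0 < e -> locally_integrable_kernel (kape e).
Proof.
move=> e0; split=> [|B]; first exact: measurable_kape.
apply: (@le_integrable _ _ R mu _ _ _ (EFin \o (fun z => (`|kape e 0| + dkap e * B ^+ 2) * cutoff B z))) => //.
- apply/measurable_EFinP; apply: measurable_funM; last exact: measurable_cutoff.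
  exact: measurableT_comp (measurable_kape s e) (@measurable_nsq R).
- move=> z _ /=; rewrite lee_fin cutoffE; case: (leP (enorm z) B) => zB; last by rewrite !mulr0.
  have B0 : 0 <= B := le_trans (enorm_ge0 z) zB.
  have d0 := dkap_gt0 s e0.
  rewrite !mulr1 [leRHS]ger0_norm ?addr_ge0 ?mulr_ge0 ?(ltW d0) ?sqr_ge0//.
  have := kape_dist hs (dotp z z) 0 e0; rewrite subr0 (ger0_norm (dotp_ge0 z)) => h.
  have := ler_normD (kape e 0) (kape e (dotp z z) - kape e 0); rewrite subrKC.
  have : dkap e * dotp z z <= dkap e * B ^+ 2.
    by rewrite ler_wpM2l ?(ltW d0)// -ler_enorm_sqr.
  linarith.
- by apply: integZ; exact: integrable_cutoff.
Qed.

Lemma locally_integrable_kernelB k1 k2 : locally_integrable_kernel k1 ->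
  locally_integrable_kernel k2 -> locally_integrable_kernel (k1 \- k2).
Proof.
move=> [m1 i1] [m2 i2]; split => [|B]; first exact: measurable_funB.
have := integrableB measurableT (i1 B) (i2 B).
by apply: eq_integrable => // z _ /=; rewrite mulrBl EFinB.
Qed.

Definition kernel_mass (k : R -> R) (B : R) : R :=
  iint (fun z => `|k (dotp z z)| * cutoff B z).

Lemma kernel_mass_ge0 k B : 0 <= kernel_mass k B.
Proof. by apply: iint_ge0 => z; rewrite mulr_ge0 ?cutoff_ge0. Qed.

Lemma kernel_mass_integrable k B : locally_integrable_kernel k ->
  mu.-integrable setT (EFin \o (fun z => `|k (dotp z z)| * cutoff B z)).
Proof.
move=> [_ /(_ B) ki]; have := integrable_norm ki.
by apply: eq_integrable => // z _ /=; rewrite normrM (ger0_norm (cutoff_ge0 _ _)).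
Qed.

(** Dominated convergence along e = 1/(n+1): away from the origin [kape e] equals [kap] as soon as e
    <= |z|^2, and where the two differ [kape e] lies between [kap 1] and [kap]. *)
Lemma kap_kape_mass (B d : R) : 0 < d ->
  exists e, [/\ 0 < e, e <= 1 & kernel_mass (kap \- kape e) B <= d].
Proof.
move=> d0; pose e_ n : R := n.+1%:R^-1.
have e0 n : 0 < e_ n by rewrite invr_gt0.
have e1 n : e_ n <= 1 by rewrite invf_le1// ler1n.
pose f_ n (z : R * R) := (`|(kap \- kape (e_ n)) (dotp z z)| * cutoff B z)%:E.
pose G (z : R * R) := (`|kap (dotp z z)| * cutoff B z + `|kap 1| * cutoff B z)%:E.
have kl n := locally_integrable_kernelB kap_locally_integrable (kape_locally_integrable (e0 n)).
have [mN1 mN] := @measurable_axes R.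
have iG : mu.-integrable setT G.
  apply: integD; first exact/kernel_mass_integrable/kap_locally_integrable.
  by apply: integZ; exact: integrable_cutoff.
have nz (z : R * R) : ~ ([set z | z.1 = 0] `|` [set z | z.2 = 0]) z -> 0 < dotp z z.
  move=> zN; rewrite dotp_gt0; apply/eqP => z0; apply: zN; left; by rewrite z0.
have mf n : measurable_fun setT (f_ n).
  exact: (measurable_int mu (kernel_mass_integrable B (kl n))).
have [] := @dominated_convergence _ _ R mu setT measurableT f_ (cst 0%E) G mf _ _ iG _.
- exact: measurable_cst.
- exists ([set z | z.1 = 0] `|` [set z | z.2 = 0]); split => // z /= h.
  apply: contrapT => /nz zz0; apply: h => _.
  apply: cvg_near_cst; near=> n; rewrite /f_ /= kape_id ?subrr ?normr0 ?mul0r//.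
  rewrite /e_ -[leRHS]invrK lef_pV2 ?posrE ?invr_gt0//.
  near: n; exists (Num.truncn (dotp z z)^-1) => // m /= tm.
  by apply/ltW/(lt_le_trans (truncnS_gt _)); rewrite ler_nat.
- exists ([set z | z.1 = 0] `|` [set z | z.2 = 0]); split => // z /= h.
  apply: contrapT => /nz zz0; apply: h => n _.
  rewrite /f_ /G lee_fin -mulrDl normrM normr_id (ger0_norm (cutoff_ge0 _ _)).
  rewrite ler_wpM2r ?cutoff_ge0//=.
  rewrite ger0_norm ?subr_ge0 ?kape_bounds//.
  have [ez|ze] := leP (e_ n) (dotp z z).
    by rewrite kape_id// subrr addr_ge0.
  have := kape_ge s (e0 n) ze.
  have /andP[+ _] := kap_diff_bounds hs (e0 n) (e1 n).
  have : 0 <= dkap 1 * (1 - e_ n) by rewrite mulr_ge0 ?subr_ge0// ltW// dkap_gt0.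
  have := ler_norm (kap (dotp z z)); have := ler_norm (- kap 1); rewrite normrN.
  linarith.
move=> _ _; rewrite integral0 => /fine_cvgP[_] /cvgrPdist_le /(_ _ d0)[n _ /(_ n (leqnn n))].
rewrite /= sub0r normrN => nd; exists (e_ n); split => //.
by rewrite /kernel_mass iintE; apply: le_trans nd; exact: ler_norm.
Unshelve. all: by end_near.
Qed.

End kernel_integrable.

(** * Convolution with the kernel *)

Section convolution.
Context {R : realType}.
Notation mu := (@area R).
Implicit Types (x y z v n : (R * R)%type) (h : R * R -> R) (k : R -> R) (B C Y : R).

Definition bnd_supp B C h :=
  [/\ measurable_fun setT h, forall z, `|h z| <= C & forall z, B < enorm z -> h z = 0].

Fact convk_key : unit. Proof. by []. Qed.
Definition convk : (R -> R) -> (R * R -> R) -> R * R -> R := locked_with convk_key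
  (fun k h y => iint (fun z => k (dotp (y - z) (y - z)) * h z)).

Lemma convkE k h y : convk k h y = iint (fun z => k (dotp (y - z) (y - z)) * h z).
Proof. by rewrite /convk unlock. Qed.

Lemma ler_dist3 (a b c d : R) : `|a - b| <= `|a - c| + `|c - d| + `|b - d|.
Proof.
rewrite (distrC b); have -> : a - b = (a - c) + (c - d) + (d - b) by ring.
by apply: le_trans (ler_normD _ _) _; rewrite lerD2r ler_normD.
Qed.

Lemma bnd_supp_ge0 B C h : bnd_supp B C h -> 0 <= C.
Proof. by case=> _ /(_ 0) hC _; exact: le_trans (normr_ge0 _) hC. Qed.

Lemma bnd_suppD B C C' h h' : bnd_supp B C h -> bnd_supp B C' h' ->
  bnd_supp B (C + C') (fun z => h z + h' z).
Proof.
move=> [mh hC h0] [mh' hC' h0']; split; first exact: measurable_funD.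
  by move=> z; apply: le_trans (ler_normD _ _) _; exact: lerD.
by move=> z zB; rewrite h0// h0'// addr0.
Qed.

Lemma bnd_suppZ B C c h : bnd_supp B C h -> bnd_supp B (`|c| * C) (fun z => c * h z).
Proof.
move=> [mh hC h0]; split; first exact: measurable_funM.
  by move=> z; rewrite normrM ler_wpM2l.
by move=> z zB; rewrite h0// mulr0.
Qed.

Lemma bnd_suppB B C C' h h' : bnd_supp B C h -> bnd_supp B C' h' ->
  bnd_supp B (C + C') (fun z => h z - h' z).
Proof.
move=> [mh hC h0] [mh' hC' h0']; split; first exact: measurable_funB.
  by move=> z; apply: le_trans (ler_normB _ _) _; exact: lerD.
by move=> z zB; rewrite h0// h0'// subr0.
Qed.

Lemma bnd_supp_le B B' C C' h : B <= B' -> C <= C' -> bnd_supp B C h -> bnd_supp B' C' h.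
Proof.
move=> BB CC [mh hC h0]; split=> // z; first exact: le_trans (hC _) _.
by move=> zB; apply: h0; exact: le_lt_trans zB.
Qed.

Lemma bnd_supp_le_cutoff B C h z : bnd_supp B C h -> `|h z| <= C * cutoff B z.
Proof.
move=> [_ hC h0]; rewrite cutoffE; case: (leP (enorm z) B) => zB; rewrite ?mulr1//.
by rewrite h0// normr0 mulr0.
Qed.

Lemma integ_bnd_supp B C h : bnd_supp B C h -> integ h.
Proof.
move=> hb; apply: (@le_integ R _ (fun z => C * cutoff B z)).
- by case: hb.
- by move=> z; exact: bnd_supp_le_cutoff.
- by apply: integZ; exact: integrable_cutoff.
Qed.

Lemma norm_iint_bnd_supp B C h : bnd_supp B C h -> `|iint h| <= C * iint (cutoff B).
Proof.
move=> hb; rewrite -iintZ; last exact: integrable_cutoff.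
apply: norm_iint_le; first by case: hb.
- by move=> z; exact: bnd_supp_le_cutoff.
- by apply: integZ; exact: integrable_cutoff.
Qed.

Lemma measurable_sub_l y : measurable_fun setT (fun z : R * R => y - z).
Proof.
have [m1 _] := @area_preserving_opp R.
have [m2 _] := area_preserving_translate y.
by have := measurableT_comp m2 m1; congr measurable_fun; apply/funext => z /=; rewrite addrC.
Qed.

Lemma area_preserving_subl y : area_preserving (fun z : R * R => y - z).
Proof.
have := area_preserving_comp (area_preserving_translate y) (@area_preserving_opp R).
by congr area_preserving; apply/funext => z /=; rewrite addrC.
Qed.

Section fixed_kernel.
Variable k : R -> R.
Hypothesis lk : locally_integrable_kernel k.

Lemma measurable_kernel y : measurable_fun setT (fun z => k (dotp (y - z) (y - z))).
Proof.
exact: measurableT_comp (measurableT_comp lk.1 (@measurable_nsq R)) (measurable_sub_l y).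
Qed.

Lemma integ_kernel_cutoff B : integ (fun z => `|k (dotp z z)| * cutoff B z).
Proof. exact: kernel_mass_integrable. Qed.

Lemma convk_shift h y : measurable_fun setT h ->
  convk k h y = iint (fun z => k (dotp z z) * h (y - z)).
Proof.
move=> mh; rewrite convkE -(@iint_preserving R _ (fun z => k (dotp z z) * h (y - z)) (area_preserving_subl y)).
  by apply: eq_iint => z; rewrite subKr.
apply: measurable_funM; first exact: measurableT_comp lk.1 (@measurable_nsq R).
exact: measurableT_comp mh (measurable_sub_l y).
Qed.

(** If z contributes then |y - z| <= B, hence |z| <= B + |y|: the mass of the kernel on that disc
    controls the convolution. *)
Lemma convk_majorant B C h y z : bnd_supp B C h ->
  `|k (dotp z z) * h (y - z)| <= C * (`|k (dotp z z)| * cutoff (B + enorm y) z).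
Proof.
move=> hb; rewrite normrM mulrCA ler_wpM2l//.
apply: le_trans (bnd_supp_le_cutoff _ hb) _; rewrite ler_wpM2l ?(bnd_supp_ge0 hb)//.
rewrite !cutoffE; case: (leP (enorm (y - z)) B) => // yz.
have -> // : enorm z <= B + enorm y.
by have := ler_enorm_distD y z 0; rewrite subr0 enormBC subr0; lra.
Qed.

Lemma integ_convk_shift B C h y : bnd_supp B C h ->
  integ (fun z => k (dotp z z) * h (y - z)).
Proof.
move=> hb; apply: le_integ (fun z => convk_majorant y z hb) _.
  apply: measurable_funM; first exact: measurableT_comp lk.1 (@measurable_nsq R).
  by case: hb => mh _ _; exact: measurableT_comp mh (measurable_sub_l y).
by apply: integZ; exact: integ_kernel_cutoff.
Qed.

Lemma integ_convk B C h y : bnd_supp B C h ->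
  integ (fun z => k (dotp (y - z) (y - z)) * h z).
Proof.
move=> hb; have := integ_preserving (area_preserving_subl y) (integ_convk_shift y hb).
by apply: integ_eq => z; rewrite subKr.
Qed.

Lemma convkD B C C' h h' y : bnd_supp B C h -> bnd_supp B C' h' ->
  convk k (fun z => h z + h' z) y = convk k h y + convk k h' y.
Proof.
move=> hb hb'; rewrite !convkE -iintD; [|exact: integ_convk hb|exact: integ_convk hb'].
by apply: eq_iint => z; rewrite mulrDr.
Qed.

Lemma convkB B C C' h h' y : bnd_supp B C h -> bnd_supp B C' h' ->
  convk k (fun z => h z - h' z) y = convk k h y - convk k h' y.
Proof.
move=> hb hb'; rewrite !convkE -iintB; [|exact: integ_convk hb|exact: integ_convk hb'].
by apply: eq_iint => z; rewrite mulrBr.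
Qed.

Lemma convkZ B C h c y : bnd_supp B C h -> convk k (fun z => c * h z) y = c * convk k h y.
Proof.
move=> hb; rewrite !convkE -iintZ; last exact: integ_convk hb.
by apply: eq_iint => z; rewrite mulrCA.
Qed.

Lemma norm_convk_le B C h y : bnd_supp B C h ->
  `|convk k h y| <= C * kernel_mass k (B + enorm y).
Proof.
move=> hb; rewrite convk_shift; last by case: hb.
rewrite /kernel_mass -iintZ; last exact: integ_kernel_cutoff.
apply: norm_iint_le => [|z|].
- by have /integ_measurable := integ_convk_shift y hb.
- exact: convk_majorant.
- by apply: integZ; exact: integ_kernel_cutoff.
Qed.

Lemma le_kernel_mass B B' : B <= B' -> kernel_mass k B <= kernel_mass k B'.
Proof.
move=> BB; apply: le_iint; try exact: integ_kernel_cutoff.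
move=> z; rewrite ler_wpM2l// !cutoffE.
by case: (leP (enorm z) B) => // zB; rewrite (le_trans zB).
Qed.

Lemma norm_convk_leY B C h y Y : bnd_supp B C h -> enorm y <= Y ->
  `|convk k h y| <= C * kernel_mass k (B + Y).
Proof.
move=> hb yY; apply: le_trans (norm_convk_le y hb) _.
by rewrite ler_wpM2l ?(bnd_supp_ge0 hb)// le_kernel_mass// lerD2l.
Qed.

Lemma bnd_supp_translate B C h v : bnd_supp B C h -> bnd_supp (B + enorm v) C (fun z => h (z + v)).
Proof.
move=> [mh hC h0]; split => //.
  by have [m2 _] := area_preserving_translate v; exact: measurableT_comp mh m2.
move=> z zB; apply: h0; have := ler_enorm_distD (- v) z 0.
by rewrite subr0 opprK subr0 enormN; lra.
Qed.

Lemma convk_translate B C h v y : bnd_supp B C h ->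
  convk k (fun z => h (z + v)) y = convk k h (y + v).
Proof.
move=> hb; rewrite convk_shift; last by have [] := bnd_supp_translate v hb.
rewrite convk_shift; last by case: hb.
by apply: eq_iint => z; rewrite addrAC.
Qed.

Lemma lip_convk B C L h Y : bnd_supp B C h -> lip_on setT L h ->
  lip_on [set y | enorm y <= Y] (L * kernel_mass k (B + Y)) (convk k h).
Proof.
move=> hb hL x y /= xY yY.
have mh : measurable_fun setT h by case: hb.
rewrite !convk_shift// -iintB; try exact: integ_convk_shift hb.
have Lxy : 0 <= L * enorm (x - y) by exact: le_trans (hL x y I I).
rewrite mulrAC /kernel_mass -iintZ; last exact: integ_kernel_cutoff.
apply: norm_iint_le => [|z|].
- apply: integ_measurable; apply: integB; exact: integ_convk_shift hb.
- rewrite -mulrBr normrM mulrCA ler_wpM2l// cutoffE.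
  case: (leP (enorm z) (B + Y)) => zB.
    by rewrite mulr1 (le_trans (hL _ _ I I))// opprB addrA subrK.
  have out u : enorm u <= Y -> h (u - z) = 0.
    move=> uY; case: hb => _ _; apply.
    by have := ler_enorm_distD u z 0; rewrite subr0 enormBC subr0; lra.
  by rewrite !out// subrr normr0 mulr0.
- by apply: integZ; exact: integ_kernel_cutoff.
Qed.

Lemma convk_refl n h y : dotp n n = 1 -> measurable_fun setT h ->
  convk k (fun z => h (refl n z)) y = convk k h (refl n y).
Proof.
move=> n1 mh; have pr := area_preserving_refl n1.
rewrite !convkE -(@iint_preserving R _ _ pr).
  apply: eq_iint => z; rewrite reflK//; congr (k _ * _).
  by rewrite -(dotp_refl (y - _) _ n1) reflB reflK.
apply: measurable_funM; first exact: measurable_kernel.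
by case: pr => mT _; exact: measurableT_comp mh mT.
Qed.

(** With [h1] and [h2] in the role of the partial derivatives of h, the Taylor remainder of the
    convolution is the convolution of the Taylor remainder. *)
Lemma convk_taylor B C h h1 h2 K y v Y : bnd_supp B C h -> bnd_supp B C h1 ->
  bnd_supp B C h2 -> 0 <= K -> enorm v <= 1 -> enorm y <= Y ->
  (forall x, `|h (x + v) - h x - (v.1 * h1 x + v.2 * h2 x)| <= K * enorm v ^+ 2) ->
  `|convk k h (y + v) - convk k h y - (v.1 * convk k h1 y + v.2 * convk k h2 y)|
    <= K * kernel_mass k (B + Y + 1) * enorm v ^+ 2.
Proof.
move=> hb hb1 hb2 K0 v1 yY hT.
have m0 : measurable_fun setT h by case: hb.
have m1 : measurable_fun setT h1 by case: hb1.
have m2 : measurable_fun setT h2 by case: hb2.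
rewrite -!(convkZ _ y hb1) -!(convkZ _ y hb2).
rewrite -(convkD y (bnd_suppZ _ hb1) (bnd_suppZ _ hb2)).
rewrite -(convk_translate v y hb).
have hbv := bnd_supp_translate v hb.
have wB : B <= B + enorm v by rewrite lerDl enorm_ge0.
have hbE := bnd_supp_le wB (lexx _) hb.
rewrite -(convkB y hbv hbE).
have hb12 := bnd_supp_le wB (lexx _) (bnd_suppD (bnd_suppZ v.1 hb1) (bnd_suppZ v.2 hb2)).
have hbd := bnd_suppB hbv hbE.
rewrite -(convkB y hbd hb12).
have hbT : bnd_supp (B + enorm v) (K * enorm v ^+ 2)
   (fun z => h (z + v) - h z - (v.1 * h1 z + v.2 * h2 z)).
  by have [ma _ za] := bnd_suppB hbd hb12; split.
apply: le_trans (norm_convk_leY hbT yY) _.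
rewrite [leRHS]mulrAC; apply: ler_wpM2l; first by rewrite mulr_ge0 ?sqr_ge0.
apply: le_kernel_mass; lra.
Qed.

End fixed_kernel.

Lemma convkBk k1 k2 B C h y : locally_integrable_kernel k1 -> locally_integrable_kernel k2 ->
  bnd_supp B C h -> convk (k1 \- k2) h y = convk k1 h y - convk k2 h y.
Proof.
move=> l1 l2 hb; rewrite !convkE -iintB; [|exact: integ_convk hb..].
by apply: eq_iint => z /=; rewrite mulrBl.
Qed.

(** * Splitting the singular kernel into a regular part and a small part *)

Section kap_convolution.
Variable s : R.
Hypothesis hs : 0 < s <= 1.
Notation kap := (kap s).
Notation kape := (kape s).
Notation dkap := (dkap s).
Notation dkape := (dkape s).
Notation conv := (convk kap).
Let lk := kap_locally_integrable hs.

Lemma kape_nsq_lip e B : 0 < e -> 0 <= B ->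
  lip_on [set x | enorm x <= B] (2 * dkap e * B) (fun x => kape e (dotp x x)).
Proof.
move=> e0 B0 x y /= xB yB; apply: le_trans (kape_dist hs _ _ e0) _.
rewrite [X in X * _ * _]mulrC -!mulrA ler_wpM2l ?(ltW (dkap_gt0 s e0))//.
rewrite -!enorm_sqr subr_sqr normrM mulrC mulrA ler_pM//; last exact: ler_dist_enorm.
by rewrite ger0_norm ?addr_ge0 ?enorm_ge0//; linarith.
Qed.

(** Here the increment falls on the kernel, whose slope is bounded, so a sup bound on h yields a
    Lipschitz bound. *)
Lemma conv_kape_lip e B C h Y : 0 < e -> 0 <= B -> 0 <= Y -> bnd_supp B C h ->
  lip_on [set y | enorm y <= Y] (2 * dkap e * (B + Y) * iint (cutoff B) * C) (convk (kape e) h).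
Proof.
move=> e0 B0 Y0 hb x y /= xY yY; have le := kape_locally_integrable hs e0.
rewrite !convkE -iintB; [|exact: integ_convk hb..].
rewrite (_ : _ * _ * C * _ = 2 * dkap e * (B + Y) * C * enorm (x - y) * iint (cutoff B)); last by ring.
rewrite -iintZ; last exact: integrable_cutoff.
apply: norm_iint_le => [|z|]; last by apply: integZ; exact: integrable_cutoff.
  by apply: integ_measurable; apply: integB; exact: integ_convk hb.
rewrite -mulrBl normrM cutoffE; case: (leP (enorm z) B) => zB; last first.
  by case: hb => _ _ ->//; rewrite normr0 !mulr0.
rewrite mulr1 mulrAC ler_pM//; last by case: hb.
have bnd u : enorm u <= Y -> enorm (u - z) <= B + Y.
  by move=> uY; apply: le_trans (ler_enormB _ _) _; linarith.
apply: le_trans (kape_nsq_lip e0 (addr_ge0 B0 Y0) (bnd x xY) (bnd y yY)) _.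
by rewrite opprB addrA subrK.
Qed.

(* The splitting kap = kape e + (kap - kape e): the convolution with the first
   part is smooth and the second part is small in L^1. *)
Lemma conv_split B Y d : 0 <= B -> 0 <= Y -> 0 < d -> exists e L, [/\ 0 < e <= 1, 0 <= L &
  forall C h, bnd_supp B C h ->
  [/\ lip_on [set y | enorm y <= Y] (L * C) (convk (kape e) h),
      forall y, enorm y <= Y -> `|conv h y - convk (kape e) h y| <= d * C &
      forall K, lip_on setT K h -> lip_on [set y | enorm y <= Y] (d * K)
        (fun y => conv h y - convk (kape e) h y)]].
Proof.
move=> B0 Y0 d0; have [e [e0 e1 md]] := kap_kape_mass hs (B + Y) d0.
have le := kape_locally_integrable hs e0.
have ld := locally_integrable_kernelB lk le.
exists e, (2 * dkap e * (B + Y) * iint (cutoff B)); split; first by rewrite e0.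
  rewrite !mulr_ge0 ?addr_ge0 ?(ltW (dkap_gt0 s e0))//.
  by apply: iint_ge0 => z; exact: cutoff_ge0.
move=> C h hb; have C0 := bnd_supp_ge0 hb.
have E y : conv h y - convk (kape e) h y = convk (kap \- kape e) h y.
  by rewrite (convkBk y lk le hb).
split; first exact: conv_kape_lip.
- move=> y yY; rewrite E mulrC; apply: le_trans (norm_convk_leY ld hb yY) _.
  by rewrite ler_wpM2l.
- move=> K hK x y xY yY; rewrite (E x) (E y).
  apply: le_trans (lip_convk ld hb hK xY yY) _.
  rewrite ler_wpM2r ?enorm_ge0// mulrC ler_wpM2r//.
  have := hK 0 (1, 0) I I.
  have -> : enorm (0 - (1, 0) : R * R) = 1.
    by rewrite sub0r enormN /enorm /dotp/= mulr1 mul0r addr0 sqrtr1.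
  by rewrite mulr1; exact: le_trans.
Qed.

(** Through [conv_split]: the error of the regular part costs d/4 at each of the two points by the
    choice of t, and its increment costs d/4 in a small disc. *)
Lemma conv_continuous B C h : 0 <= B -> bnd_supp B C h -> continuous (conv h).
Proof.
move=> B0 hb x; apply/cvgrPdist_lt => d d0.
have C0 := bnd_supp_ge0 hb.
pose t := d / (4 * (C + 1)).
have t0 : 0 < t by rewrite divr_gt0// mulr_gt0// ltr_wpDl.
have tC : t * C <= d / 4.
  have tE : t * (C + 1) = d / 4 by rewrite /t; field; linarith.
  by rewrite -tE ler_wpM2l ?(ltW t0)//; linarith.
have Y0 : 0 <= enorm x + 1 by rewrite addr_ge0 ?enorm_ge0.
have [e [L [_ L0 /(_ C h hb)[h1 h2 _]]]] := conv_split B0 Y0 t0.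
near=> y.
have xy : enorm (y - x) < Num.min 1 (d / (4 * (L * C + 1))).
  near: y; apply: near_enorm; rewrite lt_min ltr01 divr_gt0// mulr_gt0//.
  by rewrite ltr_wpDl// mulr_ge0.
move: xy; rewrite lt_min => /andP[xy1 xy2].
have yY : enorm y <= enorm x + 1.
  by have := ler_enormD x (y - x); rewrite addrC subrK; linarith.
have xY : enorm x <= enorm x + 1 by linarith.
have := h2 x xY; have := h2 y yY; have := h1 x y xY yY.
have : L * C * enorm (x - y) <= d / 4.
  rewrite enormBC; move: xy2; rewrite ltr_pdivlMr ?mulr_gt0 ?ltr_wpDl ?mulr_ge0//.
  by have := enorm_ge0 (y - x); have : 0 <= L * C by [rewrite mulr_ge0]; nra.
have := ler_dist3 (conv h x) (conv h y) (convk (kape e) h x) (convk (kape e) h y).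
linarith.
Unshelve. all: by end_near.
Qed.

Lemma measurable_conv B C h : 0 <= B -> bnd_supp B C h -> measurable_fun setT (conv h).
Proof. by move=> B0 hb; apply: continuous_measurable_plane; exact: conv_continuous hb. Qed.

End kap_convolution.

End convolution.

(** * Gradients, and symmetry of the convolution *)

Section fubini_generic.
Context d (T : measurableType d) {R : realType}.
Variable m : {sigma_finite_measure set T -> \bar R}.

(** The product majorant makes f integrable on the product by Tonelli, and makes every section
    integrable, so that [fine] may be taken inside. *)
Lemma Rintegral_swap (f : T * T -> R) (g h : T -> R) :
  measurable_fun setT f -> (forall x y, `|f (x, y)| <= g x * h y) ->
  (forall x, 0 <= g x) -> (forall x, 0 <= h x) ->
  m.-integrable setT (EFin \o g) -> m.-integrable setT (EFin \o h) ->
  \int[m]_x \int[m]_y f (x, y) = \int[m]_y \int[m]_x f (x, y).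
Proof.
move=> mf fgh g0 h0 gi hi.
have mf' : measurable_fun setT (EFin \o f) by exact/measurable_EFinP.
have i1 x : m.-integrable setT (fun y => (f (x, y))%:E).
  apply: (le_integrable measurableT _ _ (integrableZl measurableT (g x) hi)) => [|y _ /=].
    by apply/measurable_EFinP; apply: measurableT_comp mf _; exact: measurable_pair1.
  by rewrite lee_fin; apply: le_trans (fgh x y) _; exact: ler_norm.
have i2 y : m.-integrable setT (fun x => (f (x, y))%:E).
  apply: (le_integrable measurableT _ _ (integrableZl measurableT (h y) gi)) => [|x _ /=].
    by apply/measurable_EFinP; apply: measurableT_comp mf _; exact: measurable_pair2.
  by rewrite lee_fin mulrC; apply: le_trans (fgh x y) _; rewrite mulrC; exact: ler_norm.
have fi : (m \x m)%E.-integrable setT (EFin \o f).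
  apply/(integrable12ltyP m m) => //.
  have [mg _] := integrableP _ _ _ gi; have [mh _] := integrableP _ _ _ hi.
  have hfin : (\int[m]_y (h y)%:E \is a fin_num)%E by exact: integrable_fin_num hi.
  apply: (@le_lt_trans _ _ (\int[m]_x ((g x)%:E * \int[m]_y (h y)%:E))%E).
    apply: ge0_le_integral => //.
    - by move=> x _; exact: integral_ge0.
    - apply: (@measurable_fun_fubini_tonelli_F _ _ _ _ _ m (fun p => `|(f p)%:E|%E)) => //.
      exact: measurableT_comp.
    - exact: emeasurable_funM.
    - move=> x _; rewrite -ge0_integralZl//; first last.
      + by rewrite lee_fin.
      + by move=> y _; rewrite lee_fin.
      apply: ge0_le_integral => //.
      + by apply: measurableT_comp => //; have [] := integrableP _ _ _ (i1 x).
      + exact: emeasurable_funM.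
      + by move=> y _; rewrite -EFinM lee_fin.
  rewrite ge0_integralZr//.
  - rewrite lte_mul_pinfty//; first by apply: integral_ge0 => x _; rewrite lee_fin.
      exact: integrable_fin_num gi.
    by rewrite ltey_eq hfin.
  - by move=> x _; rewrite lee_fin.
  - by apply: integral_ge0 => x _; rewrite lee_fin.
rewrite /Rintegral; congr (fine _).
under eq_integral do rewrite fineK ?integrable_fin_num//.
under [RHS]eq_integral do rewrite fineK ?integrable_fin_num//.
exact: (Fubini fi).
Qed.

End fubini_generic.

Section gradient.
Context {R : realType}.
Implicit Types (x y v g : (R * R)%type) (f : R * R -> R) (G : R * R -> R * R).

Definition has_grad f y g := forall e : R, 0 < e -> exists2 d : R, 0 < d &
  forall v, enorm v < d -> `|f (y + v) - f y - dotp g v| <= e * enorm v.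

(** The gradient field exists on a disc but is required to be continuous only at the centre. In this
    form the notion passes to limits in the Lipschitz seminorm, and at every point it implies
    [C1]. *)
Definition C1at f y := exists G (r : R), [/\ 0 < r,
  forall x, enorm (x - y) < r -> has_grad f x (G x) &
  forall e, 0 < e -> exists2 d : R, 0 < d &
    forall x, enorm (x - y) < d -> enorm (G x - G y) <= e].

Lemma has_grad_taylor f y g (K r : R) : 0 < r -> 0 <= K ->
  (forall v, enorm v <= r -> `|f (y + v) - f y - dotp g v| <= K * enorm v ^+ 2) ->
  has_grad f y g.
Proof.
move=> r0 K0 fT e e0; have K1 : 0 < K + 1 by rewrite ltr_wpDl.
exists (Num.min r (e / (K + 1))); first by rewrite lt_min r0 divr_gt0.
move=> v; rewrite lt_min => /andP[vr ve]; apply: le_trans (fT v (ltW vr)) _.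
rewrite expr2 mulrA ler_wpM2r ?enorm_ge0//.
move: ve; rewrite ltr_pdivlMr// => /ltW; apply: le_trans.
by rewrite mulrC ler_wpM2l ?enorm_ge0// lerDl.
Qed.

Lemma has_gradD f1 f2 y g1 g2 : has_grad f1 y g1 -> has_grad f2 y g2 ->
  has_grad (fun x => f1 x + f2 x) y (g1 + g2).
Proof.
move=> h1 h2 e e0; have e2 : 0 < e / 2 by rewrite divr_gt0.
have [d1 d10 H1] := h1 _ e2; have [d2 d20 H2] := h2 _ e2.
exists (Num.min d1 d2); first by rewrite lt_min d10.
move=> v; rewrite lt_min => /andP[v1 v2].
have := H1 v v1; have := H2 v v2.
rewrite dotpDl (_ : f1 (y + v) + f2 (y + v) - (f1 y + f2 y) - (dotp g1 v + dotp g2 v) =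
  (f1 (y + v) - f1 y - dotp g1 v) + (f2 (y + v) - f2 y - dotp g2 v)); last by ring.
move=> h h'; apply: le_trans (ler_normD _ _) _.
by have := lerD h' h; rewrite -mulrDl -splitr.
Qed.

Lemma has_gradZ c f y g : has_grad f y g -> has_grad (fun x => c * f x) y (c *: g).
Proof.
move=> h e e0; have c1 : 0 < `|c| + 1 by rewrite ltr_wpDl.
have [d d0 H] := h _ (divr_gt0 e0 c1); exists d => // v vd.
rewrite dotpZl -!mulrBr normrM.
apply: le_trans (_ : `|c| * (e / (`|c| + 1) * enorm v) <= _).
  by rewrite ler_wpM2l// H.
rewrite mulrA ler_wpM2r ?enorm_ge0// mulrCA ler_piMr ?(ltW e0)//.
by rewrite ler_pdivrMr// mul1r lerDl.
Qed.

Lemma has_grad_cst (c : R) y : has_grad (fun=> c) y 0.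
Proof.
move=> e e0; exists 1 => // v _.
by rewrite dotp0l !subrr normr0 mulr_ge0 ?enorm_ge0// ltW.
Qed.

Lemma has_grad_dotp b y : has_grad (dotp b) y b.
Proof.
move=> e e0; exists 1 => // v _.
by rewrite dotpDr [X in X - _ - _]addrC addrK subrr normr0 mulr_ge0 ?enorm_ge0// ltW.
Qed.

Lemma has_grad_affine f a b y g : has_grad f (a *: y + b) g ->
  has_grad (fun x => f (a *: x + b)) y (a *: g).
Proof.
move=> h e e0; have a1 : 0 < `|a| + 1 by rewrite ltr_wpDl.
have [d d0 H] := h _ (divr_gt0 e0 a1).
exists (d / (`|a| + 1)); first by rewrite divr_gt0.
move=> v; rewrite ltr_pdivlMr// => vd.
have av : enorm (a *: v) < d.
  apply: le_lt_trans vd; rewrite enormZ mulrC ler_wpM2l ?enorm_ge0//.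
  by rewrite lerDl.
have := H _ av; rewrite dotpZl dotpZr scalerDr (addrAC (a *: y) (a *: v)) => h1.
apply: le_trans h1 _; rewrite enormZ mulrA ler_wpM2r ?enorm_ge0//.
by rewrite -mulrA ler_piMr ?(ltW e0)// mulrC ler_pdivrMr// mul1r lerDl.
Qed.

Lemma eq_has_grad f1 f2 y g (r : R) : 0 < r ->
  (forall x, enorm (x - y) < r -> f1 x = f2 x) -> has_grad f1 y g -> has_grad f2 y g.
Proof.
move=> r0 f12 h e e0; have [d d0 H] := h e e0.
exists (Num.min d r); first by rewrite lt_min d0.
move=> v; rewrite lt_min => /andP[vd vr].
by rewrite -!f12 ?H// ?subrr ?enorm0// addrC addKr.
Qed.

(** The expansion is tested on small multiples of g itself. For g = 0 it remains to see that L >= 0,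
    which the increment at one nonzero vector shows. *)
Lemma has_grad_lip f y g (L r : R) : 0 < r ->
  (forall v, enorm v < r -> `|f (y + v) - f y| <= L * enorm v) ->
  has_grad f y g -> enorm g <= L.
Proof.
move=> r0 fL h; apply/ler_addgt0Pr => e e0.
have [g0|gn0] := eqVneq g 0.
  rewrite g0 enorm0 addr_ge0 ?(ltW e0)//.
  have u : enorm ((r / 2, 0) : R * R) = r / 2.
    by rewrite /enorm /dotp/= mulr0 addr0 -expr2 sqrtr_sqr ger0_norm// divr_ge0 ?ltW.
  have := fL (r / 2, 0); rewrite u => /(_ ltac:(linarith)) h1.
  have : 0 <= L * (r / 2) := le_trans (normr_ge0 _) h1.
  by rewrite pmulr_lge0// divr_gt0.
have ng0 : 0 < enorm g by rewrite lt0r enorm_eq0 gn0 enorm_ge0.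
have [d d0 H] := h e e0.
pose t := Num.min d r / 2 / enorm g.
have m0 : 0 < Num.min d r by rewrite lt_min d0.
have t0 : 0 < t by rewrite divr_gt0// divr_gt0.
have tg : enorm (t *: g) = Num.min d r / 2.
  by rewrite enormZ gtr0_norm// /t divfK// gt_eqF.
have : enorm (t *: g) < Num.min d r by rewrite tg; linarith.
rewrite lt_min => /andP[td tr].
have := H _ td; have := fL _ tr.
rewrite dotpZr -enorm_sqr !enormZ (gtr0_norm t0) => h1 h2.
have := ler_normB (f (y + t *: g) - f y) (f (y + t *: g) - f y - t * enorm g ^+ 2).
rewrite opprB addrCA subrr addr0 ger0_norm; last by rewrite mulr_ge0 ?sqr_ge0// ltW.
move=> h3; rewrite -(ler_pM2r (mulr_gt0 t0 ng0)).
by rewrite mulrDl; rewrite expr2 in h3; linarith.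
Qed.

Lemma has_gradB f1 f2 y g1 g2 : has_grad f1 y g1 -> has_grad f2 y g2 ->
  has_grad (fun x => f1 x - f2 x) y (g1 - g2).
Proof.
move=> h1 h2; have := has_gradD h1 (has_gradZ (-1) h2); rewrite scaleN1r.
by apply: (eq_has_grad ltr01) => x _; rewrite mulN1r.
Qed.

Lemma has_grad_unique f y g g' : has_grad f y g -> has_grad f y g' -> g = g'.
Proof.
move=> h h'; have := has_gradB h h' => hd.
have : enorm (g - g') <= 0.
  by apply: (has_grad_lip ltr01) hd => v _; rewrite !subrr mul0r normr0.
by rewrite le_eqVlt ltNge enorm_ge0 orbF enorm_eq0 subr_eq0 => /eqP.
Qed.

Lemma C1atD f1 f2 y : C1at f1 y -> C1at f2 y -> C1at (fun x => f1 x + f2 x) y.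
Proof.
move=> [G1 [r1 [r10 h1 c1]]] [G2 [r2 [r20 h2 c2]]].
exists (fun x => G1 x + G2 x), (Num.min r1 r2); split.
- by rewrite lt_min r10.
- by move=> x; rewrite lt_min => /andP[x1 x2]; apply: has_gradD; [exact: h1|exact: h2].
- move=> e e0; have e2 : 0 < e / 2 by rewrite divr_gt0.
  have [d1 d10 H1] := c1 _ e2; have [d2 d20 H2] := c2 _ e2.
  exists (Num.min d1 d2); first by rewrite lt_min d10.
  move=> x; rewrite lt_min => /andP[x1 x2]; rewrite opprD addrACA.
  by apply: le_trans (ler_enormD _ _) _; rewrite [e]splitr lerD// ?H1 ?H2.
Qed.

Lemma C1atZ c f y : C1at f y -> C1at (fun x => c * f x) y.
Proof.
move=> [G [r [r0 h1 c1]]]; exists (fun x => c *: G x), r; split => //.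
  by move=> x xr; apply: has_gradZ; exact: h1.
move=> e e0; have a1 : 0 < `|c| + 1 by rewrite ltr_wpDl.
have [d d0 H] := c1 _ (divr_gt0 e0 a1); exists d => // x xd.
rewrite -scalerBr enormZ; apply: le_trans (_ : `|c| * (e / (`|c| + 1)) <= _).
  by rewrite ler_wpM2l// H.
by rewrite mulrCA ler_piMr ?(ltW e0)// ler_pdivrMr// mul1r lerDl.
Qed.

Lemma C1atB f1 f2 y : C1at f1 y -> C1at f2 y -> C1at (fun x => f1 x - f2 x) y.
Proof.
move=> h1 h2; have := C1atD h1 (C1atZ (-1) h2); congr C1at.
by apply/funext => x; rewrite mulN1r.
Qed.

Lemma C1at_cst c y : C1at (fun=> c) y.
Proof.
exists (fun=> 0), 1; split => //; first by move=> x _; exact: has_grad_cst.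
by move=> e e0; exists 1 => // x _; rewrite subrr enorm0 ltW.
Qed.

Lemma C1at_dotp b y : C1at (dotp b) y.
Proof.
exists (fun=> b), 1; split => //; first by move=> x _; exact: has_grad_dotp.
by move=> e e0; exists 1 => // x _; rewrite subrr enorm0 ltW.
Qed.

Lemma C1at_affine f a b y : C1at f (a *: y + b) -> C1at (fun x => f (a *: x + b)) y.
Proof.
move=> [G [r [r0 h1 c1]]]; have a1 : 0 < `|a| + 1 by rewrite ltr_wpDl.
have key (d : R) x : enorm (x - y) < d / (`|a| + 1) ->
    enorm (a *: x + b - (a *: y + b)) < d.
  rewrite ltr_pdivlMr// => h; rewrite opprD addrACA subrr addr0 -scalerBr enormZ.
  by apply: le_lt_trans h; rewrite mulrC ler_wpM2l ?enorm_ge0// lerDl.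
exists (fun x => a *: G (a *: x + b)), (r / (`|a| + 1)); split.
- by rewrite divr_gt0.
- by move=> x xr; apply: has_grad_affine; apply: h1; exact: key.
- move=> e e0; have [d d0 H] := c1 _ (divr_gt0 e0 a1).
  exists (d / (`|a| + 1)); first by rewrite divr_gt0.
  move=> x xd; rewrite -scalerBr enormZ; apply: le_trans (_ : `|a| * (e / (`|a| + 1)) <= _).
    by rewrite ler_wpM2l// H// key.
  by rewrite mulrCA ler_piMr ?(ltW e0)// ler_pdivrMr// mul1r lerDl.
Qed.

Lemma eq_C1at f1 f2 y (r : R) : 0 < r ->
  (forall x, enorm (x - y) < r -> f1 x = f2 x) -> C1at f1 y -> C1at f2 y.
Proof.
move=> r0 f12 [G [r' [r'0 h1 c1]]].
have rr0 : 0 < Num.min r r' / 2 by rewrite divr_gt0// lt_min r0.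
exists G, (Num.min r r' / 2); split => //.
have : Num.min r r' <= r by rewrite ge_min lexx.
have : Num.min r r' <= r' by rewrite ge_min lexx orbT.
move=> m1 m2 x xr.
apply: (@eq_has_grad f1 _ _ _ (Num.min r r' / 2)) => //.
  by move=> x' x'x; apply: f12; have := ler_enorm_distD x x' y; linarith.
by apply: h1; linarith.
Qed.

Lemma C1at_sum (I : Type) (s : seq I) (F : I -> R * R -> R) y :
  (forall i, C1at (F i) y) -> C1at (fun x => \sum_(i <- s) F i x) y.
Proof.
move=> h; elim: s => [|i s IH].
  by have := C1at_cst 0 y; congr C1at; apply/funext => x; rewrite big_nil.
have := C1atD (h i) IH; congr C1at; apply/funext => x; by rewrite big_cons.
Qed.

(** Differences of approximants have small Lipschitz constants, hence uniformly close gradients by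
    [has_grad_lip]; the limit of these is the gradient of f. This replaces differentiation under a
    singular integral, and later under an infinite sum. *)
Lemma C1at_approx f y (r : R) : 0 < r ->
  (forall e : R, 0 < e -> exists2 F, forall x, enorm (x - y) < r -> C1at F x &
     lip_on [set x | enorm (x - y) < r] e (fun x => f x - F x)) ->
  C1at f y.
Proof.
move=> r0 appr.
pose e_ n : R := n.+1%:R^-1.
have e_0 n : 0 < e_ n by rewrite invr_gt0.
have /choice[F_ FP] : forall n, exists F, (forall x, enorm (x - y) < r -> C1at F x) /\
    lip_on [set x | enorm (x - y) < r] (e_ n) (fun x => f x - F x).
  by move=> n; have [F F1 F2] := appr _ (e_0 n); exists F.
have Fg n x : enorm (x - y) < r -> exists g, has_grad (F_ n) x g.
  move=> xr; have [/(_ x xr)[G [r' [r'0 h _]]] _] := FP n.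
  by exists (G x); apply: h; rewrite subrr enorm0.
have /choice[G' GP''] : forall p : nat * (R * R), exists g,
    enorm (p.2 - y) < r -> has_grad (F_ p.1) p.2 g.
  move=> [n x] /=; have [xr|xr] := ltP (enorm (x - y)) r; last by exists 0.
  by have [g hg] := Fg n x xr; exists g.
pose G_ n x := G' (n, x).
have GP n x : enorm (x - y) < r -> has_grad (F_ n) x (G_ n x).
  by move=> xr; exact: (GP'' (n, x)).
have Gdist n m x : enorm (x - y) < r -> enorm (G_ n x - G_ m x) <= e_ n + e_ m.
  move=> xr; have hd := has_gradB (GP n x xr) (GP m x xr).
  have rx0 : 0 < r - enorm (x - y) by rewrite subr_gt0.
  apply: has_grad_lip rx0 _ hd => v vr.
  have xvr : enorm (x + v - y) < r.
    by have := ler_enormD (x - y) v; rewrite addrAC; linarith.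
  have [_ /(_ (x + v) x xvr xr) h1] := FP n; have [_ /(_ (x + v) x xvr xr) h2] := FP m.
  move: h1 h2; rewrite [x + v]addrC addrK => h1 h2.
  rewrite (_ : _ - _ = (f (v + x) - F_ m (v + x) - (f x - F_ m x)) -
     (f (v + x) - F_ n (v + x) - (f x - F_ n x))); last by ring.
  by apply: le_trans (ler_normB _ _) _; rewrite mulrDl addrC lerD.
have small e : 0 < e -> exists n, e_ n < e.
  move=> e0; have /cvgrPdist_lt/(_ _ e0)[n _ /(_ n (leqnn n))] := @cvg_harmonic R.
  by rewrite /= sub0r normrN ger0_norm ?(ltW (e_0 n))// => h; exists n.
have lim_coord (u : nat -> R) : (forall n m, `|u n - u m| <= e_ n + e_ m) ->
    exists l, forall n, `|u n - l| <= e_ n.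
  move=> ucau; pose A := [set u n - e_ n | n in setT].
  have ubA m : ubound A (u m + e_ m).
    by move=> _ [n _ <-]; have := ucau n m; rewrite ler_norml => /andP[]; linarith.
  have A0 : A !=set0 by exists (u 0%N - e_ 0%N), 0%N.
  exists (sup A) => n; have h1 := ge_sup A0 (ubA n).
  have h2 : u n - e_ n <= sup A by apply: ub_le_sup; [exists (u 0%N + e_ 0%N)|exists n].
  by rewrite ler_norml; apply/andP; split; linarith.
have Gcvg x : exists g, enorm (x - y) < r -> forall n, enorm (G_ n x - g) <= e_ n *+ 2.
  have [xr|xr] := ltP (enorm (x - y)) r; last by exists 0.
  have [l1 L1] : exists l, forall n, `|(G_ n x).1 - l| <= e_ n.
    by apply: lim_coord => n m; apply: le_trans (Gdist n m x xr); exact: (normr_fst_le (G_ n x - G_ m x)).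
  have [l2 L2] : exists l, forall n, `|(G_ n x).2 - l| <= e_ n.
    by apply: lim_coord => n m; apply: le_trans (Gdist n m x xr); exact: (normr_snd_le (G_ n x - G_ m x)).
  exists (l1, l2) => _ n; by apply: le_trans (enorm_le_coord _) _; rewrite mulr2n; apply: lerD; [exact: L1|exact: L2].
have /choice[G GP'] := Gcvg.
exists G, r; split => // [x xr|].
  move=> e e0; have e4 : 0 < e / 4 by rewrite divr_gt0.
  have [n ne] := small _ e4.
  have rx0 : 0 < r - enorm (x - y) by rewrite subr_gt0.
  have [d d0 H] := GP n x xr _ e4.
  exists (Num.min d (r - enorm (x - y))); first by rewrite lt_min d0.
  move=> v; rewrite lt_min => /andP[vd vr].
  have xvr : enorm (x + v - y) < r.
    by have := ler_enormD (x - y) v; rewrite addrAC; linarith.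
  have := H v vd; have [_ /(_ (x + v) x xvr xr)] := FP n.
  rewrite [x + v]addrC addrK => h1 h2.
  have h3 : `|dotp (G_ n x - G x) v| <= e_ n *+ 2 * enorm v.
    by apply: le_trans (normr_dotp _ _) _; rewrite ler_wpM2r ?enorm_ge0// GP'.
  rewrite (_ : _ - _ - _ = (f (v + x) - F_ n (v + x) - (f x - F_ n x)) +
    (F_ n (v + x) - F_ n x - dotp (G_ n x) v) + dotp (G_ n x - G x) v); last first.
    by rewrite dotpDl dotpNl; ring.
  apply: le_trans (ler_normD _ _) _; have := ler_normD (f (v + x) - F_ n (v + x) - (f x - F_ n x))
    (F_ n (v + x) - F_ n x - dotp (G_ n x) v).
  have : e_ n * enorm v <= e / 4 * enorm v by rewrite ler_wpM2r ?enorm_ge0// ltW.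
  by rewrite mulr2n mulrDl in h3; linarith.
move=> e e0; have e8 : 0 < e / 8 by rewrite divr_gt0.
have yr : enorm (y - y) < r by rewrite subrr enorm0.
have [n ne] := small _ e8; have [/(_ y yr)[Gn [rn [rn0 hn cn]]] _] := FP n.
have [d d0 H] := cn _ e8.
exists (Num.min d (Num.min rn r)); first by rewrite !lt_min d0 rn0.
move=> x; rewrite !lt_min => /and3P[xd xrn xr].
have Ex : Gn x = G_ n x by apply: has_grad_unique (hn _ xrn) (GP n x xr).
have Ey : Gn y = G_ n y by apply: has_grad_unique (hn _ _) (GP n y yr); rewrite subrr enorm0.
have := H x xd; rewrite Ex Ey => h1.
have := ler_enorm_distD (G_ n x) (G x) (G y); have := ler_enorm_distD (G_ n y) (G_ n x) (G y).
have := GP' x xr n; have := GP' y yr n; rewrite (enormBC (G_ n x) (G x)) !mulr2n; linarith.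
Qed.

Lemma has_grad_C1at f y : C1at f y -> exists g, has_grad f y g.
Proof.
by move=> [G [r [r0 h _]]]; exists (G y); apply: h; rewrite subrr enorm0.
Qed.

Lemma C1at_continuous f y : C1at f y -> {for y, continuous f}.
Proof.
move=> /has_grad_C1at[g hg]; apply/cvgrPdist_le => e e0.
have [d d0 H] := hg 1 ltr01.
have g1 : 0 < 1 + enorm g by rewrite ltr_pwDl ?enorm_ge0.
near=> x; have xd : enorm (x - y) < d by near: x; exact: near_enorm.
have xe : enorm (x - y) < e / (1 + enorm g) by near: x; apply: near_enorm; exact: divr_gt0.
have := H _ xd; rewrite [y + _]addrC subrK mul1r => h1.
move: xe; rewrite ltr_pdivlMr// mulrDr mulr1 => xe.
have := normr_dotp g (x - y); have := ler_normD (f x - f y - dotp g (x - y)) (dotp g (x - y)).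
by rewrite subrK distrC [enorm g * _]mulrC; linarith.
Unshelve. all: by end_near. Qed.

Lemma has_grad_derivable f y g v : has_grad f y g -> is_derive y v f (dotp g v).
Proof.
move=> h.
have cvg : (fun t : R => t^-1 *: ((f \o shift y) (t *: v) - f y)) @ 0^' --> dotp g v.
  apply/cvgrPdist_le => e e0.
  have v1 : 0 < enorm v + 1 by rewrite ltr_wpDl ?enorm_ge0.
  have [d d0 H] := h _ (divr_gt0 e0 v1).
  near=> t.
  have t0 : t != 0 by near: t; exact: nbhs_dnbhs_neq.
  have tn : 0 < `|t| by rewrite normr_gt0.
  have td : enorm (t *: v) < d.
    rewrite enormZ; apply: le_lt_trans (_ : `|t| * (enorm v + 1) < _).
      by rewrite ler_wpM2l// lerDl.
    rewrite -ltr_pdivlMr//; near: t; apply: dnbhs0_lt; exact: divr_gt0.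
  have := H _ td; rewrite /= [y + _]addrC dotpZr enormZ => {}H.
  rewrite -[X in X - _](mulKf t0) /GRing.scale/= -mulrBr normrM normrV ?unitfE//.
  rewrite distrC ler_pdivrMl//; apply: le_trans H _.
  rewrite mulrCA ler_pM2l// -mulrA ler_piMr ?(ltW e0)//.
  by rewrite mulrC ler_pdivrMr// mul1r lerDl.
apply: DeriveDef; first by apply/cvg_ex; exists (dotp g v).
exact/cvg_lim.
Unshelve. all: by end_near. Qed.

Lemma has_grad_grad f y g : has_grad f y g -> grad f y = g.
Proof.
move=> h; rewrite /grad (@derive_val _ _ _ _ _ _ _ (has_grad_derivable e1 h)).
rewrite (@derive_val _ _ _ _ _ _ _ (has_grad_derivable e2 h)).
by rewrite /dotp/= !mulr1 !mulr0 addr0 add0r -surjective_pairing.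
Qed.

Lemma C1at_C1 f : (forall y, C1at f y) -> C1 f.
Proof.
move=> h.
have hg y : has_grad f y (grad f y).
  by have [g hg] := has_grad_C1at (h y); rewrite (has_grad_grad hg).
have gc y (e : R) : 0 < e -> \forall x \near y, enorm (grad f x - grad f y) <= e.
  move=> e0; have [G [r [r0 hG cG]]] := h y; have [d d0 H] := cG _ e0.
  near=> x; have xr : enorm (x - y) < r by near: x; exact: near_enorm.
  have xd : enorm (x - y) < d by near: x; exact: near_enorm.
  rewrite (has_grad_grad (hG x xr)) (has_grad_grad (hG y _)) ?subrr ?enorm0//.
  exact: H.
split=> [x|x|y|y].
- by have [] := has_grad_derivable e1 (hg x).
- by have [] := has_grad_derivable e2 (hg x).
- apply/cvgrPdist_le => e e0; near=> x; rewrite distrC.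
  have : enorm (grad f x - grad f y) <= e by near: x; exact: gc.
  exact: le_trans (normr_fst_le _).
- apply/cvgrPdist_le => e e0; near=> x; rewrite distrC.
have : enorm (grad f x - grad f y) <= e by near: x; exact: gc.
exact: le_trans (normr_snd_le _).
Unshelve. all: by end_near. Qed.

End gradient.

(** * Regularity and self-adjointness of the convolution *)

Section conv_gradient.
Context {R : realType}.
Variable s : R.
Hypothesis hs : 0 < s <= 1.
Implicit Types (x y z u v : (R * R)%type) (h : R * R -> R) (e B C L : R).
Notation conv := (convk (kap s)).

Lemma measurable_dkape e : measurable_fun setT (dkape s e).
Proof.
rewrite (_ : dkape s e = (@powR R ^~ (s - 2)) \o (fun t => Num.max t e)); last first.
  by apply/funext => t /=; rewrite dkapeE dkapE.
by apply: measurableT_comp; [exact: measurable_powR|exact: measurable_maxr].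
Qed.

(** Differentiation under the integral: by [kape_taylor] the remainder is quadratic uniformly over
    the support of h, and the gradient is itself Lipschitz because [dkape] is. *)
Lemma C1at_conv_kape e B C h y : 0 < e -> 0 <= B -> bnd_supp B C h ->
  C1at (convk (kape s e) h) y.
Proof.
move=> e0 B0 hb; have C0 := bnd_supp_ge0 hb.
have mh : measurable_fun setT h by case: hb.
have le := kape_locally_integrable hs e0.
pose p := e `^ (s - 3); have p0 : 0 <= p by exact: powR_ge0.
have D0 := ltW (dkap_gt0 s e0); set D := dkap s e in D0.
(* With c a coordinate function this is a partial derivative of the kernel in x, times h z. *)
pose g (c : R * R -> R) x z := - 2 * dkape s e (dotp (x - z) (x - z)) * c (x - z) * h z.
pose M := enorm y + B + 2.
have M0 : 0 <= M by rewrite !addr_ge0 ?enorm_ge0.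
have xzM x z : enorm (x - y) <= 2 -> enorm z <= B -> enorm (x - z) <= M.
  move=> xy zB; have := ler_enormB x z; have := ler_enormD (x - y) y.
  by rewrite subrK /M; linarith.
have mg c x : measurable_fun setT c -> measurable_fun setT (g c x).
  move=> mc; apply: measurable_funM => //.
  apply: measurable_funM; last exact: (measurableT_comp mc (measurable_sub_l x)).
  apply: measurable_funM => //.
  exact: (measurableT_comp (measurable_dkape e) (measurableT_comp (@measurable_nsq R) (measurable_sub_l x))).
have ig (c : R * R -> R) x : measurable_fun setT c -> (forall w, `|c w| <= enorm w) -> enorm (x - y) <= 2 ->
    integ (g c x).
  move=> mc cn xy; apply: (@le_integ _ _ (fun z => 2 * D * M * C * cutoff B z)).
  - exact: mg.
  - move=> z; rewrite cutoffE; case: (leP (enorm z) B) => zB; last first.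
      by rewrite /g; case: hb => _ _ ->//; rewrite !mulr0 normr0.
    rewrite mulr1 /g !normrM normrN; apply: ler_pM => //; last by case: hb.
    apply: ler_pM => //; last exact: le_trans (cn _) (xzM _ _ _ _).
    by rewrite !ger0_norm// ?dkape_ge0// ler_wpM2l// dkape_le.
  - by apply: integZ; exact: integrable_cutoff.
pose G x := (iint (g fst x), iint (g snd x)).
have i1 x : enorm (x - y) <= 2 -> integ (g fst x).
  by apply: ig; [exact: measurable_fst|exact: normr_fst_le].
have i2 x : enorm (x - y) <= 2 -> integ (g snd x).
  by apply: ig; [exact: measurable_snd|exact: normr_snd_le].
pose K := 4 * p * (2 * M + 1) ^+ 2 + D.
have K0 : 0 <= K by rewrite addr_ge0// mulr_ge0 ?sqr_ge0// mulr_ge0.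
have ic := @integrable_cutoff R B.
exists G, 2; split => // [x xy|].
  apply: (@has_grad_taylor _ _ _ _ (K * C * iint (cutoff B)) 1) => //.
    by rewrite !mulr_ge0// iint_ge0// => z; exact: cutoff_ge0.
  move=> v v1; rewrite !convkE.
  have iv w : integ (fun z => kape s e (dotp (w - z) (w - z)) * h z) by exact: integ_convk hb.
  have xy2 := ltW xy.
  have -> : dotp (G x) v = iint (fun z => v.1 * g fst x z + v.2 * g snd x z).
    rewrite iintD ?iintZ; try (by apply: integZ; auto); try by auto.
    by rewrite /dotp/= (mulrC v.1) (mulrC v.2).
  rewrite -iintB// -iintB; [|exact: integB|by apply: integD; apply: integZ; auto].
  rewrite (_ : _ * _ * _ * _ = K * C * enorm v ^+ 2 * iint (cutoff B)); last by ring.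
  rewrite -iintZ//.
  have ii := integB (integB (iv (x + v)) (iv x)) (integD (integZ v.1 (i1 x xy2)) (integZ v.2 (i2 x xy2))).
  apply: norm_iint_le; [exact: integ_measurable ii| |exact: integZ].
  move=> z; rewrite cutoffE; case: (leP (enorm z) B) => zB; last first.
    by rewrite /g; case: hb => _ _ ->//; rewrite !mulr0 !addr0 !subr0 normr0.
  have xM := xzM x z xy2 zB.
  have T := kape_taylor hs (dotp (x + v - z) (x + v - z)) (dotp (x - z) (x - z)) e0.
  rewrite mulr1 (_ : _ - _ = (kape s e (dotp (x + v - z) (x + v - z)) - kape s e (dotp (x - z) (x - z))
     + 2 * dkape s e (dotp (x - z) (x - z)) * dotp (x - z) v) * h z); last first.
    by rewrite /g [dotp _ v]/dotp/=; ring.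
  rewrite normrM [leRHS]mulrAC ler_pM//; last by case: hb.
  have E : dotp (x + v - z) (x + v - z) = dotp (x - z) (x - z) + (2 * dotp (x - z) v + dotp v v).
    by rewrite addrAC !dotpE [dotp v x]dotpC [dotp v z]dotpC; ring.
  set a := dotp (x - z) (x - z) in E T *; set b := dotp (x - z) v in E *.
  have bb : `|2 * b + dotp v v| <= (2 * M + 1) * enorm v.
    apply: le_trans (ler_normD _ _) _; rewrite normrM (ger0_norm (dotp_ge0 v)) ger0_norm//.
    rewrite -enorm_sqr [leRHS]mulrDl mul1r -mulrA lerD//.
      by rewrite ler_wpM2l//; apply: le_trans (normr_dotp _ _) _; rewrite ler_wpM2r ?enorm_ge0.
    by rewrite expr2 ler_piMr ?enorm_ge0.
  rewrite E in T *; rewrite [a + _ - a]addrAC subrr add0r in T.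
  rewrite (_ : _ + _ = (kape s e (a + (2 * b + dotp v v)) - kape s e a +
     dkape s e a * (2 * b + dotp v v)) - dkape s e a * dotp v v); last by ring.
  apply: le_trans (ler_normB _ _) _; rewrite /K [leRHS]mulrDl; apply: lerD.
    apply: le_trans T _; rewrite -[leRHS]mulrA -exprMn; apply: ler_wpM2l; first by rewrite mulr_ge0.
    by rewrite lerXn2r ?nnegrE ?mulr_ge0 ?addr_ge0 ?enorm_ge0 ?mulr_ge0.
  by rewrite normrM !ger0_norm ?dkape_ge0 ?dotp_ge0// enorm_sqr ler_wpM2r ?dotp_ge0 ?dkape_le.
pose L := 2 * (2 * p * (2 * M) * M + D) * C * iint (cutoff B).
have L0 : 0 <= L.
  rewrite !mulr_ge0 ?addr_ge0 ?mulr_ge0 ?iint_ge0// => z; exact: cutoff_ge0.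
have gL (c : R * R -> R) x : measurable_fun setT c -> (forall w, `|c w| <= enorm w) ->
    (forall w w', c (w - w') = c w - c w') ->
    enorm (x - y) <= 1 -> `|iint (g c x) - iint (g c y)| <= L * enorm (x - y).
  move=> mc cn cB xy; have xy2 : enorm (x - y) <= 2 by linarith.
  have yy : enorm (y - y) <= 2 by rewrite subrr enorm0.
  rewrite -iintB; [|exact: ig..].
  rewrite /L (_ : _ * _ * _ * _ = 2 * (2 * p * (2 * M) * M + D) * C * enorm (x - y) * iint (cutoff B)); last by ring.
  rewrite -iintZ//; apply: norm_iint_le; [by apply: integ_measurable; apply: integB; exact: ig| |exact: integZ].
  move=> z; rewrite cutoffE; case: (leP (enorm z) B) => zB; last first.
    by rewrite /g; case: hb => _ _ ->//; rewrite !mulr0 subrr normr0.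
  rewrite mulr1 /g -mulrBl normrM [leRHS]mulrAC ler_pM//; last by case: hb.
  have xM := xzM x z xy2 zB; have yM := xzM y z yy zB.
  rewrite (_ : _ - _ = - 2 * ((dkape s e (dotp (x - z) (x - z)) - dkape s e (dotp (y - z) (y - z))) * c (x - z)
     + dkape s e (dotp (y - z) (y - z)) * c (x - y))); last first.
    by rewrite !cB; ring.
  rewrite normrM normrN (ger0_norm (ler0n R 2)) -[leRHS]mulrA ler_wpM2l// [leRHS]mulrDl.
  apply: le_trans (ler_normD _ _) _; apply: lerD; rewrite normrM; last first.
    apply: ler_pM => //.
    by rewrite ger0_norm ?dkape_ge0 ?dkape_le.
  apply: (@le_trans _ _ (2 * p * (2 * M * enorm (x - y)) * M)); last by rewrite le_eqVlt; apply/orP; left; apply/eqP; ring.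
  apply: ler_pM => //; last exact: le_trans (cn _) xM.
  apply: le_trans (dkape_dist hs _ _ e0) _; rewrite ler_wpM2l ?mulr_ge0//.
  rewrite -!enorm_sqr subr_sqr normrM mulrC; apply: ler_pM => //.
    by rewrite ger0_norm ?addr_ge0 ?enorm_ge0//; linarith.
  by apply: le_trans (ler_dist_enorm _ _) _; rewrite opprB addrA subrK.
move=> r r0; have L1 : 0 < 2 * L + 1 by rewrite ltr_wpDl// mulr_ge0.
exists (Num.min 1 (r / (2 * L + 1))); first by rewrite lt_min ltr01 divr_gt0.
move=> x; rewrite lt_min => /andP[/ltW x1]; rewrite ltr_pdivlMr// => xr.
apply: le_trans (enorm_le_coord _) _.
have := gL fst x (@measurable_fst _ _ _ _) (@normr_fst_le _) (fun _ _ => erefl) x1.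
have := gL snd x (@measurable_snd _ _ _ _) (@normr_snd_le _) (fun _ _ => erefl) x1.
have := enorm_ge0 (x - y); rewrite /G /=; linarith.
Qed.

(** For a Lipschitz density the error of the regular part is small in the Lipschitz seminorm, so
    [C1at_approx] applies; [kap] itself is never differentiated. *)
Lemma C1at_conv B C L h y : 0 <= B -> bnd_supp B C h -> lip_on setT L h -> C1at (conv h) y.
Proof.
move=> B0 hb hL; apply: (C1at_approx ltr01) => d d0.
have L1 : 0 < `|L| + 1 by rewrite ltr_wpDl.
have [e [L' [/andP[e0 _] L'0 /(_ C h hb)[_ _ H]]]] := conv_split hs B0 (addr_ge0 (enorm_ge0 y) ler01) (divr_gt0 d0 L1).
exists (convk (kape s e) h); first by move=> x _; exact: C1at_conv_kape hb.
have sub x : enorm (x - y) < 1 -> enorm x <= enorm y + 1.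
  by have := ler_enormD (x - y) y; rewrite subrK; linarith.
move=> x x' /= /sub xY /sub x'Y; apply: le_trans (H _ hL _ _ xY x'Y) _.
rewrite ler_wpM2r ?enorm_ge0// -mulrA ler_piMr ?(ltW d0)// mulrC ler_pdivrMr// mul1r.
by have := ler_norm L; linarith.
Qed.

(** The truncated kernel is bounded on the product of the supports and depends on |x - y| only, so
    Fubini's theorem applies. *)
Lemma conv_kape_sym e B C h1 h2 : 0 < e -> 0 <= B -> bnd_supp B C h1 -> bnd_supp B C h2 ->
  iint (fun y => convk (kape s e) h1 y * h2 y) = iint (fun y => h1 y * convk (kape s e) h2 y).
Proof.
move=> e0 B0 hb1 hb2; have C0 := bnd_supp_ge0 hb1.
have mh1 : measurable_fun setT h1 by case: hb1.
have mh2 : measurable_fun setT h2 by case: hb2.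
pose K := `|kape s e 0| + dkap s e * (2 * B) ^+ 2.
have D0 := ltW (dkap_gt0 s e0).
have K0 : 0 <= K by rewrite addr_ge0// mulr_ge0// sqr_ge0.
pose Q := (measurableTypeR R * measurableTypeR R)%type.
pose f (p : Q * Q) : R := kape s e (dotp (p.1 - p.2) (p.1 - p.2)) * h1 p.2 * h2 p.1.
have -> : iint (fun y => convk (kape s e) h1 y * h2 y) = \int[@area R]_x \int[@area R]_y f (x, y).
  rewrite iintE; apply: eq_Rintegral => x _; rewrite convkE /f /=.
  rewrite mulrC -iintZ; last exact: (integ_convk (kape_locally_integrable hs e0) x hb1).
  by rewrite iintE; apply: eq_Rintegral => y _; rewrite mulrC.
have -> : iint (fun y => h1 y * convk (kape s e) h2 y) = \int[@area R]_y \int[@area R]_x f (x, y).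
  rewrite iintE; apply: eq_Rintegral => x _; rewrite convkE /f /=.
  rewrite -iintZ; last exact: (integ_convk (kape_locally_integrable hs e0) x hb2).
  rewrite iintE; apply: eq_Rintegral => y _.
  by rewrite (_ : dotp (x - y) (x - y) = dotp (y - x) (y - x)) ?mulrA ?(mulrC (h1 x))// -(opprB y x) dotpNl dotpNr opprK.
have mf : measurable_fun [set: Q * Q] f.
  have mx : measurable_fun [set: Q * Q] (fst : Q * Q -> Q) by exact: measurable_fst.
  have my : measurable_fun [set: Q * Q] (snd : Q * Q -> Q) by exact: measurable_snd.
  have mx1 := measurableT_comp (@measurable_fst _ _ (measurableTypeR R) (measurableTypeR R)) mx.
  have mx2 := measurableT_comp (@measurable_snd _ _ (measurableTypeR R) (measurableTypeR R)) mx.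
  have my1 := measurableT_comp (@measurable_fst _ _ (measurableTypeR R) (measurableTypeR R)) my.
  have my2 := measurableT_comp (@measurable_snd _ _ (measurableTypeR R) (measurableTypeR R)) my.
  have d1 := measurable_funB mx1 my1; have d2 := measurable_funB mx2 my2.
  have mn := measurable_funD (measurable_funM d1 d1) (measurable_funM d2 d2).
  apply: measurable_funM; last exact: (measurableT_comp mh2 mx).
  apply: measurable_funM; last exact: (measurableT_comp mh1 my).
  exact: (measurableT_comp (measurable_kape s e) mn).
pose g1 x := K * C * cutoff B x; pose g2 x := C * cutoff B x.
have fg x y : `|f (x, y)| <= g1 x * g2 y.
  rewrite /f /g1 /g2 /= !cutoffE; case: (leP (enorm x) B) => xB; last first.
    by case: hb2 => _ _ ->//; rewrite !mulr0 normr0 mul0r.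
  case: (leP (enorm y) B) => yB; last first.
    by case: hb1 => _ _ ->//; rewrite !mulr0 mul0r normr0.
  rewrite !mulr1 !normrM mulrAC; apply: ler_pM => //; last by case: hb1.
  apply: ler_pM => //; last by case: hb2.
  rewrite -[kape _ _ _](subrK (kape s e 0)) addrC; apply: le_trans (ler_normD _ _) _.
  rewrite lerD2l; apply: le_trans (kape_dist hs _ _ e0) _; rewrite ler_wpM2l//.
  rewrite subr0 ger0_norm ?dotp_ge0// -enorm_sqr lerXn2r ?nnegrE ?enorm_ge0 ?mulr_ge0//.
  by have := ler_enormB x y; linarith.
have g10 x : 0 <= g1 x by rewrite /g1 !mulr_ge0// cutoff_ge0.
have g20 x : 0 <= g2 x by rewrite /g2 !mulr_ge0// cutoff_ge0.
have i1 : integ g1 by apply: integZ; exact: integrable_cutoff.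
have i2 : integ g2 by apply: integZ; exact: integrable_cutoff.
pose m : {sigma_finite_measure set Q -> \bar R} :=
  HB.pack_for {sigma_finite_measure set Q -> \bar R} (@lebesgue_measure R \x @lebesgue_measure R)%E
    (Measure_isSigmaFinite.Build _ _ _ (@lebesgue_measure R \x @lebesgue_measure R)%E area_sigma_finite).
exact: (@Rintegral_swap _ Q R m f g1 g2 mf fg g10 g20 i1 i2).
Qed.

(** Both sides differ from those of [conv_kape_sym] by at most t * I, which is at most d/2. *)
Lemma conv_sym B C h1 h2 : 0 <= B -> bnd_supp B C h1 -> bnd_supp B C h2 ->
  iint (fun y => conv h1 y * h2 y) = iint (fun y => h1 y * conv h2 y).
Proof.
move=> B0 hb1 hb2; have C0 := bnd_supp_ge0 hb1; have lk := kap_locally_integrable hs.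
apply/eqP; rewrite -subr_eq0 -normr_le0; apply/ler_addgt0Pr => d d0; rewrite add0r.
pose I := C * iint (cutoff B) * C.
have I0 : 0 <= I by rewrite !mulr_ge0// iint_ge0// => z; exact: cutoff_ge0.
have I1 : 0 < 2 * I + 1 by rewrite ltr_wpDl// mulr_ge0.
have [e [L [/andP[e0 _] L0 H]]] := conv_split hs B0 B0 (divr_gt0 d0 I1).
set t := d / (2 * I + 1) in H.
have t0 : 0 <= t by rewrite divr_ge0 ?(ltW d0) ?(ltW I1).
have mconv h : bnd_supp B C h -> measurable_fun setT (conv h) by exact: measurable_conv.
have ic h h' : bnd_supp B C h -> bnd_supp B C h' ->
    `|iint (fun y => conv h y * h' y) - iint (fun y => convk (kape s e) h y * h' y)| <= t * I.
  move=> hb hb'; have [HL Ht _] := H C h hb.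
  have mh' : measurable_fun setT h' by case: hb'.
  have D y : `|conv h y * h' y - convk (kape s e) h y * h' y| <= t * (C * C) * cutoff B y.
    rewrite -mulrBl normrM mulrA cutoffE; case: (leP (enorm y) B) => yB; last first.
      by case: hb' => _ _ ->//; rewrite normr0 !mulr0.
    by rewrite mulr1 ler_pM//; [exact: Ht|case: hb'].
  pose K := C * kernel_mass (kap s) (B + B) * C.
  have i1 : integ (fun y => conv h y * h' y).
    apply: (@le_integ _ _ (fun z => K * cutoff B z)).
    - by apply: measurable_funM => //; exact: mconv.
    - move=> y; rewrite normrM cutoffE; case: (leP (enorm y) B) => yB; last first.
        by case: hb' => _ _ ->//; rewrite normr0 !mulr0.
      by rewrite mulr1 ler_pM//; [exact: norm_convk_leY hb yB|case: hb'].
    - by apply: integZ; exact: integrable_cutoff.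
  have mke : measurable_fun setT (convk (kape s e) h).
    apply: continuous_measurable_plane => y; apply: C1at_continuous.
    exact: C1at_conv_kape hb.
  have i2 : integ (fun y => convk (kape s e) h y * h' y).
    have ii : integ (fun y => conv h y * h' y - convk (kape s e) h y * h' y).
      apply: (le_integ _ D); last by apply: integZ; exact: integrable_cutoff.
      by apply: measurable_funB; apply: measurable_funM => //; exact: mconv.
    by apply: integ_eq (integB i1 ii) => y; ring.
  rewrite -iintB// /I (_ : t * _ = t * (C * C) * iint (cutoff B)); last by ring.
  rewrite -iintZ; last exact: integrable_cutoff.
  apply: norm_iint_le D _; first by apply: integ_measurable; exact: integB.
  by apply: integZ; exact: integrable_cutoff.
have H1 := ic _ _ hb1 hb2; have := ic _ _ hb2 hb1.
rewrite [X in `|X - _|](@eq_iint _ _ (fun y => h1 y * conv h2 y)); last by move=> y; rewrite mulrC.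
rewrite [X in `|_ - X|](@eq_iint _ _ (fun y => h1 y * convk (kape s e) h2 y)); last by move=> y; rewrite mulrC.
rewrite -(conv_kape_sym e0 B0 hb1 hb2) => H2.
have tI : t * I + t * I <= d.
  rewrite -mulrDr /t mulrAC -mulrA ler_piMr ?(ltW d0)// ler_pdivrMr// mul1r; linarith.
apply: le_trans tI; apply: le_trans (lerD H1 H2); apply: le_trans (ler_normB _ _).
by rewrite opprB addrA subrK.
Qed.

End conv_gradient.

(** * The radial vortex and its linearisation *)

Section reflections.
Context {R : realType}.
Implicit Types (x y n : (R * R)%type).

Lemma pair_ext x y : x.1 = y.1 -> x.2 = y.2 -> x = y.
Proof. by case: x y => [a b] [c d] /= -> ->. Qed.

(** The mirror is the perpendicular bisector of x and y; for x = y != 0 the normal has to be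
    orthogonal to y. That reflections act transitively on circles is all the rotation invariance
    that is used. *)
Lemma refl_transitive x y : enorm x = enorm y -> exists2 m : R * R, dotp m m = 1 & refl m x = y.
Proof.
move=> xy; have dxy : dotp x x = dotp y y by rewrite -!enorm_sqr xy.
have [->|nxy] := eqVneq x y.
  have [->|y0] := eqVneq y 0.
    by exists (1, 0); rewrite ?/refl ?dotp0r ?mulr0 ?scale0r ?subr0// /dotp/= !mulr0 addr0 mulr1.
  have ny0 : enorm y != 0 by rewrite enorm_eq0.
  have py : dotp (perp y) y = 0 by rewrite /dotp /perp /=; ring.
  exists ((enorm y)^-1 *: perp y); last by rewrite /refl dotpZl py !mulr0 scale0r subr0.
  rewrite dotpZl dotpZr mulrA -expr2 exprVn enorm_sqr.
  by rewrite (_ : dotp (perp y) (perp y) = dotp y y) ?mulVf ?gt_eqF ?dotp_gt0// /dotp/perp/=; ring.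
have d0 : enorm (x - y) != 0 by rewrite enorm_eq0 subr_eq0.
have E : dotp (x - y) (x - y) = 2 * dotp (x - y) x.
  by rewrite !dotpE (dotpC y x) -dxy; ring.
exists ((enorm (x - y))^-1 *: (x - y)).
  rewrite dotpZl dotpZr mulrA -expr2 exprVn enorm_sqr mulVf// gt_eqF//.
  by rewrite dotp_gt0 subr_eq0.
rewrite /refl dotpZl scalerA (_ : _ * _ = 1) ?scale1r ?subKr//.
by rewrite mulrCA -E -enorm_sqr expr2 mulKf// divff.
Qed.

Lemma dotp_refl_swap n x y : dotp x (refl n y) = dotp (refl n x) y.
Proof. by rewrite /refl !dotpE (dotpC x n); ring. Qed.

Lemma refl_self n : dotp n n = 1 -> refl n n = - n.
Proof. by move=> n1; rewrite /refl n1 mulr1 scaler_nat mulr2n opprD addrA subrr add0r. Qed.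

Lemma refl_perp n y : dotp n y = 0 -> refl n y = y.
Proof. by move=> ny; rewrite /refl ny mulr0 scale0r subr0. Qed.

(** For x inside the disc and y outside, f y = 0 and the whole increment falls on f, so g need not
    be controlled outside. *)
Lemma lip_onM (f g : R * R -> R) (B A L M K : R) : 0 <= A -> 0 <= L -> 0 <= M -> 0 <= K ->
  (forall z, `|f z| <= A) -> lip_on setT L f -> (forall z, B < enorm z -> f z = 0) ->
  (forall z, enorm z <= B -> `|g z| <= M) ->
  lip_on [set z | enorm z <= B] K g -> lip_on setT (L * M + A * K) (fun z => f z * g z).
Proof.
move=> A0 L0 M0 K0 fA fL f0 gM gK.
have key x y : enorm x <= B -> `|f x * g x - f y * g y| <= (L * M + A * K) * enorm (x - y).
  move=> xB.
  rewrite (_ : _ - _ = (f x - f y) * g x + f y * (g x - g y)); last by ring.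
  apply: le_trans (ler_normD _ _) _; rewrite !normrM mulrDl; apply: lerD.
    by rewrite mulrAC ler_pM ?gM// fL.
  have [yB|yB] := leP (enorm y) B; first by rewrite -mulrA ler_pM// gK.
  by rewrite f0// normr0 mul0r !mulr_ge0 ?enorm_ge0.
move=> x y _ _; have [xB|xB] := leP (enorm x) B; first exact: key.
have [yB|yB] := leP (enorm y) B; first by rewrite distrC enormBC; exact: key.
by rewrite !f0// !mul0r subrr normr0 mulr_ge0 ?enorm_ge0 ?addr_ge0 ?mulr_ge0.
Qed.

End reflections.

(** * The cutoff profile *)

Section profile.
Context {R : realType}.
Implicit Types t u h : R.

Definition pos t : R := Num.max 0 t.

Lemma pos_cases t : (t <= 0 /\ pos t = 0) \/ (0 <= t /\ pos t = t).
Proof.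
by rewrite /pos; case: (leP t 0) => h; [left|right; rewrite ltW].
Qed.

(* A C^{1,1} cutoff, equal to 1 for t <= 2 and to 0 for t >= 3. *)
Definition omega t : R :=
  2 * (pos (3 - t) ^+ 2 - 2 * pos (5 / 2 - t) ^+ 2 + pos (2 - t) ^+ 2).
Definition domega t : R := - 4 * (pos (3 - t) - 2 * pos (5 / 2 - t) + pos (2 - t)).

Ltac pos_split t := case: (pos_cases (3 - t)) => -[? ->]; case: (pos_cases (5 / 2 - t)) => -[? ->];
  case: (pos_cases (2 - t)) => -[? ->].

Lemma omega_lo t : t <= 2 -> omega t = 1.
Proof.
move=> t2; rewrite /omega /pos !max_r; [|linarith..].
by field.
Qed.

Lemma omega_hi t : 3 <= t -> omega t = 0.
Proof. by move=> t3; rewrite /omega /pos !max_l; [ring|linarith..]. Qed.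

Lemma domega_out t : (t <= 2) || (3 <= t) -> domega t = 0.
Proof. by move=> /orP[]h; rewrite /domega; pos_split t; linarith. Qed.

Lemma domega_le0 t : domega t <= 0.
Proof. by rewrite /domega; pos_split t; linarith. Qed.

Lemma domega_ge t : - 2 <= domega t.
Proof. by rewrite /domega; pos_split t; linarith. Qed.

Lemma domega_mid t : 9 / 4 <= t <= 11 / 4 -> domega t <= - 1.
Proof. by move=> /andP[? ?]; rewrite /domega; pos_split t; linarith. Qed.

Lemma pos_dist t u : `|pos t - pos u| <= `|t - u|.
Proof.
by case: (pos_cases t) => -[? ->]; case: (pos_cases u) => -[? ->];
  rewrite ler_norml; apply/andP; split; case: (ler0P (t - u)); linarith.
Qed.

Lemma domega_dist t u : `|domega t - domega u| <= 16 * `|t - u|.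
Proof.
have := pos_dist (3 - t) (3 - u); have := pos_dist (5 / 2 - t) (5 / 2 - u).
have := pos_dist (2 - t) (2 - u).
have E (c : R) : c - t - (c - u) = u - t by ring.
rewrite !E (distrC u t) /domega !ler_norml => /andP[? ?] /andP[? ?] /andP[? ?].
by apply/andP; split; linarith.
Qed.

Lemma pos_taylor t h : `|pos (t + h) ^+ 2 - pos t ^+ 2 - 2 * pos t * h| <= h ^+ 2.
Proof.
case: (pos_cases t) => -[? ->]; case: (pos_cases (t + h)) => -[? ->];
  rewrite ler_norml; apply/andP; split; nra.
Qed.

Lemma omega_taylor t h : `|omega (t + h) - omega t - domega t * h| <= 8 * h ^+ 2.
Proof.
have := pos_taylor (3 - t) (- h); have := pos_taylor (5 / 2 - t) (- h).
have := pos_taylor (2 - t) (- h); rewrite !sqrrN /omega /domega.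
have E (c : R) : c - t - h = c - (t + h) by ring.
rewrite !E !ler_norml => /andP[? ?] /andP[? ?] /andP[? ?].
by apply/andP; split; linarith.
Qed.

Lemma omega_lip1 t u : t <= u -> 0 <= omega t - omega u <= 2 * (u - t).
Proof.
have dom (x : R) : is_derive x 1 omega (domega x).
  have cvg : (fun h : R => h^-1 *: ((omega \o shift x) (h *: (1 : R)) - omega x)) @ 0^' --> domega x.
    apply/cvgrPdist_le => e e0; near=> h.
    have h0 : h != 0 by near: h; exact: nbhs_dnbhs_neq.
    have hn : 0 < `|h| by rewrite normr_gt0.
    have he : `|h| < e / 8 by near: h; apply: dnbhs0_lt; exact: divr_gt0.
    rewrite /= -[domega x](mulKf h0) /GRing.scale/= -mulrBr normrM normfV mulr1.
    rewrite distrC ler_pdivrMl// [h + x]addrC [h * _]mulrC.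
    apply: le_trans (omega_taylor x h) _; rewrite -(real_normK (num_real h)) expr2 mulrA.
    by rewrite [leRHS]mulrC ler_wpM2r//; linarith.
  apply: DeriveDef; first by apply/cvg_ex; exists (domega x).
  exact/cvg_lim.
move=> tu.
have cont : {within `[t, u], continuous omega}.
  by apply: derivable_within_continuous => x _; have [] := dom x.
have [c _ E] := MVT_segment tu (fun x _ => dom x) cont.
have := domega_le0 c; have := domega_ge c; rewrite -opprB E => h1 h2.
by apply/andP; split; nra.
Unshelve. all: by end_near. Qed.

Lemma omega_dist t u : `|omega t - omega u| <= 2 * `|t - u|.
Proof.
wlog tu : t u / t <= u.
  by move=> H; have [/H//|/ltW/H] := leP t u; rewrite distrC (distrC u).
have /andP[h1 h2] := omega_lip1 tu.
by rewrite ger0_norm// distrC ger0_norm ?subr_ge0.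
Qed.

Lemma omega_ge0 t : 0 <= omega t.
Proof.
have [h|/ltW h] := leP t 3; last by rewrite omega_hi.
by have := omega_lip1 h; rewrite (@omega_hi 3)// subr0 => /andP[].
Qed.

Lemma omega_le1 t : omega t <= 1.
Proof.
have [h|/ltW h] := leP t 2; first by rewrite omega_lo.
by have := omega_lip1 h; rewrite (@omega_lo 2)// => /andP[]; linarith.
Qed.

Lemma measurable_lip (f : R -> R) (L : R) : (forall t u, `|f t - f u| <= L * `|t - u|) ->
  measurable_fun setT f.
Proof.
move=> fL; apply: continuous_measurable_fun => t; apply/cvgrPdist_le => e e0.
have L1 : 0 < `|L| + 1 by rewrite ltr_wpDl.
near=> u; apply: le_trans (fL _ _) _.
have : `|t - u| <= e / (`|L| + 1) by near: u; apply: cvgr_dist_le; rewrite ?divr_gt0.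
rewrite ler_pdivlMr// => h; apply: le_trans h; rewrite mulrC ler_wpM2l//.
by have := ler_norm L; linarith.
Unshelve. all: by end_near. Qed.

Lemma measurable_omega : measurable_fun setT omega.
Proof. exact: measurable_lip omega_dist. Qed.

Lemma measurable_domega : measurable_fun setT domega.
Proof. exact: measurable_lip domega_dist. Qed.

End profile.

(** * The radial vortex, its angular velocity, and the contraction estimate *)

Section base_vortex.
Context {R : realType}.
Variable s : R.
Hypothesis hs : 0 < s <= 1.
Implicit Types (x y z u v n m : (R * R)%type) (f h : R * R -> R) (t B C L : R).
Notation conv := (convk (kap s)).
Let lk := kap_locally_integrable hs.
Let B2 : (0 : R) <= 2. Proof. by []. Qed.

Definition W0 z : R := omega (dotp z z).
(** Half the derivative of [W0] in the direction n: the infinitesimal translations of the radial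
    vortex. *)
Definition gw n z : R := domega (dotp z z) * dotp n z.

Lemma enorm_e1 : enorm (e1 : R * R) = 1.
Proof. by rewrite /enorm /dotp/= mulr0 addr0 mulr1 sqrtr1. Qed.

Lemma enorm_Ze1 t : 0 <= t -> enorm (t *: (e1 : R * R)) = t.
Proof. by move=> t0; rewrite enormZ enorm_e1 mulr1 ger0_norm. Qed.

Lemma enorm_unit n : dotp n n = 1 -> enorm n = 1.
Proof. by rewrite /enorm => ->; rewrite sqrtr1. Qed.

(** The squared norm is not Lipschitz on the plane; cut at 4 = 2^2 it is, with constant 2 + 2. The
    cut is harmless since [omega] and [domega] vanish beyond 3. *)
Lemma nsq_cut_dist x y :
  `|Num.min (dotp x x) 4 - Num.min (dotp y y) 4| <= 4 * enorm (x - y).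
Proof.
have E u : Num.min (dotp u u) 4 = Num.min (enorm u) 2 ^+ 2.
  have u0 := enorm_ge0 u; rewrite -enorm_sqr.
  have [h|h] := leP (enorm u) 2; first by rewrite min_l//; nra.
  by rewrite min_r; [rewrite expr2; ring|nra].
rewrite !E subr_sqr normrM mulrC.
have a0 u : 0 <= Num.min (enorm u) 2 by rewrite le_min enorm_ge0/=.
have a2 u : Num.min (enorm u) 2 <= 2 by rewrite ge_min lexx orbT.
apply: ler_pM => //.
  by rewrite ger0_norm ?addr_ge0//; have := a2 x; have := a2 y; linarith.
apply: le_trans (ler_dist_enorm x y).
case: (leP (enorm x) 2) => hx; case: (leP (enorm y) 2) => hy //; last by rewrite subrr normr0.
  by rewrite ler0_norm ?subr_le0// ler0_norm ?subr_le0//; linarith.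
by rewrite ger0_norm ?subr_ge0 ?(ltW hx)// ger0_norm ?subr_ge0//; linarith.
Qed.

Lemma nsq_gt4 z : 2 < enorm z -> 4 < dotp z z.
Proof. by move=> z2; rewrite -enorm_sqr; have := enorm_ge0 z; nra. Qed.

Lemma domega_nsq z : domega (dotp z z) = domega (Num.min (dotp z z) 4).
Proof. by case: (leP (dotp z z) 4) => // h; rewrite !domega_out//; apply/orP; right; linarith. Qed.

Lemma lip_domega : lip_on setT 64 (fun z : R * R => domega (dotp z z)).
Proof.
move=> x y _ _; rewrite !domega_nsq; apply: le_trans (domega_dist _ _) _.
by have := nsq_cut_dist x y; linarith.
Qed.

Lemma domega_supp z : 2 < enorm z -> domega (dotp z z) = 0.
Proof. by move=> /nsq_gt4 h; rewrite domega_out//; apply/orP; right; linarith. Qed.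

Lemma domega_norm t : `|domega t| <= 2.
Proof. by rewrite ler0_norm ?domega_le0//; have := domega_ge t; linarith. Qed.

Lemma measurable_domega_nsq : measurable_fun setT (fun z : R * R => domega (dotp z z)).
Proof. exact: measurableT_comp (@measurable_domega R) (@measurable_nsq R). Qed.

Lemma measurable_dotp n : measurable_fun setT (dotp n).
Proof.
by apply: measurable_funD; apply: measurable_funM.
Qed.

Lemma bnd_supp_domegaM f C : 0 <= C -> measurable_fun setT f ->
  (forall z, enorm z <= 2 -> `|f z| <= C) ->
  bnd_supp 2 (2 * C) (fun z => domega (dotp z z) * f z).
Proof.
move=> C0 mf fC; split.
- exact: measurable_funM measurable_domega_nsq mf.
- move=> z; have [z2|z2] := leP (enorm z) 2; last by rewrite domega_supp// mul0r normr0 mulr_ge0.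
  by rewrite normrM ler_pM ?domega_norm ?fC.
- by move=> z z2; rewrite domega_supp// mul0r.
Qed.

Lemma dotp_le2 n z : enorm z <= 2 -> `|dotp n z| <= 2 * enorm n.
Proof.
by move=> z2; apply: le_trans (normr_dotp _ _) _; rewrite mulrC ler_wpM2r ?enorm_ge0.
Qed.

Lemma bnd_supp_gw n : bnd_supp 2 (4 * enorm n) (gw n).
Proof.
have := @bnd_supp_domegaM (dotp n) (2 * enorm n) _ (measurable_dotp n) (@dotp_le2 n).
by rewrite mulrA -natrM; apply; rewrite mulr_ge0 ?enorm_ge0.
Qed.

Lemma lip_gw n : lip_on setT (130 * enorm n) (gw n).
Proof.
have n0 := enorm_ge0 n.
rewrite (_ : 130 * _ = 64 * (2 * enorm n) + 2 * enorm n); last by ring.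
apply: (@lip_onM _ _ _ 2) => //; rewrite ?mulr_ge0//.
- by move=> z; exact: domega_norm.
- exact: lip_domega.
- exact: domega_supp.
- exact: dotp_le2.
- by move=> x y _ _; rewrite -dotpNr -dotpDr; exact: normr_dotp.
Qed.

Lemma bnd_supp_W0 : bnd_supp 2 1 W0.
Proof.
split.
- exact: measurableT_comp (@measurable_omega R) (@measurable_nsq R).
- by move=> z; rewrite ger0_norm ?omega_ge0// omega_le1.
- by move=> z /nsq_gt4 h; rewrite /W0 omega_hi//; linarith.
Qed.

Lemma gw_lin a b n m z : gw (a *: n + b *: m) z = a * gw n z + b * gw m z.
Proof. by rewrite /gw !dotpE; ring. Qed.

Lemma conv_gw_lin a b n m y : conv (gw (a *: n + b *: m)) y = a * conv (gw n) y + b * conv (gw m) y.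
Proof.
have -> : gw (a *: n + b *: m) = (fun z => a * gw n z + b * gw m z).
  by apply/funext => z; exact: gw_lin.
have ha := bnd_suppZ a (bnd_supp_gw n); have hb := bnd_suppZ b (bnd_supp_gw m).
rewrite (convkD lk y ha hb) (convkZ lk a y (bnd_supp_gw n)).
by rewrite (convkZ lk b y (bnd_supp_gw m)).
Qed.

Lemma conv_gw_refl n m y : dotp m m = 1 -> conv (gw n) (refl m y) = conv (gw (refl m n)) y.
Proof.
move=> m1; rewrite -(convk_refl lk y m1); last by case: (bnd_supp_gw n).
congr (convk _ _ y); apply/funext => z.
by rewrite /gw dotp_refl// dotp_refl_swap.
Qed.

(** The reflection of normal n fixes y and turns [gw n] into its opposite. *)
Lemma conv_gw_perp n y : dotp n n = 1 -> dotp n y = 0 -> conv (gw n) y = 0.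
Proof.
move=> n1 ny; have := conv_gw_refl n y n1; rewrite refl_perp// refl_self//.
have := conv_gw_lin (-1) 0 n 0 y; rewrite scaler0 addr0 scaleN1r mul0r addr0 => -> h.
linarith.
Qed.

(** By rotation invariance the convolution of [gw n] is n . y times this radial factor. It is also
    the derivative of [phi0], so the gradient of [conv W0] is 2 lam y: up to a factor, the angular
    velocity of the vortex. At t = 0 the quotient is 0 by convention. *)
Definition lam t : R := conv (gw e1) (Num.sqrt t *: e1) / Num.sqrt t.

(** The vector n is split along y and [perp y]: the second component contributes nothing by
    [conv_gw_perp], and the first is carried to the ray of [e1] by a reflection. *)
Lemma conv_gwE n y : y != 0 -> conv (gw n) y = lam (dotp y y) * dotp n y.
Proof.
move=> y0; have dy : dotp y y != 0 by rewrite gt_eqF ?dotp_gt0.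
have ey : enorm y != 0 by rewrite enorm_eq0.
have par : conv (gw y) y = lam (dotp y y) * dotp y y.
  have [m m1 my] := refl_transitive (esym (enorm_Ze1 (enorm_ge0 y))).
  have := conv_gw_refl (enorm y *: e1) y m1.
  rewrite -{2}my reflK// my => <-.
  have := conv_gw_lin (enorm y) 0 e1 0 (enorm y *: e1).
  rewrite scaler0 addr0 mul0r addr0 => ->.
  by rewrite /lam -!/(enorm y) -enorm_sqr expr2 mulrA divfK// mulrC.
pose b := dotp n (perp y) / dotp y y.
have pp : dotp (perp y) (perp y) = dotp y y by rewrite /dotp/perp/=; ring.
have dec : n = (dotp n y / dotp y y) *: y + (dotp n (perp y) / enorm y) *: ((enorm y)^-1 *: perp y).
  rewrite scalerA -mulrA -invfM -expr2 enorm_sqr.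
  move: dy; rewrite /dotp /perp; case: n y {y0 ey par b pp} => n1 n2 [y1 y2] /= dy.
  set A := (n1 * y1 + _) / _; set B := (n1 * y2 + _) / _; apply: pair_ext.
    by change (n1 = A * y1 + B * y2); rewrite /A /B; field.
  by change (n2 = A * y2 + B * - y1); rewrite /A /B; field.
rewrite [in LHS]dec conv_gw_lin par conv_gw_perp ?mulr0 ?addr0.
- by field.
- by rewrite dotpZl dotpZr pp -enorm_sqr; field.
- by rewrite dotpZl (_ : dotp _ y = 0) ?mulr0// /dotp/perp/=; ring.
Qed.

Definition k1 B : R := 2 * dkap s ((B + 1) ^+ 2).

(** Up to K the truncated kernel decreases at least at the rate [dkap s K], uniformly in e; this is
    what survives when e tends to 0. *)
Lemma kape_diff (e t u K : R) : 0 < e -> e <= K -> t <= u -> u <= K ->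
  dkap s K * (u - t) <= kape s e t - kape s e u.
Proof.
move=> e0 eK tu uK.
have D a : 0 < a -> a <= K -> dkap s K <= dkap s a by move=> a0 aK; exact: dkap_le.
have K0 : 0 < K := lt_le_trans e0 eK.
have DK := dkap_gt0 s K0; have DeK := D _ e0 eK.
rewrite !kapeE; case: ifPn => te; case: ifPn => ue.
- by nra.
- have eu : e <= u by rewrite leNgt.
  have /andP[h _] := kap_diff_bounds hs e0 eu.
  have := D u (lt_le_trans e0 eu) uK; nra.
- by exfalso; move: te; rewrite (le_lt_trans tu ue).
- have et : e <= t by rewrite leNgt.
  have /andP[h _] := kap_diff_bounds hs (lt_le_trans e0 et) tu.
  have := D u (lt_le_trans (lt_le_trans e0 et) tu) uK; nra.
Qed.

(* For h odd under the reflection across the line orthogonal to n and nonnegative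
   on the side of n, the kernel at z minus its reflection is bounded below. *)
Lemma conv_odd_ge B Y C h n y : 0 <= B -> bnd_supp B C h -> dotp n n = 1 ->
  (forall z, h (refl n z) = - h z) -> (forall z, 0 <= dotp n z * h z) ->
  enorm y <= Y -> 0 <= dotp n y ->
  2 * dkap s ((B + Y + 1) ^+ 2) * dotp n y * iint (fun z => dotp n z * h z) <= conv h y.
Proof.
move=> B0 hb n1 hodd hpos yY ny.
have C0 := bnd_supp_ge0 hb; have Y0 : 0 <= Y := le_trans (enorm_ge0 y) yY.
have mh : measurable_fun setT h by case: hb.
set K := (B + Y + 1) ^+ 2; set I := iint _.
have K1 : 1 <= K by rewrite /K expr_ge1//; linarith.
have DK := dkap_gt0 s (lt_le_trans ltr01 K1).
apply/ler_addgt0Pr => d d0.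
have C1 : 0 < C + 1 by rewrite ltr_wpDl.
have [e [L [/andP[e0 e1'] L0 /(_ C h hb)[_ H _]]]] := conv_split hs B0 Y0 (divr_gt0 d0 C1).
have {}H := H y yY.
have hK : d / (C + 1) * C <= d.
  by rewrite -mulrA ler_piMr ?(ltW d0)// mulrC ler_pdivrMr// mul1r lerDl.
suff : 2 * dkap s K * dotp n y * I <= convk (kape s e) h y.
  by move: H; rewrite ler_norml => /andP[H _]; linarith.
have le := kape_locally_integrable hs e0.
have odd : convk (kape s e) h (refl n y) = - convk (kape s e) h y.
  rewrite -(convk_refl le y n1 mh) -mulN1r -(convkZ le (-1) y hb).
  by congr (convk _ _ y); apply/funext => z; rewrite hodd mulN1r.
have ih : integ (fun z => dotp n z * h z).
  apply: (@le_integ _ _ (fun z => B * C * cutoff B z)).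
  - by apply: measurable_funM => //; exact: measurable_dotp.
  - move=> z; rewrite cutoffE; case: (leP (enorm z) B) => zB; last first.
      by case: hb => _ _ ->//; rewrite !mulr0 normr0.
    rewrite mulr1 normrM ler_pM//; last by case: hb.
    by apply: le_trans (normr_dotp _ _) _; rewrite (enorm_unit n1) mul1r.
  - by apply: integZ; exact: integrable_cutoff.
(* As h is odd, so is its convolution, and twice the value at y is the integral of h against the
   kernel seen from y minus the kernel seen from the mirror image of y. *)
have E : 2 * convk (kape s e) h y =
    iint (fun z => kape s e (dotp (y - z) (y - z)) * h z - kape s e (dotp (refl n y - z) (refl n y - z)) * h z).
  rewrite iintB; [|exact: integ_convk hb..].
  by rewrite -!convkE odd; ring.
suff : 4 * dkap s K * dotp n y * I <= 2 * convk (kape s e) h y by linarith.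
rewrite E /I -iintZ//; apply: le_iint.
- exact: integZ.
- by apply: integB; exact: integ_convk hb.
move=> z; have [zB|zB] := leP (enorm z) B; last first.
  by case: hb => _ _ ->//; rewrite !mulr0 subrr.
rewrite -mulrBl.
(* For y on the side of n, the kernel difference therefore has the sign of n . z, which is also the
   sign of h z where both are nonzero. *)
have F : dotp (refl n y - z) (refl n y - z) = dotp (y - z) (y - z) + 4 * dotp n y * dotp n z.
  rewrite /refl !dotpE n1 (dotpC y n) (dotpC z n) (dotpC z y); ring.
have bK u : enorm u <= Y -> dotp (u - z) (u - z) <= K.
  move=> uY; rewrite -enorm_sqr /K ler_pXn2r ?nnegrE ?enorm_ge0//; last linarith.
  by have := ler_enormB u z; linarith.
have yK := bK y yY; have rK := bK (refl n y); rewrite enorm_refl// in rK.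
have {}rK := rK yY.
set a := dotp (y - z) (y - z) in F yK *; set b := dotp (refl n y - z) _ in F rK *.
have hz := hpos z.
have [nz|nz] := leP 0 (dotp n z).
  have ab : a <= b by rewrite F lerDl !mulr_ge0.
  have := kape_diff e0 (le_trans e1' K1) ab rK; rewrite (_ : b - a = 4 * dotp n y * dotp n z); last by rewrite F; ring.
  move=> hd; have [nz0|nz0] := eqVneq (dotp n z) 0.
    by rewrite F nz0 mulr0 addr0 subrr !mul0r !mulr0.
  have h0 : 0 <= h z by move: hz; rewrite pmulr_rge0// lt0r nz0.
  by have := ler_wpM2r h0 hd; linarith.
have ab : b <= a by rewrite F gerDl mulr_ge0_le0 ?(ltW nz)// mulr_ge0.
have := kape_diff e0 (le_trans e1' K1) ab yK; rewrite (_ : a - b = - (4 * dotp n y * dotp n z)); last by rewrite F; ring.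
move=> hd; have h0 : h z <= 0 by move: hz; rewrite nmulr_rge0.
by have := ler_wnM2r h0 hd; linarith.
Qed.

Definition Pi0 : R := iint (fun z => - domega (dotp z z) * dotp e1 z ^+ 2).

Lemma integ_Pi0 n : integ (fun z => - domega (dotp z z) * dotp n z ^+ 2).
Proof.
have h : bnd_supp 2 (2 * (2 * enorm n) ^+ 2) (fun z => domega (dotp z z) * dotp n z ^+ 2).
  apply: bnd_supp_domegaM; first exact: sqr_ge0.
    by apply: measurable_funX; exact: measurable_dotp.
  move=> z z2; rewrite normrX ler_pXn2r ?nnegrE ?mulr_ge0 ?enorm_ge0//; exact: dotp_le2.
by apply: integ_eq (integN (integ_bnd_supp h)) => z; rewrite mulNr.
Qed.

Lemma Pi0E n : dotp n n = 1 -> iint (fun z => - domega (dotp z z) * dotp n z ^+ 2) = Pi0.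
Proof.
move=> n1; have [m m1 mn] : exists2 m : R * R, dotp m m = 1 & refl m e1 = n.
  by apply: refl_transitive; rewrite enorm_e1 enorm_unit.
rewrite /Pi0 -(iint_preserving (area_preserving_refl m1)); last exact: integ_measurable (integ_Pi0 n).
by apply: eq_iint => z; rewrite dotp_refl// dotp_refl_swap -mn reflK.
Qed.

(** On a small square with corner (3/2, 0) one has 9/4 <= |z|^2 <= 11/4, where [domega] is at most
    -1. *)
Lemma Pi0_gt0 : 0 < Pi0.
Proof.
pose b := 1 / 20 : R.
pose Bx : set (R * R) := `[3 / 2, 3 / 2 + b] `*` `[0, b].
have mB : measurable (Bx : set (measurableTypeR R * measurableTypeR R)%type) by exact: measurableX.
have b0 : 0 < b by rewrite divr_gt0.
have aB : @area R Bx = (b * b)%:E.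
  rewrite /area /Bx product_measure1E//= !lebesgue_measure_itv/= !lte_fin ltrDl b0 -!EFinB.
  by rewrite addrAC subrr add0r subr0 EFinM.
have iB : integ (\1_Bx).
  apply: (@le_integ _ _ (cutoff 10)); [exact: measurable_indic| |exact: integrable_cutoff].
  move=> z; rewrite indicE cutoffE; case: (boolP (z \in Bx)) => /= [|_]; last by rewrite normr0.
  rewrite inE /Bx /= !in_itv/= => -[/andP[z1 z1'] /andP[z2 z2']].
  suff -> : enorm z <= 10 by rewrite normr1.
  apply: le_trans (enorm_le_coord _) _; rewrite /b in z1' z2'.
  by rewrite !ger0_norm; linarith.
apply: lt_le_trans (_ : iint (\1_Bx) <= _).
  have -> : iint (\1_Bx) = fine (@area R Bx) by rewrite iintE /Rintegral integral_indic// setIT.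
  by rewrite aB/= mulr_gt0.
apply: le_iint => //; first exact: integ_Pi0.
move=> z; rewrite indicE; case: (boolP (z \in Bx)) => /= [|_]; last first.
  by rewrite mulr_ge0 ?sqr_ge0// oppr_ge0 domega_le0.
rewrite inE /Bx /= !in_itv/= => -[/andP[z1 z1'] /andP[z2 z2']].
have hd : domega (dotp z z) <= - 1.
  by apply: domega_mid; rewrite /dotp; rewrite /b in z1' z2'; apply/andP; split; nra.
have : 1 <= dotp e1 z ^+ 2 by rewrite /dotp/= mul1r mul0r addr0; nra.
nra.
Qed.

(** The function - [gw e1] is odd and nonnegative on the side of [e1], so [conv_odd_ge] bounds its
    convolution below by a multiple of e1 . y; division by sqrt t leaves a constant. *)
Lemma lam_neg : exists2 c : R, 0 < c & forall t, 0 < t -> t <= 5 -> lam t <= - c.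
Proof.
pose K := 2 * dkap s ((2 + 3 + 1) ^+ 2).
have K0 : 0 < K by rewrite mulr_gt0// dkap_gt0// exprn_gt0.
exists (K * Pi0); first by rewrite mulr_gt0 ?Pi0_gt0.
move=> t t0 t5; set r := Num.sqrt t.
have r0 : 0 < r by rewrite sqrtr_gt0.
have r3 : r <= 3 by rewrite -(ler_pXn2r (isT : (0 < 2)%N)) ?nnegrE ?(ltW r0)// sqr_sqrtr ?(ltW t0)//; linarith.
have n1 : dotp e1 e1 = 1 :> R by rewrite /dotp/= mulr0 mulr1 addr0.
have hb := bnd_suppZ (-1) (bnd_supp_gw e1).
have ny : dotp e1 (r *: (e1 : R * R)) = r by rewrite dotpZr n1 mulr1.
have := @conv_odd_ge 2 3 _ _ e1 (r *: e1) B2 hb n1.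
rewrite (convkZ lk (-1) _ (bnd_supp_gw e1)) ny enorm_Ze1 ?(ltW r0)// -/K.
rewrite (@eq_iint _ _ (fun z => - domega (dotp z z) * dotp e1 z ^+ 2)) -/Pi0; last first.
  by move=> z; rewrite /gw; ring.
move=> h; have : K * r * Pi0 <= -1 * conv (gw e1) (r *: e1).
  apply: (h _ _ r3 isT).
    by move=> z; rewrite /gw dotp_refl// dotp_n_refl//; ring.
  by move=> z; rewrite /gw; have := domega_le0 (dotp z z); have := sqr_ge0 (dotp e1 z); nra.
rewrite /lam -/r ler_pdivrMr//; linarith.
Qed.

Lemma lam_lip : exists K, forall t u : R, 1 / 2 <= t -> t <= 5 -> 1 / 2 <= u -> u <= 5 ->
  `|lam t - lam u| <= K * `|t - u|.
Proof.
pose F r := conv (gw e1) (r *: (e1 : R * R)).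
have hb := bnd_supp_gw e1; have hL := @lip_gw e1; rewrite enorm_e1 mulr1 in hb hL.
pose K1 := 130 * kernel_mass (kap s) (2 + 3); pose K2 := 4 * kernel_mass (kap s) (2 + 3).
have m0 := kernel_mass_ge0 (kap s) (2 + 3).
have Flip r q : 0 <= r -> r <= 3 -> 0 <= q -> q <= 3 -> `|F r - F q| <= K1 * `|r - q|.
  move=> r0 r3 q0 q3; apply: le_trans (lip_convk lk hb hL (Y := 3) _ _) _; rewrite /= ?enorm_Ze1//.
  by rewrite -scalerBl enormZ enorm_e1 !mulr1.
have Fb r : 0 <= r -> r <= 3 -> `|F r| <= K2.
  by move=> r0 r3; apply: norm_convk_leY => //; rewrite enorm_Ze1.
exists (2 * K1 + 4 * K2) => t u t2 t5 u2 u5.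
have sb (w : R) : 1 / 2 <= w -> w <= 5 -> [/\ 1 / 2 <= Num.sqrt w, Num.sqrt w <= 3 & Num.sqrt w ^+ 2 = w].
  move=> w2 w5; have w0 : 0 <= w by linarith.
  have s0 := sqrtr_ge0 w; have := sqr_sqrtr w0; set q := Num.sqrt w in s0 * => q2.
  by split => //; nra.
rewrite /lam -/(F _) -/(F _).
have [] := sb t t2 t5; have [] := sb u u2 u5.
set a := Num.sqrt t; set b := Num.sqrt u => b2 b3 bE a2 a3 aE.
have ab : `|a - b| <= `|t - u|.
  rewrite -aE -bE subr_sqr normrM ler_peMr//; rewrite ger0_norm; linarith.
have a0 : a != 0 by rewrite gt_eqF//; linarith.
have b0 : b != 0 by rewrite gt_eqF//; linarith.
rewrite (_ : _ - _ = (F a - F b) / a + F b * (b - a) / (a * b)); last by field; rewrite a0 b0.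
apply: le_trans (ler_normD _ _) _; rewrite [leRHS]mulrDl.
have ai : `|a^-1| <= 2.
  by rewrite ger0_norm ?invr_ge0; [rewrite invf_ple ?posrE; linarith|linarith].
have bi : `|b^-1| <= 2.
  by rewrite ger0_norm ?invr_ge0; [rewrite invf_ple ?posrE; linarith|linarith].
apply: lerD.
  rewrite normrM mulrC -[leRHS]mulrA ler_pM//; apply: le_trans (Flip _ _ _ _ _ _) _; try linarith.
  by rewrite ler_wpM2l// mulr_ge0.
rewrite !normrM invfM normrM (distrC b) (_ : 4 * K2 * _ = K2 * `|t - u| * (2 * 2)); last by ring.
by apply: ler_pM; rewrite ?mulr_ge0//; apply: ler_pM => //; apply: Fb; linarith.
Qed.

Definition phi0 t : R := conv W0 (Num.sqrt t *: e1).

Lemma conv_W0 y : conv W0 y = phi0 (dotp y y).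
Proof.
have [m m1 my] := refl_transitive (esym (enorm_Ze1 (enorm_ge0 y))).
rewrite /phi0 -/(enorm y) -my -(convk_refl lk y m1); last by case: bnd_supp_W0.
by congr (convk _ _ y); apply/funext => z; rewrite /W0 dotp_refl.
Qed.

(** The partial derivatives of [W0] are 2 [gw e1] and 2 [gw e2], so [convk_taylor] and [conv_gwE]
    give the gradient. *)
Lemma has_grad_conv_W0 y : y != 0 -> has_grad (conv W0) y ((2 * lam (dotp y y)) *: y).
Proof.
move=> y0.
have hb1 := bnd_suppZ 2 (bnd_supp_gw e1); have hb2 := bnd_suppZ 2 (bnd_supp_gw e2).
rewrite enorm_e1 in hb1.
have ee2 : enorm (e2 : R * R) = 1 by rewrite /enorm /dotp/= mulr0 add0r mulr1 sqrtr1.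
rewrite ee2 in hb2.
have Ce : `|2| * (4 * 1) = 8 :> R by rewrite ger0_norm//; ring.
rewrite Ce in hb1 hb2.
have hb : bnd_supp 2 8 W0 by apply: bnd_supp_le bnd_supp_W0 => //; linarith.
have K0 := ler0n R 400.
(* For |x| <= 3 the squared norm changes by at most 7 |v|: [omega_taylor] costs 8 * 49 and the term
   |v|^2 of the change costs 2, in all 394. For |x| > 3 also |x + v| > 2 and everything vanishes. *)
have T x v : enorm v <= 1 ->
    `|W0 (x + v) - W0 x - (v.1 * (2 * gw e1 x) + v.2 * (2 * gw e2 x))| <= 400 * enorm v ^+ 2.
  move=> v1; have v0 := enorm_ge0 v.
  have -> : v.1 * (2 * gw e1 x) + v.2 * (2 * gw e2 x) = 2 * domega (dotp x x) * dotp x v.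
    by rewrite /gw /dotp/=; ring.
  have [x3|x3] := leP (enorm x) 3; last first.
    have xv : 2 < enorm (x + v) by have := ler_enormB (x + v) v; rewrite addrK; linarith.
    have x4 : 4 < dotp x x by apply: nsq_gt4; linarith.
    have xv4 := nsq_gt4 xv.
    rewrite /W0 !omega_hi; [|linarith|linarith].
    rewrite domega_supp; last linarith.
    by rewrite mulr0 mul0r !subr0 normr0 mulr_ge0 ?sqr_ge0.
  have E : dotp (x + v) (x + v) = dotp x x + (2 * dotp x v + dotp v v).
    by rewrite !dotpE (dotpC v x); ring.
  rewrite /W0 E; have := omega_taylor (dotp x x) (2 * dotp x v + dotp v v).
  have vv := enorm_sqr v; rewrite -vv.
  have xv : `|dotp x v| <= 3 * enorm v.
    by apply: le_trans (normr_dotp _ _) _; rewrite ler_wpM2r.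
  have h2 : (2 * dotp x v + enorm v ^+ 2) ^+ 2 <= 49 * enorm v ^+ 2.
    have h7 : `|2 * dotp x v + enorm v ^+ 2| <= 7 * enorm v.
      by move: xv; rewrite !ler_norml => /andP[? ?]; apply/andP; split; nra.
    rewrite -real_normK ?num_real// (_ : 49 = 7 ^+ 2); last by ring.
    by rewrite -exprMn ler_pXn2r ?nnegrE ?mulr_ge0.
  have := domega_ge (dotp x x); have := domega_le0 (dotp x x).
  have := sqr_ge0 (enorm v).
  rewrite !ler_norml => ? ? ? /andP[? ?]; apply/andP; split; nra.
have := @has_grad_taylor _ (conv W0) y ((2 * lam (dotp y y)) *: y)
  (400 * kernel_mass (kap s) (2 + enorm y + 1)) 1 ltr01.
apply; first by rewrite mulr_ge0// kernel_mass_ge0.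
move=> v v1; have := convk_taylor lk hb hb1 hb2 K0 v1 (lexx (enorm y)) (fun x => T x v v1).
rewrite (convkZ lk _ _ (bnd_supp_gw e1)) (convkZ lk _ _ (bnd_supp_gw e2)) !conv_gwE//.
congr (`|_ - _| <= _); rewrite /dotp/= /GRing.scale/=; ring.
Qed.

Lemma is_derive_phi0 t : 0 < t -> is_derive t 1 phi0 (lam t).
Proof.
move=> t0; set r := Num.sqrt t.
have r0 : 0 < r by rewrite sqrtr_gt0.
have rt : r ^+ 2 = t by rewrite sqr_sqrtr// ltW.
have y0 : r *: (e1 : R * R) != 0 by rewrite -enorm_eq0 enorm_Ze1 ?gt_eqF// ltW.
have n1 : dotp e1 e1 = 1 :> R by rewrite /dotp/= mulr0 mulr1 addr0.
have := has_grad_derivable e1 (has_grad_conv_W0 y0).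
rewrite !dotpZl dotpZr n1 mulr1 -expr2 rt => hd.
have hd' : is_derive r 1 (fun q : R => conv W0 (q *: e1)) (2 * lam t * r).
  have E : (fun h : R => h^-1 *: (((fun q : R => conv W0 (q *: e1)) \o shift r) (h *: 1) - conv W0 (r *: e1)))
      = (fun h : R => h^-1 *: ((conv W0 \o shift (r *: e1)) (h *: e1) - conv W0 (r *: e1))).
    by apply/funext => q /=; rewrite [q *: (1 : R)]mulr1 scalerDl.
  by case: hd => hd1 hd2; apply: DeriveDef; rewrite ?/derivable ?/derive E.
have hs' := is_derive1_sqrt t0; rewrite -/r in hs'.
have := is_derive1_comp hd' hs'; rewrite /phi0 /comp.
by rewrite (_ : 2 * lam t * r * (2 * r)^-1 = lam t)//; field; rewrite gt_eqF.
Qed.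

Lemma lam_bounded : exists2 K : R, 0 < K & forall t, 1 / 2 <= t -> t <= 5 -> `|lam t| <= K.
Proof.
have [K HK] := lam_lip; exists (`|lam 1| + 5 * `|K| + 1).
  by rewrite ltr_wpDl// addr_ge0// mulr_ge0.
move=> t t2 t5; have h1 : (1 / 2 : R) <= 1 by linarith.
have h5 : (1 : R) <= 5 by linarith.
have h := HK t 1 t2 t5 h1 h5; have := ler_normD (lam t - lam 1) (lam 1); rewrite subrK => h2.
have : K * `|t - 1| <= `|K| * 5.
  apply: le_trans (_ : `|K| * `|t - 1| <= _); first by rewrite ler_wpM2r// ler_norm.
  by rewrite ler_wpM2l// ler_norml; apply/andP; split; linarith.
linarith.
Qed.

(** Contains the set 2 <= |y|^2 <= 3 that carries [domega], with a margin 1/4 on each side: a change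
    of |y|^2 by at most 1/8 does not activate the profile near the boundary. *)
Definition annulus y := 7 / 4 <= dotp y y <= 13 / 4.

(** A bound on a seminorm of the antisymmetric parts. The free multiple c makes it blind to linear
    functions, which are the displacements caused by infinitesimal translations; radial functions
    are invisible as well. *)
Definition mirror (a : R) f := forall n, dotp n n = 1 -> exists c : R, forall y,
  annulus y -> 0 <= dotp n y -> `|f y - f (refl n y) - c * dotp n y| <= a * dotp n y.

Lemma annulus_refl n y : dotp n n = 1 -> annulus (refl n y) = annulus y.
Proof. by move=> n1; rewrite /annulus dotp_refl. Qed.

Lemma domega_annulus z : ~~ annulus z -> domega (dotp z z) = 0.
Proof.
by rewrite /annulus negb_and -!ltNge => /orP[] h; rewrite domega_out//; apply/orP; [left|right]; linarith.
Qed.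

Lemma annulus_enorm y : annulus y -> enorm y <= 2.
Proof. by move=> /andP[_ h]; rewrite ler_enorm_sqr//; linarith. Qed.

Lemma annulus_neq0 y : annulus y -> y != 0.
Proof. by move=> /andP[h _]; rewrite -dotp_gt0; linarith. Qed.

(* The linearised problem contracts: the kernel bound of conv_odd_ge plays the role of a
   Doeblin minorisation, the constant c absorbing the eigenvalue 1 of the translations. *)
Lemma mirror_conv : exists2 d : R, 0 < d <= 1 & forall C f (a : R), bnd_supp 2 C f -> 0 <= a -> mirror a f ->
  mirror ((1 - d) * a) (fun y => conv (fun z => domega (dotp z z) * f z) y / lam (dotp y y)).
Proof.
pose k := 2 * dkap s ((2 + 2 + 1) ^+ 2).
have k0 : 0 < k by rewrite mulr_gt0// dkap_gt0// exprn_gt0.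
have P0 := Pi0_gt0.
have [K0 K00 lamK] := lam_bounded; have [c0 c00 lamc] := lam_neg.
(* K bounds |lam| on the annulus and exceeds k Pi0, so that the gain k Pi0 / K is at most 1. *)
pose K := K0 + k * Pi0; have kP : 0 < k * Pi0 by rewrite mulr_gt0.
have K_gt0 : 0 < K by rewrite addr_gt0.
exists (k * Pi0 / K); first by rewrite divr_gt0//= ler_pdivrMr// mul1r lerDr ltW.
move=> C f a fb a0 fM n n1; have [c Hc] := fM n n1.
have mf : measurable_fun setT f by case: fb.
have C0 := bnd_supp_ge0 fb.
pose h0 z := f z - f (refl n z) - c * dotp n z.
have mfr : measurable_fun setT (fun z => f (refl n z)) := measurableT_comp mf (area_preserving_refl n1).1.
have mn := @measurable_dotp n.
have mh0 : measurable_fun setT h0.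
  by apply: measurable_funB; [exact: measurable_funB|exact: measurable_funM].
have h0odd z : h0 (refl n z) = - h0 z by rewrite /h0 reflK// dotp_n_refl//; ring.
have h0a z : annulus z -> `|h0 z| <= a * `|dotp n z|.
  move=> az; have [nz|nz] := leP 0 (dotp n z); first by rewrite (ger0_norm nz); exact: Hc.
  rewrite -normrN -h0odd (ltr0_norm nz) -(dotp_n_refl z n1).
  by apply: Hc; rewrite ?annulus_refl// dotp_n_refl// oppr_ge0 ltW.
have nz2 z : enorm z <= 2 -> `|dotp n z| <= 2 by move=> /(@dotp_le2 n); rewrite enorm_unit// mulr1.
pose C' := C + C + `|c| * 2.
have h0C z : enorm z <= 2 -> `|h0 z| <= C'.
  move=> z2; apply: le_trans (ler_normB _ _) _; apply: lerD.
    by apply: le_trans (ler_normB _ _) _; case: fb => _ h _; exact: lerD.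
  by rewrite normrM ler_wpM2l// nz2.
have C'0 : 0 <= C' by rewrite !addr_ge0// mulr_ge0.
have bH0 := bnd_supp_domegaM C'0 mh0 h0C.
pose H z := -1 * (domega (dotp z z) * h0 z).
have bH : bnd_supp 2 (2 * C') H by have := bnd_suppZ (-1) bH0; rewrite normrN1 mul1r.
have bg := bnd_suppZ (- a) (bnd_supp_gw n).
pose I := iint (fun z => dotp n z * H z).
have iN (u : R * R -> R) D : bnd_supp 2 D u -> integ (fun z => dotp n z * u z).
  move=> bu; have D0 := bnd_supp_ge0 bu; apply: (@le_integ _ _ (fun z => 2 * D * cutoff 2 z)).
  - by apply: measurable_funM => //; case: bu.
  - move=> z; rewrite cutoffE; case: (leP (enorm z) 2) => z2; last first.
      by case: bu => _ _ ->//; rewrite !mulr0 normr0.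
    by rewrite mulr1 normrM ler_pM// ?nz2//; case: bu.
  - by apply: integZ; exact: integrable_cutoff.
(* For both signs e the function - a [gw n] + e H is odd and nonnegative on the side of n, because
   |h0 z| <= a |n . z| on the annulus. So [conv_odd_ge] bounds conv H from both sides. *)
have main (e : R) y : e ^+ 2 = 1 -> annulus y -> 0 <= dotp n y ->
    k * dotp n y * (a * Pi0 + e * I) <= - a * (lam (dotp y y) * dotp n y) + e * conv H y
    /\ 0 <= a * Pi0 + e * I.
  move=> e1 ay ny.
  have beH := bnd_suppZ e bH; have bb := bnd_suppD bg beH.
  have E1 : conv (fun z => - a * gw n z + e * H z) y = - a * (lam (dotp y y) * dotp n y) + e * conv H y.
    rewrite (convkD lk y bg beH) (convkZ lk _ y (bnd_supp_gw n)) (convkZ lk _ y bH).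
    by rewrite conv_gwE// annulus_neq0.
  have E2 : iint (fun z => dotp n z * (- a * gw n z + e * H z)) = a * Pi0 + e * I.
    rewrite -(Pi0E n1) -iintZ; last exact: integ_Pi0.
    rewrite /I -iintZ; last exact: iN bH.
    rewrite -iintD; [|apply: integZ; exact: integ_Pi0|apply: integZ; exact: iN bH].
    by apply: eq_iint => z; rewrite /gw; ring.
  have pos z : 0 <= dotp n z * (- a * gw n z + e * H z).
    have [az|az] := boolP (annulus z); last by rewrite /gw /H domega_annulus// !mul0r !mulr0 addr0 mulr0.
    have E3 : dotp n z * (- a * gw n z + e * H z) =
      - domega (dotp z z) * (a * (dotp n z * dotp n z) + dotp n z * (e * h0 z)) by rewrite /gw /H; ring.
    rewrite E3 mulr_ge0 ?oppr_ge0 ?domega_le0//.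
    have eh : `|dotp n z * (e * h0 z)| <= a * (dotp n z * dotp n z).
      have en : `|e| = 1 by apply/eqP; rewrite -sqr_norm_eq1// e1.
      rewrite !normrM en mul1r.
      have -> : dotp n z * dotp n z = `|dotp n z| * `|dotp n z| by rewrite -normrM ger0_norm// -expr2 sqr_ge0.
      by rewrite mulrCA ler_wpM2l// h0a.
    by move: eh; rewrite ler_norml => /andP[? _]; linarith.
  split; last by rewrite -E2; apply: iint_ge0.
  rewrite -E1 -E2; apply: (conv_odd_ge B2 bb n1) => //; last exact: annulus_enorm.
  by move=> z; rewrite /gw /H dotp_n_refl// dotp_refl// h0odd; ring.
(* The two minorants shift the multiple from c by k I / K; the constant K stands here instead of -
   lam because the multiple may not depend on y. *)
exists (c + k * I / K) => y ay ny.
have [l1 l2] : 0 < - lam (dotp y y) /\ - lam (dotp y y) <= K.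
  have /andP[y1 y2] := ay; split; first by have := lamc (dotp y y); linarith.
  have := lamK (dotp y y); rewrite ler_norml => h; have /andP[] := h ltac:(linarith) ltac:(linarith).
  by rewrite /K; linarith.
have [m1 p1] := main 1 y (expr1n _ _) ay ny; have [m2 p2] := main (-1) y (sqrr_sign R 1) ay ny.
set l := lam (dotp y y) in l1 l2 m1 m2 *.
have ln0 : l != 0 by rewrite lt_eqF// -oppr_gt0.
rewrite dotp_refl// -/l.
have fb' := bnd_supp_domegaM C0 mf (fun z _ => let: And3 _ h _ := fb in h z).
have frb : bnd_supp 2 (2 * C) (fun z => domega (dotp z z) * f (refl n z)).
  by apply: bnd_supp_domegaM => // z _; case: fb.
have D : conv (fun z => domega (dotp z z) * f z) y - conv (fun z => domega (dotp z z) * f z) (refl n y)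
    = - conv H y + c * (l * dotp n y).
  rewrite -(convk_refl lk y n1); last by case: fb'.
  rewrite [X in _ - X](_ : _ = conv (fun z => domega (dotp z z) * f (refl n z)) y); last first.
    by congr (convk _ _ y); apply/funext => z; rewrite dotp_refl.
  rewrite -(convkB lk y fb' frb) /l -conv_gwE ?annulus_neq0//.
  rewrite -(convkZ lk c y (bnd_supp_gw n)) -mulN1r -(convkZ lk _ y bH).
  rewrite -(convkD lk y (bnd_suppZ (-1) bH) (bnd_suppZ c (bnd_supp_gw n))).
  by congr (convk _ _ y); apply/funext => z; rewrite /H /gw /h0; ring.
rewrite -mulrBl D (_ : _ - _ = (conv H y - k * I / K * (- l) * dotp n y) / - l); last first.
  by field; rewrite ln0 gt_eqF.
have lp : `|(- l)^-1| = (- l)^-1 by rewrite gtr0_norm// invr_gt0.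
rewrite normrM lp ler_pdivrMr//.
(* The minorants are weakened by the factor q <= 1, as their nonnegativity permits, so that division
   by - l leaves the constant 1 / K. *)
pose q := - l / K.
have q1 : q <= 1 by rewrite /q ler_pdivrMr// mul1r.
have q0 : 0 <= q by rewrite /q divr_ge0 ?ltW.
have E : k * I / K * - l * dotp n y = q * (k * dotp n y * I) by rewrite /q; field; rewrite gt_eqF.
have E' : (1 - k * Pi0 / K) * a * dotp n y * - l = - a * (l * dotp n y) - q * (k * dotp n y * (a * Pi0)).
  by rewrite /q; field; rewrite gt_eqF.
have kn : 0 <= k * dotp n y by rewrite mulr_ge0 ?(ltW k0).
rewrite E E'; set X := conv H y in m1 m2 *; set W := k * dotp n y in m1 m2 kn *.
have := ler_wpM2l (mulr_ge0 kn p1) q1; have := ler_wpM2l (mulr_ge0 kn p2) q1.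
rewrite ler_norml => h1 h2; apply/andP; split; nra.
Qed.

End base_vortex.

(** * The fixed point map *)

Section core_estimates.
Context {R : realType}.
Variable s : R.
Hypothesis hs : 0 < s <= 1.
Implicit Types (x y z n b : (R * R)%type) (f h xi : R * R -> R) (t D : R).
Notation conv := (convk (kap s)).
Notation lam := (lam s).
Notation phi0 := (phi0 s).
Let lk := kap_locally_integrable hs.
Let B2 : (0 : R) <= 2. Proof. by []. Qed.
Let B3 : (0 : R) <= 3. Proof. by []. Qed.

Lemma MVT_seg (f df : R -> R) (a b : R) : a <= b ->
  (forall x : R, a <= x <= b -> is_derive x 1 f (df x)) ->
  exists2 c : R, a <= c <= b & f b - f a = df c * (b - a).
Proof.
move=> ab fdf.
have cont : {within `[a, b], continuous f}.
  by apply: derivable_within_continuous => x; rewrite in_itv/= => /fdf[].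
have oo_cc (x : R) : x \in `]a, b[ -> a <= x <= b.
  by rewrite in_itv/= => /andP[ax xb]; rewrite !ltW.
have [c /=] := @MVT_segment R f df a b ab (fun (x : R) xab => fdf x (oo_cc x xab)) cont.
by rewrite in_itv/=; exists c.
Qed.

Definition Er t (v : R) : R := phi0 (t + v) - phi0 t - lam t * v.

Lemma Er0 t : Er t 0 = 0.
Proof. by rewrite /Er addr0 subrr mulr0 subrr. Qed.

(** In v the remainder has derivative lam (t + v) - lam t, of size O(D). In t the mean value theorem
    is applied to phi0 (t + v) - phi0 t alone, and the term lam t * v is handled by the Lipschitz
    bound, so [lam] is not differentiated. *)
Lemma Er_dist : exists2 K : R, 0 <= K & forall D t t' (v v' : R), D <= 1 / 8 ->
  7 / 4 <= t <= 13 / 4 -> 7 / 4 <= t' <= 13 / 4 -> `|v| <= D -> `|v'| <= D ->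
  `|Er t v - Er t' v'| <= K * D * (`|v - v'| + `|t - t'|).
Proof.
have [K HK] := lam_lip hs; exists (2 * `|K|) => [|D t t' v v' D8 ht ht' hv hv']; first exact: mulr_ge0.
have D0 : 0 <= D := le_trans (normr_ge0 _) hv.
have lamK (a c : R) : 1 <= a <= 4 -> 1 <= c <= 4 -> `|lam a - lam c| <= `|K| * `|a - c|.
  move=> /andP[? ?] /andP[? ?]; apply: le_trans (HK a c _ _ _ _) _; try linarith.
  by rewrite ler_wpM2r// ler_norm.
have P1 (u w w' : R) : 7 / 4 <= u <= 13 / 4 -> `|w| <= D -> `|w'| <= D -> w <= w' ->
    `|Er u w - Er u w'| <= `|K| * D * `|w - w'|.
  move=> /andP[hu1 hu2] hw hw' ww.
  have [w1 w2] : - D <= w /\ w <= D by move: hw; rewrite ler_norml => /andP[].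
  have [w1' w2'] : - D <= w' /\ w' <= D by move: hw'; rewrite ler_norml => /andP[].
  have dE (c : R) : w <= c <= w' -> is_derive c 1 (fun c => phi0 (u + c) - lam u * c) (lam (u + c) - lam u).
    move=> /andP[c1 c2]; have uc : 0 < u + c by linarith.
    have d1 := is_derive_phi0 hs uc.
    have d2 : is_derive c 1 (fun c => u + c) 1.
      have := is_deriveD (is_derive_cst u c (1 : R)) (is_derive_id c (1 : R)).
      by rewrite add0r.
    have d3 : is_derive c 1 (fun c => phi0 (u + c)) (lam (u + c)).
      by have := is_derive1_comp d1 d2; rewrite mulr1.
    have d4 : is_derive c 1 (fun c => lam u * c) (lam u).
      have := is_deriveZ (lam u) (is_derive_id c (1 : R)).
      by rewrite [lam u *: 1]mulr1.
    exact: is_deriveB.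
  have [c /andP[c1 c2] E] := MVT_seg ww dE.
  rewrite distrC (_ : Er u w' - Er u w = (lam (u + c) - lam u) * (w' - w)); last by rewrite -E /Er; ring.
  rewrite normrM (distrC w) ler_wpM2r//; apply: le_trans (lamK _ _ _ _) _; try (by apply/andP; split; linarith).
  rewrite ler_wpM2l// addrAC subrr add0r ler_norml; apply/andP; split; linarith.
have P2 (u u' w : R) : 7 / 4 <= u <= 13 / 4 -> 7 / 4 <= u' <= 13 / 4 -> `|w| <= D -> u <= u' ->
    `|Er u w - Er u' w| <= 2 * `|K| * D * `|u - u'|.
  move=> /andP[hu1 hu2] /andP[hu1' hu2'] hw uu.
  have [w1 w2] : - D <= w /\ w <= D by move: (hw); rewrite ler_norml => /andP[].
  have dE (c : R) : u <= c <= u' -> is_derive c 1 (fun c => phi0 (c + w) - phi0 c) (lam (c + w) - lam c).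
    move=> /andP[c1 c2]; have uc : 0 < c + w by linarith.
    have d1 := is_derive_phi0 hs uc.
    have d2 : is_derive c 1 (fun c => c + w) 1.
      have := is_deriveD (is_derive_id c (1 : R)) (is_derive_cst w c (1 : R)).
      by rewrite addr0.
    have d3 : is_derive c 1 (fun c => phi0 (c + w)) (lam (c + w)).
      by have := @is_derive1_comp _ phi0 (fun c => c + w) c _ _ d1 d2; rewrite mulr1.
    have c0 : 0 < c by linarith.
    have d4 := is_derive_phi0 hs c0.
    exact: is_deriveB.
  have [c /andP[c1 c2] E] := MVT_seg uu dE.
  rewrite (_ : Er u w - Er u' w = - ((lam (c + w) - lam c) * (u' - u)) - (lam u - lam u') * w); last first.
    by rewrite -E /Er; ring.
  apply: le_trans (ler_normB _ _) _; rewrite normrN !normrM (distrC u' u).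
  have h1 : `|lam (c + w) - lam c| <= `|K| * D.
    apply: le_trans (lamK _ _ _ _) _; try (by apply/andP; split; linarith).
    by rewrite ler_wpM2l// addrAC subrr add0r.
  have h2 : `|lam u - lam u'| <= `|K| * `|u - u'| by apply: lamK; apply/andP; split; linarith.
  have := ler_pM (normr_ge0 _) (normr_ge0 _) h2 hw.
  have := ler_wpM2r (normr_ge0 (u - u')) h1; linarith.
have Q1 (u w w' : R) : 7 / 4 <= u <= 13 / 4 -> `|w| <= D -> `|w'| <= D ->
    `|Er u w - Er u w'| <= `|K| * D * `|w - w'|.
  move=> hu hw hw'; have [ww|/ltW ww] := leP w w'; first exact: P1.
  by rewrite distrC (distrC w); exact: P1.
have Q2 (u u' w : R) : 7 / 4 <= u <= 13 / 4 -> 7 / 4 <= u' <= 13 / 4 -> `|w| <= D ->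
    `|Er u w - Er u' w| <= 2 * `|K| * D * `|u - u'|.
  move=> hu hu' hw; have [ww|/ltW ww] := leP u u'; first exact: P2.
  by rewrite distrC (distrC u); exact: P2.
apply: le_trans (ler_distD (Er t v') _ _) _; rewrite mulrDr.
have : 0 <= `|K| * D * `|v - v'| by rewrite !mulr_ge0.
have := Q1 t v v' ht hv hv'; have := Q2 t t' v' ht ht' hv'; linarith.
Qed.

Definition W xi z : R := omega (dotp z z + xi z).

(* The states: xi perturbs the level sets of the radial vortex and b is the drift. *)
Definition st D xi b := [/\ bnd_supp 2 D xi, forall y, ~~ annulus y -> xi y = 0,
  forall x y, annulus x -> annulus y -> `|xi x - xi y| <= enorm (x - y) & enorm b <= D].

(** Two normalisations: no displacement on the ray of [e1], so that a level set is named by its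
    radius there, and orthogonality to the translation modes. *)
Definition nrm xi := (forall y, annulus y -> xi (enorm y *: e1) = 0) /\
  forall n, iint (fun z => domega (dotp z z) * xi z * conv (gw n) z) = 0.

Section one_state.
Variables (D : R) (xi : R * R -> R) (b : (R * R)%type).
Hypotheses (D8 : D <= 1 / 8) (hst : st D xi b).

Let xiD z : `|xi z| <= D. Proof. by case: hst => -[]. Qed.
Let xiD' z : - D <= xi z /\ xi z <= D.
Proof. by have := xiD z; rewrite ler_norml => /andP[]. Qed.
Let D0 : 0 <= D. Proof. exact: le_trans (normr_ge0 _) (xiD 0). Qed.

Lemma W_supp z : 25 / 8 <= dotp z z -> W xi z = 0.
Proof.
move=> h; rewrite /W; have [az|az] := boolP (annulus z).
  by have [x1 x2] := xiD' z; have D8' := D8; rewrite omega_hi//; lra.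
by case: hst => _ -> // _ _; rewrite addr0 omega_hi//; lra.
Qed.

Lemma W_core z : dotp z z <= 15 / 8 -> W xi z = 1.
Proof.
move=> h; rewrite /W; have [az|az] := boolP (annulus z).
  by have [x1 x2] := xiD' z; have D8' := D8; rewrite omega_lo//; lra.
by case: hst => _ -> // _ _; rewrite addr0 omega_lo//; lra.
Qed.

Lemma measurable_W : measurable_fun setT (W xi).
Proof.
have mx : measurable_fun setT xi by case: hst => -[].
exact: measurableT_comp (@measurable_omega R) (measurable_funD (@measurable_nsq R) mx).
Qed.

Lemma bnd_supp_W : bnd_supp 2 1 (W xi).
Proof.
split; first exact: measurable_W.
- by move=> z; rewrite ger0_norm ?omega_ge0// omega_le1.
- by move=> z /nsq_gt4 h; rewrite W_supp//; lra.
Qed.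

Lemma nsq_lip2 x y : enorm x <= 2 -> enorm y <= 2 -> `|dotp x x - dotp y y| <= 4 * enorm (x - y).
Proof.
move=> x2 y2; have := nsq_cut_dist x y; rewrite !min_l//.
  by rewrite -enorm_sqr; have := enorm_ge0 y; nra.
by rewrite -enorm_sqr; have := enorm_ge0 x; nra.
Qed.

(** [xi] may jump at the boundary of the annulus, but [W xi] is already 0 or 1 there. In the mixed
    case the two points are separated by the shell 7/4 <= |z|^2 <= 15/8 or 25/8 <= |z|^2 <= 13/4, of
    width above 1/40, unless the values agree. *)
Lemma lip_W : lip_on setT 40 (W xi).
Proof.
have W01 z : 0 <= W xi z <= 1 by rewrite /W omega_ge0 omega_le1.
have mixed x y : annulus x -> ~~ annulus y -> `|W xi x - W xi y| <= 40 * enorm (x - y).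
  move=> ax; rewrite /annulus negb_and -!ltNge => hy.
  have x0 := enorm_ge0 x; have y0 := enorm_ge0 y; have x2 := annulus_enorm ax.
  have := ler_dist_enorm x y; rewrite ler_norml => /andP[d1 d2].
  have W1 := W01 x; have W2 := W01 y.
  have w1 : `|W xi x - W xi y| <= 1.
    by move: W1 W2 => /andP[? ?] /andP[? ?]; rewrite ler_norml; apply/andP; split; lra.
  case/orP: hy => hy.
    have Wy : W xi y = 1 by apply: W_core; lra.
    have [hx|hx] := leP (dotp x x) (15 / 8).
      by rewrite Wy W_core// subrr normr0 mulr_ge0 ?enorm_ge0.
    apply: le_trans w1 _; rewrite -!enorm_sqr in hx hy; nra.
  have Wy : W xi y = 0 by apply: W_supp; lra.
  have [hx|hx] := leP (25 / 8) (dotp x x).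
    by rewrite Wy W_supp// subrr normr0 mulr_ge0 ?enorm_ge0.
  apply: le_trans w1 _; rewrite -!enorm_sqr in hx hy; nra.
move=> x y _ _; have [ax|ax] := boolP (annulus x); have [ay|ay] := boolP (annulus y).
- rewrite /W; apply: le_trans (omega_dist _ _) _.
  have := nsq_lip2 (annulus_enorm ax) (annulus_enorm ay).
  case: hst => _ _ /(_ x y ax ay) h _.
  have := ler_normD (dotp x x - dotp y y) (xi x - xi y).
  rewrite (_ : dotp x x - _ + _ = dotp x x + xi x - (dotp y y + xi y)); last by ring.
  by have := enorm_ge0 (x - y); lra.
- exact: mixed.
- by rewrite distrC enormBC; exact: mixed.
- case: hst => _ x0 _ _; rewrite /W !x0// !addr0.
  have E z : omega (dotp z z) = omega (Num.min (dotp z z) 4).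
    by case: (leP (dotp z z) 4) => // h; rewrite !omega_hi//; lra.
  rewrite (E x) (E y); apply: le_trans (omega_dist _ _) _.
  by have := nsq_cut_dist x y; have := enorm_ge0 (x - y); lra.
Qed.

(** For a normalised [xi], the distance from the origin at which the level set of |y|^2 + xi through
    y meets the ray of [e1]. *)
Definition rr y : R := Num.sqrt (dotp y y + xi y).

Lemma rr_bounds y : annulus y -> [/\ 1 <= rr y, rr y <= 2, rr y ^+ 2 = dotp y y + xi y &
  `|rr y - enorm y| <= `|xi y|].
Proof.
move=> ay; have /andP[y1 y2] := ay; have [x1 x1'] := xiD' y; have D8' := D8.
have r0 : 0 <= rr y := sqrtr_ge0 _.
have E : rr y ^+ 2 = dotp y y + xi y by rewrite sqr_sqrtr//; lra.
have e1 : 1 <= enorm y by have := enorm_ge0 y; have := enorm_sqr y; nra.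
have r1 : 1 <= rr y by nra.
split => //; first nra.
have -> : xi y = (rr y - enorm y) * (rr y + enorm y).
  by rewrite -subr_sqr E enorm_sqr; ring.
by rewrite normrM ler_peMr// ger0_norm; lra.
Qed.

End one_state.

Lemma st0 D : 0 <= D -> st D (fun=> 0) 0.
Proof.
move=> D0; split=> [|//|x y _ _|]; last by rewrite enorm0.
- by split=> // z; rewrite normr0.
- by rewrite subrr normr0 enorm_ge0.
Qed.

Lemma W_zero : W (fun=> 0) = W0.
Proof. by apply/funext => z; rewrite /W addr0. Qed.

(** In the linearisation at [W0], 32 is 16 for the second-order remainder plus 16 for evaluating
    [domega] at |z|^2 instead of the perturbed argument. *)
Lemma W_diff D xi1 xi2 b1 b2 z : D <= 1 / 8 -> st D xi1 b1 -> st D xi2 b2 ->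
  `|W xi1 z - W xi2 z| <= 2 * `|xi1 z - xi2 z| /\
  `|W xi1 z - W xi2 z - domega (dotp z z) * (xi1 z - xi2 z)| <= 32 * D * `|xi1 z - xi2 z|.
Proof.
move=> D8 [[_ h1 _] _ _ _] [[_ h2 _] _ _ _]; split.
  by apply: le_trans (omega_dist _ _) _; rewrite opprD addrACA subrr add0r.
have := omega_taylor (dotp z z + xi2 z) (xi1 z - xi2 z).
rewrite (_ : dotp z z + xi2 z + _ = dotp z z + xi1 z); last by ring.
rewrite -/(W xi1 z) -/(W xi2 z) => T.
have d1 : `|domega (dotp z z + xi2 z) - domega (dotp z z)| <= 16 * D.
  by apply: le_trans (domega_dist _ _) _; rewrite addrAC subrr add0r ler_wpM2l.
set v := xi1 z - xi2 z in T *.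
have v2 : `|v| <= 2 * D.
  by apply: le_trans (ler_normB _ _) _; have := h1 z; have := h2 z; linarith.
have T2 : 8 * v ^+ 2 <= 16 * D * `|v|.
  by rewrite -real_normK ?num_real// expr2; have := normr_ge0 v; nra.
rewrite (_ : _ - _ - _ = (W xi1 z - W xi2 z - domega (dotp z z + xi2 z) * v) +
  (domega (dotp z z + xi2 z) - domega (dotp z z)) * v); last by ring.
apply: le_trans (ler_normD _ _) _; rewrite normrM.
by have := ler_wpM2r (normr_ge0 v) d1; linarith.
Qed.

End core_estimates.

(** * The iteration map and its linear part *)

Section iteration.
Context {R : realType}.
Variable s : R.
Hypothesis hs : 0 < s <= 1.
Implicit Types (x y z n b : (R * R)%type) (f h xi : R * R -> R) (t D q : R).
Notation conv := (convk (kap s)).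
Notation lam := (lam s).
Notation phi0 := (phi0 s).
Let lk := kap_locally_integrable hs.
Let B2 : (0 : R) <= 2. Proof. by []. Qed.
Let B3 : (0 : R) <= 3. Proof. by []. Qed.

Lemma measurable_ray f : measurable_fun setT f -> measurable_fun setT (fun t : R => f (t *: e1)).
Proof.
move=> mf; apply: (measurableT_comp mf).
have -> : (fun t : R => t *: (e1 : R * R)) = (fun t => (t * 1, t * 0)) by [].
by apply: (@measurable_fun_pair _ _ _ (measurableTypeR R) (measurableTypeR R) (measurableTypeR R)); apply: measurable_funM.
Qed.

Lemma measurable_sqrtr : measurable_fun setT (@Num.sqrt R).
Proof. by apply: continuous_measurable_fun => t; exact: sqrt_continuous. Qed.

Lemma measurable_inv_sign (f : R * R -> R) : measurable_fun setT f ->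
  measurable_fun setT (fun z => (Num.max 0 (f z))^-1).
Proof.
move=> mf; rewrite (_ : (fun z => _) = (@powR R ^~ (- 1)) \o (fun z => Num.max 0 (f z))).
  by apply: measurableT_comp; [exact: measurable_powR|exact: measurable_maxr].
by apply/funext => z /=; rewrite powR_inv1// le_max lexx.
Qed.

Lemma measurable_phi0 : measurable_fun setT phi0.
Proof.
have m := measurable_conv hs B2 (@bnd_supp_W0 R).
exact: (measurableT_comp (measurable_ray m) measurable_sqrtr).
Qed.

Lemma measurable_lam_nsq : measurable_fun setT (fun y : R * R => lam (dotp y y)).
Proof.
have m := measurable_ray (measurable_conv hs B2 (@bnd_supp_gw R e1)).
have me := @measurable_enorm R.
have -> : (fun y : R * R => lam (dotp y y)) = (fun y => conv (gw e1) (enorm y *: e1) * (Num.max 0 (enorm y))^-1).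
  by apply/funext => y; rewrite /lam max_r ?enorm_ge0.
apply: measurable_funM; first exact: (measurableT_comp m me).
exact: measurable_inv_sign.
Qed.

Lemma measurable_annulus : measurable_fun setT (@annulus R).
Proof.
by apply: measurable_and; apply: measurable_fun_ler => //; exact: measurable_nsq.
Qed.

Definition on_annulus f y := if annulus y then f y else 0.

Lemma measurable_on_annulus f : measurable_fun setT f -> measurable_fun setT (on_annulus f).
Proof. by move=> mf; apply: measurable_fun_ifT => //; exact: measurable_annulus. Qed.

Lemma on_annulusE f y : annulus y -> on_annulus f y = f y.
Proof. by rewrite /on_annulus => ->. Qed.

Definition lam_inv y : R := on_annulus (fun y => (lam (dotp y y))^-1) y.

Lemma lam_annulus : exists2 c : R, 0 < c & forall y, annulus y -> lam (dotp y y) <= - c.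
Proof.
have [c c0 H] := lam_neg hs; exists c => // y /andP[h1 h2]; apply: H; linarith.
Qed.

Lemma measurable_lam_inv : measurable_fun setT lam_inv.
Proof.
have [c c0 H] := lam_annulus.
have -> : lam_inv = on_annulus (fun y => - (Num.max 0 (- lam (dotp y y)))^-1).
  apply/funext => y; rewrite /lam_inv /on_annulus; case: ifPn => // /H h.
  by rewrite max_r ?invrN ?opprK//; linarith.
apply: measurable_on_annulus; apply: measurable_funN; apply: measurable_inv_sign.
by apply: measurable_funN; exact: measurable_lam_nsq.
Qed.

Lemma gw_refl_self n y : dotp n n = 1 -> gw n (refl n y) = - gw n y.
Proof. by move=> n1; rewrite /gw dotp_refl// dotp_n_refl// mulrN. Qed.

Lemma gw_out n y : ~~ annulus y -> gw n y = 0.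
Proof. by move=> h; rewrite /gw domega_annulus// mul0r. Qed.

Lemma integ_gwM n B f : measurable_fun setT f -> (forall y, annulus y -> `|f y| <= B) -> 0 <= B ->
  integ (fun y => f y * gw n y) /\ `|iint (fun y => f y * gw n y)| <= 4 * enorm n * B * iint (cutoff 2).
Proof.
move=> mf fB B0; have bg := bnd_supp_gw n.
have hb : bnd_supp 2 (4 * enorm n * B) (fun y => f y * gw n y).
  split.
  - by apply: measurable_funM => //; case: bg.
  - move=> z; have [az|az] := boolP (annulus z); last first.
      by rewrite gw_out// mulr0 normr0 !mulr_ge0 ?enorm_ge0.
    by rewrite normrM mulrC ler_pM// ?fB//; case: bg.
  - by move=> z z2; case: bg => _ _ ->//; rewrite mulr0.
by split; [exact: integ_bnd_supp hb|exact: norm_iint_bnd_supp].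
Qed.

(** The reflection of normal n preserves f and reverses [gw n], so the integral equals its
    opposite. *)
Lemma iint_radial_gw f n B : dotp n n = 1 -> measurable_fun setT f -> (forall y, f (refl n y) = f y) ->
  (forall y, annulus y -> `|f y| <= B) -> 0 <= B -> iint (fun y => f y * gw n y) = 0.
Proof.
move=> n1 mf fr fB B0; have [ig _] := integ_gwM n mf fB B0.
have := iint_preserving (area_preserving_refl n1) (integ_measurable ig).
rewrite (@eq_iint _ _ (fun y => - (f y * gw n y))); last first.
  by move=> y; rewrite fr gw_refl_self// mulrN.
by rewrite iintN//; linarith.
Qed.

Lemma unit_e1 : dotp e1 e1 = 1 :> R. Proof. by rewrite /dotp/= mulr0 mulr1 addr0. Qed.
Lemma unit_e2 : dotp e2 e2 = 1 :> R. Proof. by rewrite /dotp/= mulr0 mulr1 add0r. Qed.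

Lemma iint_dotp_gw b n : (n = e1 \/ n = e2) -> iint (fun y => dotp b y * gw n y) = - (Pi0 : R) * dotp b n.
Proof.
move=> en.
have n1 : dotp n n = 1 by case: en => ->; rewrite ?unit_e1 ?unit_e2.
pose m := perp n.
have mm : dotp m n = 0 by rewrite /m /dotp /perp/=; ring.
have decb y : dotp b y = dotp b n * dotp n y + dotp b m * dotp m y.
  by rewrite /m; case: en => ->; rewrite /dotp /perp/=; ring.
have hb u : forall y, annulus y -> `|dotp u y| <= 2 * enorm u.
  by move=> y /annulus_enorm; exact: dotp_le2.
have u0 (u : R * R) : 0 <= 2 * enorm u by rewrite mulr_ge0 ?enorm_ge0.
have [i1 _] := integ_gwM n (measurable_dotp n) (hb n) (u0 n).
have [i2 _] := integ_gwM n (measurable_dotp m) (hb m) (u0 m).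
rewrite (@eq_iint _ _ (fun y => dotp b n * (dotp n y * gw n y) + dotp b m * (dotp m y * gw n y))); last first.
  by move=> y; rewrite decb; ring.
rewrite iintD; [|exact: integZ|exact: integZ].
rewrite !iintZ// [iint (fun z => dotp m z * _)](iint_radial_gw n1 (measurable_dotp m) _ (hb m) (u0 m)).
  rewrite mulr0 addr0 -(Pi0E n1) -iintN; last exact: integ_Pi0.
  by rewrite mulrC; congr (_ * _); apply: eq_iint => y; rewrite /gw; ring.
by move=> y; rewrite dotp_refl_swap refl_perp// dotpC.
Qed.

(** All that the core problem retains of the other vortices: a correction whose slope is controlled
    by the sup norm of the vorticity, which is compatible with differences, and which is C^1 for
    Lipschitz vorticities. *)
Definition perturbation (eta : R) (Rop : (R * R -> R) -> R * R -> R) := [/\ 0 <= eta,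
  forall B h, bnd_supp 2 B h -> lip_on [set y | enorm y <= 3] (eta * B) (Rop h),
  forall B h h' y, bnd_supp 2 B h -> bnd_supp 2 B h' -> enorm y <= 3 ->
    Rop (fun z => h z - h' z) y = Rop h y - Rop h' y &
  forall L h y, bnd_supp 2 1 h -> lip_on setT L h -> C1at (Rop h) y].

Definition split_ke (d e L : R) := forall C h, bnd_supp 2 C h ->
  [/\ lip_on [set y | enorm y <= 3] (L * C) (convk (kape s e) h),
      forall y, enorm y <= 3 -> `|conv h y - convk (kape s e) h y| <= d * C &
      forall K, lip_on setT K h -> lip_on [set y | enorm y <= 3] (d * K)
        (fun y => conv h y - convk (kape s e) h y)].

Section map.
Variables (eta : R) (Rop : (R * R -> R) -> R * R -> R).
Hypothesis pert : perturbation eta Rop.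

(** The stream function without its radial part [conv W0] and without the drift. *)
Definition Th xi y := conv (fun z => W xi z - W0 z) y + Rop (W xi) y.

(** Equality of the stream function at y and at rr e1 reads phi0 (|y|^2) + Th y + b . y = phi0
    (|y|^2 + xi) + Th (rr e1) + b.1 rr. Expanding [phi0] at |y|^2 gives lam xi = G + b . (y - |y|
    e1); the term linear in b is kept apart to be determined by [Tb]. *)
Definition G xi b : R * R -> R := on_annulus (fun y => - Er s (dotp y y) (xi y) +
  (Th xi y - Th xi (rr xi y *: e1)) + b.1 * (enorm y - rr xi y)).

(** The new drift solves the orthogonality condition: integrated against [gw n], the function b . y
    gives - Pi0 (b . n), and the radial term |y| b.1 gives 0. *)
Definition Tb xi b : R * R := (iint (fun z => G xi b z * gw e1 z) / (Pi0 : R),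
                               iint (fun z => G xi b z * gw e2 z) / (Pi0 : R)).

Definition Tx xi b y := (G xi b y + dotp (Tb xi b) (y - enorm y *: e1)) * lam_inv y.

Lemma bnd_supp_WB D xi b : D <= 1 / 8 -> st D xi b ->
  bnd_supp 2 (2 * D) (fun z => W xi z - W0 z) /\ lip_on setT 80 (fun z => W xi z - W0 z).
Proof.
move=> D8 hst; have hst' := hst; case: hst' => -[mx xD x2] _ _ _.
have D0 : 0 <= D := le_trans (normr_ge0 _) (xD 0).
have [mW _ W2] := bnd_supp_W D8 hst; have [m0 _ W02] := @bnd_supp_W0 R.
split; first split.
- exact: measurable_funB.
- move=> z; have [h _] := W_diff z D8 hst (st0 D0); move: h; rewrite W_zero subr0 => h.
  by apply: le_trans h _; rewrite ler_wpM2l.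
- by move=> z z2; rewrite W2// W02// subrr.
- move=> x y _ _; have l1 := lip_W D8 hst I I (x := x) (y := y).
  have := lip_W D8 (st0 D0) I I (x := x) (y := y); rewrite W_zero => l2.
  rewrite (_ : _ - _ = (W xi x - W xi y) - (W0 x - W0 y)); last by ring.
  by apply: le_trans (ler_normB _ _) _; linarith.
Qed.

Lemma Th_lip D xi b d e L : D <= 1 / 8 -> st D xi b -> split_ke d e L ->
  lip_on [set y | enorm y <= 3] (L * (2 * D) + d * 80 + eta) (Th xi).
Proof.
move=> D8 hst sp x y x3 y3; case: pert => _ /(_ 1 _ (bnd_supp_W D8 hst) x y x3 y3) h3 _ _.
have [hb hl] := bnd_supp_WB D8 hst.
have [/(_ x y x3 y3) h1 _ /(_ _ hl x y x3 y3) h2] := sp _ _ hb.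
rewrite /Th (_ : _ - _ = (convk (kape s e) (fun z => W xi z - W0 z) x - convk (kape s e) (fun z => W xi z - W0 z) y) +
  ((conv (fun z => W xi z - W0 z) x - convk (kape s e) (fun z => W xi z - W0 z) x) -
   (conv (fun z => W xi z - W0 z) y - convk (kape s e) (fun z => W xi z - W0 z) y))
  + (Rop (W xi) x - Rop (W xi) y)); last by ring.
rewrite (mulrDl (L * (2 * D) + d * 80)) (mulrDl (L * (2 * D))); apply: le_trans (ler_normD _ _) _; apply: lerD; last by rewrite mulr1 in h3.
by apply: le_trans (ler_normD _ _) _; exact: lerD.
Qed.

Lemma measurable_Th D xi b : D <= 1 / 8 -> st D xi b -> measurable_fun setT (Th xi).
Proof.
move=> D8 hst; have [hb hl] := bnd_supp_WB D8 hst; apply: measurable_funD.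
  exact: measurable_conv hb.
apply: continuous_measurable_plane => y; apply: C1at_continuous.
by case: pert => _ _ _; apply; [exact: bnd_supp_W D8 hst|exact: lip_W D8 hst].
Qed.

Lemma measurable_rr xi : measurable_fun setT xi -> measurable_fun setT (rr xi).
Proof.
move=> mx; apply: (measurableT_comp measurable_sqrtr).
by apply: measurable_funD => //; exact: measurable_nsq.
Qed.

Lemma measurable_G D xi b : D <= 1 / 8 -> st D xi b -> measurable_fun setT (G xi b).
Proof.
move=> D8 hst; have mx : measurable_fun setT xi by case: hst => -[].
have mT := measurable_Th D8 hst; have mr := measurable_rr mx; have mn := @measurable_nsq R.
have mp := measurable_phi0.
apply: measurable_on_annulus; apply: measurable_funD; first apply: measurable_funD.
- apply: measurable_funN; apply: measurable_funB; first apply: measurable_funB.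
  + exact: (measurableT_comp mp (measurable_funD mn mx)).
  + exact: (measurableT_comp mp mn).
  + by apply: measurable_funM => //; exact: measurable_lam_nsq.
- by apply: measurable_funB => //; exact: (measurableT_comp (measurable_ray mT) mr).
- by apply: measurable_funM => //; apply: measurable_funB => //; exact: measurable_enorm.
Qed.

Lemma measurable_lin b : measurable_fun setT (fun y : R * R => dotp b (y - enorm y *: e1)).
Proof.
have -> : (fun y : R * R => dotp b (y - enorm y *: e1)) = (fun y => dotp b y - enorm y * b.1).
  by apply/funext => y; rewrite dotpDr dotpNr dotpZr {2}/dotp/= mulr1 mulr0 addr0.
apply: measurable_funB; first exact: measurable_dotp.
by apply: measurable_funM => //; exact: measurable_enorm.
Qed.

Lemma measurable_Tx D xi b : D <= 1 / 8 -> st D xi b -> measurable_fun setT (Tx xi b).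
Proof.
move=> D8 hst; apply: measurable_funM; last exact: measurable_lam_inv.
by apply: measurable_funD; [exact: measurable_G D8 hst|exact: measurable_lin].
Qed.

Lemma Tx_out xi b y : ~~ annulus y -> Tx xi b y = 0.
Proof. by move=> h; rewrite /Tx /lam_inv /on_annulus (negbTE h) mulr0. Qed.

Lemma TxE xi b y : annulus y ->
  lam (dotp y y) * Tx xi b y = G xi b y + dotp (Tb xi b) (y - enorm y *: e1).
Proof.
move=> ay; rewrite /Tx /lam_inv on_annulusE// mulrCA divff ?mulr1//.
by have [c c0 /(_ y ay) h] := lam_annulus; rewrite lt_eqF//; linarith.
Qed.

Lemma annulus_Ze1 y : annulus (enorm y *: (e1 : R * R)) = annulus y.
Proof. by rewrite /annulus dotpZl dotpZr unit_e1 mulr1 -expr2 enorm_sqr. Qed.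

Lemma lin_Ze1 b y : dotp b (y - enorm y *: e1) = dotp b y - enorm y * b.1.
Proof. by rewrite dotpDr dotpNr dotpZr {2}/dotp/= mulr1 mulr0 addr0. Qed.

Lemma lin_bound b y : annulus y -> `|dotp b (y - enorm y *: e1)| <= 4 * enorm b.
Proof.
move=> /annulus_enorm y2; apply: le_trans (normr_dotp _ _) _; rewrite mulrC ler_wpM2r ?enorm_ge0//.
by apply: le_trans (ler_enormB _ _) _; rewrite enorm_Ze1 ?enorm_ge0//; linarith.
Qed.

(** On the ray of [e1] all terms of the map cancel. For the orthogonality, [domega] times conv (gw
    n) is lam times [gw n]; this lam cancels the one in the denominator of [Tx], and the choice of
    [Tb] concludes. *)
Lemma nrm_Tx D xi b B : D <= 1 / 8 -> st D xi b -> nrm s xi -> 0 <= B ->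
  (forall y, annulus y -> `|G xi b y| <= B) -> nrm s (Tx xi b).
Proof.
move=> D8 hst [n1 _] B0 GB; split.
  move=> y ay; have ay' : annulus (enorm y *: (e1 : R * R)) by rewrite annulus_Ze1.
  have x0 := n1 _ ay.
  rewrite /Tx lin_Ze1 enorm_Ze1 ?enorm_ge0// /G on_annulusE// x0 Er0.
  have -> : rr xi (enorm y *: e1) = enorm y.
    by rewrite /rr x0 addr0 dotpZl dotpZr unit_e1 mulr1 -expr2 sqrtr_sqr ger0_norm ?enorm_ge0.
  rewrite enorm_Ze1 ?enorm_ge0// !subrr mulr0 oppr0 !addr0 add0r dotpZr.
  by rewrite [dotp _ e1]/dotp/= mulr1 mulr0 addr0 subrr mul0r.
suff H n : n = e1 \/ n = e2 -> iint (fun z => domega (dotp z z) * Tx xi b z * conv (gw n) z) = 0.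
  have bT : bnd_supp 2 1 W0 := @bnd_supp_W0 R.
  have [c c0 lc] := lam_annulus.
  have TB z : `|Tx xi b z| <= (B + 4 * enorm (Tb xi b)) / c.
    rewrite /Tx /lam_inv /on_annulus; case: ifPn => [az|_]; last first.
      by rewrite mulr0 normr0 divr_ge0 ?(ltW c0)// addr_ge0// mulr_ge0 ?enorm_ge0.
    rewrite normrM; apply: ler_pM => //.
      by apply: le_trans (ler_normD _ _) _; apply: lerD; [exact: GB|exact: lin_bound].
    have lz := lc z az; have ln : lam (dotp z z) < 0 by linarith.
    by rewrite normfV ltr0_norm// lef_pV2 ?posrE; linarith.
  have ig m : integ (fun z => domega (dotp z z) * Tx xi b z * conv (gw m) z).
    have hb : bnd_supp 2 _ (fun z => domega (dotp z z) * Tx xi b z) :=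
      bnd_supp_domegaM (le_trans (normr_ge0 _) (TB 0)) (measurable_Tx D8 hst) (fun z _ => TB z).
    set C := _ * _ in hb; have C0 := bnd_supp_ge0 hb.
    pose M := 4 * enorm m * kernel_mass (kap s) (2 + 2).
    apply: (@le_integ _ _ (fun z => C * M * cutoff 2 z)).
    - apply: measurable_funM; first by case: hb.
      exact: measurable_conv (bnd_supp_gw m).
    - move=> z; rewrite normrM cutoffE; case: (leP (enorm z) 2) => z2; last first.
        by case: hb => _ _ ->//; rewrite normr0 mul0r mulr0.
      rewrite mulr1 ler_pM//; first by case: hb.
      exact: norm_convk_leY (bnd_supp_gw m) z2.
    - by apply: integZ; exact: integrable_cutoff.
  move=> n; have -> : n = n.1 *: e1 + n.2 *: e2.
    by apply: pair_ext; rewrite /= /GRing.scale/= ?mulr0 ?mulr1 ?addr0 ?add0r.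
  rewrite (@eq_iint _ _ (fun z => n.1 * (domega (dotp z z) * Tx xi b z * conv (gw e1) z) +
     n.2 * (domega (dotp z z) * Tx xi b z * conv (gw e2) z))); last first.
    by move=> z; rewrite conv_gw_lin//; ring.
  rewrite iintD; [|exact: integZ|exact: integZ].
  by rewrite !iintZ// !H ?mulr0 ?addr0; auto.
move=> en; have nn : dotp n n = 1 by case: en => ->; rewrite ?unit_e1 ?unit_e2.
have mG := measurable_G D8 hst.
rewrite (@eq_iint _ _ (fun z => G xi b z * gw n z + (dotp (Tb xi b) z * gw n z - enorm z * (Tb xi b).1 * gw n z))); last first.
  move=> z; have [az|az] := boolP (annulus z); last first.
    by rewrite gw_out// domega_annulus// !mul0r !mulr0 subrr addr0.
  rewrite conv_gwE ?annulus_neq0// (_ : _ * _ * _ = gw n z * (lam (dotp z z) * Tx xi b z)); last first.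
    by rewrite /gw; ring.
  by rewrite TxE// lin_Ze1; ring.
have [iG _] := integ_gwM n mG GB B0.
have hT y : annulus y -> `|dotp (Tb xi b) y| <= 2 * enorm (Tb xi b).
  by move=> /annulus_enorm; exact: dotp_le2.
have T0 : 0 <= 2 * enorm (Tb xi b) by rewrite mulr_ge0 ?enorm_ge0.
have [iT _] := integ_gwM n (measurable_dotp (Tb xi b)) hT T0.
have mr : measurable_fun setT (fun z : R * R => enorm z * (Tb xi b).1).
  by apply: measurable_funM => //; exact: measurable_enorm.
have hr y : annulus y -> `|enorm y * (Tb xi b).1| <= 2 * enorm (Tb xi b).
  move=> /annulus_enorm y2; rewrite normrM ger0_norm ?enorm_ge0//.
  by rewrite ler_pM ?enorm_ge0// normr_fst_le.
have [ir _] := integ_gwM n mr hr T0.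
rewrite iintD//; last exact: integB.
rewrite iintB// (iint_radial_gw nn mr _ hr T0); last by move=> y; rewrite enorm_refl.
rewrite iint_dotp_gw// subr0.
have P0 := @Pi0_gt0 R.
have -> : dotp (Tb xi b) n = iint (fun z => G xi b z * gw n z) / (Pi0 : R).
  by case: en => ->; rewrite /dotp/= ?mulr0 ?mulr1 ?addr0 ?add0r.
by rewrite mulNr mulrC divfK ?subrr// gt_eqF.
Qed.


Lemma rr_dist D xi1 xi2 b1 b2 y : D <= 1 / 8 -> st D xi1 b1 -> st D xi2 b2 -> annulus y ->
  `|rr xi1 y - rr xi2 y| <= `|xi1 y - xi2 y|.
Proof.
move=> D8 h1 h2 ay; have [r1 _ E1 _] := rr_bounds D8 h1 ay; have [r2 _ E2 _] := rr_bounds D8 h2 ay.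
have -> : xi1 y - xi2 y = (rr xi1 y - rr xi2 y) * (rr xi1 y + rr xi2 y).
  by rewrite -subr_sqr E1 E2; ring.
by rewrite normrM ler_peMr// ger0_norm; linarith.
Qed.

Lemma bnd_W12 D xi1 xi2 b1 b2 q : D <= 1 / 8 -> st D xi1 b1 -> st D xi2 b2 ->
  (forall z, `|xi1 z - xi2 z| <= q) -> bnd_supp 2 (2 * q) (fun z => W xi1 z - W xi2 z) /\
  bnd_supp 2 (32 * D * q) (fun z => W xi1 z - W xi2 z - domega (dotp z z) * (xi1 z - xi2 z)).
Proof.
move=> D8 h1 h2 hq.
have [m1 b1' s1] := bnd_supp_W D8 h1; have [m2 b2' s2] := bnd_supp_W D8 h2.
have [[mx1 hx1 _] _ _ _] := h1; have [[mx2 _ _] _ _ _] := h2.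
have D0 : 0 <= D := le_trans (normr_ge0 _) (hx1 0).
split; split.
- exact: measurable_funB.
- by move=> z; have [h _] := W_diff z D8 h1 h2; apply: le_trans h _; rewrite ler_wpM2l.
- by move=> z z2; rewrite s1// s2// subrr.
- apply: measurable_funB; first exact: measurable_funB.
  by apply: measurable_funM; [exact: measurable_domega_nsq|exact: measurable_funB].
- by move=> z; have [_ h] := W_diff z D8 h1 h2; apply: le_trans h _; rewrite ler_wpM2l// mulr_ge0.
- by move=> z z2; rewrite s1// s2// domega_supp// mul0r !subrr.
Qed.

(** Small together with D, eta and d. The product of L and D forces D to be chosen after L, which
    itself depends on d. *)
Definition kappa D KE d L := KE * D + 64 * D * kernel_mass (kap s) (2 + 3) + 9 * eta +
  4 * L * D + 84 * d + 2 * D.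

(** Up to the small factor [kappa], only the linearised convolution acts, at y minus at |y| e1;
    everything else is of second order or comes from the perturbation. *)
Lemma G_diff D xi1 xi2 b1 b2 d e L KE q r : D <= 1 / 8 -> st D xi1 b1 -> st D xi2 b2 ->
  split_ke d e L -> 0 <= d -> 0 <= L ->
  (forall D t t' (v v' : R), D <= 1 / 8 ->
    7 / 4 <= t <= 13 / 4 -> 7 / 4 <= t' <= 13 / 4 -> `|v| <= D -> `|v'| <= D ->
    `|Er s t v - Er s t' v'| <= KE * D * (`|v - v'| + `|t - t'|)) -> 0 <= KE ->
  (forall z, `|xi1 z - xi2 z| <= q) -> enorm (b1 - b2) <= r ->
  forall y, annulus y -> `|G xi1 b1 y - G xi2 b2 y -
    (conv (fun z => domega (dotp z z) * (xi1 z - xi2 z)) y -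
     conv (fun z => domega (dotp z z) * (xi1 z - xi2 z)) (enorm y *: e1))|
    <= kappa D KE d L * (q + r).
Proof.
move=> D8 h1 h2 sp d0 L0 HE KE0 hq hr y ay.
have [eta0 R1 R2 _] := pert.
have q0 : 0 <= q := le_trans (normr_ge0 _) (hq 0).
have r0 : 0 <= r := le_trans (enorm_ge0 _) hr.
have [[mx1 hx1 _] _ _ hb1] := h1; have [[mx2 hx2 _] _ _ hb2] := h2.
have D0 : 0 <= D := le_trans (normr_ge0 _) (hx1 0).
have [w1 w2] := bnd_W12 D8 h1 h2 hq.
have [r11 r12 r13 r14] := rr_bounds D8 h1 ay; have [r21 r22 r23 r24] := rr_bounds D8 h2 ay.
have rd := rr_dist D8 h1 h2 ay.
have ey2 := annulus_enorm ay; have ey0 := enorm_ge0 y.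
have e3 t : 0 <= t -> t <= 2 -> enorm (t *: (e1 : R * R)) <= 3 by move=> t0 t2; rewrite enorm_Ze1//; linarith.
have y3 : enorm y <= 3 by linarith.
have p3 := e3 _ ey0 ey2.
have q3 : enorm (rr xi1 y *: (e1 : R * R)) <= 3 by apply: e3; linarith.
have q3' : enorm (rr xi2 y *: (e1 : R * R)) <= 3 by apply: e3; linarith.
set Dl := fun z => domega (dotp z z) * (xi1 z - xi2 z).
set V := fun z => W xi1 z - W xi2 z.
have bDl : bnd_supp 2 (2 * q) Dl.
  apply: bnd_supp_domegaM => //; exact: measurable_funB.
have bW1 := (bnd_supp_WB D8 h1).1; have bW2 := (bnd_supp_WB D8 h2).1.
have ThB x : enorm x <= 3 -> Th xi1 x - Th xi2 x = conv V x + Rop V x.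
  move=> x3; rewrite /Th (R2 1 _ _ _ (bnd_supp_W D8 h1) (bnd_supp_W D8 h2) x3).
  rewrite (_ : conv V x = conv (fun z => W xi1 z - W0 z) x - conv (fun z => W xi2 z - W0 z) x); first by ring.
  rewrite -(convkB lk x bW1 bW2); congr (convk _ _ x); apply/funext => z; rewrite /V; ring.
have rem x : enorm x <= 3 -> `|conv V x - conv Dl x| <= 32 * D * q * kernel_mass (kap s) (2 + 3).
  by move=> x3; rewrite -(convkB lk x w1 bDl); exact: norm_convk_leY w2 x3.
have T1 : `|Er s (dotp y y) (xi1 y) - Er s (dotp y y) (xi2 y)| <= KE * D * q.
  apply: le_trans (HE D _ _ _ _ D8 ay ay (hx1 y) (hx2 y)) _.
  by rewrite subrr normr0 addr0 ler_wpM2l// mulr_ge0.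
have T2 := rem y y3; have T3 := rem _ p3.
have yr : enorm (y - rr xi1 y *: e1) <= 4.
  by apply: le_trans (ler_enormB _ _) _; rewrite enorm_Ze1; linarith.
have T4 : `|Rop V y - Rop V (rr xi1 y *: e1)| <= eta * (2 * q) * 4.
  by apply: le_trans (R1 _ _ w1 _ _ y3 q3) _; rewrite ler_wpM2l// !mulr_ge0.
have er : enorm (enorm y *: e1 - rr xi1 y *: e1) <= D.
  rewrite -scalerBl enormZ enorm_e1 mulr1 distrC; apply: le_trans r14 (hx1 y).
(* The two points are within D, but a sup bound on V does not make conv V Lipschitz: the regular
   part moves by L (2 q) D and the small part costs d (2 q) at each point. *)
have T5 : `|conv V (enorm y *: e1) - conv V (rr xi1 y *: e1)| <= L * (2 * q) * D + 2 * (d * (2 * q)).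
  have [S1 S2 _] := sp _ _ w1.
  have := S1 _ _ p3 q3; have := S2 _ p3; have := S2 _ q3.
  have Lq : 0 <= L * (2 * q) by rewrite !mulr_ge0.
  have := ler_wpM2l Lq er.
  set A := conv V _; set A' := conv V _; set A1 := convk _ V _; set A2 := convk _ V _ => u1 u2 u3 u4.
  rewrite (_ : A - A' = (A - A2) - (A' - A1) + (A2 - A1)); last by ring.
  apply: le_trans (ler_normD _ _) _; have := ler_normB (A - A2) (A' - A1); linarith.
have T6 : `|Th xi2 (rr xi2 y *: e1) - Th xi2 (rr xi1 y *: e1)| <= (L * (2 * D) + d * 80 + eta) * q.
  apply: le_trans (Th_lip D8 h2 sp q3' q3) _; rewrite ler_wpM2l ?addr_ge0 ?mulr_ge0//.
  by rewrite -scalerBl enormZ enorm_e1 mulr1 distrC; exact: le_trans rd (hq y).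
have T7 : `|(b1.1 - b2.1) * (enorm y - rr xi1 y)| <= r * D.
  rewrite normrM; apply: ler_pM => //; first exact: le_trans (normr_fst_le (b1 - b2)) hr.
  by rewrite distrC; exact: le_trans r14 (hx1 y).
have T8 : `|b2.1 * (rr xi2 y - rr xi1 y)| <= D * q.
  rewrite normrM; apply: ler_pM => //; first exact: le_trans (normr_fst_le b2) hb2.
  by rewrite distrC; exact: le_trans rd (hq y).
rewrite /G !on_annulusE//.
have E := ThB y y3; have E' := ThB _ q3.
set A1 := conv Dl y in T2 *; set A2 := conv Dl (enorm y *: e1) in T3 *.
(* Telescoping: the values of [Th] for [xi1] are those for [xi2] plus the convolution and the
   perturbation of V, and each change of evaluation point is isolated. *)
rewrite (_ : _ - _ = - (Er s (dotp y y) (xi1 y) - Er s (dotp y y) (xi2 y))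
  + (conv V y - A1) - (conv V (enorm y *: e1) - A2)
  + (Rop V y - Rop V (rr xi1 y *: e1)) + (conv V (enorm y *: e1) - conv V (rr xi1 y *: e1))
  + (Th xi2 (rr xi2 y *: e1) - Th xi2 (rr xi1 y *: e1))
  + (b1.1 - b2.1) * (enorm y - rr xi1 y) + b2.1 * (rr xi2 y - rr xi1 y)); last first.
  have -> : Th xi1 y = Th xi2 y + (conv V y + Rop V y) by rewrite -E addrC subrK.
  have -> : Th xi1 (rr xi1 y *: e1) = Th xi2 (rr xi1 y *: e1) + (conv V (rr xi1 y *: e1) + Rop V (rr xi1 y *: e1)).
    by rewrite -E' addrC subrK.
  ring.
have M0 := kernel_mass_ge0 (kap s) (2 + 3).
apply: (@le_trans _ _ (KE * D * q + 2 * (32 * D * q * kernel_mass (kap s) (2 + 3)) + eta * (2 * q) * 4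
  + (L * (2 * q) * D + 2 * (d * (2 * q))) + (L * (2 * D) + d * 80 + eta) * q + r * D + D * q)).
  have tri (a b ca cb : R) : `|a| <= ca -> `|b| <= cb -> `|a + b| <= ca + cb.
    by move=> ha hb; apply: le_trans (ler_normD _ _) _; exact: lerD.
  apply: (tri) T8; apply: (tri) T7; apply: (tri) T6; apply: (tri) T5; apply: (tri) T4.
  have T1' := T1; rewrite -normrN in T1'; have T3' := T3; rewrite -normrN in T3'.
  by apply: le_trans (tri _ _ _ _ (tri _ _ _ _ T1' T2) T3') _; linarith.
rewrite /kappa; set M := kernel_mass _ _ in M0 *.
have p1 : 0 <= KE * D * r by rewrite !mulr_ge0.
have p2 : 0 <= D * M * r by rewrite !mulr_ge0.
have p4 : 0 <= eta * r by rewrite !mulr_ge0.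
have p5 : 0 <= L * D * r by rewrite !mulr_ge0.
have p6 : 0 <= d * r by rewrite !mulr_ge0.
have p7 : 0 <= D * r by rewrite !mulr_ge0.
have p8 : 0 <= D * q by rewrite !mulr_ge0.
linarith.
Qed.

(** The linear part does not move the drift: its value at y, integrated against [gw n], vanishes by
    [conv_sym] and the normalisation of both states, and its value at |y| e1 is radial. Only the
    error k is left. *)
Lemma Tb_diff D xi1 xi2 b1 b2 (k : R) B : D <= 1 / 8 -> st D xi1 b1 -> st D xi2 b2 ->
  nrm s xi1 -> nrm s xi2 -> 0 <= B ->
  (forall y, annulus y -> `|G xi1 b1 y| <= B) -> (forall y, annulus y -> `|G xi2 b2 y| <= B) -> 0 <= k ->
  (forall y, annulus y -> `|G xi1 b1 y - G xi2 b2 y -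
    (conv (fun z => domega (dotp z z) * (xi1 z - xi2 z)) y -
     conv (fun z => domega (dotp z z) * (xi1 z - xi2 z)) (enorm y *: e1))| <= k) ->
  enorm (Tb xi1 b1 - Tb xi2 b2) <= 8 * iint (@cutoff R 2) / Pi0 * k.
Proof.
move=> D8 h1 h2 [_ n1] [_ n2] B0 G1 G2 k0 Hk.
have m1 := measurable_G D8 h1; have m2 := measurable_G D8 h2.
have [[mx1 hx1 _] _ _ _] := h1; have [[mx2 hx2 _] _ _ _] := h2.
have D0 : 0 <= D := le_trans (normr_ge0 _) (hx1 0).
have hq z : `|xi1 z - xi2 z| <= 2 * D.
  by apply: le_trans (ler_normB _ _) _; have := hx1 z; have := hx2 z; linarith.
set Dl := fun z => domega (dotp z z) * (xi1 z - xi2 z) in Hk.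
have bDl : bnd_supp 2 (2 * (2 * D)) Dl.
  by apply: bnd_supp_domegaM => //; [rewrite mulr_ge0|exact: measurable_funB].
have P0 := @Pi0_gt0 R.
have mc := measurable_conv hs B2 bDl.
have mray : measurable_fun setT (fun y : R * R => conv Dl (enorm y *: e1)).
  exact: (measurableT_comp (measurable_ray mc) (@measurable_enorm R)).
pose Cc := 2 * (2 * D) * kernel_mass (kap s) (2 + 3).
have Cc0 : 0 <= Cc by rewrite !mulr_ge0 ?kernel_mass_ge0.
have cb x : enorm x <= 3 -> `|conv Dl x| <= Cc by move=> x3; exact: norm_convk_leY bDl x3.
have cA y : annulus y -> `|conv Dl y| <= Cc by move=> /annulus_enorm y2; apply: cb; linarith.
have cA' y : annulus y -> `|conv Dl (enorm y *: e1)| <= Cc.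
  by move=> /annulus_enorm y2; apply: cb; rewrite enorm_Ze1 ?enorm_ge0//; linarith.
have comp n : n = e1 \/ n = e2 ->
   `|iint (fun z => G xi1 b1 z * gw n z) / Pi0 - iint (fun z => G xi2 b2 z * gw n z) / Pi0| <=
   4 * iint (@cutoff R 2) / Pi0 * k.
  move=> en; have nn : dotp n n = 1 by case: en => ->; rewrite ?unit_e1 ?unit_e2.
  have [i1 _] := integ_gwM n m1 G1 B0; have [i2 _] := integ_gwM n m2 G2 B0.
  have [i3 _] := integ_gwM n mc cA Cc0; have [i4 _] := integ_gwM n mray cA' Cc0.
  have [_ i5] := integ_gwM n (measurable_funB (measurable_funB m1 m2) (measurable_funB mc mray)) Hk k0.
  have z3 : iint (fun z => conv Dl z * gw n z) = 0.
    have bg := bnd_supp_gw n.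
    pose C := Num.max (2 * (2 * D)) (4 * enorm n).
    have bD' : bnd_supp 2 C Dl by apply: bnd_supp_le bDl; rewrite // le_max lexx.
    have bg' : bnd_supp 2 C (gw n) by apply: bnd_supp_le bg; rewrite // le_max lexx orbT.
    rewrite (conv_sym hs B2 bD' bg').
    have := n1 n; have := n2 n.
    have ii xi b : st D xi b -> integ (fun z => domega (dotp z z) * xi z * conv (gw n) z).
      move=> [[mx hx _] _ _ _].
      have hb : bnd_supp 2 (2 * D) (fun z => domega (dotp z z) * xi z) by apply: bnd_supp_domegaM.
      pose M := 4 * enorm n * kernel_mass (kap s) (2 + 2).
      apply: (@le_integ _ _ (fun z => 2 * D * M * cutoff 2 z)).
      - apply: measurable_funM; first by case: hb.
        exact: measurable_conv (bnd_supp_gw n).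
      - move=> z; rewrite normrM cutoffE; case: (leP (enorm z) 2) => z2; last first.
          by case: hb => _ _ ->//; rewrite normr0 mul0r mulr0.
        rewrite mulr1 ler_pM//; first by case: hb.
        exact: norm_convk_leY (bnd_supp_gw n) z2.
      - by apply: integZ; exact: integrable_cutoff.
    have j1 := ii _ _ h1; have j2 := ii _ _ h2 => u1 u2.
    transitivity (iint (fun z => domega (dotp z z) * xi1 z * conv (gw n) z - domega (dotp z z) * xi2 z * conv (gw n) z)).
      by apply: eq_iint => z; rewrite /Dl; ring.
    by rewrite iintB// u1 u2 subrr.
  have z4 : iint (fun z => conv Dl (enorm z *: e1) * gw n z) = 0.
    by apply: (iint_radial_gw nn mray _ cA' Cc0) => y; rewrite enorm_refl.
  rewrite -mulrBl -iintB//.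
  have -> : iint (fun z => G xi1 b1 z * gw n z - G xi2 b2 z * gw n z) =
      iint (fun z => (G xi1 b1 z - G xi2 b2 z - (conv Dl z - conv Dl (enorm z *: e1))) * gw n z).
    rewrite [RHS](@eq_iint _ _ (fun z => G xi1 b1 z * gw n z - G xi2 b2 z * gw n z -
      (conv Dl z * gw n z - conv Dl (enorm z *: e1) * gw n z))); last by move=> z; ring.
    rewrite [RHS]iintB; [|exact: integB|exact: integB].
    by rewrite (iintB i3 i4) z3 z4 subrr subr0.
  rewrite normrM [ `|_^-1|]gtr0_norm ?invr_gt0// (_ : _ * k = 4 * k * iint (cutoff 2) / Pi0); last by field; rewrite gt_eqF.
  rewrite ler_wpM2r ?invr_ge0 ?(ltW P0)//; apply: le_trans i5 _.
  by rewrite enorm_unit// mulr1.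
apply: le_trans (enorm_le_coord _) _.
have := comp e1 (or_introl erefl); have := comp e2 (or_intror erefl).
have -> : 8 * iint (@cutoff R 2) / Pi0 * k = 4 * iint (@cutoff R 2) / Pi0 * k + 4 * iint (@cutoff R 2) / Pi0 * k by ring.
by move=> u1 u2; apply: lerD.
Qed.

End map.
End iteration.

(** * Contraction *)

Section contraction.
Context {R : realType}.
Variable s : R.
Hypothesis hs : 0 < s <= 1.
Implicit Types (x y z n b : (R * R)%type) (f h xi : R * R -> R) (t D q a c r : R).
Notation conv := (convk (kap s)).
Notation lam := (lam s).
Let lk := kap_locally_integrable hs.
Let B2 : (0 : R) <= 2. Proof. by []. Qed.

Lemma integ_nrm D xi n : bnd_supp 2 D xi ->
  integ (fun z => domega (dotp z z) * xi z * conv (gw n) z) /\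
  `|iint (fun z => domega (dotp z z) * xi z * conv (gw n) z)| <=
     2 * D * (4 * enorm n * kernel_mass (kap s) (2 + 2)) * iint (cutoff 2).
Proof.
move=> [mx hx x2]; have D0 : 0 <= D := le_trans (normr_ge0 _) (hx 0).
have hb : bnd_supp 2 (2 * D) (fun z => domega (dotp z z) * xi z) by apply: bnd_supp_domegaM.
set M := 4 * enorm n * _.
have hb' : bnd_supp 2 (2 * D * M) (fun z => domega (dotp z z) * xi z * conv (gw n) z).
  split.
  - apply: measurable_funM; first by case: hb.
    exact: measurable_conv (bnd_supp_gw n).
  - move=> z; have [z2|z2] := leP (enorm z) 2; last first.
      by rewrite x2// mulr0 mul0r normr0 !mulr_ge0 ?enorm_ge0 ?kernel_mass_ge0.
    rewrite normrM ler_pM//; first by case: hb.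
    exact: norm_convk_leY (bnd_supp_gw n) z2.
  - by move=> z z2; rewrite x2// mulr0 mul0r.
by split; [exact: integ_bnd_supp hb'|exact: norm_iint_bnd_supp].
Qed.

Lemma nrmB D D' xi1 xi2 : bnd_supp 2 D xi1 -> bnd_supp 2 D' xi2 -> nrm s xi1 -> nrm s xi2 ->
  nrm s (fun y => xi1 y - xi2 y).
Proof.
move=> h1 h2 [p1 i1] [p2 i2]; split=> [y ay|n]; first by rewrite p1// p2// subrr.
rewrite (@eq_iint _ _ (fun z => domega (dotp z z) * xi1 z * conv (gw n) z -
   domega (dotp z z) * xi2 z * conv (gw n) z)); last by move=> z; ring.
rewrite iintB; [|exact: (integ_nrm n h1).1|exact: (integ_nrm n h2).1].
by rewrite i1 i2 subrr.
Qed.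

(* The normalisation controls the constants c in the mirror seminorm, hence the sup norm. *)
Lemma mirror_sup : exists2 Cq : R, 1 <= Cq & forall C a c f1 f2 xi, bnd_supp 2 C xi ->
  (forall y, annulus y -> xi y = f1 y + f2 y) -> mirror a f1 ->
  (forall y, annulus y -> `|f2 y| <= c) -> 0 <= a -> 0 <= c -> nrm s xi ->
  forall y, annulus y -> `|xi y| <= Cq * (a + c).
Proof.
have [c0 c00 lc] := lam_annulus hs; have P0 := @Pi0_gt0 R.
pose Mg := 4 * kernel_mass (kap s) (2 + 2); pose M0 := iint (@cutoff R 2).
have Mg0 : 0 <= Mg by rewrite mulr_ge0 ?kernel_mass_ge0.
have M00 : 0 <= M0 by apply: iint_ge0 => z; exact: cutoff_ge0.
have cP : 0 < c0 * Pi0 by rewrite mulr_gt0.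
pose C2 := 4 * Mg * M0 / (c0 * Pi0).
have C20 : 0 <= C2 := divr_ge0 (mulr_ge0 (mulr_ge0 (ler0n _ 4) Mg0) M00) (ltW cP).
exists (2 + 2 * C2); first by linarith.
move=> C a c f1 f2 xi bx dec m1 f2c a0 ge0c [p1 i1] y ay.
have ac0 : 0 <= a + c by exact: addr_ge0.
(* The mirror carries y to the ray where [xi] vanishes, so that xi y is its own antisymmetric
   part. *)
have [m mm my] : exists2 m, dotp m m = 1 & refl m y = enorm y *: e1.
  by apply: refl_transitive; rewrite enorm_Ze1 ?enorm_ge0.
wlog my0 : m mm my / 0 <= dotp m y.
  move=> H; have [h|h] := leP 0 (dotp m y); first exact: (H m).
  apply: (H (- m)); rewrite ?dotpNl ?dotpNr ?opprK//; last by rewrite oppr_ge0 ltW.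
  by rewrite -my /refl dotpNl mulrN scalerN scaleNr opprK.
have [cn Hcn] := m1 m mm.
have mn := enorm_unit mm.
pose g z := xi z - xi (refl m z) - cn * dotp m z.
have A1 z : annulus z -> 0 <= dotp m z -> `|g z| <= 2 * (a + c).
  move=> az mz; have az' : annulus (refl m z) by rewrite annulus_refl.
  rewrite /g !dec// (_ : _ - _ - _ = (f1 z - f1 (refl m z) - cn * dotp m z) + (f2 z - f2 (refl m z))); last by ring.
  apply: le_trans (ler_normD _ _) _; have := Hcn z az mz; have := f2c z az; have := f2c _ az'.
  have := ler_normB (f2 z) (f2 (refl m z)).
  have m2 : dotp m z <= 2.
    by apply: le_trans (ler_norm _) _; apply: le_trans (dotp_le2 m (annulus_enorm az)) _; rewrite mn mulr1.
  have := ler_wpM2l a0 m2; linarith.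
have A2 z : annulus z -> `|g z| <= 2 * (a + c).
  move=> az; have [mz|mz] := leP 0 (dotp m z); first exact: A1.
  have -> : g z = - g (refl m z) by rewrite /g reflK// dotp_n_refl//; ring.
  by rewrite normrN; apply: A1; rewrite ?annulus_refl// dotp_n_refl// oppr_ge0 ltW.
have mx : measurable_fun setT xi by case: bx.
have br : bnd_supp 2 C (fun z => xi (refl m z)).
  have [_ hx x2] := bx; split=> [|z|z z2]; rewrite ?hx ?x2 ?enorm_refl//.
  exact: (measurableT_comp mx (area_preserving_refl mm).1).
have [j1 _] := integ_nrm m bx; have [j2 _] := integ_nrm m br.
have i2 : iint (fun z => domega (dotp z z) * xi (refl m z) * conv (gw m) z) = 0.
  have := iint_preserving (area_preserving_refl mm) (integ_measurable j1).
  rewrite i1 (@eq_iint _ _ (fun z => - (domega (dotp z z) * xi (refl m z) * conv (gw m) z))).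
    by rewrite iintN// => /eqP; rewrite oppr_eq0 => /eqP.
  move=> z; rewrite dotp_refl// conv_gw_refl// refl_self//.
  have := conv_gw_lin hs (-1) 0 m 0 z; rewrite scaler0 addr0 scaleN1r mul0r addr0 => ->; ring.
pose w z := domega (dotp z z) * conv (gw m) z.
have cgb z : enorm z <= 2 -> `|conv (gw m) z| <= Mg.
  by move=> z2; have := norm_convk_leY lk (bnd_supp_gw m) z2; rewrite mn mulr1.
have mcg := measurable_conv hs B2 (bnd_supp_gw m).
have bw : bnd_supp 2 (2 * Mg) w by apply: bnd_supp_domegaM.
have bl : bnd_supp 2 (2 * (2 * Mg)) (fun z => w z * dotp m z).
  have [mw hw w2] := bw; split.
  - by apply: measurable_funM => //; exact: measurable_dotp.
  - move=> z; have [z2|z2] := leP (enorm z) 2; last by rewrite w2// mul0r normr0; linarith.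
    by rewrite normrM mulrC ler_pM//; have := dotp_le2 m z2; rewrite mn mulr1.
  - by move=> z z2; rewrite w2// mul0r.
have jl := integ_bnd_supp bl.
(* The test function w annihilates [xi] and its reflection but sees m . z with a positive weight;
   integrating g against it therefore controls the multiple [cn]. *)
have Il : c0 * Pi0 <= iint (fun z => w z * dotp m z).
  rewrite -(Pi0E mm) -iintZ; last exact: integ_Pi0.
  apply: le_iint => //; first by apply: integZ; exact: integ_Pi0.
  move=> z; rewrite /w; have [az|az] := boolP (annulus z); last first.
    by rewrite domega_annulus// oppr0 !mul0r mulr0.
  rewrite conv_gwE ?annulus_neq0//; have := lc z az; have := domega_le0 (dotp z z) => u1 u2.
  have := sqr_ge0 (dotp m z) => u3.
  have := mulr_le0_ge0 u1 u3 => u4; have := ler_wnM2r u4 u2; rewrite expr2 in u4 *; linarith.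
have jg : iint (fun z => w z * g z) = - cn * iint (fun z => w z * dotp m z).
  rewrite (@eq_iint _ _ (fun z => (domega (dotp z z) * xi z * conv (gw m) z -
    domega (dotp z z) * xi (refl m z) * conv (gw m) z) - cn * (w z * dotp m z))); last first.
    by move=> z; rewrite /g /w; ring.
  rewrite iintB; [|exact: integB|exact: integZ].
  by rewrite iintB// i1 i2 iintZ// subrr sub0r mulNr.
have bg : bnd_supp 2 (2 * Mg * (2 * (a + c))) (fun z => w z * g z).
  have [mw hw w2] := bw; split.
  - apply: measurable_funM => //; apply: measurable_funB; last by apply: measurable_funM => //; exact: measurable_dotp.
    by apply: measurable_funB => //; case: br.
  - move=> z; have [az|az] := boolP (annulus z); last first.
      by rewrite /w domega_annulus// !mul0r normr0 (mulr_ge0 (mulr_ge0 (ler0n _ 2) Mg0))// mulr_ge0.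
    by rewrite normrM ler_pM// A2.
  - by move=> z z2; rewrite w2// mul0r.
have cnb : `|cn| <= C2 * (a + c).
  rewrite /C2 mulrAC ler_pdivlMr//.
  have := norm_iint_bnd_supp bg; rewrite jg normrM normrN => h.
  apply: le_trans (_ : `|cn| * `|iint (fun z => w z * dotp m z)| <= _).
    by rewrite ler_wpM2l//; apply: le_trans Il (ler_norm _).
  by apply: le_trans h _; rewrite /M0; linarith.
have := A1 y ay my0; rewrite /g my p1// subr0 => h.
have := ler_normD (xi y - cn * dotp m y) (cn * dotp m y); rewrite subrK normrM => h2.
have h3 : `|dotp m y| <= 2 by have := dotp_le2 m (annulus_enorm ay); rewrite mn mulr1.
have := ler_pM (normr_ge0 _) (normr_ge0 _) cnb h3; linarith.
Qed.

(** The difference of two displacements is split into a part small in the mirror seminorm and a part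
    small in the sup norm. *)
Definition mclose a c r xi1 b1 xi2 b2 := enorm (b1 - b2) <= r /\
  exists2 f, bnd_supp 2 c f & mirror a (fun y => xi1 y - xi2 y - f y).

Definition Cb : R := 8 * iint (@cutoff R 2) / Pi0.

Lemma Cb_ge0 : 0 <= Cb.
Proof.
rewrite divr_ge0 ?(ltW (@Pi0_gt0 R))// mulr_ge0//; apply: iint_ge0 => z; exact: cutoff_ge0.
Qed.

Section map_step.
Variables (eta : R) (Rop : (R * R -> R) -> R * R -> R).
Hypothesis pert : perturbation eta Rop.
Notation G := (G s Rop).
Notation Tb := (Tb s Rop).
Notation Tx := (Tx s Rop).

(** The mirror part contracts by [mirror_conv]. On the bounded part the kernel is split: the regular
    half yields a Lipschitz function, hence a new mirror part, and the small half stays bounded with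
    a small factor. Values at |y| e1 are radial, so mirrors do not see them. *)
Lemma step D xi1 b1 xi2 b2 a c r k B d1 e1' L1 dm c0 : D <= 1 / 8 -> st D xi1 b1 -> st D xi2 b2 ->
  nrm s xi1 -> nrm s xi2 -> 0 <= B ->
  (forall y, annulus y -> `|G xi1 b1 y| <= B) -> (forall y, annulus y -> `|G xi2 b2 y| <= B) ->
  0 <= k -> (forall y, annulus y -> `|G xi1 b1 y - G xi2 b2 y -
    (conv (fun z => domega (dotp z z) * (xi1 z - xi2 z)) y -
     conv (fun z => domega (dotp z z) * (xi1 z - xi2 z)) (enorm y *: e1))| <= k) ->
  split_ke s d1 e1' L1 -> 0 <= L1 -> 0 < e1' ->
  (forall C f a, bnd_supp 2 C f -> 0 <= a -> mirror a f ->
     mirror ((1 - dm) * a) (fun y => conv (fun z => domega (dotp z z) * f z) y / lam (dotp y y))) ->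
  0 < c0 -> (forall y, annulus y -> lam (dotp y y) <= - c0) -> 0 <= a -> 0 <= c ->
  mclose a c r xi1 b1 xi2 b2 ->
  mclose ((1 - dm) * a + 4 * L1 / c0 * c) ((4 * d1 * c + (1 + 4 * Cb) * k) / c0) (Cb * k)
    (Tx xi1 b1) (Tb xi1 b1) (Tx xi2 b2) (Tb xi2 b2).
Proof.
move=> D8 h1 h2 n1 n2 B0 GB1 GB2 k0 Hk sp L10 e10 mc c00 lc a0 ge0c [_ [f2 bf2 mf1]].
have Tbd := Tb_diff hs pert D8 h1 h2 n1 n2 B0 GB1 GB2 k0 Hk; rewrite -/Cb in Tbd.
split=> //; have [[mx1 hx1 s1] _ _ _] := h1; have [[mx2 hx2 s2] _ _ _] := h2.
pose f1 y := xi1 y - xi2 y - f2 y.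
have bd : bnd_supp 2 (D + D) (fun y => xi1 y - xi2 y) by apply: bnd_suppB.
have bf1 : bnd_supp 2 (D + D + c) f1 by apply: bnd_suppB.
have D0 : 0 <= D := le_trans (normr_ge0 _) (hx1 0).
have C10 := bnd_supp_ge0 bf1.
have bo f C : bnd_supp 2 C f -> bnd_supp 2 (2 * C) (fun z => domega (dotp z z) * f z).
  by move=> bf; have [mf hf _] := bf; apply: bnd_supp_domegaM => //; exact: bnd_supp_ge0 bf.
have bo1 := bo _ _ bf1; have bo2 := bo _ _ bf2.
set u := fun z => domega (dotp z z) * f1 z in bo1; set v := fun z => domega (dotp z z) * f2 z in bo2.
have [S1 S2 _] := sp _ _ bo2.
have le := kape_locally_integrable hs e10.
have convE y : conv (fun z => domega (dotp z z) * (xi1 z - xi2 z)) y = conv u y + conv v y.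
  rewrite -(convkD lk y bo1 bo2); congr (convk _ _ y); apply/funext => z.
  by rewrite /u /v /f1; ring.
pose ke := convk (kape s e1') v.
(* F collects what goes into the new mirror part; the rest of the difference is the new bounded
   part. *)
pose F y := (conv u y - conv u (enorm y *: e1) + (ke y - ke (enorm y *: e1))) * lam_inv s y.
have mcu := measurable_conv hs B2 bo1.
have mke : measurable_fun setT ke.
  by apply: continuous_measurable_plane => y; apply: C1at_continuous; exact: C1at_conv_kape bo2.
have mF : measurable_fun setT F.
  apply: measurable_funM; last exact: measurable_lam_inv.
  by apply: measurable_funD; apply: measurable_funB => //;
    apply: (measurableT_comp (measurable_ray _) (@measurable_enorm R)).
have mT1 := measurable_Tx hs pert D8 h1; have mT2 := measurable_Tx hs pert D8 h2.
have li y : annulus y -> lam_inv s y = (lam (dotp y y))^-1 by move=> ay; rewrite /lam_inv on_annulusE.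
have lib y : annulus y -> `|lam_inv s y| <= c0^-1.
  move=> ay; have lz := lc y ay; have ln : lam (dotp y y) < 0 by linarith.
  by rewrite li// normfV ltr0_norm// lef_pV2 ?posrE; linarith.
have an3 y : annulus y -> enorm y <= 3 /\ enorm (enorm y *: (e1 : R * R)) <= 3.
  by move=> /annulus_enorm y2; rewrite enorm_Ze1 ?enorm_ge0//; split; linarith.
exists (fun y => Tx xi1 b1 y - Tx xi2 b2 y - F y).
  have bnd y : annulus y -> `|Tx xi1 b1 y - Tx xi2 b2 y - F y| <= (4 * d1 * c + (1 + 4 * Cb) * k) / c0.
    move=> ay; have [y3 y3'] := an3 y ay.
    have -> : Tx xi1 b1 y - Tx xi2 b2 y - F y =
      ((conv v y - ke y) - (conv v (enorm y *: e1) - ke (enorm y *: e1)) +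
       (G xi1 b1 y - G xi2 b2 y - (conv (fun z => domega (dotp z z) * (xi1 z - xi2 z)) y -
         conv (fun z => domega (dotp z z) * (xi1 z - xi2 z)) (enorm y *: e1))) +
       dotp (Tb xi1 b1 - Tb xi2 b2) (y - enorm y *: e1)) * lam_inv s y.
      by rewrite /Tx /F !convE dotpDl dotpNl; ring.
    rewrite normrM; apply: ler_pM => //; last exact: lib.
    apply: le_trans (ler_normD _ _) _.
    have t1 := ler_normD (conv v y - ke y - (conv v (enorm y *: e1) - ke (enorm y *: e1)))
      (G xi1 b1 y - G xi2 b2 y - (conv (fun z => domega (dotp z z) * (xi1 z - xi2 z)) y -
         conv (fun z => domega (dotp z z) * (xi1 z - xi2 z)) (enorm y *: e1))).
    have t2 := ler_normB (conv v y - ke y) (conv v (enorm y *: e1) - ke (enorm y *: e1)).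
    have t3 := S2 y y3; have t4 := S2 _ y3'; have t5 := Hk y ay.
    have t6 := lin_bound (Tb xi1 b1 - Tb xi2 b2) ay; rewrite -/ke in t3 t4; linarith.
  split=> [|y|y y2].
  - by apply: measurable_funB => //; exact: measurable_funB.
  - have [ay|ay] := boolP (annulus y); first exact: bnd.
    rewrite !Tx_out// /F /lam_inv /on_annulus (negbTE ay) mulr0 !subr0 normr0.
    have aa : annulus ((3 / 2, 0) : R * R) by rewrite /annulus /dotp/=; apply/andP; split; linarith.
    exact: le_trans (normr_ge0 _) (bnd _ aa).
  - have ay : ~~ annulus y by apply/negP => /annulus_enorm; rewrite leNgt y2.
    by rewrite !Tx_out// /F /lam_inv /on_annulus (negbTE ay) mulr0 !subr0.
move=> n nn; have [cn Hcn] := mc _ _ _ bf1 a0 mf1 n nn; exists cn => y ay ny.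
have ay' : annulus (refl n y) by rewrite annulus_refl.
rewrite !subKr /F !li// dotp_refl// enorm_refl//.
set l := lam (dotp y y) in Hcn *.
have {}Hcn := Hcn y ay ny; rewrite dotp_refl// -/l -/u in Hcn.
rewrite (_ : _ - _ - _ = (conv u y / l - conv u (refl n y) / l - cn * dotp n y) +
   (ke y - ke (refl n y)) / l); last by ring.
apply: le_trans (ler_normD _ _) _; rewrite [leRHS]mulrDl; apply: lerD; first exact: Hcn.
have [y3 _] := an3 y ay; have [y3' _] := an3 _ ay'.
(* One factor 2 is the bound on |domega|, the other comes from |y - refl n y| = 2 (n . y). *)
rewrite normrM (_ : 4 * L1 / c0 * c * dotp n y = L1 * (2 * c) * (2 * dotp n y) / c0); last by ring.
have := lib y ay; rewrite li// -/l => lb; apply: ler_pM => //.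
apply: le_trans (S1 _ _ y3 y3') _; rewrite ler_wpM2l ?mulr_ge0//.
by rewrite /refl opprB addrC subrK enormZ enorm_unit// mulr1 ger0_norm// mulr_ge0.
Qed.

(** Each summand of [G] is Lipschitz with a constant of order [kappa]. Points of the annulus are
    within 4 of their place on the ray, and [rr] is Lipschitz with constant 5 = 4 + 1, from |y|^2
    and from [xi]. *)
Lemma G_bound D xi b d e L KE : D <= 1 / 8 -> st D xi b -> split_ke s d e L -> 0 <= d -> 0 <= L ->
  (forall D t t' (v v' : R), D <= 1 / 8 ->
    7 / 4 <= t <= 13 / 4 -> 7 / 4 <= t' <= 13 / 4 -> `|v| <= D -> `|v'| <= D ->
    `|Er s t v - Er s t' v'| <= KE * D * (`|v - v'| + `|t - t'|)) -> 0 <= KE ->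
  (forall y, annulus y -> `|G xi b y| <= 4 * kappa s eta D KE d L) /\
  (forall x y, annulus x -> annulus y -> `|G xi b x - G xi b y| <= 12 * kappa s eta D KE d L * enorm (x - y)).
Proof.
move=> D8 hst sp d0 L0 HE KE0.
have eta0 : 0 <= eta by case: pert.
have [[mx hx _] _ hl hb] := hst.
have D0 : 0 <= D := le_trans (normr_ge0 _) (hx 0).
have M0 := kernel_mass_ge0 (kap s) (2 + 3).
pose g := KE * D + (L * (2 * D) + d * 80 + eta) + D.
have gk : g <= kappa s eta D KE d L.
  have p1 : 0 <= D * kernel_mass (kap s) (2 + 3) by rewrite mulr_ge0.
  have p2 : 0 <= L * D by rewrite mulr_ge0.
  by rewrite /g /kappa; linarith.
have T := Th_lip pert D8 hst sp.
have p1 : 0 <= KE * D by rewrite mulr_ge0.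
have p2 : 0 <= L * (2 * D) + d * 80 + eta by rewrite !addr_ge0 ?mulr_ge0.
have rb y (ay : annulus y) := rr_bounds D8 hst ay.
have r3 y : annulus y -> enorm (rr xi y *: (e1 : R * R)) <= 3.
  by move=> /rb[h1 h2 _ _]; rewrite enorm_Ze1; linarith.
have y3 y : annulus y -> enorm y <= 3 by move=> /annulus_enorm; linarith.
split=> [y ay|x y ax ay].
  apply: le_trans (_ : 4 * g <= _); last by rewrite ler_wpM2l.
  rewrite /G on_annulusE//; have [r1 r2 _ r4] := rb y ay.
  have t1 : `|Er s (dotp y y) (xi y)| <= KE * D * D.
    have := HE D (dotp y y) (dotp y y) (xi y) 0 D8 ay ay (hx y); rewrite normr0 Er0 subr0 subrr normr0 addr0 subr0.
    by move=> /(_ D0) h; apply: le_trans h _; rewrite ler_wpM2l.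
  have t2 := T _ _ (y3 y ay) (r3 y ay).
  have t3 : enorm (y - rr xi y *: e1) <= 4.
    by apply: le_trans (ler_enormB _ _) _; have := annulus_enorm ay; rewrite enorm_Ze1; linarith.
  have t4 := ler_wpM2l p2 t3.
  have t5 : `|b.1 * (enorm y - rr xi y)| <= D * D.
    rewrite normrM; apply: ler_pM => //; first exact: le_trans (normr_fst_le b) hb.
    by rewrite distrC; exact: le_trans r4 (hx y).
  have := ler_normD (- Er s (dotp y y) (xi y) + (Th s Rop xi y - Th s Rop xi (rr xi y *: e1))) (b.1 * (enorm y - rr xi y)).
  have := ler_normD (- Er s (dotp y y) (xi y)) (Th s Rop xi y - Th s Rop xi (rr xi y *: e1)).
  rewrite normrN /g; have D1 : D * D <= D by rewrite ler_piMl//; linarith.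
  have := ler_wpM2l KE0 D1; linarith.
apply: le_trans (_ : 12 * g * enorm (x - y) <= _); last first.
  by rewrite ler_wpM2r ?enorm_ge0// ler_wpM2l.
have [r1 r2 r5 _] := rb x ax; have [r1' r2' r5' _] := rb y ay.
have e0 := enorm_ge0 (x - y).
have nl := nsq_lip2 (annulus_enorm ax) (annulus_enorm ay).
have xl := hl x y ax ay.
have t1 := HE D _ _ _ _ D8 ax ay (hx x) (hx y).
have t1' : `|Er s (dotp x x) (xi x) - Er s (dotp y y) (xi y)| <= KE * D * (5 * enorm (x - y)).
  by apply: le_trans t1 _; rewrite ler_wpM2l//; linarith.
have t2 := T _ _ (y3 x ax) (y3 y ay); have t3 := T _ _ (r3 x ax) (r3 y ay).
have rd : `|rr xi x - rr xi y| <= 5 * enorm (x - y).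
  have : `|(rr xi x - rr xi y) * (rr xi x + rr xi y)| <= 5 * enorm (x - y).
    rewrite -subr_sqr r5 r5' (_ : _ - _ = (dotp x x - dotp y y) + (xi x - xi y)); last by ring.
    by apply: le_trans (ler_normD _ _) _; linarith.
  by apply: le_trans; rewrite normrM ler_peMr// ger0_norm; linarith.
rewrite -scalerBl enormZ enorm_e1 mulr1 in t3.
have t4 := ler_wpM2l p2 rd.
have t5 : `|b.1 * ((enorm x - enorm y) - (rr xi x - rr xi y))| <= D * (6 * enorm (x - y)).
  rewrite normrM; apply: ler_pM => //; first exact: le_trans (normr_fst_le b) hb.
  by apply: le_trans (ler_normB _ _) _; have := ler_dist_enorm x y; linarith.
rewrite /G !on_annulusE// (_ : _ - _ = - (Er s (dotp x x) (xi x) - Er s (dotp y y) (xi y))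
  + (Th s Rop xi x - Th s Rop xi y) - (Th s Rop xi (rr xi x *: e1) - Th s Rop xi (rr xi y *: e1))
  + b.1 * ((enorm x - enorm y) - (rr xi x - rr xi y))); last by ring.
set A := Er _ _ _ - _ in t1' *; set A2 := Th _ _ _ _ - _ in t2 *; set A3 := Th _ _ _ _ - _ in t3 *.
set A4 := b.1 * _ in t5 *.
have := ler_normD (- A + A2 - A3) A4; have := ler_normB (- A + A2) A3; have := ler_normD (- A) A2.
rewrite normrN /g => u1 u2 u3.
have p3 : 0 <= KE * D * enorm (x - y) by rewrite mulr_ge0.
have p4 : 0 <= (L * (2 * D) + d * 80 + eta) * enorm (x - y) by rewrite mulr_ge0.
have p5 : 0 <= D * enorm (x - y) by rewrite mulr_ge0.
linarith.
Qed.

Lemma Tb_bound D xi b B : D <= 1 / 8 -> st D xi b -> 0 <= B ->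
  (forall y, annulus y -> `|G xi b y| <= B) -> enorm (Tb xi b) <= Cb * B.
Proof.
move=> D8 hst B0 GB; have mG := measurable_G hs pert D8 hst; have P0 := @Pi0_gt0 R.
have comp n : enorm n = 1 -> `|iint (fun z => G xi b z * gw n z) / Pi0| <= 4 * iint (@cutoff R 2) / Pi0 * B.
  move=> n1; have [_] := integ_gwM n mG GB B0; rewrite n1 mulr1 => h.
  rewrite normrM [ `|_^-1|]gtr0_norm ?invr_gt0// [leRHS]mulrAC ler_wpM2r ?invr_ge0 ?(ltW P0)//.
  by apply: le_trans h _; rewrite mulrAC.
have ee2 : enorm (e2 : R * R) = 1 by rewrite enorm_unit// unit_e2.
apply: le_trans (enorm_le_coord _) _; rewrite /Cb.
have := comp e1 (@enorm_e1 R); have := comp e2 ee2 => u1 u2.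
rewrite (_ : 8 * _ / _ * _ = 4 * iint (@cutoff R 2) / Pi0 * B + 4 * iint (@cutoff R 2) / Pi0 * B); last by ring.
exact: lerD.
Qed.

(** The constant is proportional to k, so the Lipschitz constant 1 imposed on states is reproduced
    once k is small. *)
Lemma Tx_lip D xi b k c0 Kl : D <= 1 / 8 -> st D xi b -> 0 <= k ->
  (forall y, annulus y -> `|G xi b y| <= 4 * k) ->
  (forall x y, annulus x -> annulus y -> `|G xi b x - G xi b y| <= 12 * k * enorm (x - y)) ->
  0 < c0 -> (forall y, annulus y -> lam (dotp y y) <= - c0) -> 0 <= Kl ->
  (forall x y, annulus x -> annulus y -> `|lam (dotp x x) - lam (dotp y y)| <= Kl * enorm (x - y)) ->
  forall x y, annulus x -> annulus y -> `|Tx xi b x - Tx xi b y| <=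
    k * ((12 + 8 * Cb) / c0 + (4 + 16 * Cb) * Kl / c0 ^+ 2) * enorm (x - y).
Proof.
move=> D8 hst k0 GB GL c00 lc Kl0 lL x y ax ay.
have k4 : 0 <= 4 * k by rewrite mulr_ge0.
have TB := Tb_bound D8 hst k4 GB; have C0 := Cb_ge0; have e0 := enorm_ge0 (x - y).
pose N z := G xi b z + dotp (Tb xi b) (z - enorm z *: e1).
have Nb z : annulus z -> `|N z| <= k * (4 + 16 * Cb).
  move=> az; apply: le_trans (ler_normD _ _) _; have := GB z az.
  have := lin_bound (Tb xi b) az; linarith.
have NL : `|N x - N y| <= k * (12 + 8 * Cb) * enorm (x - y).
  rewrite /N (_ : _ - _ = (G xi b x - G xi b y) + dotp (Tb xi b) ((x - y) - (enorm x - enorm y) *: e1)); last first.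
    by rewrite !lin_Ze1 dotpDr [in RHS]dotpDr !dotpNr dotpZr [dotp _ e1]/dotp/=; ring.
  apply: le_trans (ler_normD _ _) _; have := GL x y ax ay.
  have h : `|dotp (Tb xi b) ((x - y) - (enorm x - enorm y) *: e1)| <= Cb * (4 * k) * (2 * enorm (x - y)).
    apply: le_trans (normr_dotp _ _) _; apply: ler_pM; rewrite ?enorm_ge0//.
    apply: le_trans (ler_enormB _ _) _; rewrite enormZ enorm_e1 mulr1.
    by have := ler_dist_enorm x y; linarith.
  linarith.
have E z : annulus z -> Tx xi b z = N z / lam (dotp z z).
  by move=> az; rewrite /Tx /lam_inv on_annulusE.
have lz z : annulus z -> lam (dotp z z) != 0 by move=> /lc h; rewrite lt_eqF//; linarith.
have lib z : annulus z -> `|(lam (dotp z z))^-1| <= c0^-1.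
  move=> az; have h := lc z az; have ln : lam (dotp z z) < 0 by linarith.
  by rewrite normfV ltr0_norm// lef_pV2 ?posrE; linarith.
rewrite !E// (_ : _ - _ = (N x - N y) / lam (dotp x x) +
  N y * (lam (dotp y y) - lam (dotp x x)) * ((lam (dotp x x))^-1 * (lam (dotp y y))^-1)); last first.
  by field; rewrite !lz.
apply: le_trans (ler_normD _ _) _; rewrite (mulrDr k) [leRHS]mulrDl; apply: lerD.
  rewrite normrM (_ : k * _ * _ = k * (12 + 8 * Cb) * enorm (x - y) / c0); last by ring.
  by apply: ler_pM => //; exact: lib.
rewrite !normrM (_ : k * _ * _ = k * (4 + 16 * Cb) * (Kl * enorm (x - y)) * (c0^-1 * c0^-1)); last first.
  by rewrite expr2 invfM; ring.
apply: ler_pM; rewrite ?mulr_ge0//.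
  by apply: ler_pM => //; [exact: Nb|rewrite distrC; exact: lL].
by apply: ler_pM => //; exact: lib.
Qed.

End map_step.
End contraction.

(** * The fixed point *)

Section geometric_limits.
Context {R : realType}.

(** The intervals [u n - e n, u n + e n] meet pairwise, so the supremum of their left ends lies in
    all of them. *)
Lemma cauchy_limit (u e : nat -> R) : (forall n m, `|u n - u m| <= e n + e m) ->
  exists l, forall n, `|u n - l| <= e n.
Proof.
move=> ucau; pose A := [set u n - e n | n in setT].
have ubA m : ubound A (u m + e m).
  by move=> _ [n _ <-]; have := ucau n m; rewrite ler_norml => /andP[]; linarith.
have A0 : A !=set0 by exists (u 0%N - e 0%N), 0%N.
exists (sup A) => n; have h1 := ge_sup A0 (ubA n).
have h2 : u n - e n <= sup A by apply: ub_le_sup; [exists (u 0%N + e 0%N)|exists n].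
by rewrite ler_norml; apply/andP; split; linarith.
Qed.

Lemma geometric_limit (u : nat -> R) (E th : R) : 0 <= E -> 0 <= th -> th <= 1 ->
  (forall n, `|u n.+1 - u n| <= E * (1 - th) * th ^+ n) ->
  exists l, forall n, `|u n - l| <= E * th ^+ n.
Proof.
move=> E0 th0 th1 H.
have key n k : `|u (n + k)%N - u n| <= E * (th ^+ n - th ^+ (n + k)).
  elim: k => [|k IH]; first by rewrite addn0 !subrr normr0 mulr0.
  rewrite addnS; apply: le_trans (ler_distD (u (n + k)%N) _ _) _.
  by have := H (n + k)%N; rewrite exprS; linarith.
apply: cauchy_limit => n m; have p k : 0 <= th ^+ k by exact: exprn_ge0.
have [nm|/ltnW nm] := leqP n m.
  have := key n (m - n)%N; rewrite subnKC// distrC => h.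
  by have := mulr_ge0 E0 (p m); linarith.
have := key m (n - m)%N; rewrite subnKC// => h.
by have := mulr_ge0 E0 (p n); linarith.
Qed.

Lemma geometric_le0 (x C th : R) : 0 <= th -> th < 1 -> (forall n, x <= C * th ^+ n) -> x <= 0.
Proof.
move=> th0 th1 H; have cv : (C * th ^+ n) @[n --> \oo] --> (0 : R).
  rewrite -(mulr0 C); apply: cvgMr; apply: cvg_expr; by rewrite ger0_norm.
by apply: (ler_cvg_to (cvg_cst x) cv); apply: nearW => n; exact: H.
Qed.

End geometric_limits.

Section fixed_point.
Context {R : realType}.
Variable s : R.
Hypothesis hs : 0 < s <= 1.
Implicit Types (x y z b : (R * R)%type) (f h xi : R * R -> R) (t D q a c r : R) (n : nat).
Notation conv := (convk (kap s)).
Notation lam := (lam s).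
Let lk := kap_locally_integrable hs.
Let B2 : (0 : R) <= 2. Proof. by []. Qed.

Lemma bnd_supp_Tx eta Rop D xi b B c0 : perturbation eta Rop -> D <= 1 / 8 -> st D xi b -> 0 <= B ->
  (forall y, annulus y -> `|G s Rop xi b y| <= B) -> 0 < c0 ->
  (forall y, annulus y -> lam (dotp y y) <= - c0) ->
  bnd_supp 2 ((1 + 4 * Cb) / c0 * B) (Tx s Rop xi b).
Proof.
move=> pert D8 hst B0 GB c00 lc; have TB := Tb_bound hs pert D8 hst B0 GB.
have C0 := @Cb_ge0 R.
split=> [|y|y y2]; first exact: (measurable_Tx hs pert D8 hst).
- have [ay|ay] := boolP (annulus y); last first.
    by rewrite Tx_out// normr0 !mulr_ge0 ?invr_ge0 ?(ltW c00)// addr_ge0// mulr_ge0.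
  rewrite (_ : _ * B = (1 + 4 * Cb) * B / c0); last by ring.
  rewrite /Tx normrM; apply: ler_pM => //.
    apply: le_trans (ler_normD _ _) _; have := GB y ay; have := lin_bound (Tb s Rop xi b) ay; linarith.
  have lz := lc y ay; have ln : lam (dotp y y) < 0 by linarith.
  by rewrite /lam_inv on_annulusE// normfV ltr0_norm// lef_pV2 ?posrE; linarith.
- by rewrite Tx_out//; apply/negP => /annulus_enorm; rewrite leNgt y2.
Qed.

(** For the unperturbed vortex without drift, only [Rop] breaks the radial symmetry. *)
Lemma G_first eta Rop : perturbation eta Rop -> forall y, annulus y ->
  `|G s Rop (fun=> 0) 0 y| <= 4 * eta.
Proof.
move=> pert y ay; have [eta0 R1 _ _] := pert.
have y2 := annulus_enorm ay; have ey0 := enorm_ge0 y.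
have rE : rr (fun=> 0) y = enorm y by rewrite /rr addr0.
have p3 : enorm (enorm y *: (e1 : R * R)) <= 3 by rewrite enorm_Ze1//; linarith.
have y3 : enorm y <= 3 by linarith.
rewrite /G on_annulusE// Er0 rE subrr mulr0 addr0 oppr0 add0r /Th W_zero.
have b0 : bnd_supp 2 0 (fun=> 0 : R) by split=> // z; rewrite normr0.
have z x : conv (fun z => W0 z - W0 z) x = 0.
  transitivity (conv (fun z => 0 * (0 : R)) x); last by rewrite (convkZ lk 0 x b0) mul0r.
  by congr (convk _ _ x); apply/funext => z'; rewrite subrr mul0r.
rewrite !z !add0r; apply: le_trans (R1 1 _ (@bnd_supp_W0 R) _ _ y3 p3) _.
rewrite mulr1 mulrC ler_wpM2r//; apply: le_trans (ler_enormB _ _) _.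
by rewrite enorm_Ze1//; linarith.
Qed.

Lemma mirror_zero f : (forall y, f y = 0) -> mirror 0 f.
Proof. by move=> f0 m _; exists 0 => y _ _; rewrite !f0 !mul0r !subr0 normr0. Qed.

(** In a + K c + r, the passage from c to a costs 4 L1 / c0 = (K - 1) / 4 and the decay of c by 1/4
    leaves K / 4, together at most half of K c. The seminorm a keeps the factor 1 - dm, and the
    errors of order [kappa] take at most dm / 4 of the total. *)
Lemma map_contracts : exists D K Cq th C eta0 : R,
  [/\ [/\ 0 < D, D <= 1 / 8, 1 <= K & 1 <= Cq], [/\ 0 <= th, th < 1, 0 <= C & 0 < eta0] &
  forall eta Rop, perturbation eta Rop -> eta <= eta0 ->
  [/\ forall xi b, st D xi b -> nrm s xi -> [/\ nrm s (Tx s Rop xi b), bnd_supp 2 Cq (Tx s Rop xi b) &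
        forall x y, annulus x -> annulus y -> `|Tx s Rop xi b x - Tx s Rop xi b y| <= enorm (x - y)],
      forall xi1 b1 xi2 b2 B B' a c r, bnd_supp 2 B xi1 -> bnd_supp 2 B' xi2 -> nrm s xi1 -> nrm s xi2 ->
        (forall y, ~~ annulus y -> xi1 y = 0) -> (forall y, ~~ annulus y -> xi2 y = 0) -> 0 <= a -> 0 <= c ->
        mclose a c r xi1 b1 xi2 b2 -> forall y, `|xi1 y - xi2 y| <= Cq * (a + c),
      forall xi1 b1 xi2 b2 a c r, st D xi1 b1 -> st D xi2 b2 -> nrm s xi1 -> nrm s xi2 ->
        0 <= a -> 0 <= c -> mclose a c r xi1 b1 xi2 b2 ->
        exists a' c' r', [/\ 0 <= a', 0 <= c', a' + K * c' + r' <= th * (a + K * c + r) &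
          mclose a' c' r' (Tx s Rop xi1 b1) (Tb s Rop xi1 b1) (Tx s Rop xi2 b2) (Tb s Rop xi2 b2)] &
      exists c r, [/\ 0 <= c, K * c + r <= C * eta &
        mclose 0 c r (Tx s Rop (fun=> 0) 0) (Tb s Rop (fun=> 0) 0) (fun=> 0) 0]]].
Proof.
have [c0 c00 lc] := lam_annulus hs.
have [dm /andP[dm0 dm1] mc] := mirror_conv hs.
have [KE KE0 HE] := Er_dist hs.
have [Kl' Kl'H] := lam_lip hs; pose Kl := 4 * `|Kl'|.
have Kl0 : 0 <= Kl by rewrite mulr_ge0.
have lL x y : annulus x -> annulus y -> `|lam (dotp x x) - lam (dotp y y)| <= Kl * enorm (x - y).
  move=> ax ay; have /andP[x1 x2] := ax; have /andP[y1 y2] := ay.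
  apply: le_trans (Kl'H _ _ _ _ _ _) _; try linarith.
  apply: le_trans (_ : `|Kl'| * `|dotp x x - dotp y y| <= _); first by rewrite ler_wpM2r// ler_norm.
  rewrite /Kl [4 * _]mulrC -mulrA ler_wpM2l//; exact: nsq_lip2 (annulus_enorm ax) (annulus_enorm ay).
have [Cq Cq1 HCq] := mirror_sup hs.
have Cq0 : 0 <= Cq := le_trans ler01 Cq1.
have Cb0 := @Cb_ge0 R; have M0 := kernel_mass_ge0 (kap s) (2 + 3).
set Cb := Cb in Cb0; set M := kernel_mass _ _ in M0.
have B3 : (0 : R) <= 3 by [].
have d10 : 0 < c0 / 16 by rewrite divr_gt0.
have [e1' [L1 [/andP[e10 _] L10 sp1]]] := conv_split hs B2 B3 d10.
pose K := 16 * L1 / c0 + 1.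
have K1 : 1 <= K by rewrite lerDr divr_ge0 ?(ltW c00)// mulr_ge0.
pose C3 := (1 + 4 * Cb) / c0.
have C30 : 0 <= C3 by rewrite divr_ge0 ?(ltW c00)// addr_ge0// mulr_ge0.
pose C5 := (K * C3 + Cb) * Cq + 1.
have KC0 : 0 <= K * C3 + Cb by rewrite addr_ge0// mulr_ge0//; linarith.
have C50 : 0 < C5 by rewrite ltr_wpDl// mulr_ge0//; linarith.
pose C6 := (12 + 8 * Cb) / c0 + (4 + 16 * Cb) * Kl / c0 ^+ 2.
have C60 : 0 <= C6.
  by rewrite addr_ge0// divr_ge0 ?exprn_ge0 ?(ltW c00)// ?mulr_ge0// addr_ge0// mulr_ge0.
(* The first bound keeps the errors below dm / 4, the second makes the Lipschitz constant of
   [Tx_lip] at most 1. *)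
pose k0 := Num.min (dm / (4 * C5)) (C6 + 1)^-1.
have k00 : 0 < k0 by rewrite lt_min divr_gt0 ?invr_gt0 ?mulr_gt0// ltr_wpDl.
have k0C5 : k0 * C5 <= dm / 4.
  have h : k0 <= dm / (4 * C5) by rewrite ge_min lexx.
  by have := ler_wpM2r (ltW C50) h; rewrite invfM mulrA mulfVK ?gt_eqF.
have k0C6 : k0 * C6 <= 1.
  have h : k0 <= (C6 + 1)^-1 by rewrite ge_min lexx orbT.
  apply: le_trans (ler_wpM2r C60 h) _; rewrite mulrC ler_pdivrMr ?mul1r ?lerDl//; linarith.
(* In [kappa] the terms 84 d, D Q and 9 eta are each kept below k0 / 3. The second split is made
   here, before D is chosen, since Q involves its Lipschitz constant [L2]. *)
have d20 : 0 < k0 / 252 := divr_gt0 k00 (ltr0Sn R 251).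
have [e2' [L2 [/andP[e20 _] L20 sp2]]] := conv_split hs B2 B3 d20.
pose Q := KE + 64 * M + 4 * L2 + 2.
have Q0 : 0 < Q by rewrite ltr_wpDl// !addr_ge0// mulr_ge0.
pose D := Num.min (1 / 8) (k0 / (3 * Q)).
have D0 : 0 < D by rewrite lt_min !divr_gt0// mulr_gt0.
have D8 : D <= 1 / 8 by rewrite ge_min lexx.
have DQ : D * Q <= k0 / 3.
  have h : D <= k0 / (3 * Q) by rewrite ge_min lexx orbT.
  by have := ler_wpM2r (ltW Q0) h; rewrite invfM mulrA mulfVK ?gt_eqF.
pose th := 1 - dm / 4.
have th0 : 0 <= th by rewrite /th; linarith.
have th1 : th < 1 by rewrite /th; linarith.
pose C8 := 4 * (K * C3 + Cb).
have C80 : 0 <= C8 by rewrite mulr_ge0.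
pose Cm := Num.max Cq (C3 * (4 * k0)).
have Cm1 : Cq <= Cm by rewrite le_max lexx.
have C5E : C5 = (K * C3 + Cb) * Cq + 1 := erefl.
have C3E : C3 = (1 + 4 * Cb) / c0 := erefl.
have KdE : K = 16 * L1 / c0 + 1 := erefl.
exists D, K, Cm, th, C8, (k0 / 27); split=> //; first by split=> //; exact: le_trans Cq1 Cm1.
  by split=> //; rewrite divr_gt0.
move=> eta Rop pert eta1.
have eta_ge0 : 0 <= eta by case: pert.
pose k := kappa s eta D KE (k0 / 252) L2.
have kk0 : k <= k0.
  by rewrite /k /kappa -/M; move: DQ; rewrite /Q => DQ; linarith.
have kge0 : 0 <= k.
  have p1 : 0 <= KE * D by rewrite mulr_ge0// ltW.
  have p2 : 0 <= D * M by rewrite mulr_ge0// ltW.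
  have p3 : 0 <= L2 * D by rewrite mulr_ge0// ltW.
  by rewrite /k /kappa -/M; linarith.
have GB xi b : st D xi b -> (forall y, annulus y -> `|G s Rop xi b y| <= 4 * k) /\
  (forall x y, annulus x -> annulus y -> `|G s Rop xi b x - G s Rop xi b y| <= 12 * k * enorm (x - y)).
  by move=> hst; exact: (G_bound pert D8 hst sp2 (ltW d20) L20 HE KE0).
have k40 : 0 <= 4 * k by rewrite mulr_ge0.
have bT xi b : st D xi b -> bnd_supp 2 (C3 * (4 * k)) (Tx s Rop xi b).
  by move=> hst; exact: (bnd_supp_Tx pert D8 hst k40 (GB _ _ hst).1 c00 lc).
have nT xi b : st D xi b -> nrm s xi -> nrm s (Tx s Rop xi b).
  by move=> hst nx; exact: (nrm_Tx hs pert D8 hst nx k40 (GB _ _ hst).1).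
have lT xi b : st D xi b -> forall x y, annulus x -> annulus y ->
    `|Tx s Rop xi b x - Tx s Rop xi b y| <= enorm (x - y).
  move=> hst x y ax ay.
  apply: le_trans (Tx_lip hs pert D8 hst kge0 (GB _ _ hst).1 (GB _ _ hst).2 c00 lc Kl0 lL ax ay) _.
  rewrite -/Cb -/C6 ler_piMl ?enorm_ge0//; apply: le_trans k0C6.
  by rewrite ler_wpM2r.
have c4k : C3 * (4 * k) <= Cm.
  by rewrite le_max; apply/orP; right; rewrite ler_wpM2l// ler_wpM2l.
have supc xi1 b1 xi2 b2 C C' a c r : bnd_supp 2 C xi1 -> bnd_supp 2 C' xi2 -> nrm s xi1 -> nrm s xi2 ->
    (forall y, ~~ annulus y -> xi1 y = 0) -> (forall y, ~~ annulus y -> xi2 y = 0) -> 0 <= a -> 0 <= c ->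
    mclose a c r xi1 b1 xi2 b2 -> forall y, `|xi1 y - xi2 y| <= Cq * (a + c).
  move=> h1 h2 n1 n2 z1 z2 a0 ge0c [_ [f bf mf]] y; have [ay|ay] := boolP (annulus y); last first.
    by rewrite z1// z2// subrr normr0 mulr_ge0// addr_ge0.
  apply: (HCq (C + C') a c (fun y => xi1 y - xi2 y - f y) f (fun y => xi1 y - xi2 y)) => //.
  - exact: bnd_suppB.
  - by move=> z _; rewrite subrK.
  - by move=> z _; case: bf.
  - exact: nrmB h1 h2 n1 n2.
have stepk xi1 b1 xi2 b2 a c r q : st D xi1 b1 -> st D xi2 b2 -> nrm s xi1 -> nrm s xi2 ->
    (forall y, `|xi1 y - xi2 y| <= q) -> 0 <= a -> 0 <= c -> mclose a c r xi1 b1 xi2 b2 ->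
    mclose ((1 - dm) * a + 4 * L1 / c0 * c) ((4 * (c0 / 16) * c + (1 + 4 * Cb) * (k * (q + r))) / c0) (Cb * (k * (q + r)))
     (Tx s Rop xi1 b1) (Tb s Rop xi1 b1) (Tx s Rop xi2 b2) (Tb s Rop xi2 b2).
  move=> h1 h2 n1 n2 hq a0 ge0c hc; have [hr _] := hc.
  have q0 : 0 <= q := le_trans (normr_ge0 _) (hq 0).
  have r0 : 0 <= r := le_trans (enorm_ge0 _) hr.
  apply: (step hs pert D8 h1 h2 n1 n2 k40 (GB _ _ h1).1 (GB _ _ h2).1 _ _ sp1 L10 e10 mc c00 lc a0 ge0c hc).
    by rewrite mulr_ge0// addr_ge0.
  exact: (G_diff hs pert D8 h1 h2 sp2 (ltW d20) L20 HE KE0 hq hr).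
have thE : th = 1 - dm / 4 := erefl.
have C8E : C8 = 4 * (K * C3 + Cb) := erefl.
clearbody th C8 Cm D Q k0 C6 C5 C3 K.
split.
- move=> xi b hst nx; split; [exact: nT|exact: bnd_supp_le (lexx _) c4k (bT _ _ hst)|exact: lT].
- move=> xi1 b1 xi2 b2 B B' a c r h1 h2 n1 n2 z1 z2 a0 ge0c hc y.
  apply: le_trans (supc _ _ _ _ _ _ _ _ _ h1 h2 n1 n2 z1 z2 a0 ge0c hc y) _.
  by rewrite ler_wpM2r// addr_ge0.
- move=> xi1 b1 xi2 b2 a c r h1 h2 n1 n2 a0 ge0c hc.
  have [hr _] := hc; have r0 : 0 <= r := le_trans (enorm_ge0 _) hr.
  have q y : `|xi1 y - xi2 y| <= Cq * (a + c).
    exact: (supc _ _ _ _ _ _ _ _ _ (let: And4 u _ _ _ := h1 in u) (let: And4 u _ _ _ := h2 in u)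
      n1 n2 (let: And4 _ u _ _ := h1 in u) (let: And4 _ u _ _ := h2 in u) a0 ge0c hc y).
  have := stepk _ _ _ _ _ _ _ _ h1 h2 n1 n2 q a0 ge0c hc.
  set kk := k * (Cq * (a + c) + r) => hc'.
  have kkb : kk <= k0 * (Cq * (a + c + r)).
    apply: le_trans (_ : k0 * (Cq * (a + c) + r) <= _).
      by rewrite ler_wpM2r// addr_ge0// mulr_ge0// addr_ge0.
    by rewrite ler_wpM2l ?(ltW k00)// (mulrDr Cq (a + c)) lerD2l ler_peMl.
  have kk_ge0 : 0 <= kk by rewrite mulr_ge0// addr_ge0// mulr_ge0// addr_ge0.
  have A0 : 0 <= 1 - dm by rewrite subr_ge0.
  have i0 : 0 <= c0^-1 by rewrite invr_ge0 ltW.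
  have Cb4 : 0 <= 1 + 4 * Cb by rewrite addr_ge0// mulr_ge0.
  eexists _, _, _; split; last exact: hc'.
  - exact: (addr_ge0 (mulr_ge0 A0 a0) (mulr_ge0 (mulr_ge0 (mulr_ge0 (ler0n _ 4) L10) i0) ge0c)).
  - exact: (mulr_ge0 (addr_ge0 (mulr_ge0 (mulr_ge0 (ler0n _ 4) (ltW d10)) ge0c) (mulr_ge0 Cb4 kk_ge0)) i0).
  have -> : (1 - dm) * a + 4 * L1 / c0 * c + K * ((4 * (c0 / 16) * c + (1 + 4 * Cb) * kk) / c0) + Cb * kk =
      (1 - dm) * a + (K - 1) / 4 * c + K / 4 * c + (K * C3 + Cb) * kk.
    by rewrite C3E KdE; field; rewrite gt_eqF.
  have h3 : (K * C3 + Cb) * kk <= dm / 4 * (a + c + r).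
    apply: le_trans (ler_wpM2l KC0 kkb) _.
    have -> : (K * C3 + Cb) * (k0 * (Cq * (a + c + r))) = k0 * (C5 - 1) * (a + c + r).
      by rewrite C5E; clear; ring.
    by rewrite ler_wpM2r ?addr_ge0//; linarith.
  rewrite thE.
  have p1 : 0 <= dm * a by rewrite mulr_ge0// ltW.
  have K0 : 0 <= K by linarith.
  have p2 := mulr_ge0 A0 (mulr_ge0 K0 ge0c).
  have p3 := mulr_ge0 A0 r0.
  have p4 := ler_wpM2r ge0c K1.
  have p5 := mulr_ge0 A0 ge0c.
  linarith.
have e0 := G_first pert; have eta4 : 0 <= 4 * eta by rewrite mulr_ge0.
have h0 := st0 (ltW D0).
exists (C3 * (4 * eta)), (Cb * (4 * eta)); split.
- by rewrite mulr_ge0.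
- by rewrite C8E; linarith.
split; first by rewrite subr0; exact: (Tb_bound hs pert D8 h0 eta4 e0).
exists (Tx s Rop (fun=> 0) 0); first by rewrite C3E; exact: (bnd_supp_Tx pert D8 h0 eta4 e0 c00 lc).
by apply: mirror_zero => y; rewrite /= subr0 subrr.
Qed.

(** Iteration from (0, 0): the first step is O(eta), so the geometric series keeps all iterates
    within C9 eta of 0, which is below D. The convergence is pointwise with a uniform rate, so the
    closed conditions that define normalised states pass to the limit. *)
Lemma fixed_point : exists eta0 C : R, [/\ 0 < eta0, 0 <= C &
  forall eta Rop, perturbation eta Rop -> eta <= eta0 -> exists xi b,
    [/\ st (C * eta) xi b, C * eta <= 1 / 8, forall y, annulus y -> xi y = Tx s Rop xi b y &
        b = Tb s Rop xi b]].
Proof.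
have [D [K [Cq [th [C8 [eta0 [[D0 D8 K1 Cq1] [th0 th1 C80 eta00] HT]]]]]]] := map_contracts.
have Cq0 : 0 <= Cq by linarith.
pose C9 := Cq * C8 / (1 - th).
have C90 : 0 <= C9 by rewrite divr_ge0 ?mulr_ge0//; linarith.
have C9E : C9 * (1 - th) = Cq * C8 by rewrite divfK// gt_eqF//; linarith.
have C91 : 0 < C9 + 1 by rewrite ltr_wpDl.
exists (Num.min eta0 (D / (C9 + 1))), C9; split => //; first by rewrite lt_min eta00 divr_gt0.
move=> eta Rop pert; rewrite le_min => /andP[eta1 eta2].
have eta_ge0 : 0 <= eta by case: pert.
have etaD : C9 * eta <= D by move: eta2; rewrite ler_pdivlMr//; linarith.
have [HA supc stepc [cc [rc [cc0 ccr hcc]]]] := HT eta Rop pert eta1.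
clearbody C9.
pose X := fix X (n : nat) : (R * R -> R) * (R * R) := if n is n'.+1 then
  (Tx s Rop (X n').1 (X n').2, Tb s Rop (X n').1 (X n').2) else (fun=> 0, 0).
pose E := C9 * eta.
have E0 : 0 <= E by rewrite mulr_ge0.
have thn n : 0 <= th ^+ n by exact: exprn_ge0.
pose I n := [/\ st D (X n).1 (X n).2, nrm s (X n).1, forall y, `|(X n).1 y| <= E * (1 - th ^+ n),
  enorm (X n).2 <= E * (1 - th ^+ n) & exists a c r, [/\ 0 <= a, 0 <= c, a + K * c + r <= th ^+ n * (C8 * eta) &
    mclose a c r (X n.+1).1 (X n.+1).2 (X n).1 (X n).2]].
have out xi b y : ~~ annulus y -> Tx s Rop xi b y = 0 by exact: Tx_out.
have bT xi b : st D xi b -> nrm s xi -> bnd_supp 2 Cq (Tx s Rop xi b) by move=> h1 h2; have [] := HA _ _ h1 h2.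
have nT xi b : st D xi b -> nrm s xi -> nrm s (Tx s Rop xi b) by move=> h1 h2; have [] := HA _ _ h1 h2.
have stout xi b : st D xi b -> forall y, ~~ annulus y -> xi y = 0 by case.
have next n : I n -> (forall y, `|(X n.+1).1 y - (X n).1 y| <= E * (1 - th) * th ^+ n) /\
    enorm ((X n.+1).2 - (X n).2) <= E * (1 - th) * th ^+ n.
  case=> hst nx _ _ [a [c [r [a0 ge0c hacr hc]]]]; have [hr _] := hc.
  have r0 : 0 <= r := le_trans (enorm_ge0 _) hr.
  have EE : E * (1 - th) * th ^+ n = Cq * (th ^+ n * (C8 * eta)).
    have gen (x9 y' p et cq c8 : R) : x9 * y' = cq * c8 -> x9 * et * y' * p = cq * (p * (c8 * et)).
      by move=> h; transitivity (x9 * y' * et * p); [ring|rewrite h; ring].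
    exact: gen C9E.
  have ac : a + c <= th ^+ n * (C8 * eta) by have := ler_wpM2r ge0c K1; linarith.
  split; rewrite EE.
    move=> y; apply: le_trans (supc _ _ _ _ _ _ _ _ _ (bT _ _ hst nx) (let: And4 u _ _ _ := hst in u)
      (nT _ _ hst nx) nx (out _ _) (stout _ _ hst) a0 ge0c hc y) _.
    exact: ler_wpM2l.
  apply: le_trans hr _; apply: le_trans (_ : th ^+ n * (C8 * eta) <= _).
    by have := ler_wpM2r ge0c K1; linarith.
  by rewrite ler_peMl// mulr_ge0// mulr_ge0.
have HI n : I n.
  elim: n => [|n IH].
    have h0 := st0 (ltW D0).
    split => //.
    - split=> // n; rewrite (@eq_iint _ _ (fun=> 0)) ?iint0// => z; by rewrite mulr0 mul0r.
    - by move=> y /=; rewrite normr0 subrr mulr0.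
    - by rewrite /= enorm0 subrr mulr0.
    by exists 0, cc, rc; split=> //; rewrite expr0 add0r mul1r.
  have [d1 d2] := next n IH; case: (IH) => hst nx xb bb [a [c [r [a0 ge0c hacr hc]]]].
  have [hr _] := hc; have r0 : 0 <= r := le_trans (enorm_ge0 _) hr.
  have Ex : E * (1 - th ^+ n.+1) = E * (1 - th) * th ^+ n + E * (1 - th ^+ n) by rewrite exprS; ring.
  have xb' y : `|(X n.+1).1 y| <= E * (1 - th ^+ n.+1).
    rewrite Ex -[(X n.+1).1 y](subrK ((X n).1 y)).
    by apply: le_trans (ler_normD _ _) _; exact: lerD.
  have bb' : enorm (X n.+1).2 <= E * (1 - th ^+ n.+1).
    rewrite Ex -[(X n.+1).2](subrK (X n).2).
    by apply: le_trans (ler_enormD _ _) _; exact: lerD.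
  have ED : E * (1 - th ^+ n.+1) <= D.
    by apply: le_trans etaD; rewrite ler_piMr//; have := thn n.+1; linarith.
  have hst' : st D (X n.+1).1 (X n.+1).2.
    split.
    - have [mT _ sT] := bT _ _ hst nx; split=> // y; exact: le_trans (xb' y) ED.
    - exact: out.
    - by have [] := HA _ _ hst nx.
    - exact: le_trans bb' ED.
  have nx' := nT _ _ hst nx.
  split=> //.
  have [a' [c' [r' [a0' c0' h' hc']]]] := stepc _ _ _ _ _ _ _ hst' hst nx' nx a0 ge0c hc.
  exists a', c', r'; split=> //; apply: le_trans h' _.
  by rewrite exprS -mulrA ler_wpM2l.
have HN n := next n (HI n).
have /choice[xi Hxi] : forall y, exists l, forall n, `|(X n).1 y - l| <= E * th ^+ n.
  by move=> y; apply: (geometric_limit E0 th0 (ltW th1)) => n; exact: (HN n).1.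
have [b1 Hb1] : exists l, forall n, `|(X n).2.1 - l| <= E * th ^+ n.
  apply: (geometric_limit E0 th0 (ltW th1)) => n.
  exact: le_trans (normr_fst_le ((X n.+1).2 - (X n).2)) (HN n).2.
have [b2 Hb2] : exists l, forall n, `|(X n).2.2 - l| <= E * th ^+ n.
  apply: (geometric_limit E0 th0 (ltW th1)) => n.
  exact: le_trans (normr_snd_le ((X n.+1).2 - (X n).2)) (HN n).2.
pose b : R * R := (b1, b2).
have Hb n : enorm ((X n).2 - b) <= 2 * (E * th ^+ n).
  by apply: le_trans (enorm_le_coord _) _; have := Hb1 n; have := Hb2 n; rewrite /b/=; linarith.
have lim0 (v C : R) : (forall n, v <= C * th ^+ n) -> v <= 0 by exact: geometric_le0.
have bE : enorm b <= E.
  rewrite -subr_le0; apply: (lim0 _ (2 * E)) => n; have [_ _ _ h _] := HI n.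
  have := ler_enormD ((X n).2) (- ((X n).2 - b)); rewrite enormN opprB addrC subrK.
  have := Hb n; have := mulr_ge0 E0 (thn n); linarith.
have xE y : `|xi y| <= E.
  rewrite -subr_le0; apply: (lim0 _ E) => n; have [_ _ h _ _] := HI n.
  have := ler_normB ((X n).1 y) ((X n).1 y - xi y); rewrite subKr.
  have := h y; have := Hxi y n; have := mulr_ge0 E0 (thn n); linarith.
have eq0 (v C : R) : (forall n, `|v| <= C * th ^+ n) -> v = 0.
  by move=> h; apply/eqP; rewrite -normr_le0; exact: lim0 h.
have mxi : measurable_fun setT xi.
  apply: (@measurable_fun_cvg _ _ R setT (fun n => (X n).1)).
    by move=> n; have [[[]]] := HI n.
  move=> y _; apply/cvgrPdist_le => e e_gt0.
  have cv : (E * th ^+ n) @[n --> \oo] --> (0 : R).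
    rewrite -(mulr0 E); apply: cvgMr; apply: cvg_expr; by rewrite ger0_norm.
  have /cvgrPdist_le/(_ _ e_gt0) := cv; apply: filterS => n; rewrite sub0r normrN ger0_norm ?mulr_ge0//.
  by rewrite distrC; exact: le_trans (Hxi y n).
have hst : st D xi b.
  split.
  - split=> // [y|y y2]; first exact: le_trans (xE y) etaD.
    apply: (eq0 _ E) => n; have [[[_ _ h] _ _ _] _ _ _ _] := HI n.
    by have := Hxi y n; rewrite h// sub0r normrN.
  - move=> y ay; apply: (eq0 _ E) => n; have [[_ h _ _] _ _ _ _] := HI n.
    by have := Hxi y n; rewrite h// sub0r normrN.
  - move=> x y ax ay; rewrite -subr_le0; apply: (lim0 _ (2 * E)) => n; have [[_ _ h _] _ _ _ _] := HI n.
    have := h x y ax ay; have := Hxi x n; have := Hxi y n.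
    have := ler_dist3 (xi x) (xi y) ((X n).1 x) ((X n).1 y).
    by rewrite (distrC (xi x) ((X n).1 x)) (distrC (xi y) ((X n).1 y)); linarith.
  - exact: le_trans bE etaD.
have bxi : bnd_supp 2 D xi by case: hst.
have hnrm : nrm s xi.
  split=> [y ay|n].
    apply: (eq0 _ E) => n; have [_ [h _] _ _ _] := HI n.
    by have := Hxi (enorm y *: e1) n; rewrite h// sub0r normrN.
  pose Cn := 2 * (4 * enorm n * kernel_mass (kap s) (2 + 2)) * iint (cutoff 2).
  apply: (eq0 _ (E * Cn)) => k'; have [[bX _ _ _] [_ h] _ _ _] := HI k'.
  have bd : bnd_supp 2 (E * th ^+ k') (fun z => (X k').1 z - xi z).
    by have [m1 _ s1] := bnd_suppB bX bxi; split=> // z; exact: Hxi.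
  have [_] := integ_nrm hs n bd.
  rewrite (@eq_iint _ _ (fun z => domega (dotp z z) * (X k').1 z * conv (gw n) z -
   domega (dotp z z) * xi z * conv (gw n) z)); last by move=> z; ring.
  rewrite iintB; [|exact: (integ_nrm hs n bX).1|exact: (integ_nrm hs n bxi).1].
  by rewrite h sub0r normrN => h'; apply: le_trans h' _; rewrite /Cn; linarith.
(* Iterate and limit are close with a = 0, the whole difference being counted in the sup norm; by
   the contraction their images are close too, which identifies the limit with its image. *)
have [C HC] : exists C : R, forall n, exists a c r, [/\ 0 <= a, 0 <= c, Cq * (a + c) <= C * th ^+ n, r <= C * th ^+ n &
   mclose a c r (X n.+1).1 (X n.+1).2 (Tx s Rop xi b) (Tb s Rop xi b)].
  exists (Cq * ((K + 2) * E)) => m; have [hm nm _ _ _] := HI m.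
  have Et0 := mulr_ge0 E0 (thn m).
  have cl : mclose 0 (E * th ^+ m) (2 * (E * th ^+ m)) (X m).1 (X m).2 xi b.
    split; first exact: Hb.
    exists (fun y => (X m).1 y - xi y).
      have bX : bnd_supp 2 D (X m).1 by case: hm.
      by have [m1 _ s1] := bnd_suppB bX bxi; split=> // z; exact: Hxi.
    by apply: mirror_zero => y; rewrite subrr.
  have [a' [c' [r' [a0' c0' h' hc']]]] := stepc _ _ _ _ _ _ _ hm hst nm hnrm (lexx 0) Et0 cl.
  have [hr' _] := hc'; have r0' : 0 <= r' := le_trans (enorm_ge0 _) hr'.
  have h2 : a' + K * c' + r' <= (K + 2) * (E * th ^+ m).
    apply: le_trans h' _; rewrite add0r -mulrDl ler_piMl ?(ltW th1)// mulr_ge0//; linarith.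
  have c1 := ler_wpM2r c0' K1.
  exists a', c', r'; split => //.
    rewrite (_ : Cq * ((K + 2) * E) * _ = Cq * ((K + 2) * (E * th ^+ m))); last by ring.
    rewrite ler_wpM2l//; linarith.
  rewrite (_ : Cq * ((K + 2) * E) * _ = Cq * ((K + 2) * (E * th ^+ m))); last by ring.
  have h3 : 0 <= (K + 2) * (E * th ^+ m) by rewrite mulr_ge0//; linarith.
  have := ler_wpM2r h3 Cq1; linarith.
have nTx := nT _ _ hst hnrm; have bTx := bT _ _ hst hnrm.
exists xi, b; split.
- by case: hst => [[m1 h1 s1] h2 h3 h4]; split.
- exact: le_trans etaD D8.
- move=> y _; apply/eqP; rewrite -subr_eq0; apply/eqP; apply: (eq0 _ (C + E)) => n.
  have [a [c [r [a0 ge0c h1 _ hc]]]] := HC n; have [hn nn _ _ _] := HI n.+1.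
  have := supc _ _ _ _ _ _ _ _ _ (let: And4 u _ _ _ := hn in u) bTx nn nTx (stout _ _ hn) (out _ _) a0 ge0c hc y.
  have := Hxi y n.+1.
  have : E * th ^+ n.+1 <= E * th ^+ n by rewrite ler_wpM2l// exprS ler_piMl// ltW.
  have := ler_distD ((X n.+1).1 y) (xi y) (Tx s Rop xi b y); rewrite (distrC (xi y) ((X n.+1).1 y)); linarith.
- apply/eqP; rewrite -subr_eq0 -enorm_eq0; apply/eqP; apply: (eq0 _ (C + 2 * E)) => n.
  have [a [c [r [_ _ _ h1 [hr _]]]]] := HC n.
  rewrite ger0_norm ?enorm_ge0//.
  have := Hb n.+1.
  have : E * th ^+ n.+1 <= E * th ^+ n by rewrite ler_wpM2l// exprS ler_piMl// ltW.
  have := ler_enorm_distD (X n.+1).2 b (Tb s Rop xi b); rewrite (enormBC b (X n.+1).2); linarith.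
Qed.

End fixed_point.

Lemma slope_remainder (R : realType) (a k n e : R) : 0 < a -> 0 <= n ->
  a * (2 * (12 * k + 1)) = e -> 2 * k * (6 * a * n) <= e / 2 * n.
Proof.
move=> ha hn h; have h1 : 12 * k * a <= e / 2 by linarith.
by have := ler_wpM2r hn h1; linarith.
Qed.

(** * From the fixed point to a vortex of class C^1 *)

Section core.
Context {R : realType}.
Variable s : R.
Hypothesis hs : 0 < s <= 1.
Implicit Types (x y z v b : (R * R)%type) (f h xi : R * R -> R) (t a c : R).
Notation conv := (convk (kap s)).
Notation lam := (lam s).
Let lk := kap_locally_integrable hs.
Let B2 : (0 : R) <= 2. Proof. by []. Qed.
Let B3 : (0 : R) <= 3. Proof. by []. Qed.

Lemma cutoff_mass_gt0 : 0 < iint (@cutoff R 1).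
Proof.
pose b := 1 / 2 : R.
pose Bx : set (R * R) := `[0, b] `*` `[0, b].
have mB : measurable (Bx : set (measurableTypeR R * measurableTypeR R)%type) by exact: measurableX.
have b0 : 0 < b by rewrite divr_gt0.
have aB : @area R Bx = (b * b)%:E.
  by rewrite /area /Bx product_measure1E//= !lebesgue_measure_itv/= !lte_fin b0 oppr0 !adde0.
have le z : \1_Bx z <= cutoff 1 z :> R.
  rewrite indicE cutoffE; case: (boolP (z \in Bx)) => /= [|_]; last exact: ler0n.
  rewrite inE /Bx /= !in_itv/= => -[/andP[z1 z1'] /andP[z2 z2']].
  suff -> : enorm z <= 1 by [].
  apply: le_trans (enorm_le_coord _) _; rewrite /b in z1' z2'.
  by rewrite !ger0_norm; linarith.
have iB : integ (\1_Bx).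
  apply: (@le_integ _ _ (cutoff 1)); [exact: measurable_indic| |exact: integrable_cutoff].
  by move=> z; rewrite ger0_norm// indicE ler0n.
apply: lt_le_trans (_ : iint (\1_Bx) <= _); last exact: le_iint (integrable_cutoff 1) le.
have -> : iint (\1_Bx) = fine (@area R Bx) by rewrite iintE /Rintegral integral_indic// setIT.
by rewrite aB/= mulr_gt0.
Qed.

Lemma C1at_of_cont f (g1 g2 : R * R -> R) y : (\forall x \near y, has_grad f x (g1 x, g2 x)) ->
  {for y, continuous g1} -> {for y, continuous g2} -> C1at f y.
Proof.
move=> hg c1 c2; have [r r0 H] := (nbhs_enormP y _).1 hg.
exists (fun x => (g1 x, g2 x)), r; split => // e e0.
have e2 : 0 < e / 2 by rewrite divr_gt0.
have /cvgrPdist_le/(_ _ e2)/nbhs_enormP[d1 d10 H1] := c1.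
have /cvgrPdist_le/(_ _ e2)/nbhs_enormP[d2 d20 H2] := c2.
exists (Num.min d1 d2); first by rewrite lt_min d10.
move=> x; rewrite lt_min => /andP[x1 x2]; apply: le_trans (enorm_le_coord _) _.
have := H1 x x1; have := H2 x x2; rewrite /= (distrC (g1 y)) (distrC (g2 y)); linarith.
Qed.

Lemma continuous_nsq : continuous (fun z : R * R => dotp z z).
Proof.
move=> z; rewrite /dotp; apply: cvgD; apply: cvgM;
  by [apply: (@cvg_fst _ _ (nbhs z.1) (nbhs z.2))|apply: (@cvg_snd _ _ (nbhs z.1) (nbhs z.2))].
Qed.

Lemma near_nsq_lt y c : dotp y y < c -> \forall x \near y, dotp x x < c.
Proof. by move=> h; apply: (cvgr_lt _ (@continuous_nsq y)). Qed.

Lemma near_nsq_gt y c : c < dotp y y -> \forall x \near y, c < dotp x x.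
Proof. by move=> h; apply: (cvgr_gt _ (@continuous_nsq y)). Qed.

Section solution.
Variables (eta D : R) (Rop : (R * R -> R) -> R * R -> R) (xi : R * R -> R) (b : R * R).
Hypotheses (pert : perturbation eta Rop) (D8 : D <= 1 / 8) (hst : st D xi b).
Hypothesis fixT : forall y, annulus y -> xi y = Tx s Rop xi b y.
Hypothesis fixb : b = Tb s Rop xi b.
Let w := W xi.
Definition Psi y := conv w y + Rop w y + dotp b y.

Let bw : bnd_supp 2 1 w. Proof. exact: bnd_supp_W D8 hst. Qed.
Let lw : lip_on setT 40 w. Proof. exact: lip_W D8 hst. Qed.

Lemma C1at_Psi y : C1at Psi y.
Proof.
apply: C1atD; last exact: C1at_dotp; apply: C1atD; first exact: C1at_conv B2 bw lw.
by case: pert => _ _ _ H; exact: (H _ _ _ bw lw).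
Qed.

Lemma Psi_Th y : Psi y = conv W0 y + (Th s Rop xi y + dotp b y).
Proof.
have E := convkB lk y bw (@bnd_supp_W0 R).
rewrite /Psi /Th -/w E; set A := conv w y; set A' := conv W0 y; ring.
Qed.

(** The fixed point equation read backwards: [G] was obtained from this identity. *)
Lemma Psi_level y : annulus y -> Psi y = Psi (rr xi y *: e1).
Proof.
move=> ay; have ln : lam (dotp y y) != 0.
  by have [c c0 /(_ y ay) h] := lam_annulus hs; rewrite lt_eqF//; lra.
have := TxE hs Rop xi b ay; rewrite -fixT// -fixb /G on_annulusE// /Er.
have [r1 _ r2 _] := rr_bounds D8 hst ay.
rewrite !Psi_Th !conv_W0// dotpZl !dotpZr unit_e1 mulr1 -expr2 r2 lin_Ze1 [dotp b e1]/dotp/= mulr1 mulr0 addr0.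
lra.
Qed.

Lemma rr_continuous y : 7 / 4 < dotp y y < 13 / 4 -> {for y, continuous (rr xi)}.
Proof.
move=> /andP[y1 y2].
apply/cvgrPdist_le => e e0; near=> x.
have ax : annulus x.
  by apply/andP; split; apply: ltW; near: x; [exact: near_nsq_gt|exact: near_nsq_lt].
have ay : annulus y by rewrite /annulus !ltW.
have [r1 _ r2 _] := rr_bounds D8 hst ay; have [q1 _ q2 _] := rr_bounds D8 hst ax.
have h : `|(rr xi y - rr xi x) * (rr xi y + rr xi x)| <= 5 * enorm (y - x).
  rewrite -subr_sqr r2 q2 (_ : _ - _ = (dotp y y - dotp x x) + (xi y - xi x)); last by ring.
  apply: le_trans (ler_normD _ _) _; case: hst => _ _ /(_ y x ay ax) h _.
  have := nsq_lip2 (annulus_enorm ay) (annulus_enorm ax); lra.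
apply: (@le_trans _ _ (5 * enorm (y - x))).
  by apply: le_trans h; rewrite normrM ler_peMr// ger0_norm; lra.
rewrite mulrC -ler_pdivlMr// enormBC; apply: ltW; near: x; apply: near_enorm; exact: divr_gt0.
Unshelve. all: by end_near. Qed.

Variable c0 : R.
Hypotheses (c00 : 0 < c0) (lc : forall t, 0 < t -> t <= 5 -> lam t <= - c0).
Hypothesis small : lip_on [set y | enorm y <= 3] (c0 / 4) (Th s Rop xi).
Hypothesis Dc : D <= c0 / 4.

Let p1 := 'D_e1 Psi.
Let p2 := 'D_e2 Psi.
Let gP y : has_grad Psi y (p1 y, p2 y).
Proof.
have [g hg] := has_grad_C1at (C1at_Psi y); have := has_grad_grad hg; rewrite /grad -/p1 -/p2 => E.
by rewrite E.
Qed.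

(** The radial vortex contributes 2 lam (t^2) t <= - 2 c0, and the rest has slope at most c0 / 4 + D
    <= c0 / 2. *)
Lemma p1_neg t : 1 <= t -> t <= 2 -> p1 (t *: e1) <= - c0.
Proof.
move=> t1 t2; have t0 : 0 <= t by lra.
have y0 : t *: (e1 : R * R) != 0 by rewrite -enorm_eq0 enorm_Ze1// gt_eqF//; lra.
have hW := has_grad_conv_W0 hs y0.
have hT := has_gradB (gP (t *: e1)) hW.
have hl : enorm ((p1 (t *: e1), p2 (t *: e1)) - (2 * lam (dotp (t *: (e1 : R * R)) (t *: e1))) *: (t *: (e1 : R * R))) <= c0 / 4 + D.
  apply: has_grad_lip (_ : 0 < 1 :> R) _ hT => // v v1.
  have v3 : enorm (t *: (e1 : R * R) + v) <= 3.
    by apply: le_trans (ler_enormD _ _) _; rewrite enorm_Ze1//; lra.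
  have v3' : enorm (t *: (e1 : R * R)) <= 3 by rewrite enorm_Ze1//; lra.
  rewrite !Psi_Th (_ : _ - _ = (Th s Rop xi (t *: e1 + v) - Th s Rop xi (t *: e1)) + dotp b v); last first.
    by rewrite dotpDr; ring.
  apply: le_trans (ler_normD _ _) _; rewrite mulrDl; apply: lerD.
    by have := small v3 v3'; rewrite (_ : t *: e1 + v - t *: e1 = v)// addrAC subrr add0r.
  apply: le_trans (normr_dotp _ _) _; rewrite ler_wpM2r ?enorm_ge0//; by case: hst.
have := le_trans (normr_fst_le _) hl; rewrite dotpZl dotpZr unit_e1 mulr1.
have -> : ((p1 (t *: e1), p2 (t *: e1)) - (2 * lam (t * t)) *: (t *: (e1 : R * R))).1 =
  p1 (t *: e1) - 2 * lam (t * t) * (t * 1) by [].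
have tt : 0 < t * t by rewrite mulr_gt0; lra.
have tt5 : t * t <= 5 by nra.
have := lc tt tt5; have Dc' := Dc; have c00' := c00; rewrite mulr1.
rewrite ler_norml => l1 /andP[_ l2].
have : 2 * lam (t * t) * t <= - (2 * c0) by nra.
lra.
Qed.

(** The expected ratio of the gradients of w and Psi: from w = omega (rr^2) and Psi y = Psi (rr e1),
    the chain rule gives grad rr = grad Psi / p1 (rr e1). *)
Let kk y : R := if annulus y then domega (dotp y y + xi y) * (2 * rr xi y) / p1 (rr xi y *: e1) else 0.

Lemma kk_out y : (dotp y y < 15 / 8) || (25 / 8 < dotp y y) -> kk y = 0.
Proof.
move=> h; rewrite /kk; case: ifPn => // ay; rewrite domega_out ?mul0r//.
have : `|xi y| <= D by case: hst => -[]. 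
have D8' := D8; rewrite ler_norml => /andP[x1 x2].
by case/orP: h => h; apply/orP; [left|right]; lra.
Qed.

(** An implicit function argument by hand, [xi] being only Lipschitz: this makes the displacement of
    rr at most 5 |v|, and [Psi_level] equates the increments of Psi at y and along the ray, both
    known to first order. *)
Lemma has_grad_w_in y : 7 / 4 < dotp y y < 13 / 4 -> has_grad w y (kk y *: (p1 y, p2 y)).
Proof.
move=> hy; have /andP[y1 y2] := hy; have ay : annulus y by rewrite /annulus !ltW.
have [r1 r2 r3 _] := rr_bounds D8 hst ay.
set r := rr xi y in r1 r2 r3; pose G1 := p1 (r *: e1).
have G1n : G1 <= - c0 := p1_neg r1 r2.
have c00' := c00; have G0 : 0 < - G1 by lra.
pose K := 2 * r / - G1.
have K0 : 0 < K by rewrite divr_gt0//; lra.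
have [r' r'0 Hr] : exists2 r' : R, 0 < r' & forall x, enorm (x - y) < r' -> annulus x.
  apply/nbhs_enormP; near=> x.
  by apply/andP; split; apply: ltW; near: x; [exact: near_nsq_gt|exact: near_nsq_lt].
move=> e e0.
(* t' - t is, up to o(|v|), the increment of Psi divided by the radial derivative *)
pose e1' := e / (2 * (12 * K + 1)).
have K12 : 0 < 2 * (12 * K + 1) by rewrite mulr_gt0// ltr_wpDl// mulr_ge0// ltW.
have e10 : 0 < e1' by rewrite divr_gt0.
have [d1 d10 H1] := gP y e10; have [d2 d20 H2] := gP (r *: e1) e10.
(* 250 = 8 * 25 + 2 * 25 covers the remainder of [omega_taylor] and the quadratic term in q - r,
   since |T| and |q - r| are at most 5 |v|. *)
pose m := e / (2 * 250 * (1 + K * `|G1|)) .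
have M0 : 0 < 2 * 250 * (1 + K * `|G1|) by rewrite mulr_gt0// ltr_pwDl// mulr_ge0// ltW.
have m0 : 0 < m by rewrite divr_gt0.
exists (Num.min (Num.min d1 (d2 / 5)) (Num.min r' m)); first by rewrite !lt_min d10 r'0 m0 divr_gt0.
move=> v; rewrite !lt_min => /andP[/andP[v1 v2] /andP[v3 v4]].
have v0 := enorm_ge0 v.
have ax : annulus (y + v) by apply: Hr; rewrite addrAC subrr add0r.
have [q1 q2 q3 _] := rr_bounds D8 hst ax.
set q := rr xi (y + v) in q1 q2 q3.
pose T := dotp (y + v) (y + v) + xi (y + v) - (dotp y y + xi y).
have TE : T = (q - r) * (q + r) by rewrite /T -q3 -r3; ring.
have Tv : `|T| <= 5 * enorm v.
  rewrite /T (_ : _ - _ = (dotp (y + v) (y + v) - dotp y y) + (xi (y + v) - xi y)); last by ring.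
  apply: le_trans (ler_normD _ _) _; case: hst => _ _ /(_ (y + v) y ax ay) h _.
  by have := nsq_lip2 (annulus_enorm ax) (annulus_enorm ay); rewrite addrAC subrr add0r in h *; lra.
have qr : `|q - r| <= `|T| by rewrite TE normrM ler_peMr// ger0_norm; lra.
have qrv : `|q - r| <= 5 * enorm v by apply: le_trans qr Tv.
have qd : enorm ((q - r) *: (e1 : R * R)) < d2.
  rewrite enormZ enorm_e1 mulr1; apply: le_lt_trans qrv _.
  by rewrite mulrC -ltr_pdivlMr.
have := H2 _ qd; have := H1 v v1.
rewrite -scalerDl [r + _]addrC subrK -(Psi_level ay) -(Psi_level ax) dotpZr.
have -> : dotp (p1 (r *: e1), p2 (r *: e1)) e1 = G1 by rewrite /dotp/= mulr1 mulr0 addr0.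
rewrite enormZ enorm_e1 mulr1 => u1 u2.
set P := Psi (y + v) - Psi y in u1 u2; set d := dotp (p1 y, p2 y) v in u1.
have u3 : `|(q - r) * G1 - d| <= 6 * e1' * enorm v.
  rewrite (_ : _ - d = (P - d) - (P - (q - r) * G1)); last by ring.
  apply: le_trans (ler_normB _ _) _.
  have := ler_wpM2l (ltW e10) qrv; lra.
have G10 : G1 != 0 by rewrite lt_eqF//; lra.
have kE : kk y = - domega (dotp y y + xi y) * K.
  rewrite /kk ay -/r -/G1 /K; by field; rewrite ?oppr_eq0 G10.
have om := omega_taylor (dotp y y + xi y) T.
have -> : w (y + v) = omega (dotp y y + xi y + T) by rewrite /w /W /T; congr omega; ring.
rewrite -[w y]/(omega (dotp y y + xi y)) dotpZl -/d kE.
set dw := domega _ in om *; have dw2 : `|dw| <= 2 := domega_norm _.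
rewrite (_ : _ - _ - _ = (omega (dotp y y + xi y + T) - omega (dotp y y + xi y) - dw * T)
  + dw * (q - r) ^+ 2 - dw * K * ((q - r) * G1 - d)); last first.
  have gen (A k' a c g d' : R) : g != 0 -> A - - k' * (2 * c / - g) * d' =
      A - k' * ((a - c) * (a + c)) + k' * (a - c) ^+ 2 - k' * (2 * c / - g) * ((a - c) * g - d').
    by move=> g0; field.
  by rewrite TE /K; exact: gen.
apply: le_trans (ler_normB _ _) _.
have T2 : T ^+ 2 <= 25 * enorm v ^+ 2.
  by rewrite -real_normK ?num_real// (_ : 25 = 5 ^+ 2); [rewrite -exprMn ler_pXn2r ?nnegrE ?mulr_ge0|ring].
have q2' : (q - r) ^+ 2 <= 25 * enorm v ^+ 2.
  by rewrite -real_normK ?num_real// (_ : 25 = 5 ^+ 2); [rewrite -exprMn ler_pXn2r ?nnegrE ?mulr_ge0|ring].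
have w1 : `|dw * (q - r) ^+ 2| <= 2 * (25 * enorm v ^+ 2).
  by rewrite normrM; apply: ler_pM => //; rewrite ger0_norm ?sqr_ge0.
have w2 : `|dw * K * ((q - r) * G1 - d)| <= 2 * K * (6 * e1' * enorm v).
  rewrite normrM (normrM dw) (gtr0_norm K0); apply: ler_pM => //; first by rewrite mulr_ge0// ltW.
  by rewrite ler_wpM2r// ltW.
have w3 := ler_normD (omega (dotp y y + xi y + T) - omega (dotp y y + xi y) - dw * T) (dw * (q - r) ^+ 2).
have w4 : 250 * enorm v ^+ 2 <= e / 2 * enorm v.
  rewrite expr2 mulrA ler_wpM2r//; move: v4; rewrite /m ltr_pdivlMr// => v4.
  have : 0 <= enorm v * (K * `|G1|) by rewrite mulr_ge0// mulr_ge0// ltW.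
  lra.
have w5 : 2 * K * (6 * e1' * enorm v) <= e / 2 * enorm v.
  by apply: slope_remainder => //; rewrite /e1' divfK// gt_eqF.
by have := sqr_ge0 (enorm v); lra.
Unshelve. all: by end_near. Qed.

Lemma has_grad_const f y k : (\forall x \near y, f x = k) -> has_grad f y 0.
Proof.
move=> /nbhs_enormP[r r0 H]; apply: (@eq_has_grad _ (fun=> k) _ _ _ r) => //.
  by move=> x xr; rewrite H.
exact: has_grad_cst.
Qed.

Lemma has_grad_w y : has_grad w y (kk y *: (p1 y, p2 y)).
Proof.
have [h1|h1] := ltP (dotp y y) (15 / 8).
  rewrite kk_out ?h1// scale0r; apply: (@has_grad_const _ _ 1).
  near=> x; apply: (W_core D8 hst); apply: ltW; near: x; exact: near_nsq_lt.
have [h2|h2] := ltP (25 / 8) (dotp y y).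
  rewrite kk_out ?h2 ?orbT// scale0r; apply: (@has_grad_const _ _ 0).
  near=> x; apply: (W_supp D8 hst); apply: ltW; near: x; exact: near_nsq_gt.
by apply: has_grad_w_in; apply/andP; split; lra.
Unshelve. all: by end_near. Qed.

(** The gradient [kk] times grad Psi is continuous: inside the annulus [rr] is continuous, Psi is
    C^1 and [p1] does not vanish on the ray; elsewhere [kk] is locally 0. *)
Lemma C1at_w y : C1at w y.
Proof.
have [_ _ c1 c2] := C1at_C1 C1at_Psi.
have kc : {for y, continuous kk}.
  have [h1|h1] := ltP (dotp y y) (15 / 8).
    apply: (@cvg_near_cst _ _ (kk y)); near=> x; rewrite !kk_out ?h1//.
    by apply/orP; left; near: x; exact: near_nsq_lt.
  have [h2|h2] := ltP (25 / 8) (dotp y y).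
    apply: (@cvg_near_cst _ _ (kk y)); near=> x; rewrite !kk_out ?h2 ?orbT//.
    by apply/orP; right; near: x; exact: near_nsq_gt.
  have hy : 7 / 4 < dotp y y < 13 / 4 by apply/andP; split; lra.
  have /andP[y1 y2] := hy; have ay : annulus y by rewrite /annulus !ltW.
  have [r1 r2 r3 _] := rr_bounds D8 hst ay.
  have rc := rr_continuous hy.
  have pc : p1 (rr xi x *: e1) @[x --> y] --> p1 (rr xi y *: e1).
    apply: (@cvg_comp _ _ _ (fun x => rr xi x *: (e1 : R * R)) p1 _ (nbhs (rr xi y *: (e1 : R * R)))); last exact: c1.
    by apply: cvgZr_tmp; exact: rc.
  have dc : domega (rr xi x ^+ 2) @[x --> y] --> domega (rr xi y ^+ 2).
    have dcont : continuous (@domega R).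
      move=> t; apply/cvgrPdist_le => e e0; near=> u; apply: le_trans (domega_dist _ _) _.
      rewrite mulrC -ler_pdivlMr//; near: u; apply: cvgr_dist_le => //; exact: divr_gt0.
    apply: (@cvg_comp _ _ _ (fun x => rr xi x ^+ 2) (@domega R) _ (nbhs (rr xi y ^+ 2))); last exact: dcont.
    by rewrite expr2; exact: (cvgM rc rc).
  have pn : p1 (rr xi y *: e1) != 0.
    by have := p1_neg r1 r2; have c00' := c00 => h; rewrite lt_eqF//; lra.
  have kE x : annulus x -> kk x = domega (rr xi x ^+ 2) * (2 * rr xi x) * (p1 (rr xi x *: e1))^-1.
    by move=> ax; rewrite /kk ax; have [_ _ -> _] := rr_bounds D8 hst ax.
  have cv : domega (rr xi x ^+ 2) * (2 * rr xi x) * (p1 (rr xi x *: e1))^-1 @[x --> y] --> kk y.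
    rewrite kE//; apply: cvgM; last exact: cvgV.
    by apply: cvgM dc _; apply: cvgM => //; exact: cvg_cst.
  apply: cvg_trans cv; apply: near_eq_cvg; near=> x; rewrite kE//.
  by apply/andP; split; apply: ltW; near: x; [exact: near_nsq_gt|exact: near_nsq_lt].
apply: (@C1at_of_cont _ (fun x => kk x * p1 x) (fun x => kk x * p2 x)).
- by near=> x; exact: has_grad_w.
- by apply: cvgM => //; exact: c1.
- by apply: cvgM => //; exact: c2.
Unshelve. all: by end_near. Qed.

End solution.

(** The bound by [cutoff 1] keeps the mass of w away from 0 uniformly in the perturbation, which the
    later normalisation requires. *)
Lemma core_vortex : exists eta0 C : R, [/\ 0 < eta0, 0 <= C &
  forall eta Rop, perturbation eta Rop -> eta <= eta0 -> exists w b,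
    [/\ bnd_supp 2 1 w, lip_on setT 40 w, forall y, C1at w y /\ cutoff 1 y <= w y, enorm b <= C * eta &
        forall y, exists g k, has_grad (fun y => conv w y + Rop w y + dotp b y) y g /\ has_grad w y (k *: g)]].
Proof.
have [eta0 [C [eta00 C0 H]]] := fixed_point hs.
have [c0 c00 lc] := lam_neg hs.
(* In [Th_lip] the term 80 d becomes c0 / 12, and the bound on eta keeps the other two terms below
   c0 / 12, within the c0 / 4 required. *)
have d0 : 0 < c0 / 960 := divr_gt0 c00 (ltr0Sn R 959).
have [e [L [_ L0 sp]]] := conv_split hs B2 B3 d0.
pose Q := 2 * L * C + 1.
have Q0 : 0 < Q by rewrite ltr_wpDl// !mulr_ge0.
have C10 : 0 < C + 1 by rewrite ltr_wpDl.
exists (Num.min eta0 (Num.min (c0 / 12 / Q) (c0 / 4 / (C + 1)))), C.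
split => //; first by rewrite !lt_min eta00 !divr_gt0.
move=> eta Rop pert; rewrite !le_min => /and3P[h1 h2 h3].
have eta_ge0 : 0 <= eta by case: pert.
have [xi [b [hst D8 fixT fixb]]] := H eta Rop pert h1.
have small : lip_on [set y | enorm y <= 3] (c0 / 4) (Th s Rop xi).
  move=> x y x3 y3; apply: le_trans (Th_lip pert D8 hst sp x3 y3) _.
  rewrite ler_wpM2r ?enorm_ge0//; move: h2; rewrite ler_pdivlMr// /Q; linarith.
have Dc : C * eta <= c0 / 4 by move: h3; rewrite ler_pdivlMr//; linarith.
exists (W xi), b; split.
- exact: bnd_supp_W D8 hst.
- exact: lip_W D8 hst.
- move=> y; split; first exact: (C1at_w pert D8 hst fixT fixb c00 lc small Dc).
  rewrite cutoffE; case: (leP (enorm y) 1) => y1; last by rewrite /W omega_ge0.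
  rewrite (W_core D8 hst)//; have := enorm_sqr y; have := enorm_ge0 y; nra.
- by case: hst.
- move=> y; have hw := has_grad_w pert D8 hst fixT fixb c00 lc small Dc y.
  have [g hg] := has_grad_C1at (C1at_Psi pert D8 hst y).
  exists g; eexists; split; first exact: hg.
  have := has_grad_grad hg; rewrite /grad => E; rewrite -E; exact: hw.
Qed.

End core.

(** * The field of the periodic images *)

Section telescoping.
Context {R : realType}.
Implicit Types (v : nat -> R) (C : R).

(** The comparison sequence in place of 1 / j^2: its tail from N on is exactly 1 / N, which gives
    every series an explicit rate. *)
Definition tele (j : nat) : R := (j%:R * j.+1%:R)^-1.

Lemma tele_ge0 j : 0 <= tele j.
Proof. by rewrite invr_ge0 mulr_ge0. Qed.

Lemma teleE j : (0 < j)%N -> tele j = j%:R^-1 - j.+1%:R^-1.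
Proof.
move=> j0; have n0 : j%:R != 0 :> R by rewrite pnatr_eq0 -lt0n.
have n1 : j%:R + 1 != 0 :> R by rewrite natr1 pnatr_eq0.
by rewrite /tele -[j.+1%:R]natr1; field; apply/andP.
Qed.

Lemma tele_sum J n : (0 < J)%N -> \sum_(J <= j < J + n) tele j = J%:R^-1 - (J + n)%:R^-1.
Proof.
move=> J0; elim: n => [|n IH]; first by rewrite addn0 big_geq// subrr.
by rewrite addnS big_nat_recr ?leq_addr//= IH teleE ?addn_gt0 ?J0// addrA subrK.
Qed.

Lemma sqr_inv_tele j : (0 < j)%N -> (j%:R ^+ 2)^-1 <= 2 * tele j :> R.
Proof.
move=> j0; have jp : 0 < j%:R :> R by rewrite ltr0n.
have j1 : 1 <= j%:R :> R by rewrite ler1n.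
rewrite /tele -[j.+1%:R]natr1; set x : R := j%:R in jp j1 *.
have -> : 2 * (x * (x + 1))^-1 = (x * (x + 1) / 2)^-1 by rewrite [in RHS]invfM invrK mulrC.
have x0 : 0 < x * (x + 1) / 2 by rewrite divr_gt0// mulr_gt0//; linarith.
by rewrite lef_pV2 ?posrE ?exprn_gt0// expr2; nra.
Qed.

Lemma tele_tail v C J N n : (0 < J)%N -> (J <= N)%N -> 0 <= C ->
  (forall j, (J <= j)%N -> `|v j| <= C * tele j) ->
  `|\sum_(j < N + n) v j - \sum_(j < N) v j| <= C * N%:R^-1.
Proof.
move=> J0 JN C0 vC; rewrite -!(big_mkord xpredT v) (@big_cat_nat _ _ _ N) ?leq_addr//= addrAC subrr add0r.
have N0 : (0 < N)%N by exact: leq_trans JN.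
apply: le_trans (_ : \sum_(N <= j < N + n) C * tele j <= _).
  apply: le_trans (ler_norm_sum _ _ _) _; apply: ler_sum_nat => j /andP[Nj _].
  by apply: vC; exact: leq_trans Nj.
by rewrite -big_distrr/= tele_sum// ler_wpM2l// gerBl invr_ge0.
Qed.

Lemma tele_limit v C J : (0 < J)%N -> 0 <= C -> (forall j, (J <= j)%N -> `|v j| <= C * tele j) ->
  exists L, forall N, (J <= N)%N -> `|\sum_(j < N) v j - L| <= C * N%:R^-1.
Proof.
move=> J0 C0 vC.
have [L HL] : exists L, forall n, `|\sum_(j < J + n) v j - L| <= C * (J + n)%:R^-1.
  apply: cauchy_limit => n m.
  have p k : 0 <= C * (J + k)%:R^-1 by rewrite mulr_ge0 ?invr_ge0.
  have [nm|/ltnW nm] := leqP n m.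
    have := tele_tail (m - n) J0 (leq_addr n J) C0 vC; rewrite -addnA subnKC// distrC => h.
    by apply: le_trans h _; rewrite lerDl.
  have := tele_tail (n - m) J0 (leq_addr m J) C0 vC; rewrite -addnA subnKC// => h.
  by apply: le_trans h _; rewrite lerDr.
by exists L => N JN; have := HL (N - J)%N; rewrite subnKC.
Qed.

Lemma inv_nat_small (e : R) : 0 < e -> exists2 N0 : nat, (0 < N0)%N & forall N, (N0 <= N)%N -> N%:R^-1 <= e.
Proof.
move=> e0; exists (Num.truncn e^-1).+1 => // N hN.
have N0 : 0 < N%:R :> R by rewrite ltr0n (leq_trans _ hN).
rewrite -[e]invrK lef_pV2 ?posrE ?invr_gt0//; apply: ltW.
by apply: lt_le_trans (_ : (Num.truncn e^-1).+1%:R <= _); [exact: truncnS_gt|rewrite ler_nat].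
Qed.

Lemma tele_cvg v C J L : (forall N, (J <= N)%N -> `|\sum_(j < N) v j - L| <= C * N%:R^-1) ->
  (\sum_(j < N.+1) v j) @[N --> \oo] --> L.
Proof.
move=> H; apply/cvgrPdist_le => e e0.
have C1 : 0 < `|C| + 1 by rewrite ltr_wpDl.
have [N0 N00 HN] := inv_nat_small (divr_gt0 e0 C1).
near=> N; rewrite distrC; apply: le_trans (H _ _) _.
  by apply: leqW; near: N; exact: nbhs_infty_ge.
have : N.+1%:R^-1 <= e / (`|C| + 1) :> R by apply: HN; apply: leqW; near: N; exact: nbhs_infty_ge.
rewrite ler_pdivlMr// => h; apply: le_trans h; rewrite mulrC ler_wpM2l ?invr_ge0//.
by have := ler_norm C; linarith.
Unshelve. all: by end_near. Qed.

End telescoping.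

Section symmetric_sums.
Context {V : nmodType}.

Definition paired (F : int -> V) (j : nat) : V := if j is i.+1 then F i.+1%:Z + F (- i.+1%:Z) else F 0.

Lemma symsum_paired (F : int -> V) N : symsum F N = \sum_(j < N.+1) paired F j.
Proof.
elim: N => [|N IH]; first by rewrite /symsum !big_ord1.
rewrite [RHS]big_ord_recr/= -IH /symsum doubleS big_ord_recr big_ord_recl/=.
have -> : 0%:Z - N.+1%:Z = - N.+1%:Z by rewrite sub0r.
have -> : (N.*2.+2)%:Z - N.+1%:Z = N.+1%:Z by rewrite -addnn; lia.
rewrite (eq_bigr (fun i : 'I_N.*2.+1 => F (i%:Z - N%:Z))); last first.
  by move=> i _; congr F; rewrite /bump/=; lia.
by rewrite -addrA [LHS]addrC -addrA.
Qed.

End symmetric_sums.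

(** * First-order expansion of the kernel far from its singularity *)

Section kernel_remainder.
Context {R : realType}.
Variable s : R.
Hypothesis hs : 0 < s <= 1.
Implicit Types (x y z V : (R * R)%type) (h : R * R -> R) (B r Y t c : R).
Notation kap := (kap s).
Notation dkap := (dkap s).
Notation conv := (convk kap).
Let lk := kap_locally_integrable hs.

(** Minus half the gradient at V of x -> kap (|x|^2). *)
Definition Phi V : R * R := dkap (dotp V V) *: V.

Lemma PhiN V : Phi (- V) = - Phi V.
Proof. by rewrite /Phi dotpNl dotpNr opprK scalerN. Qed.

Lemma dkapM c t : 0 <= c -> 0 <= t -> dkap (c * t) = dkap c * dkap t.
Proof. by move=> c0 t0; rewrite !dkapE powRM. Qed.

Lemma PhiZ c V : 0 <= c -> Phi (c *: V) = (dkap (c ^+ 2) * c) *: Phi V.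
Proof.
move=> c0; rewrite /Phi dotpZl dotpZr mulrA -expr2 dkapM ?sqr_ge0 ?dotp_ge0//.
by rewrite !scalerA; congr (_ *: _); ring.
Qed.

Lemma dkap_le_inv c : 1 <= c -> dkap c <= c^-1.
Proof.
move=> c1; rewrite dkapE -powR_inv1; last linarith.
by apply: ler_powR => //; case/andP: hs => *; linarith.
Qed.

(** Since s <= 1, t^(s - 2) <= 1 / t for t >= 1; at t = j^2 this is the decay that makes the lattice
    sums converge. *)
Lemma dkap_nat c (j : nat) : (0 < j)%N -> 0 < c -> dkap (j%:R ^+ 2 * c) <= dkap c * (2 * tele j).
Proof.
move=> j0 c0; have j1 : 1 <= j%:R ^+ 2 :> R by rewrite expr_ge1// ?ler1n.
rewrite dkapM ?sqr_ge0 ?(ltW c0)// mulrC ler_wpM2l ?(ltW (dkap_gt0 s c0))//.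
exact: le_trans (dkap_le_inv j1) (sqr_inv_tele j0).
Qed.

(** As r <= |V| / 2, the squared distances stay above |V|^2 / 4. The mean value theorem in the
    squared distance leaves two errors, from the quadratic part of |V + x|^2 and from the change of
    slope: 50 = 2 + 48. *)
Lemma kap_remainder V x x' r : 0 < enorm V -> 2 * r <= enorm V -> enorm x <= r -> enorm x' <= r ->
  `|kap (dotp (V + x) (V + x)) - kap (dotp (V + x') (V + x')) + 2 * dotp (Phi V) (x - x')|
    <= 50 * r * dkap (dotp V V / 4) * enorm (x - x').
Proof.
move=> V0 rV xr x'r.
wlog tt' : x x' xr x'r / dotp (V + x) (V + x) <= dotp (V + x') (V + x').
  move=> H; have [/H|/ltW/H] := leP (dotp (V + x) (V + x)) (dotp (V + x') (V + x')); first exact.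
  move=> h; have := h x'r xr; rewrite (enormBC x') -normrN; congr (`|_| <= _).
  by rewrite -(opprB x x') dotpNr; ring.
have r0 : 0 <= r := le_trans (enorm_ge0 _) xr.
set al := dotp V V / 4; have VV := enorm_sqr V.
have al0 : 0 < al by rewrite divr_gt0// -VV exprn_gt0.
have range u : enorm u <= r -> al <= dotp (V + u) (V + u) /\ `|dotp (V + u) (V + u) - dotp V V| <= 3 * r * enorm V.
  move=> ur; have u0 := enorm_ge0 u; split.
    rewrite /al -VV -enorm_sqr; have := enorm_ge0 (V + u).
    by have := ler_enormB (V + u) u; rewrite addrK => h h2; nra.
  rewrite (_ : _ - _ = 2 * dotp V u + dotp u u); last by rewrite !dotpE (dotpC u V); ring.
  apply: le_trans (ler_normD _ _) _; rewrite normrM (ger0_norm (dotp_ge0 u)) ger0_norm//.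
  have := normr_dotp V u; have := enorm_sqr u.
  by have := ler_wpM2l (ltW V0) ur; nra.
have [t0 t1] := range x xr; have [t0' t1'] := range x' x'r.
set t := dotp (V + x) (V + x) in tt' t0 t1 *; set t' := dotp (V + x') _ in tt' t0' t1' *.
have [c [c1 c2 E]] := MVT_gt0 (lt_le_trans al0 t0) tt' (is_derive_kap s).
have cV : `|c - dotp V V| <= 3 * r * enorm V.
  move: t1 t1'; rewrite !ler_norml => /andP[u1 u2] /andP[u3 u4]; apply/andP; split; linarith.
have alc : al <= c by exact: le_trans c1.
have alV : al <= dotp V V by rewrite /al; have := dotp_ge0 V; linarith.
have dc : dkap c <= dkap al by exact: dkap_le.
have dd := dkap_dist hs al0 alc alV.
have D0 := dkap_gt0 s al0; have Dc0 := dkap_gt0 s (lt_le_trans al0 alc).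
have pal : al `^ (s - 3) * al = dkap al.
  by rewrite dkapE -{2}(powRr1 (ltW al0)) -powRD ?(gt_eqF al0) ?implybT//; congr (_ `^ _); ring.
have -> : kap t - kap t' + 2 * dotp (Phi V) (x - x') =
    - (dkap c * dotp (x + x') (x - x') + 2 * (dkap c - dkap (dotp V V)) * dotp V (x - x')).
  have -> : kap t - kap t' = dkap c * (t' - t) by rewrite -[LHS]opprB E; ring.
  rewrite /t /t' /Phi dotpZl !dotpE (dotpC x V) (dotpC x' V) (dotpC x' x); ring.
rewrite normrN; apply: le_trans (ler_normD _ _) _.
have e0 := enorm_ge0 (x - x').
have w1 : `|dkap c * dotp (x + x') (x - x')| <= dkap al * (2 * r * enorm (x - x')).
  rewrite normrM; apply: ler_pM => //; first by rewrite gtr0_norm.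
  apply: le_trans (normr_dotp _ _) _; rewrite ler_wpM2r//.
  by apply: le_trans (ler_enormD _ _) _; linarith.
have w2 : `|2 * (dkap c - dkap (dotp V V)) * dotp V (x - x')| <=
    2 * (2 * al `^ (s - 3) * (3 * r * enorm V)) * (enorm V * enorm (x - x')).
  rewrite !normrM (ger0_norm (ler0n R 2)); apply: ler_pM; rewrite ?mulr_ge0//; last exact: normr_dotp.
  rewrite ler_wpM2l//; apply: le_trans dd _; rewrite ler_wpM2l// mulr_ge0// powR_ge0//.
have w3 : 2 * (2 * al `^ (s - 3) * (3 * r * enorm V)) * (enorm V * enorm (x - x')) =
   48 * r * dkap al * enorm (x - x').
  rewrite -pal; have -> : al = enorm V ^+ 2 / 4 by rewrite /al VV.
  by set P := _ `^ _; field.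
linarith.
Qed.

Lemma conv_remainder B h V y y' Y : bnd_supp 2 B h -> 0 < enorm V -> 2 * (Y + 2) <= enorm V ->
  enorm y <= Y -> enorm y' <= Y ->
  `|conv h (V + y) - conv h (V + y') + 2 * iint h * dotp (Phi V) (y - y')|
    <= 50 * (Y + 2) * dkap (dotp V V / 4) * B * iint (cutoff 2) * enorm (y - y').
Proof.
move=> hb V0 YV yY y'Y; have ih := integ_bnd_supp hb; have [mh hB h0] := hb.
rewrite !convkE -iintB; [|exact: (integ_convk lk _ hb)..].
rewrite (_ : 2 * iint h * _ = iint (fun z => 2 * dotp (Phi V) (y - y') * h z)); last by rewrite iintZ//; ring.
have i1 := integB (integ_convk lk (V + y) hb) (integ_convk lk (V + y') hb).
have i2 := integZ (2 * dotp (Phi V) (y - y')) ih.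
rewrite -iintD//.
set K := 50 * (Y + 2) * dkap (dotp V V / 4).
rewrite (_ : K * B * _ * _ = K * enorm (y - y') * B * iint (cutoff 2)); last by ring.
rewrite -iintZ; last exact: integrable_cutoff.
apply: norm_iint_le; [exact: integ_measurable (integD i1 i2)| |by apply: integZ; exact: integrable_cutoff].
move=> z; rewrite cutoffE; case: (leP (enorm z) 2) => z2; last first.
  by rewrite h0// !mulr0 subrr addr0 normr0.
rewrite mulr1 -mulrBl -mulrDl normrM; apply: ler_pM => //.
have Y2 u : enorm u <= Y -> enorm (u - z) <= Y + 2.
  by move=> uY; apply: le_trans (ler_enormB _ _) _; linarith.
have := kap_remainder V0 YV (Y2 y yY) (Y2 y' y'Y).
have -> : y - z - (y' - z) = y - y' by rewrite opprB addrA subrK.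
by rewrite -[V + y - z]addrA -[V + y' - z]addrA.
Qed.

End kernel_remainder.

(** * Series of functions with summable Lipschitz constants *)

Section function_series.
Context {R : realType}.
Implicit Types (b : nat -> R * R -> R) (x y : (R * R)%type) (C Y K : R) (j J N : nat).

Definition fseries b y : R := lim ((\sum_(j < N.+1) b j y) @[N --> \oo]).

Lemma fseriesE b y (L : R) : (\sum_(j < N.+1) b j y) @[N --> \oo] --> L -> fseries b y = L.
Proof. by move=> h; apply/cvg_lim. Qed.

(** At the common zero y0 convergence is trivial, and the summable Lipschitz bounds spread it to
    every disc. *)
Definition tame b y0 := (forall j, (0 < j)%N -> b j y0 = 0) /\
  forall Y, exists C J, [/\ 0 <= C, (0 < J)%N & forall j, (J <= j)%N ->
    lip_on [set y | enorm y <= Y] (C * tele j) (b j)].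

Lemma fseries_cvg b y0 y : tame b y0 -> (\sum_(j < N.+1) b j y) @[N --> \oo] --> fseries b y.
Proof.
move=> [b0 /(_ (Num.max (enorm y) (enorm y0)))[C [J [C0 J0 H]]]].
have hb j : (J <= j)%N -> `|b j y| <= C * enorm (y - y0) * tele j.
  move=> Jj; have := H j Jj y y0; rewrite /= !le_max !lexx ?orbT => /(_ isT isT).
  by rewrite (b0 j (leq_trans J0 Jj)) subr0 mulrAC.
have [L HL] := tele_limit J0 (mulr_ge0 C0 (enorm_ge0 _)) hb.
by have c := tele_cvg (v := fun j => b j y) HL; rewrite (fseriesE c).
Qed.

Lemma fseries_tail b y0 Y C J N : tame b y0 -> 0 <= C -> (0 < J)%N -> (J <= N)%N ->
  (forall j, (J <= j)%N -> lip_on [set y | enorm y <= Y] (C * tele j) (b j)) ->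
  lip_on [set y | enorm y <= Y] (C * N%:R^-1) (fun y => fseries b y - \sum_(j < N) b j y).
Proof.
move=> tb C0 J0 JN H x y /= xY yY.
have hv j : (J <= j)%N -> `|b j x - b j y| <= C * enorm (x - y) * tele j.
  by move=> Jj; rewrite mulrAC; exact: H.
have [L HL] := tele_limit J0 (mulr_ge0 C0 (enorm_ge0 _)) hv.
have E : fseries b x - fseries b y = L.
  have c1 : (\sum_(j < n.+1) b j x - \sum_(j < n.+1) b j y) @[n --> \oo] --> fseries b x - fseries b y.
    by apply: cvgB; exact: fseries_cvg tb.
  rewrite -(cvg_lim (@Rhausdorff R) c1); apply/cvg_lim => //.
  have := tele_cvg (v := fun j => b j x - b j y) HL; rewrite (_ : (fun n => _) = (fun n => \sum_(j < n.+1) b j x - \sum_(j < n.+1) b j y))//.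
  by apply/funext => n; exact: sumrB.
have := HL N JN; rewrite -E sumrB mulrAC distrC; congr (`|_| <= _); ring.
Qed.

(** The tails are small in the Lipschitz seminorm, so partial sums serve as approximants in
    [C1at_approx]. *)
Lemma C1at_fseries b y0 y : tame b y0 -> (forall j x, C1at (b j) x) -> C1at (fseries b) y.
Proof.
move=> tb hb; apply: (C1at_approx ltr01) => e e0.
have [_ /(_ (enorm y + 1))[C [J [C0 J0 H]]]] := tb.
have C1 : 0 < C + 1 by rewrite ltr_wpDl.
have [N0 N00 HN] := inv_nat_small (divr_gt0 e0 C1).
exists (fun x => \sum_(j < maxn J N0) b j x) => [x _|x z /= xy zy].
  exact: C1at_sum.
have ball u : enorm (u - y) < 1 -> enorm u <= enorm y + 1.
  move=> uy; have := ler_enormD (u - y) y; rewrite subrK => h; apply: le_trans h _.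
  by rewrite addrC lerD2l ltW.
have := fseries_tail tb C0 J0 (leq_maxl J N0) H (ball _ xy) (ball _ zy).
move=> h; apply: le_trans h _; rewrite ler_wpM2r ?enorm_ge0//.
have := HN _ (leq_maxr J N0); rewrite ler_pdivlMr// => h; apply: le_trans h.
by rewrite mulrC ler_wpM2l ?invr_ge0// lerDl.
Qed.

Lemma fseries_lip b y0 (c : nat -> R * R) S (D : set (R * R)) K : tame b y0 ->
  (forall x, (dotp (\sum_(j < N.+1) c j) x) @[N --> \oo] --> dotp S x) ->
  (forall N x y, D x -> D y ->
    `|\sum_(j < N.+1) (b j x - b j y - dotp (c j) (x - y))| <= K * enorm (x - y)) ->
  lip_on D K (fun y => fseries b y - dotp S y).
Proof.
move=> tb cS H x y Dx Dy.
have c1 : (\sum_(j < n.+1) b j x - \sum_(j < n.+1) b j y - dotp (\sum_(j < n.+1) c j) (x - y)) @[n --> \oo]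
    --> fseries b x - fseries b y - dotp S (x - y).
  by apply: cvgB => //; apply: cvgB; exact: fseries_cvg tb.
have -> : fseries b x - dotp S x - (fseries b y - dotp S y) = fseries b x - fseries b y - dotp S (x - y).
  by rewrite dotpDr dotpNr; ring.
apply/ler_addgt0Pr => e e0.
have /cvgrPdist_le/(_ e e0)[N _ /(_ N (leqnn N))] := c1.
set F := (X in `|_ - X|) => h; have hF : `|F| <= K * enorm (x - y).
  apply: le_trans (H N x y Dx Dy); rewrite /F sumrB sumrB.
  rewrite (_ : \sum_(j < N.+1) dotp (c j) (x - y) = dotp (\sum_(j < N.+1) c j) (x - y))//.
  by rewrite (big_morph (fun u => dotp u (x - y)) (fun u v => dotpDl u v _) (dotp0l _)).
rewrite -[X in `|X|](subrK F); apply: le_trans (ler_normD _ _) _.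
by rewrite addrC lerD.
Qed.

End function_series.

(** * The field of the image vortices and its linear part *)

Section cells.
Context {R : realType}.
Variables (s l e g : R) (P : (R * R)%type).
Hypotheses (hs : 0 < s <= 1) (e0 : 0 < e) (g0 : 0 < g).
Notation kap := (kap s).
Notation dkap := (dkap s).
Notation conv := (convk kap).
Notation Phi := (Phi s).
Implicit Types (h : R * R -> R) (x y V : (R * R)%type) (B C Y : R) (j N : nat) (k : int).
Hypothesis geoV : forall k, g * `|k|%:R <= enorm (period l k).
Hypothesis geoT : forall k, g * (maxn 1 `|k|)%:R <= enorm (P + period l k).

Definition far_const : R := 100 * dkap (g ^+ 2 / 4) * iint (cutoff 2).

Lemma far_const_ge0 : 0 <= far_const.
Proof.
rewrite /far_const !mulr_ge0//; first by rewrite ltW// dkap_gt0// divr_gt0// exprn_gt0.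
by apply: iint_ge0 => z; exact: cutoff_ge0.
Qed.

(** e V is the offset before rescaling, of length at least g n; homogeneity extracts dkap (e^-2),
    which is e^(4 - 2 s), and leaves the decay [tele n]. *)
Lemma far_lip B h V y y' Y n : bnd_supp 2 B h -> (0 < n)%N -> g * n%:R <= enorm (e *: V) ->
  2 * (Y + 2) * e <= g * n%:R -> enorm y <= Y -> enorm y' <= Y ->
  `|conv h (V + y) - conv h (V + y') + 2 * iint h * dotp (Phi V) (y - y')|
    <= far_const * (Y + 2) * dkap (e ^- 2) * B * tele n * enorm (y - y').
Proof.
move=> hb n0 nV YV yY y'Y; have gn : 0 < g * n%:R by rewrite mulr_gt0// ltr0n.
have eV : e * enorm V = enorm (e *: V) by rewrite enormZ gtr0_norm.
have V0 : 0 < enorm V by rewrite -(pmulr_rgt0 _ e0) eV (lt_le_trans gn).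
have YV' : 2 * (Y + 2) <= enorm V.
  by rewrite -(ler_pM2r e0) (le_trans YV)// (le_trans nV)// -eV mulrC.
have Y0 : 0 <= Y := le_trans (enorm_ge0 _) yY.
apply: le_trans (conv_remainder hs hb V0 YV' yY y'Y) _.
rewrite ler_wpM2r ?enorm_ge0//.
have c0 : 0 < e ^- 2 * (g ^+ 2 / 4) by rewrite mulr_gt0 ?invr_gt0 ?divr_gt0 ?exprn_gt0.
have dV : dkap (dotp V V / 4) <= dkap (e ^- 2) * dkap (g ^+ 2 / 4) * (2 * tele n).
  rewrite -dkapM ?invr_ge0 ?divr_ge0 ?sqr_ge0 ?exprn_ge0 ?(ltW e0)//.
  apply: le_trans (dkap_nat hs n0 c0); apply: dkap_le => //.
    by rewrite mulr_gt0// exprn_gt0// ltr0n.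
  have -> : n%:R ^+ 2 * (e ^- 2 * (g ^+ 2 / 4)) = (g * n%:R) ^+ 2 / e ^+ 2 / 4.
    by rewrite exprMn; ring.
  rewrite ler_pM2r// ler_pdivrMr ?exprn_gt0// -enorm_sqr -exprMn [enorm V * e]mulrC eV.
  by rewrite ler_pXn2r ?nnegrE ?enorm_ge0 ?(ltW gn).
have B0 := bnd_supp_ge0 hb; have M0 : 0 <= iint (cutoff 2 : R * R -> R) by apply: iint_ge0 => z; exact: cutoff_ge0.
have Y2 : 0 <= 50 * (Y + 2) by lra.
have -> : far_const * (Y + 2) * dkap (e ^- 2) * B * tele n =
  50 * (Y + 2) * (dkap (e ^- 2) * dkap (g ^+ 2 / 4) * (2 * tele n)) * B * iint (cutoff 2).
  by rewrite /far_const; ring.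
by rewrite ler_wpM2r// ler_wpM2r// ler_wpM2l.
Qed.

(** The k-th image of the vortex and the k-th antivortex seen from y = (x - p) / e, for P = p - q.
    For k = 0 the vortex itself is left out. The antivortex is the image of the vortex under x -> -
    x, hence the sign of y. *)
Definition cell h k y := (if k == 0 then 0 else conv h (e^-1 *: period l k + y)) -
  conv h (- (e^-1 *: (P + period l k)) - y).

Lemma cellE h k y : cell h k y = (if k == 0 then 0 else conv h (e^-1 *: period l k + y)) -
  conv h (- (e^-1 *: (P + period l k)) - y).
Proof. by []. Qed.

Definition cell_slope k : R * R :=
  Phi (e^-1 *: (P + period l k)) - (if k == 0 then 0 else Phi (e^-1 *: period l k)).

Lemma cell_lip B h k y y' Y : bnd_supp 2 B h -> 2 * (Y + 2) * e <= g * (maxn 1 `|k|)%:R ->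
  enorm y <= Y -> enorm y' <= Y ->
  `|cell h k y - cell h k y' - 2 * iint h * dotp (cell_slope k) (y - y')|
    <= 2 * (far_const * (Y + 2) * dkap (e ^- 2) * B * tele (maxn 1 `|k|)) * enorm (y - y').
Proof.
move=> hb Yk yY y'Y; have m0 : (0 < maxn 1 `|k|)%N by rewrite leq_max.
have gT : g * (maxn 1 `|k|)%:R <= enorm (e *: (- (e^-1 *: (P + period l k)))).
  by rewrite scalerN enormN scalerA divff ?gt_eqF// scale1r.
have := far_lip hb m0 gT Yk (y := - y) (y' := - y'); rewrite !enormN => /(_ yY y'Y).
have -> : - y - - y' = - (y - y') by rewrite opprB opprK addrC.
rewrite PhiN dotpNl dotpNr opprK enormN => h1.
have h2 : `|(if k == 0 then 0 else conv h (e^-1 *: period l k + y)) -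
   (if k == 0 then 0 else conv h (e^-1 *: period l k + y')) +
   2 * iint h * dotp (if k == 0 then 0 else Phi (e^-1 *: period l k)) (y - y')|
   <= far_const * (Y + 2) * dkap (e ^- 2) * B * tele (maxn 1 `|k|) * enorm (y - y').
  have [k0|k0] := eqVneq k 0.
    rewrite dotp0l mulr0 subrr addr0 normr0; exact: le_trans (normr_ge0 _) h1.
  have km : maxn 1 `|k| = `|k|%N by apply/maxn_idPr; rewrite absz_gt0.
  rewrite km in Yk m0 *; apply: far_lip => //.
  by rewrite scalerA divff ?gt_eqF// scale1r.
rewrite -[leRHS]mulrA [leRHS]mulr_natl mulr2n; apply: le_trans (lerD h2 h1).
apply: le_trans (ler_normB _ _).
rewrite /cell /cell_slope dotpDl dotpNl le_eqVlt; apply/orP; left; apply/eqP; congr (`|_|); ring.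
Qed.

Lemma periodN k : period l (- k) = - period l k :> R * R.
Proof. by rewrite /period mulrNz mulNr scaleNr. Qed.

Definition flux k : R * R := Phi (P + period l k).

(** [Phi] is odd, so the images k and - k of the vortex cancel and only the antivortices are
    left. *)
Lemma paired_slope j : paired cell_slope j = (dkap (e ^- 2) * e^-1) *: paired flux j.
Proof.
have ei : 0 <= e^-1 by rewrite invr_ge0 ltW.
have hT k : Phi (e^-1 *: (P + period l k)) = (dkap (e ^- 2) * e^-1) *: flux k.
  by rewrite PhiZ// exprVn.
case: j => [|i]; first by rewrite /= /cell_slope eqxx subr0 hT.
rewrite /= /cell_slope oppr_eq0 !hT /=; set c := _ * _.
by rewrite periodN scalerN PhiN opprK addrACA addNr addr0 scalerDr.
Qed.

(** Phi (P + V) + Phi (P - V) has a component along P of the size of dkap (|V|^2), and one along V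
    in which the two values of dkap nearly cancel, as |P + V|^2 - |P - V|^2 = 4 P . V. Both are O(1
    / j^2), while a single term may decay only like 1 / j. *)
Lemma flux_bound : exists2 C, 0 <= C & forall j, (0 < j)%N -> enorm (paired flux j) <= C * tele j.
Proof.
have g2 : 0 < g ^+ 2 by rewrite exprn_gt0.
have G0 := dkap_gt0 s g2; have P0 := enorm_ge0 P.
pose C := dkap (g ^+ 2) * 2 * (2 * enorm P + 8 * enorm P * (l ^+ 2 / g ^+ 2)).
have C0 : 0 <= 2 * enorm P + 8 * enorm P * (l ^+ 2 / g ^+ 2).
  by apply: addr_ge0; [exact: mulr_ge0|apply: mulr_ge0; [exact: mulr_ge0|rewrite divr_ge0 ?sqr_ge0]].
exists C; first by rewrite !mulr_ge0// ltW.
case=> // i _; set j := i.+1; have j0 : 0 < j%:R :> R by rewrite ltr0n.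
rewrite /= /flux periodN; have T1 := geoT i.+1%:Z; have T2 := geoT (- i.+1%:Z).
move: T1 T2; rewrite abszN /= periodN (_ : maxn 1 i.+1 = j); last exact/maxn_idPr.
set V : R * R := period l i.+1 => T1 T2.
have eV : enorm V ^+ 2 = j%:R ^+ 2 * l ^+ 2.
  by rewrite enorm_sqr /V /period dotpZl dotpZr /dotp /e2/= /j -pmulrn; ring.
clearbody V.
pose a0 := j%:R ^+ 2 * g ^+ 2; have a00 : 0 < a0 by rewrite mulr_gt0// exprn_gt0.
have ge_a0 x : g * j%:R <= enorm x -> a0 <= dotp x x.
  move=> h; rewrite -enorm_sqr /a0 mulrC -exprMn ler_pXn2r ?nnegrE ?enorm_ge0//.
  by rewrite mulr_ge0 ?ltW.
have {}T1 := ge_a0 _ T1; have {}T2 := ge_a0 _ T2.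
rewrite /Phi; set tp := dotp _ _ in T1 *; set tm := dotp _ _ in T2 *.
have -> : dkap tp *: (P + V) + dkap tm *: (P - V) = (dkap tp + dkap tm) *: P + (dkap tp - dkap tm) *: V.
  by apply: pair_ext; rewrite /= /GRing.scale/=; ring.
have d1 : dkap tp <= dkap a0 by exact: dkap_le.
have d2 : dkap tm <= dkap a0 by exact: dkap_le.
have d3 : `|dkap tp - dkap tm| <= 8 * a0 `^ (s - 3) * (enorm P * enorm V).
  apply: le_trans (dkap_dist hs a00 T1 T2) _.
  have -> : tp - tm = 4 * dotp P V by rewrite /tp /tm /dotp /=; ring.
  rewrite normrM ger0_norm//; have := normr_dotp P V.
  by have := powR_ge0 a0 (s - 3) => p0 h; have := ler_wpM2l p0 h; lra.
have da : a0 `^ (s - 3) * a0 = dkap a0.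
  by rewrite dkapE -{2}(powRr1 (ltW a00)) -powRD ?(gt_eqF a00) ?implybT//; congr (_ `^ _); ring.
apply: le_trans (ler_enormD _ _) _; rewrite !enormZ ger0_norm; last first.
  by rewrite addr_ge0// ltW// dkap_gt0// (lt_le_trans a00).
apply: le_trans (_ : (2 * enorm P + 8 * enorm P * (l ^+ 2 / g ^+ 2)) * dkap a0 <= _); last first.
  rewrite /C [leRHS]mulrAC mulrC ler_wpM2r// -mulrA.
  exact: (dkap_nat hs (ltn0Sn i) g2).
rewrite [leRHS]mulrDl; apply: lerD.
  by rewrite mulrAC ler_wpM2r//; lra.
apply: le_trans (ler_wpM2r (enorm_ge0 _) d3) _.
rewrite -da; set Q := a0 `^ _; rewrite le_eqVlt; apply/orP; left; apply/eqP.
transitivity (8 * Q * enorm P * enorm V ^+ 2); first by ring.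
by rewrite eV /a0; field; exact: lt0r_neq0.
Qed.

Lemma lattice_flux : exists S : R * R,
  (\sum_(j < N.+1) paired flux j) @[N --> \oo] --> S /\
  forall x, (dotp (\sum_(j < N.+1) paired flux j) x) @[N --> \oo] --> dotp S x.
Proof.
have [C C0 HC] := flux_bound.
have h1 j : (1 <= j)%N -> `|(paired flux j).1| <= C * tele j.
  by move=> j1; apply: le_trans (HC j j1); exact: normr_fst_le.
have h2 j : (1 <= j)%N -> `|(paired flux j).2| <= C * tele j.
  by move=> j1; apply: le_trans (HC j j1); exact: normr_snd_le.
have [L1 H1] := tele_limit (ltn0Sn 0) C0 h1; have [L2 H2] := tele_limit (ltn0Sn 0) C0 h2.
pose S : R * R := (L1, L2); exists S.
have H N : (1 <= N)%N -> enorm (S - \sum_(j < N) paired flux j) <= 2 * C * N%:R^-1.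
  move=> N1; apply: le_trans (enorm_le_coord _) _; rewrite -mulrA mulr_natl mulr2n.
  rewrite [`|_.1|]distrC [`|_.2|]distrC; apply: lerD.
    by rewrite (big_morph (@fst R R) (id1 := 0) (op1 := +%R)) ?H1.
  by rewrite (big_morph (@snd R R) (id1 := 0) (op1 := +%R)) ?H2.
have cS : (\sum_(j < N.+1) paired flux j) @[N --> \oo] --> S; last (split; first exact: cS).
  move=> A /nbhs_enormP[d d0 dA].
  have C1 : 0 < 2 * C + 1 by rewrite ltr_wpDl ?mulr_ge0.
  have [N0 N00 HN] := inv_nat_small (divr_gt0 d0 C1).
  exists N0 => // N /= NN; apply: dA; rewrite enormBC.
  apply: le_lt_trans (H _ (ltn0Sn N)) _.
  have := HN _ (leqW NN); rewrite ler_pdivlMr// => h; apply: lt_le_trans h.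
  by rewrite mulrDr mulr1 mulrC ltrDl invr_gt0.
move=> x.
apply: (@cvg_comp _ _ _ (fun N => \sum_(j < N.+1) paired flux j) (fun u => dotp u x) _ (nbhs S)) cS _.
have := C1at_continuous (C1at_dotp x S); rewrite (_ : dotp x = fun u => dotp u x)//.
by apply/funext => u; exact: dotpC.
Qed.


Lemma paired_cell_lip B h j y y' Y : bnd_supp 2 B h -> 2 * (Y + 2) * e <= g * (maxn 1 j)%:R ->
  enorm y <= Y -> enorm y' <= Y ->
  `|paired (cell h ^~ y) j - paired (cell h ^~ y') j - 2 * iint h * dotp (paired cell_slope j) (y - y')|
    <= 4 * (far_const * (Y + 2) * dkap (e ^- 2) * B * tele (maxn 1 j)) * enorm (y - y').
Proof.
move=> hb Yj yY y'Y; set K := _ * tele _.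
have c1 := cell_lip hb (k := j%:Z) Yj yY y'Y.
have c2 := cell_lip hb (k := - j%:Z); rewrite abszN in c2; have {}c2 := c2 _ _ _ Yj yY y'Y.
case: j @K c1 c2 Yj => [|i] K c1 c2 Yj /=.
  apply: le_trans c1 _; rewrite ler_wpM2r ?enorm_ge0// ler_wpM2r//; last lra.
  rewrite /K; move: far_const far_const_ge0 => F F0.
  have Y2 : 0 <= Y + 2 by have := enorm_ge0 y; lra.
  have E0 : 0 <= dkap (e ^- 2) by rewrite ltW// dkap_gt0// invr_gt0 exprn_gt0.
  by rewrite !mulr_ge0 ?tele_ge0 ?(bnd_supp_ge0 hb).
have -> : 4 * K * enorm (y - y') = 2 * K * enorm (y - y') + 2 * K * enorm (y - y') by ring.
apply: le_trans (lerD c1 c2); apply: le_trans (ler_normD _ _).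
rewrite le_eqVlt; apply/orP; left; apply/eqP; congr (`|_|).
by rewrite dotpDl /=; ring.
Qed.

Definition field h := fseries (fun j y => paired (cell h ^~ y) j).

(** For P = 2 p the common zero is the point x = 0, the centre of the symmetry that exchanges
    vortices and antivortices; there the cells k and - k cancel. *)
Lemma field_tame B h : bnd_supp 2 B h ->
  tame (fun j y => paired (cell h ^~ y) j) (- ((e^-1 / 2) *: P)).
Proof.
move=> hb; split.
  case=> // i _; rewrite /= /cell oppr_eq0 /= periodN.
  move: (period l _) => V; set y0 := - _.
  have -> : - (e^-1 *: (P + V)) - y0 = e^-1 *: (- V) + y0.
    by rewrite /y0; apply: pair_ext; rewrite /= /GRing.scale/=; lra.
  have -> : - (e^-1 *: (P - V)) - y0 = e^-1 *: V + y0.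
    by rewrite /y0; apply: pair_ext; rewrite /= /GRing.scale/=; lra.
  by rewrite addrC subrKA subrr.
move=> Y; have [C C0 HC] := flux_bound.
pose K := far_const * (Y + 2) * dkap (e ^- 2) * B.
pose J := (Num.truncn (2 * (Y + 2) * e / g)).+1.
exists (4 * `|K| + `|2 * iint h| * (dkap (e ^- 2) * e^-1 * C)), J.
have E0 : 0 <= dkap (e ^- 2) by rewrite ltW// dkap_gt0// invr_gt0 exprn_gt0.
have F0 : 0 <= dkap (e ^- 2) * e^-1 by rewrite mulr_ge0// invr_ge0 ltW.
split => //; first by rewrite addr_ge0// mulr_ge0// mulr_ge0.
move=> j Jj y y' /= yY y'Y; have j0 : (0 < j)%N by exact: leq_trans Jj.
have mj : maxn 1 j = j by apply/maxn_idPr.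
have Yj : 2 * (Y + 2) * e <= g * (maxn 1 j)%:R.
  rewrite mj [leRHS]mulrC -ler_pdivrMr//; apply: ltW; apply: lt_le_trans (truncnS_gt _) _.
  by rewrite ler_nat.
have := paired_cell_lip hb Yj yY y'Y; rewrite mj paired_slope.
set D := paired _ _ - paired _ _; set T := 2 * iint h * _ => h1.
have hT : `|T| <= `|2 * iint h| * (dkap (e ^- 2) * e^-1 * C) * tele j * enorm (y - y').
  rewrite /T normrM -!mulrA ler_wpM2l// dotpZl normrM (ger0_norm F0) -mulrA.
  rewrite mulrA [leRHS]mulrA ler_wpM2l// mulrA; apply: le_trans (normr_dotp _ _) _.
  by rewrite ler_wpM2r ?enorm_ge0// HC.
rewrite -[D](subrK T); apply: le_trans (ler_normD _ _) _.
rewrite (mulrDl _ _ (tele j)) (mulrDl _ _ (enorm _)); apply: lerD hT.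
apply: le_trans h1 _; rewrite ler_wpM2r ?enorm_ge0// -[leRHS]mulrA ler_wpM2l// ler_wpM2r ?tele_ge0//.
exact: ler_norm.
Qed.

Lemma C1at_field B K h y : bnd_supp 2 B h -> lip_on setT K h -> C1at (field h) y.
Proof.
move=> hb hK; apply: (C1at_fseries y (field_tame hb)).
have c k x : C1at (cell h k) x.
  have aff (a : R) V : C1at (fun y => conv h (a *: y + V)) x.
    by apply: C1at_affine; exact: (C1at_conv hs _ (ler0n R 2) hb hK).
  apply: C1atB.
    case: (k == 0); first exact: C1at_cst.
    by have := aff 1 (e^-1 *: period l k); congr C1at; apply/funext => z; rewrite scale1r addrC.
  by have := aff (-1) (- (e^-1 *: (P + period l k))); congr C1at; apply/funext => z; rewrite scaleN1r addrC.
by case=> [|j] x /=; [exact: c|exact: C1atD].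
Qed.

Lemma fieldB B h h' y : bnd_supp 2 B h -> bnd_supp 2 B h' ->
  field (fun z => h z - h' z) y = field h y - field h' y.
Proof.
move=> hb hb'; apply: fseriesE.
have c k x : cell (fun z => h z - h' z) k x = cell h k x - cell h' k x.
  rewrite /cell !(convkB (kap_locally_integrable hs) _ hb hb').
  by case: (k == 0); ring.
rewrite (_ : (fun N => _) = (fun N => \sum_(j < N.+1) paired (cell h ^~ y) j -
   \sum_(j < N.+1) paired (cell h' ^~ y) j)).
  by apply: cvgB; apply: fseries_cvg; [exact: field_tame hb|exact: field_tame hb'].
apply/funext => N; rewrite -sumrB; apply: eq_bigr => -[[|j] ?] _ /=; rewrite !c//.
ring.
Qed.

Lemma tele_max_sum N : \sum_(j < N.+1) tele (maxn 1 j) <= 2 :> R.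
Proof.
have t1 : tele 1 <= 1 :> R by rewrite /tele mul1r invf_le1// ler1n.
rewrite big_ord_recl (_ : 2 = 1 + 1 :> R)//; apply: lerD => //.
rewrite (eq_bigr (fun j : 'I_N => tele (1 + j))); last by move=> j _; rewrite /bump/=; congr tele; apply/maxn_idPr.
have := @tele_sum R 1 N (ltn0Sn 0); rewrite big_add1 big_mkord.
by move=> ->; rewrite invr1 gerBl invr_ge0.
Qed.

(** The estimates are used on the disc of radius 3: 10 = 2 (3 + 2), and 40 = 4 * 5 * 2 where 2
    bounds the sum of the tele (maxn 1 j). *)
Lemma field_lip B h S : bnd_supp 2 B h -> 10 * e <= g ->
  (forall x, (dotp (\sum_(j < N.+1) paired flux j) x) @[N --> \oo] --> dotp S x) ->
  lip_on [set y | enorm y <= 3] (40 * far_const * dkap (e ^- 2) * B)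
    (fun y => field h y - dotp ((2 * iint h * (dkap (e ^- 2) * e^-1)) *: S) y).
Proof.
move=> hb eg cS; set m := 2 * iint h * _.
apply: (fseries_lip (c := fun j => m *: paired flux j) (field_tame hb)).
  move=> x; rewrite dotpZl.
  rewrite (_ : (fun N => _) = (fun N => m * dotp (\sum_(j < N.+1) paired flux j) x)).
    by apply: cvgM; [exact: cvg_cst|exact: cS].
  by apply/funext => N; rewrite -scaler_sumr dotpZl.
move=> N x y x3 y3.
apply: le_trans (ler_norm_sum _ _ _) _.
pose Q := far_const * 5 * dkap (e ^- 2) * B.
have Q0 : 0 <= Q.
  rewrite /Q; move: far_const far_const_ge0 => F F0.
  have E0 : 0 <= dkap (e ^- 2) by rewrite ltW// dkap_gt0// invr_gt0 exprn_gt0.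
  by rewrite !mulr_ge0 ?(bnd_supp_ge0 hb).
apply: le_trans (_ : \sum_(j < N.+1) 4 * Q * enorm (x - y) * tele (maxn 1 j) <= _).
  apply: ler_sum => j _.
  have Yj : 2 * (3 + 2) * e <= g * (maxn 1 j)%:R.
    have -> : 2 * (3 + 2) * e = 10 * e by ring.
    by apply: le_trans eg _; rewrite ler_peMr ?(ltW g0)// ler1n leq_max.
  have := paired_cell_lip hb Yj x3 y3; rewrite paired_slope !dotpZl mulrA.
  have -> : 3 + 2 = 5 :> R by ring.
  move=> h1; apply: le_trans h1 _; rewrite le_eqVlt; apply/orP; left; apply/eqP.
  by rewrite /Q; ring.
rewrite -mulr_sumr; apply: le_trans (ler_wpM2l _ (tele_max_sum N)) _.
  by apply: mulr_ge0 (enorm_ge0 _); exact: mulr_ge0.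
by rewrite /Q le_eqVlt; apply/orP; left; apply/eqP; ring.
Qed.

Lemma field_perturbation S : 10 * e <= g ->
  (forall x, (dotp (\sum_(j < N.+1) paired flux j) x) @[N --> \oo] --> dotp S x) ->
  perturbation (40 * far_const * dkap (e ^- 2))
    (fun h y => field h y - dotp ((2 * iint h * (dkap (e ^- 2) * e^-1)) *: S) y).
Proof.
move=> eg cS; split.
- move: far_const far_const_ge0 => F F0.
  have E0 : 0 <= dkap (e ^- 2) by rewrite ltW// dkap_gt0// invr_gt0 exprn_gt0.
  by rewrite !mulr_ge0.
- by move=> B h hb; exact: field_lip.
- move=> B h h' y hb hb' _; rewrite (fieldB y hb hb') (iintB (integ_bnd_supp hb) (integ_bnd_supp hb')).
  rewrite !dotpZl; ring.
- move=> L h y hb hL; apply: C1atB; [exact: C1at_field hb hL|exact: C1at_dotp].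
Qed.

End cells.

Section symmetric_shift.
Context {V : zmodType}.
Implicit Types F : int -> V.

Lemma symsum_shift F N : symsum (fun k => F (k + 1)) N - symsum F N = F N.+1%:Z - F (- N%:Z).
Proof.
rewrite /symsum -sumrB -(big_mkord xpredT (fun i => F (i%:Z - N%:Z + 1) - F (i%:Z - N%:Z))).
have := @telescope_sumr V 0 N.*2.+1 (fun i => F (i%:Z - N%:Z)) isT.
have -> : N.*2.+1%:Z - N%:Z = N.+1%:Z by rewrite -addnn; lia.
rewrite sub0r => <-; apply: eq_bigr => i _; congr (F _ - _); lia.
Qed.

Lemma symsum_opp F F' N : (forall k, F k = - F' (- k)) -> symsum F N = - symsum F' N.
Proof.
move=> H; rewrite !symsum_paired -sumrN; apply: eq_bigr => -[[|j] ?] _ /=; first by rewrite H oppr0.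
by rewrite !H opprK opprD addrC.
Qed.

End symmetric_shift.

(** * Oddness and periodicity of the total potential *)

Section potential_field.
Context {R : realType}.
Variables (s l e g : R) (P : (R * R)%type).
Hypotheses (hs : 0 < s <= 1) (e0 : 0 < e) (g0 : 0 < g).
Notation kap := (kap s).
Notation dkap := (dkap s).
Notation conv := (convk kap).
Notation Phi := (Phi s).
Implicit Types (h : R * R -> R) (x y V : (R * R)%type) (B C Y : R) (j N : nat) (k : int).
Hypothesis geoV : forall k, g * `|k|%:R <= enorm (period l k).
Hypothesis geoT : forall k, g * (maxn 1 `|k|)%:R <= enorm (P + period l k).
Notation cell := (cell s l e P).
Notation field := (field s l e P).
Notation A k := (e^-1 *: period l k).

Definition full h k y := conv h (A k + y) - conv h (- (e^-1 *: (P + period l k)) - y).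

Definition potential h y := conv h y + field h y.

Lemma period0 : period l 0 = 0 :> R * R.
Proof. by rewrite /period mul0r scale0r. Qed.

Lemma periodD k k' : period l (k + k') = period l k + period l k' :> R * R.
Proof. by rewrite /period intrD mulrDl scalerDl. Qed.

Lemma full_cell h k y : full h k y = (if k == 0 then conv h y else 0) + cell h k y.
Proof.
rewrite /full cellE; case: eqVneq => [->|_]; last by rewrite add0r.
by rewrite period0 scaler0 add0r sub0r.
Qed.

Lemma potential_cvg B h y : bnd_supp 2 B h -> symsum (full h ^~ y) N @[N --> \oo] --> potential h y.
Proof.
move=> hb; rewrite (_ : (fun N => _) = (fun N => conv h y + \sum_(j < N.+1) paired (cell h ^~ y) j)).
  by apply: cvgD; [exact: cvg_cst|exact: fseries_cvg (field_tame hs e0 g0 geoV geoT hb)].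
apply/funext => N; rewrite symsum_paired !big_ord_recl /= full_cell eqxx -addrA; congr (_ + (_ + _)).
Qed.

(** The central symmetry exchanges vortices with antivortices and k with - k, and the symmetric
    partial sums respect it. *)
Lemma potential_odd B h y : bnd_supp 2 B h -> potential h (- (e^-1 *: P) - y) = - potential h y.
Proof.
move=> hb; have c1 := potential_cvg (y := - (e^-1 *: P) - y) hb.
rewrite -(cvg_lim (@Rhausdorff R) c1); apply/cvg_lim => //.
rewrite (_ : (fun N => _) = (fun N => - symsum (full h ^~ y) N)); first by apply: cvgN; exact: potential_cvg hb.
apply/funext => N; apply: symsum_opp => k; rewrite /full periodN [RHS]opprB; congr (conv _ _ - conv _ _).
  by apply: pair_ext; rewrite /= /GRing.scale/=; ring.
by apply: pair_ext; rewrite /= /GRing.scale/=; ring.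
Qed.

Lemma enorm_Phi_le V : 1 <= enorm V -> enorm (Phi V) <= (enorm V)^-1.
Proof.
move=> V1; have V0 : 0 < enorm V by lra.
have V2 : 1 <= dotp V V by rewrite -enorm_sqr expr_ge1// ltW.
rewrite (_ : Phi V = dkap (dotp V V) *: V)// enormZ gtr0_norm; last by rewrite dkap_gt0// (lt_le_trans ltr01).
apply: le_trans (ler_wpM2r (ltW V0) (dkap_le_inv hs V2)) _.
by rewrite -enorm_sqr expr2 invfM mulfVK ?gt_eqF.
Qed.

(** The bound obtained is O(1 / |k|): not summable, but enough for boundary terms. *)
Lemma full_vanish B h y y' (d : R) : bnd_supp 2 B h -> 0 < d ->
  exists N0 : nat, forall k, (N0 <= `|k|)%N -> `|full h k y - full h k y'| <= d.
Proof.
move=> hb d0; pose Y := Num.max (enorm y) (enorm y').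
have yY : enorm y <= Y by rewrite le_max lexx.
have y'Y : enorm y' <= Y by rewrite le_max lexx orbT.
pose K := far_const s g * (Y + 2) * dkap (e ^- 2) * B.
pose Q := (2 * K + `|2 * iint h| * (2 * e / g)) * enorm (y - y').
have Q1 : 0 < `|Q| + 1 by rewrite ltr_wpDl.
have [N1 N10 HN] := inv_nat_small (divr_gt0 d0 Q1).
pose J := (Num.truncn (2 * (Y + 2) * e / g)).+1.
exists (maxn J N1) => k; rewrite geq_max => /andP[Jk Nk].
have k0 : (0 < `|k|)%N by exact: leq_trans Nk.
have kp : 0 < `|k|%:R :> R by rewrite ltr0n.
have mk : maxn 1 `|k| = `|k|%N by apply/maxn_idPr.
have kn0 : k == 0 = false by apply/negbTE; rewrite -absz_gt0.
have Yk : 2 * (Y + 2) * e <= g * `|k|%:R.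
  rewrite [leRHS]mulrC -ler_pdivrMr//; apply: ltW; apply: lt_le_trans (truncnS_gt _) _.
  by rewrite ler_nat.
have ek : e <= g * `|k|%:R.
  by apply: le_trans Yk; rewrite ler_peMl ?(ltW e0)//; have := enorm_ge0 y; lra.
rewrite !full_cell kn0 !add0r.
have Yk' : 2 * (Y + 2) * e <= g * (maxn 1 `|k|)%:R by rewrite mk.
have := cell_lip hs e0 g0 geoV geoT hb Yk' yY y'Y; rewrite mk -/K.
have small V : g * `|k|%:R <= enorm V -> enorm (Phi (e^-1 *: V)) <= e / g * `|k|%:R^-1.
  move=> gV; have V0 : 0 < enorm V by apply: lt_le_trans gV; exact: mulr_gt0.
  have eV : enorm (e^-1 *: V) = enorm V / e by rewrite enormZ ger0_norm ?invr_ge0 1?mulrC// ltW.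
  apply: le_trans (enorm_Phi_le _) _; first by rewrite eV ler_pdivlMr// mul1r (le_trans ek).
  rewrite eV invf_div -mulrA -invfM ler_wpM2l ?(ltW e0)// lef_pV2 ?posrE//.
  exact: mulr_gt0.
have sl : enorm (cell_slope s l e P k) <= 2 * e / g * `|k|%:R^-1.
  rewrite /cell_slope kn0; apply: le_trans (ler_enormB _ _) _.
  have s1 := small _ (geoV k).
  have s2 : enorm (Phi (e^-1 *: (P + period l k))) <= e / g * `|k|%:R^-1.
    by apply: small; have := geoT k; rewrite mk.
  by apply: le_trans (lerD s2 s1) _; rewrite le_eqVlt; apply/orP; left; apply/eqP; ring.
set D := cell h k y - _; set T := 2 * iint h * _ => h1.
have hT : `|T| <= `|2 * iint h| * (2 * e / g * `|k|%:R^-1 * enorm (y - y')).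
  rewrite /T normrM ler_wpM2l//; apply: le_trans (normr_dotp _ _) _.
  by rewrite ler_wpM2r ?enorm_ge0.
have tk : K * tele `|k| <= K * `|k|%:R^-1.
  have K0 : 0 <= K.
    have := far_const_ge0 s g0; rewrite /K; move: (far_const s g) => F F0.
    have Y2 : 0 <= Y + 2 by have := enorm_ge0 y; lra.
    have E0 : 0 <= dkap (e ^- 2) by rewrite ltW// dkap_gt0// invr_gt0 exprn_gt0.
    by rewrite !mulr_ge0// (bnd_supp_ge0 hb).
  by rewrite ler_wpM2l// teleE// gerBl invr_ge0.
rewrite -[D](subrK T); apply: le_trans (ler_normD _ _) _; apply: le_trans (lerD h1 hT) _.
apply: le_trans (_ : `|Q| * `|k|%:R^-1 <= _); last first.
  have := HN _ Nk; rewrite ler_pdivlMr// => h2; apply: le_trans h2.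
  by rewrite mulrC ler_wpM2l ?invr_ge0// lerDl.
apply: le_trans (_ : Q * `|k|%:R^-1 <= _); last by rewrite ler_wpM2r ?invr_ge0// ler_norm.
have -> : Q * `|k|%:R^-1 = 2 * (K * `|k|%:R^-1) * enorm (y - y') +
    `|2 * iint h| * (2 * e / g * `|k|%:R^-1 * enorm (y - y')) by rewrite /Q; ring.
by rewrite lerD2r ler_wpM2r ?enorm_ge0// ler_wpM2l.
Qed.

(** A shift by one period displaces the window |k| <= N by one and leaves the boundary terms k = N +
    1 and k = - N, whose variation in y vanishes in the limit. So the potential is periodic up to a
    constant, which gradients ignore. *)
Lemma potential_shift1 B h y y' : bnd_supp 2 B h ->
  potential h (A 1 + y) - potential h y = potential h (A 1 + y') - potential h y'.
Proof.
move=> hb; have c x : full h N.+1%:Z x - full h (- N%:Z) x @[N --> \oo] --> potential h (A 1 + x) - potential h x.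
  rewrite (_ : (fun N => _) = (fun N => symsum (full h ^~ (A 1 + x)) N - symsum (full h ^~ x) N)).
    by apply: cvgB; exact: potential_cvg hb.
  apply/funext => N; rewrite -(symsum_shift (full h ^~ x)); congr (_ - _); apply: eq_bigr => i _.
  rewrite /full periodD; congr (conv _ _ - conv _ _); apply: pair_ext; rewrite /= /GRing.scale/=; ring.
apply/eqP; rewrite -subr_eq0 -normr_le0; apply/ler_addgt0Pr => d d0; rewrite add0r.
have d4 : 0 < d / 4 by rewrite divr_gt0.
have [N0 H] := full_vanish y y' hb d4.
have /cvgrPdist_le/(_ _ d4)[N1 _ H1] := c y; have /cvgrPdist_le/(_ _ d4)[N2 _ H2] := c y'.
pose N := maxn N0 (maxn N1 N2).
have n0 : (N0 <= N)%N by exact: leq_maxl.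
have n1 : (N1 <= N)%N by rewrite /N !leq_max leqnn orbT.
have n2 : (N2 <= N)%N by rewrite /N !leq_max leqnn !orbT.
have := H N.+1%:Z (leqW n0); have := H (- N%:Z); rewrite abszN => /(_ n0).
have := H1 N n1; have := H2 N n2.
rewrite !ler_norml => /andP[u1 u2] /andP[u3 u4] /andP[u5 u6] /andP[u7 u8].
by apply/andP; split; lra.
Qed.

Lemma potential_shift B h k : bnd_supp 2 B h -> exists c : R, forall y, potential h (A k + y) = potential h y + c.
Proof.
move=> hb; pose c := potential h (A 1 + 0) - potential h 0.
have c1 y : potential h (A 1 + y) = potential h y + c by have := potential_shift1 y 0 hb; rewrite -/c => <-; ring.
have nat_shift n y : potential h (A n%:Z + y) = potential h y + n%:R * c.
  elim: n => [|n IH]; first by rewrite period0 scaler0 add0r mul0r addr0.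
  rewrite (_ : A n.+1 + y = A 1 + (A n%:Z + y)).
    by rewrite c1 IH -natr1; ring.
  by rewrite -addn1 PoszD periodD scalerDr -addrA addrCA.
case: (intP k) => [|n|n]; [by exists (0 * c) => y; rewrite -(nat_shift 0)|by exists (n.+1%:R * c)|].
exists (- (n.+1%:R * c)) => y; have := nat_shift n.+1 (A (- n.+1%:Z) + y).
by rewrite addrA periodN scalerN subrr add0r => ->; rewrite addrK.
Qed.

End potential_field.

(** * The stream function of the periodic vortex pair *)

Section singletons.
Context {R : realType}.
Implicit Types f g : R * R -> R.

Lemma set1X (v : R * R) : [set v] = [set v.1] `*` [set v.2].
Proof. by case: v => a b; apply/seteqP; split=> [_ ->//|[? ?] /= [-> ->]]. Qed.

Lemma area_set1 (v : R * R) : (@area R [set v] = 0)%E.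
Proof. by rewrite set1X /area product_measure1E//= lebesgue_measure_set1 mul0e. Qed.

Lemma eq_iint_off v f g : measurable_fun setT f -> measurable_fun setT g ->
  (forall z, z != v -> f z = g z) -> iint f = iint g.
Proof.
move=> mf mg fg; rewrite !iintE /Rintegral; congr fine.
apply: ae_eq_integral => //; [exact/measurable_EFinP|exact/measurable_EFinP|].
exists [set v]; split; [by rewrite set1X; exact: measurableX|exact: area_set1|].
move=> z /= nz; apply: contrapT => zv; apply: nz => _; congr EFin; apply: fg.
by apply/eqP.
Qed.

End singletons.

Section differentiability.
Context {R : realType}.

Lemma dotp_linear (g : R * R) : linear (dotp g).
Proof. by move=> a x y; rewrite dotpDr dotpZr. Qed.

HB.instance Definition _ (g : R * R) := @GRing.isLinear.Build R (R * R)%type R _ (dotp g) (dotp_linear g).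

Lemma enorm_le_norm (v : R * R) : enorm v <= 2 * `|v|.
Proof.
apply: le_trans (enorm_le_coord v) _; rewrite mulr_natl mulr2n.
by apply: lerD; rewrite prod_normE le_max lexx ?orbT.
Qed.

Lemma has_grad_differentiable (f : R * R -> R) y g : has_grad f y g -> differentiable f y.
Proof.
move=> h; have c : continuous (dotp g) by move=> z; exact: C1at_continuous (C1at_dotp g z).
have key (e : R) : 0 < e -> \forall v \near (0 : R * R), `|f (v + y) - (f y + dotp g v)| <= e * `|v|.
  move=> e0; have e2 : 0 < e / 2 by rewrite divr_gt0.
  have [d d0 H] := h _ e2; apply/nbhs_enormP; exists d => // v; rewrite subr0 => vd.
  rewrite (addrC v) opprD addrA; apply: le_trans (H v vd) _.
  by have := ler_wpM2l (ltW e2) (enorm_le_norm v); linarith.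
by apply/diff_locallyP; rewrite (@diff_unique R (R * R)%type R f (dotp g) y c); [split; [exact: c|]|];
  apply/eqaddoP => e e0; exact: key.
Qed.

End differentiability.

Section stream_kernel.
Context {R : realType}.
Variable s : R.
Hypothesis hs : 0 < s <= 1.
Notation kap := (kap s).
Notation conv := (convk kap).
Let lk := kap_locally_integrable hs.
Implicit Types (h : R * R -> R) (x y z v p : (R * R)%type) (e : R).

Definition kernel_coef : R := if s == 1 then (4 * pi)^-1 else c_ s * (1 - s).

(** Passing to |x|^2 doubles the logarithm, whence 4 pi instead of 2 pi. For s = 1 the value at x =
    0 is settled by the conventions on inverse and logarithm at 0. *)
Lemma G_kap x : G_ s x = kernel_coef * kap (dotp x x).
Proof.
rewrite /G_ /kernel_coef kapE -enorm_sqr; have := enorm_ge0 x; set r := enorm x => r0.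
have [s1|s1] := eqVneq s 1; last first.
  have s0 : 1 - s != 0 by rewrite subr_eq0 eq_sym.
  rewrite -powR_mulrn// -powRrM (_ : 2 * s - 2 = 2 * (s - 1)); last by ring.
  by set Q := _ `^ _; field.
have [->|rn] := eqVneq r 0; first by rewrite invr0 expr0n/= !ln0// oppr0 !mulr0.
have rp : 0 < r by rewrite lt_def rn.
rewrite lnV ?posrE// lnXn// -mulr_natl; have := pi_gt0 R; move: (pi : R) => q q0; field; exact: lt0r_neq0.
Qed.

Lemma calC_kernel : calC s = 2 * kernel_coef.
Proof.
rewrite /calC /kernel_coef; case: (s == 1); last by ring.
by have := pi_gt0 R; move: (pi : R) => q q0; field; exact: lt0r_neq0.
Qed.

Lemma iint_scale e f : 0 < e -> integ f -> iint (fun z => f (e *: z)) = e ^- 2 * iint f.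
Proof. by move=> e0 fi; rewrite !iintE Rintegral_area_scale. Qed.

Definition rescale e p h x := h (e^-1 *: (x - p)).

Lemma bnd_supp_rescale e p B C h : 0 < e -> bnd_supp B C h ->
  bnd_supp (e * B + enorm p) C (rescale e p h).
Proof.
move=> e0 [mh hC h0]; split; [|by move=> z; exact: hC|move=> z ez]; last first.
  apply: h0; rewrite enormZ gtr0_norm ?invr_gt0// -(ltr_pM2l e0) mulrA mulfV ?gt_eqF// mul1r.
  by have := ler_enorm_distD p z 0; rewrite !subr0; linarith.
apply: measurableT_comp mh _; apply: measurable_fun_pair => /=.
  apply: measurable_funM; [exact: measurable_cst|apply: measurable_funD => //].
apply: measurable_funM; [exact: measurable_cst|apply: measurable_funD => //].
Qed.

Lemma iint_rescale e p B C h : 0 < e -> bnd_supp B C h -> iint (rescale e p h) = e ^+ 2 * iint h.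
Proof.
move=> e0 hb; have ri := integ_bnd_supp (bnd_supp_rescale p e0 hb).
have e2 : e ^+ 2 != 0 by rewrite expf_neq0// gt_eqF.
have pr := area_preserving_translate p.
rewrite -(iint_preserving pr (integ_measurable ri)).
have := iint_scale e0 (integ_preserving pr ri).
rewrite (_ : (fun z => _) = h); first by move=> ->; rewrite mulrA mulfV// mul1r.
by apply/funext => z; rewrite /rescale addrK scalerA mulVf ?gt_eqF// scale1r.
Qed.

(** For s = 1 the kernel is homogeneous up to an additive constant, which shows up multiplied by the
    mass. Homogeneity is known for positive arguments only, so the integrands are compared off one
    point. *)
Lemma conv_rescale e p : 0 < e -> exists k, forall B C h v, bnd_supp B C h ->
  conv (rescale e p h) v = e ^+ 2 * ((e ^+ 2) `^ (s - 1) * conv h (e^-1 *: (v - p)) + k * iint h).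
Proof.
move=> e0; have e2 : 0 < e ^+ 2 by rewrite exprn_gt0.
have [k Hk] := kap_scale s e2; exists k => B C h v hb.
have rb := bnd_supp_rescale p e0 hb; have ri := integ_convk lk v rb.
have pr := area_preserving_translate p; set y := e^-1 *: (v - p).
rewrite convkE -(iint_preserving pr (integ_measurable ri)).
have := iint_scale e0 (integ_preserving pr ri); set I := iint _ => hI.
have -> : iint (fun z => kap (dotp (v - (z + p)) (v - (z + p))) * rescale e p h (z + p)) = e ^+ 2 * I.
  by rewrite hI mulrA mulfV ?mul1r// gt_eqF.
congr (_ * _); rewrite /I convkE.
have hi := integ_bnd_supp hb; have ci := integ_convk lk y hb.
rewrite -!iintZ// -iintD; [|exact: integZ|exact: integZ].
apply: (@eq_iint_off R y).
- apply: measurable_funM.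
    apply: measurableT_comp (measurable_kap s) _.
    have mm := measurableT_comp (@measurable_nsq R) (measurable_sub_l y).
    rewrite (_ : (fun z => _) = (fun z => e ^+ 2 * dotp (y - z) (y - z))).
      by apply: measurable_funM; [exact: measurable_cst|exact: mm].
    apply/funext => z; rewrite /y; set u := v - p.
    have -> : v - (e *: z + p) = e *: (e^-1 *: u - z).
      by rewrite scalerBr scalerA mulfV ?gt_eqF// scale1r /u opprD addrA addrAC.
    by rewrite dotpZl dotpZr mulrA -expr2.
  rewrite (_ : (fun z => _) = h); first by case: hb.
  by apply/funext => z; rewrite /rescale addrK scalerA mulVf ?gt_eqF// scale1r.
- exact: integ_measurable (integD (integZ _ ci) (integZ _ hi)).
move=> z zy; rewrite /rescale addrK scalerA mulVf ?gt_eqF// scale1r mulrA -mulrDl; congr (_ * _).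
have -> : v - (e *: z + p) = e *: (y - z).
  by rewrite /y scalerBr scalerA mulfV ?gt_eqF// scale1r opprD addrA addrAC.
rewrite dotpZl dotpZr mulrA -expr2 Hk// dotp_gt0 subr_eq0 eq_sym//.
Qed.

Lemma conv_reflect B C h v : bnd_supp B C h -> conv (fun z => h (- z)) v = conv h (- v).
Proof.
move=> hb; have pr := @area_preserving_opp R; have [mo _] := pr.
have hm : bnd_supp B C (fun z => h (- z)).
  by case: hb => mh hC h0; split => // [|z zB]; [exact: measurableT_comp mh mo|apply: h0; rewrite enormN].
rewrite !convkE -(iint_preserving pr (integ_measurable (integ_convk lk v hm))).
apply: eq_iint => z; rewrite opprK; congr (kap _ * _).
by rewrite -opprD dotpNl dotpNr opprK.
Qed.

End stream_kernel.

Section periodization.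
Context {R : realType}.
Implicit Types (f : R * R -> R) (x z : (R * R)%type) (l M X : R) (k : int).

Lemma snd_add x z : (x + z).2 = x.2 + z.2. Proof. by []. Qed.

Lemma snd_opp x : (- x).2 = - x.2. Proof. by []. Qed.

Lemma snd_period l k : (period l k : R * R).2 = k%:~R * l.
Proof. by rewrite /period /= /GRing.scale/= mulr1. Qed.

Lemma fsum_symsum (V : nmodType) (F : int -> V) N : (forall k, (N < `|k|)%N -> F k = 0) ->
  \sum_(k \in [set: int]) F k = symsum F N.
Proof.
move=> F0; pose r := [seq i%:Z - N%:Z | i <- iota 0 N.*2.+1].
have ur : uniq r by rewrite map_inj_uniq ?iota_uniq// => i j; lia.
rewrite (fsbigE r) //; last first.
  move=> k _ kr; apply: F0; rewrite ltnNge; apply: contra kr => kN; apply/mapP.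
  by exists (absz (k + N%:Z)); [rewrite mem_iota|]; lia.
rewrite big_map (eq_bigl xpredT); last by move=> i; rewrite in_setT.
by rewrite /symsum -(big_mkord xpredT (fun i => F (i%:Z - N%:Z))) /index_iota subn0.
Qed.

Lemma enorm_period l k : 0 < l -> enorm (period l k : R * R) = `|k|%:R * l.
Proof.
move=> l0; rewrite /period enormZ normrM (gtr0_norm l0).
have -> : enorm (e2 : R * R) = 1 by rewrite /enorm /dotp /e2 /= !mulr0 add0r mulr1 sqrtr1.
by rewrite mulr1 -intr_norm -abszE.
Qed.

Lemma period_far l X : 0 < l -> exists N, forall k, (N < `|k|)%N -> X < enorm (period l k : R * R).
Proof.
move=> l0; exists (Num.truncn (X / l)).+1 => k Nk; rewrite enorm_period// -ltr_pdivrMr//.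
by apply: lt_le_trans (truncnS_gt _) _; rewrite ler_nat ltnW.
Qed.

Lemma periodize_shift l f x : periodize l f (x + l *: e2) = periodize l f x.
Proof.
rewrite /periodize [RHS](@reindex_fsbigT _ _ _ int int (fun k : int => k + 1)); last first.
  by exists (fun k : int => k - 1) => k; [rewrite addrK|rewrite subrK].
apply: eq_fsbigr => k _; congr f; rewrite (addrC k) periodD addrA; congr (_ + _ + _).
by rewrite /period mul1r.
Qed.

End periodization.

Section vortex_pair.
Context {R : realType}.
Variables (s l : R) (p : (R * R)%type).
Hypotheses (hs : 0 < s <= 1) (l0 : 0 < l) (hp : - (l / 2) < p.2 < 0).
Notation kap := (kap s).
Notation dkap := (dkap s).
Notation conv := (convk kap).
Notation Phi := (Phi s).
Implicit Types (h w : R * R -> R) (x y z : (R * R)%type) (e : R) (k : int).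

(** For p.2 = - a this is min (2 a, l - 2 a), the vertical distance from a vortex to the nearest
    antivortices. *)
Definition gap : R := Num.min (- (p.2 + p.2)) (l + (p.2 + p.2)).

Lemma gap_gt0 : 0 < gap.
Proof. by move/andP: hp => [h1 h2]; rewrite lt_min; apply/andP; split; linarith. Qed.

Lemma gap_period k : gap * `|k|%:R <= enorm (period l k : R * R).
Proof.
rewrite enorm_period// mulrC ler_wpM2l//.
by move/andP: hp => [h1 h2]; rewrite ge_min; apply/orP; right; linarith.
Qed.

Lemma gap_dipole k : gap * (maxn 1 `|k|)%:R <= enorm (p + p + period l k).
Proof.
apply: le_trans (normr_snd_le _); move/andP: hp => [h1 h2].
rewrite !(snd_add, snd_period); have g1 : gap <= - (p.2 + p.2) by rewrite ge_min lexx.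
have g2 : gap <= l + (p.2 + p.2) by rewrite ge_min lexx orbT.
have g0 := gap_gt0; case: (intP k) => [|n|n].
- by rewrite /= mul0r addr0 mulr1 -normrN; apply: le_trans g1 (ler_norm _).
- have -> : maxn 1 `|n.+1%:Z| = n.+1 by apply/maxn_idPr.
  apply: le_trans (ler_norm _); rewrite -pmulrn -natr1.
  by have : 0 <= n%:R :> R by []; move: (n%:R : R) => t t0; nra.
- have -> : maxn 1 `|- n.+1%:Z| = n.+1 by rewrite abszN; apply/maxn_idPr.
  rewrite -normrN mulrNz; apply: le_trans (ler_norm _); rewrite -pmulrn -natr1.
  by have : 0 <= n%:R :> R by []; move: (n%:R : R) => t t0; nra.
Qed.

Section one_scale.
Variables (e : R) (w : R * R -> R).
Hypotheses (e0 : 0 < e) (e_small : 2 * e < l / 2 + p.2) (wb : bnd_supp 2 1 w) (m0 : 0 < iint w).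

Definition vortex x := (iint w * e ^+ 2)^-1 * rescale e p w x.
Definition antivortex x := vortex (- x).
Definition dipole x := vortex x - antivortex x.
Definition wave x := periodize l vortex x - periodize l antivortex x.

Lemma vortex_supp x : vortex x != 0 -> enorm (x - p) <= 2 * e.
Proof.
case: wb => _ _ h0; rewrite mulf_eq0 negb_or => /andP[_]; apply: contraTT; rewrite -ltNge => h.
rewrite negbK /rescale h0// enormZ gtr0_norm ?invr_gt0// -(ltr_pM2l e0) mulrA mulfV ?gt_eqF// mul1r.
by rewrite mulrC.
Qed.

Lemma bnd_supp_vortex : bnd_supp (e * 2 + enorm p) (`|(iint w * e ^+ 2)^-1| * 1) vortex.
Proof. exact: bnd_suppZ (bnd_supp_rescale p e0 wb). Qed.

Lemma bnd_supp_antivortex : bnd_supp (e * 2 + enorm p) (`|(iint w * e ^+ 2)^-1| * 1) antivortex.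
Proof.
have [_ [mo _]] := (tt, @area_preserving_opp R); have [mh hC h0] := bnd_supp_vortex.
split; [exact: measurableT_comp mh mo|by move=> z; exact: hC|by move=> z zB; apply: h0; rewrite enormN].
Qed.

(** The condition 2 e < l / 2 + p.2 keeps the vortex and the antivortex inside the strip, so no
    image with k != 0 enters it. *)
Lemma wave_strip y : strip l y -> wave y = dipole y.
Proof.
move=> /andP[y1 y2]; have es := e_small; move/andP: hp => [h1 h2]; rewrite /wave /dipole /periodize.
have far k : (0 < `|k|)%N -> vortex (y + period l k) = 0 /\ antivortex (y + period l k) = 0.
  move=> k0; have kl : l <= `|k%:~R * l|.
    by rewrite normrM (gtr0_norm l0) ler_peMl ?(ltW l0)// -intr_norm -abszE ler1n.
  have r1 : `|y.2| < l / 2 by rewrite ltr_norml y1.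
  split; apply/eqP; apply: contraT => /vortex_supp; rewrite leNgt => /negP[].
    apply: lt_le_trans (normr_snd_le _); rewrite !(snd_add, snd_opp, snd_period).
    set t := k%:~R * l in kl *; have := ler_normD (y.2 + t - p.2) (p.2 - y.2).
    have -> : y.2 + t - p.2 + (p.2 - y.2) = t by ring.
    have := ler_normB p.2 y.2; rewrite (ltr0_norm h2); lra.
  apply: lt_le_trans (normr_snd_le _); rewrite !(snd_add, snd_opp, snd_period).
  set t := k%:~R * l in kl *; have := ler_normD (- (y.2 + t) - p.2) (p.2 + y.2).
  have -> : - (y.2 + t) - p.2 + (p.2 + y.2) = - t by ring.
  by rewrite normrN; have := ler_normD p.2 y.2; rewrite (ltr0_norm h2); lra.
have z : period l 0 = 0 :> R * R by exact: period0.
by rewrite !(fsum_symsum (N := 0%N)) /symsum ?big_ord1 /= ?subr0 ?z ?addr0// => k /far[].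
Qed.

Lemma dipole_off_strip y : ~ strip l y -> dipole y = 0.
Proof.
move=> ny; have es := e_small; move/andP: hp => [h1 h2]; have {}ny : l / 2 <= `|y.2|.
  by rewrite leNgt; apply/negP => h; apply: ny; rewrite /strip/=; rewrite ltr_norml in h.
have v0 z : l / 2 <= `|z.2| -> vortex z = 0.
  move=> hz; apply/eqP; apply: contraT => /vortex_supp; rewrite leNgt => /negP[].
  apply: lt_le_trans (normr_snd_le _); have := ler_normD (z.2 - p.2) p.2.
  by rewrite snd_add snd_opp subrK (ltr0_norm h2); lra.
by rewrite /dipole /antivortex !v0 ?subrr//= normrN.
Qed.

Lemma measurable_strip : measurable (strip l).
Proof.
have -> : strip l = [set: R] `*` `](- (l / 2)), (l / 2)[%classic.
  by apply/seteqP; split => [x h|x [_ /=]]; rewrite /= ?in_itv//.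
exact: measurableX.
Qed.

Notation P := (p + p).
Definition stream_coef : R := kernel_coef s * (e ^+ 2) `^ (s - 1) / iint w.
Definition stream x := stream_coef * potential s l e P w (e^-1 *: (x - p)).

(** The integral over the strip is that of the dipole over the plane, and rescaling turns it into a
    multiple of [full]. The additive constants of [conv_rescale] cancel because the two vortices
    have the same mass. *)
Lemma is_stream_wave : is_stream s l wave stream.
Proof.
have vb := bnd_supp_vortex; have avb := bnd_supp_antivortex.
have db := bnd_suppB vb avb; have lk := kap_locally_integrable hs.
have I x k := integZ (kernel_coef s) (integ_convk lk (x + period l k) db).
have E x k z : ((fun y => G_ s (x - y + period l k) * wave y) \_ (strip l)) z =
    kernel_coef s * (kap (dotp (x + period l k - z) (x + period l k - z)) * (vortex z - antivortex z)).
  rewrite patchE; case: ifPn => zs; last first.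
    have := @dipole_off_strip z; rewrite /dipole => ->; first by rewrite !mulr0.
    by move=> h; move/negP: zs; apply; exact: mem_set.
  rewrite wave_strip; last exact: set_mem.
  by rewrite G_kap /dipole mulrA addrAC.
split.
  move=> x k; apply/integrable_mkcond; first exact: measurable_strip.
  have := integ_eq (fun z => esym (E x k z)) (I x k).
  by rewrite /integ -restrict_EFin.
move=> x; set y := e^-1 *: (x - p).
have [kc Hk] := conv_rescale hs p e0.
have c := potential_cvg hs e0 gap_gt0 gap_period gap_dipole (y := y) wb.
rewrite (_ : (fun N => _) = (fun N => stream_coef * symsum (full s l e P w ^~ y) N)).
  by apply: cvgM; [exact: cvg_cst|exact: c].
apply/funext => N; rewrite /symsum mulr_sumr; apply: eq_bigr => i _; set k := _ - _.
rewrite Rintegral_mkcond -iintE (eq_iint (E x k)) iintZ; last exact: (integ_convk lk (x + period l k) db).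
rewrite -convkE (convkB lk _ vb avb) (conv_reflect hs _ vb).
have cv v : conv vortex v = (iint w)^-1 * ((e ^+ 2) `^ (s - 1) * conv w (e^-1 *: (v - p)) + kc * iint w).
  rewrite (convkZ lk _ _ (bnd_supp_rescale p e0 wb)) (Hk _ _ _ _ wb) mulrA; congr (_ * _).
  by rewrite invfM -mulrA mulVf ?mulr1// expf_neq0// gt_eqF.
rewrite !cv /stream_coef /full.
have -> : e^-1 *: (x + period l k - p) = e^-1 *: period l k + y.
  by rewrite /y -scalerDr; congr (_ *: _); rewrite -addrA addrCA.
have -> : e^-1 *: (- (x + period l k) - p) = - (e^-1 *: (P + period l k)) - y.
  by rewrite /y; apply: pair_ext; rewrite /= /GRing.scale/=; ring.
by ring.
Qed.

(** On a bounded set finitely many images are present, so the regularity and the gradient of the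
    wave are those of a finite sum. *)
Lemma wave_local N X x : (forall k, (N < `|k|)%N -> X + (e * 2 + enorm p) < enorm (period l k : R * R)) ->
  enorm x <= X -> wave x = symsum (fun k => dipole (x + period l k)) N.
Proof.
move=> HN xX; have [_ _ v0] := bnd_supp_vortex; have [_ _ a0] := bnd_supp_antivortex.
have far k : (N < `|k|)%N -> e * 2 + enorm p < enorm (x + period l k).
  by move=> /HN h; have := ler_enormB (x + period l k) x; rewrite addrC addKr; lra.
rewrite /wave /periodize !(fsum_symsum (N := N)); first by rewrite /symsum -sumrB.
  by move=> k /far; exact: a0.
by move=> k /far; exact: v0.
Qed.

Variables (sigma b : R * R).
Hypothesis crit : forall y, exists g c,
  has_grad (fun y => conv w y + (field s l e P w y - dotp sigma y) + dotp b y) y g /\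
  has_grad w y (c *: g).

(** The constant part of the velocity: [sigma] is the slope of the image field that was removed from
    the core problem, b the drift found there. *)
Definition drift : R * R := perp ((stream_coef * e^-1) *: (sigma - b)).

Lemma critical_potential y : exists g, has_grad (potential s l e P w) y (g + (sigma - b)) /\
  forall g', has_grad (potential s l e P w) y (g' + (sigma - b)) -> exists c, has_grad w y (c *: g').
Proof.
have [g [c [h1 h2]]] := crit y.
have hp' : has_grad (potential s l e P w) y (g + (sigma - b)).
  have := has_gradD h1 (has_grad_dotp (sigma - b) y).
  apply: (eq_has_grad ltr01) => x _; rewrite /potential dotpDl dotpNl; ring.
exists g; split => // g' h'; exists c.
by have := has_grad_unique hp' h' => /addIr <-.
Qed.

(** The core problem makes gradients parallel for one copy of w. Periodicity up to constants and
    oddness of the potential transport this to every image and every antivortex, with the same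
    vector g. *)
Lemma stream_grad x : exists g, has_grad stream x ((stream_coef * e^-1) *: (g + (sigma - b))) /\
  forall k, exists c, has_grad (fun x => dipole (x + period l k)) x (c *: g).
Proof.
have affE (a : R) (u v : R * R) : a *: (u + v) = a *: u + a *: v by exact: scalerDr.
pose y := e^-1 *: (x - p); have [g [h _]] := critical_potential y; exists g; split.
  rewrite -scalerA; apply: has_gradZ; rewrite (_ : (fun z => _) = fun z => potential s l e P w (e^-1 *: z + e^-1 *: (- p))).
    by apply: has_grad_affine; rewrite -affE.
  by apply/funext => z; rewrite affE.
move=> k; pose y1 := e^-1 *: period l k + y; pose y2 := - (e^-1 *: P) - y1.
have [g1 [h1 w1]] := critical_potential y1; have [g2 [h2 w2]] := critical_potential y2.
have [c Hc] := potential_shift hs e0 gap_gt0 gap_period gap_dipole k wb.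
have hg1 : has_grad (potential s l e P w) y1 (g + (sigma - b)).
  have u1 : has_grad (fun z => potential s l e P w (1 *: z + e^-1 *: period l k)) y (1 *: (g1 + (sigma - b))).
    by apply: has_grad_affine; rewrite scale1r (addrC y); exact: h1.
  have u2 : has_grad (fun z => potential s l e P w (1 *: z + e^-1 *: period l k)) y (g + (sigma - b)).
    have := has_gradD h (has_grad_cst c y); rewrite addr0.
    by apply: (eq_has_grad ltr01) => z _; rewrite scale1r (addrC z) Hc.
  by have := has_grad_unique u1 u2; rewrite scale1r => <-.
have [c1 hc1] := w1 _ hg1.
have /w2[c2 hc2] : has_grad (potential s l e P w) y2 (g + (sigma - b)).
  have u1 : has_grad (fun z => potential s l e P w ((-1) *: z + - (e^-1 *: P))) y1 ((-1) *: (g2 + (sigma - b))).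
    by apply: has_grad_affine; rewrite scaleN1r (addrC (- y1)); exact: h2.
  have u2 : has_grad (fun z => potential s l e P w ((-1) *: z + - (e^-1 *: P))) y1 ((-1) *: (g + (sigma - b))).
    apply: (eq_has_grad ltr01) (has_gradZ (-1) hg1) => z _; rewrite scaleN1r (addrC (- z)) mulN1r.
    by rewrite (potential_odd hs e0 gap_gt0 gap_period gap_dipole z wb).
  by have := has_grad_unique u1 u2; rewrite !scaleN1r => /oppr_inj <-.
pose c0 := (iint w * e ^+ 2)^-1; exists (c0 * (e^-1 * c1 + e^-1 * c2)).
have -> : (c0 * (e^-1 * c1 + e^-1 * c2)) *: g = c0 *: (e^-1 *: (c1 *: g)) - c0 *: ((- e^-1) *: (c2 *: g)).
  by rewrite !scalerA -scalerBl; congr (_ *: _); ring.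
apply: has_gradB; apply: has_gradZ.
  rewrite (_ : (fun z => _) = fun z => w (e^-1 *: z + e^-1 *: (period l k - p))).
    apply: has_grad_affine; move: hc1; congr has_grad; rewrite /y1 /y -!affE; congr (_ *: _).
    by rewrite addrCA.
  by apply/funext => z; rewrite /rescale -affE addrA.
rewrite (_ : (fun z => _) = fun z => w ((- e^-1) *: z + e^-1 *: (- period l k - p))).
  apply: has_grad_affine; move: hc2; congr has_grad; rewrite /y2 /y1 /y.
  by apply: pair_ext; rewrite /= /GRing.scale/=; ring.
apply/funext => z; rewrite /rescale; congr w; apply: pair_ext; rewrite /= /GRing.scale/=; ring.
Qed.

(** Subtracting the drift leaves a velocity proportional to [perp g], while the gradient of the wave
    is a multiple of g. *)
Lemma wave_traveling : travelling_wave s l wave drift.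
Proof.
exists stream; split; first exact: is_stream_wave.
  by move=> x; have [g [h _]] := stream_grad x; exact: has_grad_differentiable h.
move=> x; have [g [h /choice[c hc]]] := stream_grad x.
have [N HN] := period_far (enorm x + 1 + (e * 2 + enorm p)) l0.
have hw : exists k : R, has_grad wave x (k *: g).
  have : exists k : R, has_grad (fun z => symsum (fun k => dipole (z + period l k)) N) x (k *: g).
    rewrite /symsum; elim: N.*2.+1 {HN} => [|n [k IH]].
      by exists 0; rewrite scale0r; apply: (eq_has_grad ltr01) (has_grad_cst 0 x) => z _; rewrite big_ord0.
    exists (k + c (n%:Z - N%:Z)); rewrite scalerDl.
    by apply: (eq_has_grad ltr01) (has_gradD IH (hc _)) => z _; rewrite big_ord_recr.
  move=> [k hk]; exists k; apply: (eq_has_grad ltr01) hk => z zx; rewrite (wave_local HN)//.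
  by have := ler_enormD (z - x) x; rewrite subrK; lra.
have [k hk] := hw; rewrite (has_grad_grad h) (has_grad_grad hk) /drift.
rewrite dotpZr /perp /dotp /= /GRing.scale/=; ring.
Qed.

Lemma C1_wave : (forall y, C1at w y) -> [/\ C1 wave, C1 vortex & C1 antivortex].
Proof.
move=> wC1; have vC x : C1at vortex x.
  apply: C1atZ; rewrite (_ : rescale e p w = fun z => w (e^-1 *: z + e^-1 *: (- p))); first exact: C1at_affine.
  by apply/funext => z; rewrite /rescale scalerDr.
have avC x : C1at antivortex x.
  have := @C1at_affine R vortex (-1) 0 x (vC _); congr C1at; apply/funext => z.
  by rewrite scaleN1r addr0.
split; apply: C1at_C1 => // x; have [N HN] := period_far (enorm x + 1 + (e * 2 + enorm p)) l0.
apply: (eq_C1at ltr01 (f1 := fun z => symsum (fun k => dipole (z + period l k)) N)).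
  by move=> z zx; rewrite (wave_local HN)//; have := ler_enormD (z - x) x; rewrite subrK; lra.
apply: C1at_sum => i; have shift f : C1at f (1 *: x + period l (i%:Z - N%:Z)) -> C1at (fun z => f (z + period l (i%:Z - N%:Z))) x.
  by move/C1at_affine; congr C1at; apply/funext => z; rewrite scale1r.
by apply: C1atB; apply: shift.
Qed.


End one_scale.

End vortex_pair.

(** * Weak convergence and existence *)

Section finite_radius.
Context {R : realType}.

Lemma finite_radius n (Q : nat -> R -> Prop) :
  (forall i, exists2 r, 0 < r & forall e, 0 < e < r -> Q i e) ->
  exists2 r : R, 0 < r & forall e, 0 < e < r -> forall i, (i < n)%N -> Q i e.
Proof.
move=> H; elim: n => [|n [r r0 IH]]; first by exists 1.
have [r' r'0 H'] := H n; exists (Num.min r r'); first by rewrite lt_min r0.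
move=> e /andP[e0]; rewrite lt_min => /andP[er er'] i; rewrite ltnS leq_eqVlt => /orP[/eqP->|ni].
  by apply: H'; rewrite e0.
by apply: IH => //; rewrite e0.
Qed.

Lemma iint_sum n (F : nat -> R * R -> R) : (forall i, integ (F i)) ->
  integ (fun z => \sum_(i < n) F i z) /\ iint (fun z => \sum_(i < n) F i z) = \sum_(i < n) iint (F i).
Proof.
move=> Fi; elim: n => [|n [IH1 IH2]].
  rewrite big_ord0 -[RHS](@iint0 R); split; last by apply: eq_iint => z; rewrite big_ord0.
  by apply: integ_eq (integZ 0 (Fi 0%N)) => z; rewrite big_ord0 mul0r.
split; first by apply: integ_eq (integD IH1 (Fi n)) => z; rewrite big_ord_recr.
rewrite big_ord_recr/= -IH2 -iintD//; apply: eq_iint => z; exact: big_ord_recr.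
Qed.

End finite_radius.

Section test_functions.
Context {R : realType}.
Variables (l : R) (p : (R * R)%type).
Implicit Types (phi psi : R * R -> R) (e d : R).

Lemma test_function_bounded phi : test_function phi -> exists X, forall x, X < enorm x -> phi x = 0.
Proof.
move=> [_ /compact_bounded[M [_ MA]]]; exists (2 * (`|M| + 1)) => x hx; apply/eqP.
apply: contraT => px; move: hx; rewrite ltNge => /negP[]; apply: le_trans (enorm_le_norm x) _.
rewrite ler_wpM2l//; apply: MA; first by have := ler_norm M; lra.
exact: subset_closure.
Qed.

Lemma dirac_comb_symsum phi z X N : test_function phi -> (forall x, X < enorm x -> phi x = 0) ->
  (forall k, (N < `|k|)%N -> X + enorm z < enorm (period l k : R * R)) ->
  dirac_comb l z phi = symsum (fun k => phi (z - period l k)) N.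
Proof.
move=> [pc _] X0 HN; rewrite /dirac_comb.
have mphi : measurable_fun setT phi := continuous_measurable_plane pc.
have E k : \int[\d_(z - period l k)]_y phi y = phi (z - period l k).
  rewrite /Rintegral integral_dirac//; last exact/measurable_EFinP.
  by rewrite diracT mul1e.
rewrite (eq_fsbigr (fun k : int => phi (z - period l k))); last by move=> k _; exact: E.
apply: fsum_symsum => k /HN h; apply: X0.
by have := ler_enormB (z - period l k) z; rewrite addrC addKr enormN; lra.
Qed.

Variables (e : R) (w : R * R -> R).
Hypotheses (e0 : 0 < e) (wb : bnd_supp 2 1 w) (w0 : forall y, 0 <= w y) (m0 : 0 < iint w).
Notation vortex := (vortex p e w).
Notation antivortex := (antivortex p e w).

Lemma vortex_ge0 x : 0 <= vortex x.
Proof. by apply: mulr_ge0 (w0 _); rewrite invr_ge0 mulr_ge0 ?sqr_ge0// ltW. Qed.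

Lemma iint_vortex : iint vortex = 1.
Proof.
rewrite iintZ; last exact: integ_bnd_supp (bnd_supp_rescale p e0 wb).
rewrite (iint_rescale p e0 wb) [iint w * _]mulrC mulVf// mulf_neq0 ?expf_neq0 ?gt_eqF//.
Qed.

(** The vortex is a probability density carried by the disc of radius 2 e around p. *)
Lemma vortex_average psi c d : measurable_fun setT psi -> 0 <= d ->
  (forall z, enorm (z - p) <= 2 * e -> `|psi z - c| <= d) ->
  integ (fun z => vortex z * psi z) /\ `|iint (fun z => vortex z * psi z) - c| <= d.
Proof.
move=> mpsi d0 H; have vi := integ_bnd_supp (bnd_supp_vortex p e0 wb).
have b1 z : `|vortex z * (psi z - c)| <= d * vortex z.
  rewrite normrM (ger0_norm (vortex_ge0 z)) mulrC; have [->|vz] := eqVneq (vortex z) 0; first by rewrite !mulr0.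
  by rewrite ler_wpM2r ?vortex_ge0//; apply: H; exact: (vortex_supp e0 wb vz).
have i1 : integ (fun z => vortex z * (psi z - c)).
  apply: le_integ b1 (integZ d vi); apply: measurable_funM; first exact: integ_measurable vi.
  by apply: measurable_funB => //; exact: measurable_cst.
have E z : vortex z * (psi z - c) + c * vortex z = vortex z * psi z by ring.
have i2 := integ_eq E (integD i1 (integZ c vi)); split => //.
rewrite -(eq_iint E) iintD//; last exact: integZ.
rewrite iintZ// iint_vortex mulr1 addrK.
have := norm_iint_le (integ_measurable i1) b1 (integZ d vi).
by rewrite iintZ// iint_vortex mulr1.
Qed.

(** A change of variables brings every image back to p, so that the k-th pair yields averages of phi
    near p - k l e2 and near - p - k l e2, each with error d. *)
Lemma wave_average phi X N d : test_function phi -> (forall x, X < enorm x -> phi x = 0) -> 0 <= d -> e < 1 ->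
  (forall k, (N < `|k|)%N -> `|X| + (2 + enorm p) < enorm (period l k : R * R)) ->
  (forall i, (i < N.*2.+1)%N -> forall z, enorm (z - p) <= 2 * e ->
    `|phi (z - period l (i%:Z - N%:Z)) - phi (p - period l (i%:Z - N%:Z))| <= d /\
    `|phi (- z - period l (i%:Z - N%:Z)) - phi (- p - period l (i%:Z - N%:Z))| <= d) ->
  `|\int[@area R]_x (wave l p e w x * phi x) - (dirac_comb l p phi - dirac_comb l (- p) phi)|
    <= N.*2.+1%:R * (2 * d).
Proof.
move=> tphi phi0 d0 e1 HN Hphi; have [pc _] := tphi.
have mphi : measurable_fun setT phi := continuous_measurable_plane pc.
have nX := ler_norm X.
have HX k : (N < `|k|)%N -> X + enorm p < enorm (period l k : R * R) by move=> /HN; lra.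
have HX' k : (N < `|k|)%N -> X + enorm (- p) < enorm (period l k : R * R) by rewrite enormN; exact: HX.
rewrite (dirac_comb_symsum tphi phi0 HX) (dirac_comb_symsum tphi phi0 HX').
have HW k : (N < `|k|)%N -> X + (e * 2 + enorm p) < enorm (period l k : R * R) by move=> /HN; lra.
pose v (i : nat) : R * R := period l (i%:Z - N%:Z).
have E x : \sum_(i < N.*2.+1) (dipole p e w (x + v i) * phi x) = wave l p e w x * phi x.
  have [xX|xX] := leP (enorm x) X; last by rewrite phi0// mulr0 big1// => i _; rewrite mulr0.
  by rewrite (wave_local e0 wb HW xX) mulr_suml.
have T1 (u : R * R) := area_preserving_translate u.
have T2 (u : R * R) := area_preserving_comp (@area_preserving_opp R) (area_preserving_translate u).
have mT (T : R * R -> R * R) : area_preserving T -> measurable_fun setT (fun z => phi (T z)).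
  by move=> [mT _]; exact: measurableT_comp mphi mT.
have main i : (i < N.*2.+1)%N -> integ (fun x => dipole p e w (x + v i) * phi x) /\
    `|iint (fun x => dipole p e w (x + v i) * phi x) - (phi (p - v i) - phi (- p - v i))| <= 2 * d.
  move=> iN; have Hi := Hphi i iN.
  have mi : measurable_fun setT (fun z : R * R => phi (z - v i)) by apply: mT; exact: T1.
  have [i1 a1] := vortex_average mi d0 (fun z hz => (Hi z hz).1).
  have mo : measurable_fun setT (fun z : R * R => phi (- z - v i)).
    by apply: mT; exact: (area_preserving_comp (T1 (- v i)) (@area_preserving_opp R)).
  have [i2 a2] := vortex_average mo d0 (fun z hz => (Hi z hz).2).
  have E1 x : vortex (x + v i) * phi (x + v i - v i) - vortex (- (x + v i)) * phi (- - (x + v i) - v i) =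
      dipole p e w (x + v i) * phi x by rewrite opprK addrK /dipole mulrBl.
  have j1 := integ_preserving (T1 (v i)) i1; have j2 := integ_preserving (T2 (v i)) i2.
  split; first exact: integ_eq E1 (integB j1 j2).
  rewrite -(eq_iint E1) (iintB j1 j2).
  rewrite (iint_preserving (T1 (v i)) (integ_measurable i1)) (iint_preserving (T2 (v i)) (integ_measurable i2)).
  by move: a1 a2; rewrite !ler_norml => /andP[u1 u2] /andP[u3 u4]; apply/andP; split; lra.
pose F i x := if (i < N.*2.+1)%N then dipole p e w (x + v i) * phi x else 0.
have Fi i : integ (F i).
  rewrite /F; have [iN|iN] := boolP (i < N.*2.+1)%N; first by have [] := main i iN.
  by apply: integ_eq (integZ 0 (integ_bnd_supp wb)) => z; rewrite mul0r.
have EF x : \sum_(i < N.*2.+1) F i x = wave l p e w x * phi x.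
  by rewrite -E; apply: eq_bigr => i _; rewrite /F ltn_ord.
have [_ S] := iint_sum N.*2.+1 Fi.
rewrite -iintE -(eq_iint EF) S /symsum -!sumrB.
apply: le_trans (ler_norm_sum _ _ _) _.
apply: le_trans (_ : \sum_(i < N.*2.+1) 2 * d <= _); last by rewrite sumr_const card_ord [leRHS]mulr_natl.
apply: ler_sum => i _; rewrite /F ltn_ord; exact: (main i (ltn_ord i)).2.
Qed.

End test_functions.

(** The radius does not depend on w, which varies with the scale: only the continuity of phi at
    finitely many points is used. *)
Lemma wave_weak (R : realType) (l : R) (p : (R * R)%type) (phi : R * R -> R) (d : R) : 0 < l ->
  test_function phi -> 0 < d -> exists2 r : R, 0 < r &
    forall e w, 0 < e < r -> bnd_supp 2 1 w -> (forall y, 0 <= w y) -> 0 < iint w ->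
    `|\int[@area R]_x (wave l p e w x * phi x) - (dirac_comb l p phi - dirac_comb l (- p) phi)| <= d.
Proof.
move=> l0 tphi d0; have [X phi0] := test_function_bounded tphi.
have [N HN] := period_far (`|X| + (2 + enorm p)) l0.
have n0 : 0 < N.*2.+1%:R :> R by rewrite ltr0n.
pose d' := d / (N.*2.+1%:R * 2); have d'0 : 0 < d' by rewrite divr_gt0// mulr_gt0.
have [pc _] := tphi.
have cont (u : R * R) : exists2 r : R, 0 < r & forall z, enorm (z - u) < r -> `|phi z - phi u| <= d'.
  have /cvgrPdist_le/(_ _ d'0)/nbhs_enormP[r r0 Hr] := pc u.
  by exists r => // z zu; rewrite distrC; exact: Hr.
pose v (i : nat) : R * R := period l (i%:Z - N%:Z).
pose Q (i : nat) (e : R) := forall z, enorm (z - p) <= 2 * e ->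
  `|phi (z - v i) - phi (p - v i)| <= d' /\ `|phi (- z - v i) - phi (- p - v i)| <= d'.
have HQ i : exists2 r, 0 < r & forall e, 0 < e < r -> Q i e.
  have [r1 r10 H1] := cont (p - v i); have [r2 r20 H2] := cont (- p - v i).
  exists (Num.min r1 r2 / 2); first by rewrite divr_gt0// lt_min r10.
  move=> e /andP[e0 er] z ze; have : enorm (z - p) < Num.min r1 r2 by linarith.
  rewrite lt_min => /andP[z1 z2]; split.
    by apply: H1; rewrite opprB addrA subrK.
  by apply: H2; rewrite opprB opprK addrA subrK addrC enormBC.
have [r r0 Hr] := finite_radius N.*2.+1 HQ.
exists (Num.min r 1); first by rewrite lt_min r0 ltr01.
move=> e w /andP[e0]; rewrite lt_min => /andP[er e1] wb w0 m0.
have Qe := Hr e (introT andP (conj e0 er)).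
have h := @wave_average R l p e w e0 wb w0 m0 phi X N d' tphi phi0 (ltW d'0) e1 HN Qe.
apply: le_trans h _.
rewrite /d' le_eqVlt; apply/orP; left; apply/eqP; field; exact: lt0r_neq0.
Qed.

(** * Existence at one scale, with the travelling speed *)

Section existence.
Context {R : realType}.
Variables (s l : R) (p : (R * R)%type).
Hypotheses (hs : 0 < s <= 1) (l0 : 0 < l) (hp : - (l / 2) < p.2 < 0).
Notation dkap := (dkap s).
Implicit Types (e : R) (S x : (R * R)%type).

Lemma perpZ (c : R) x : perp (c *: x) = c *: perp x.
Proof. by apply: pair_ext; rewrite /= /GRing.scale/=; ring. Qed.

Lemma speed_sum_flux N : speed_sum s l p (- p) N = perp (\sum_(j < N.+1) paired (flux s l (p + p)) j).
Proof.
rewrite -symsum_paired /speed_sum /symsum opprK.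
rewrite (big_morph (@perp R) (id1 := 0) (op1 := +%R)); first last.
- by rewrite /perp /= oppr0.
- by move=> x y; rewrite /perp /= opprD.
apply: eq_bigr => i _; rewrite /flux /Phi dkapE -enorm_sqr -powR_mulrn ?enorm_ge0// -powRrM.
set r := enorm _; have -> : 2%:R * (s - 2) = - (4 - 2 * s) by ring.
by rewrite powRN perpZ.
Qed.

Lemma enorm_perp x : enorm (perp x) = enorm x.
Proof. by rewrite /enorm /dotp /perp /=; congr Num.sqrt; ring. Qed.

Lemma perpB x y : perp (x - y) = perp x - perp y.
Proof. by rewrite /perp /= opprD. Qed.

Lemma scale_dkap e : 0 < e -> (e ^+ 2) `^ (s - 1) * dkap (e ^- 2) = e ^+ 2.
Proof.
move=> e0; have e20 : 0 < e ^+ 2 by rewrite exprn_gt0.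
rewrite dkapE -powR_inv1 ?(ltW e20)// -powRrM -powRD ?(gt_eqF e20) ?implybT//.
by have -> : s - 1 + -1 * (s - 2) = 1 by [ring]; rewrite powRr1// ltW.
Qed.

(** The true order is e^(4 - 2 s); the bound e is enough for the size of the perturbation and of the
    speed error. *)
Lemma dkap_small e : 0 < e -> e <= 1 -> dkap (e ^- 2) <= e.
Proof.
move=> e0 e1; have e20 : 0 < e ^+ 2 by rewrite exprn_gt0.
apply: le_trans (dkap_le_inv hs _) _; first by rewrite invf_ge1// expr_le1 ?(ltW e0).
by rewrite invrK expr2 ler_piMl// ltW.
Qed.

(** In the main part of the speed the powers of e and the mass of w cancel exactly, by [scale_dkap]
    and [calC_kernel]. The error is the term of the drift b alone, and the lower bound on the mass
    makes it O(e). *)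
Lemma vortex_pair : exists S, speed_sum s l p (- p) N @[N --> \oo] --> perp S /\
  exists e0 C : R, [/\ 0 < e0, 2 * e0 <= l / 2 + p.2, 0 <= C & forall e, 0 < e < e0 -> exists w U,
    [/\ bnd_supp 2 1 w, (forall y, C1at w y /\ cutoff 1 y <= w y),
       travelling_wave s l (wave l p e w) U & enorm (U - calC s *: perp S) <= C * e]].
Proof.
have g0 := gap_gt0 hp; have gV := gap_period l0 hp; have gT := gap_dipole hp.
have [S [cS dS]] := lattice_flux hs g0 gT; exists S; split.
  rewrite (_ : speed_sum s l p (- p) = fun N => perp (\sum_(j < N.+1) paired (flux s l (p + p)) j)).
    move=> A /nbhs_enormP[r r0 rA]; have /cS : nbhs S [set x | enorm (x - S) < r] by apply/nbhs_enormP; exists r.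
    move=> [N0 _ h]; exists N0 => // N NN; apply: rA; rewrite -perpB enorm_perp; exact: h.
  by apply/funext => N; exact: speed_sum_flux.
have [eta0 [C [eta00 C0 H]]] := core_vortex hs.
pose F := 40 * far_const s (gap l p).
have F0 : 0 <= F by rewrite mulr_ge0 ?far_const_ge0.
have F1 : 0 < F + 1 by rewrite ltr_wpDl.
have M0 : 0 < iint (cutoff 1 : R * R -> R) := cutoff_mass_gt0.
pose E0 := Num.min (Num.min 1 (gap l p / 10)) (Num.min ((l / 2 + p.2) / 2) (eta0 / (F + 1))).
have p2 : 0 < l / 2 + p.2 by move/andP: hp => [*]; linarith.
exists E0, (`|kernel_coef s| * C * F / iint (cutoff 1 : R * R -> R)).
have E0p : 0 < E0 by rewrite !lt_min ltr01 !divr_gt0.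
have E3 : E0 <= (l / 2 + p.2) / 2 by rewrite !ge_min lexx !orbT.
split => //; first by linarith.
  by rewrite divr_ge0 ?(ltW M0)// mulr_ge0// mulr_ge0.
move=> e /andP[e0 eE]; move: (eE); rewrite !lt_min => /andP[/andP[e1 e2] /andP[e3 e4]].
have Ee := dkap_small e0 (ltW e1).
have E10 : 10 * e <= gap l p by linarith.
have pert := field_perturbation hs e0 g0 gV gT E10 dS.
have etale : F * dkap (e ^- 2) <= eta0.
  move: e4; rewrite ltr_pdivlMr// => e4; have := ler_wpM2l F0 Ee; linarith.
have [w [b [wb wL wC hb crit]]] := H _ _ pert etale.
have wp y : 0 <= w y by apply: le_trans (cutoff_ge0 1 y) _; case: (wC y).
have mM : iint (cutoff 1) <= iint w.
  apply: le_iint; [exact: integrable_cutoff|exact: integ_bnd_supp wb|by move=> z; case: (wC z)].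
have m0 : 0 < iint w by exact: lt_le_trans mM.
exists w, (drift s e w ((2 * iint w * (dkap (e ^- 2) * e^-1)) *: S) b); split => //.
  by apply: wave_traveling => //; linarith.
have -> : drift s e w ((2 * iint w * (dkap (e ^- 2) * e^-1)) *: S) b - calC s *: perp S =
   - perp ((stream_coef s e w * e^-1) *: b).
  have en : e != 0 by rewrite gt_eqF.
  have mn : iint w != 0 by rewrite gt_eqF.
  rewrite /drift scalerBr perpB scalerA addrAC !perpZ.
  rewrite (_ : stream_coef s e w * e^-1 * _ = calC s) ?subrr ?sub0r//.
  rewrite calC_kernel /stream_coef; have := scale_dkap e0.
  set X := _ `^ _; set Y := dkap _ => XY.
  transitivity (2 * kernel_coef s * (X * Y) / e ^+ 2); first by field; apply/andP.
  by rewrite XY mulfK// expf_neq0.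
rewrite enormN enorm_perp enormZ.
have XY := scale_dkap e0; set X := _ `^ _ in XY; set Y := dkap _ in XY hb Ee.
have X0 : 0 < X by rewrite powR_gt0// exprn_gt0.
have cf : `|stream_coef s e w * e^-1| = `|kernel_coef s| * X / iint w / e.
  by rewrite /stream_coef !normrM !normfV (gtr0_norm m0) (gtr0_norm e0) (gtr0_norm X0).
rewrite cf; apply: le_trans (_ : `|kernel_coef s| * X / iint w / e * (C * (F * Y)) <= _).
  by rewrite ler_wpM2l// !mulr_ge0 ?invr_ge0 ?(ltW m0) ?(ltW e0) ?(ltW X0).
have en : e != 0 by rewrite gt_eqF.
have mn : iint w != 0 by rewrite gt_eqF.
have -> : `|kernel_coef s| * X / iint w / e * (C * (F * Y)) = `|kernel_coef s| * C * F * (X * Y / e) / iint w.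
  by field; apply/andP.
rewrite XY expr2 mulfK// [leRHS]mulrAC; clear -F0 C0 e0 m0 M0 mM; clearbody F.
by rewrite ler_wpM2l ?lef_pV2 ?posrE// !mulr_ge0// ltW.
Qed.

End existence.

Lemma closed_ball_enorm (R : realType) (z : R * R) (r : R) : closed [set x | enorm (x - z) <= r].
Proof.
move=> x /= cx; rewrite leNgt; apply/negP => h.
have d0 : 0 < enorm (x - z) - r by rewrite subr_gt0.
have [y [/= y1 y2]] := cx _ (near_enorm x d0).
by have := ler_enorm_distD y x z; rewrite (enormBC x y); linarith.
Qed.

Lemma supp_sub_disc (R : realType) (f : R * R -> R) (z : R * R) (r L : R) : r < L ->
  (forall x, f x != 0 -> enorm (x - z) <= r) -> supp f `<=` disc L z.
Proof.
move=> rL H x fx; apply: le_lt_trans rL; apply: (@closed_ball_enorm _ z r).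
by apply: closureS fx => y /=; exact: H.
Qed.

Theorem theorem1p5 (R : realType) (s l d a : R)
    (hs : 0 < s <= 1) (hl : 0 < l) (hd : 0 <= d) (ha : 0 < a < l / 2)
    (p q : (R * R)%type) (hp : p = (- d, - a)) (hq : q = (d, a)) :
  exists tau : R, 1 < tau <= 2 /\
  forall sigma : R -> R,
    (forall e, 0 < e -> 0 < sigma e) ->
    (exists C, 0 < C /\ \forall e \near 0^'+, sigma e / e <= C) ->
    (e `^ tau / sigma e @[e --> 0^'+] --> (0 : R)) ->
  exists e0 L : R, [/\ 0 < e0, 0 < L &
  exists (theta0 theta1 theta2 : R -> (R * R)%type -> R)
         (U : R -> (R * R)%type),
  [/\ forall e, 0 < e < e0 ->
        [/\ C1 (theta0 e), C1 (theta1 e) & C1 (theta2 e)] /\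
        [/\ travelling_wave s l (theta0 e) (U e),
            periodic2 l (theta0 e),
            forall x, theta0 e x =
              periodize l (theta1 e) x - periodize l (theta2 e) x,
            supp (theta1 e) `<=` disc (L * e) p &
            supp (theta2 e) `<=` disc (L * sigma e) q],
      exists S : (R * R)%type,
        (speed_sum s l p q N @[N --> \oo] --> S) /\
        (U e - calC s *: S @[e --> 0^'+] --> (0 : (R * R)%type)) &
      forall phi : (R * R)%type -> R, test_function phi ->
        \int[@area R]_x (theta0 e x * phi x) @[e --> 0^'+] -->
        dirac_comb l p phi - dirac_comb l q phi]].
Proof.
have -> : q = - p by rewrite hp hq; apply: pair_ext; rewrite /= opprK.
have p2 : - (l / 2) < p.2 < 0 by move: ha; rewrite hp /= => /andP[a0 a1]; apply/andP; split; linarith.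
exists 2; split; first by rewrite ltr1n lexx.
move=> sigma s0 _ _.
have [S [cS [e0 [C [e00 e0l C0 H]]]]] := vortex_pair hs hl p2.
(* The vorticities live on closed discs of radius 2 r e; the constant 3 leaves room for the closure
   in an open disc. *)
exists e0, 3; split => //.
pose r e := Num.min e (sigma e).
have r0 e : 0 < e -> 0 < r e by move=> ep; rewrite lt_min ep s0.
have re e : r e <= e by rewrite ge_min lexx.
have rs e : r e <= sigma e by rewrite ge_min lexx orbT.
(* Vortex and speed are selected as functions of e, with the value 0 outside ]0, e0[. *)
have /choice[wU HwU] : forall e, exists wU : (R * R -> R) * (R * R), 0 < e < e0 ->
    [/\ bnd_supp 2 1 wU.1, (forall y, C1at wU.1 y /\ cutoff 1 y <= wU.1 y),
       travelling_wave s l (wave l p (r e) wU.1) wU.2 & enorm (wU.2 - calC s *: perp S) <= C * e].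
  move=> e; have [/andP[ep ee]|h] := boolP (0 < e < e0); last by exists (fun=> 0, 0); move=> he; case/negP: h.
  have [|w [U [w1 w2 w3 w4]]] := H (r e).
    by rewrite r0//= (le_lt_trans (re e)).
  exists (w, U) => _; split => //; apply: le_trans w4 _; by rewrite ler_wpM2l.
have mass e : 0 < e < e0 -> 0 < iint (wU e).1 /\ forall y, 0 <= (wU e).1 y.
  move=> he; have [w1 w2 _ _] := HwU e he; split.
    apply: lt_le_trans (@cutoff_mass_gt0 R) _; apply: le_iint; [exact: integrable_cutoff|exact: integ_bnd_supp w1|].
    by move=> z; case: (w2 z).
  by move=> y; apply: le_trans (cutoff_ge0 1 y) _; case: (w2 y).
exists (fun e => wave l p (r e) (wU e).1), (fun e => vortex p (r e) (wU e).1),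
  (fun e => antivortex p (r e) (wU e).1), (fun e => (wU e).2); split.
- move=> e he; have [w1 w2 w3 _] := HwU e he; have ep : 0 < e by case/andP: he.
  have vs x : vortex p (r e) (wU e).1 x != 0 -> enorm (x - p) <= 2 * r e by exact: (vortex_supp (r0 e ep) w1).
  split; first by apply: C1_wave => //; [exact: r0|move=> y; case: (w2 y)].
  split => //.
  + by move=> x; rewrite /wave !periodize_shift.
  + apply: supp_sub_disc vs; have := re e; have := r0 e ep; linarith.
  + apply: (@supp_sub_disc _ _ _ (2 * r e)); first by have := rs e; have := r0 e ep; linarith.
    by move=> x /vs; rewrite -opprD enormN opprK.
- exists (perp S); split => //.
  move=> A /nbhs_enormP[d' d'0 dA].
  have C1 : 0 < C + 1 by rewrite ltr_wpDl.
  suff : \forall e \near 0^'+, A ((wU e).2 - calC s *: perp S) by [].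
  near=> e; apply: dA; rewrite subr0.
  have ep : 0 < e by near: e; exact: nbhs_right_gt.
  have ee : e < e0 by near: e; exact: nbhs_right_lt.
  have ed : e < d' / (C + 1) by near: e; apply: nbhs_right_lt; exact: divr_gt0.
  have [_ _ _ wC] := HwU e (introT andP (conj ep ee)).
  apply: le_lt_trans wC _; move: ed; rewrite ltr_pdivlMr//; nra.
- move=> phi tphi; apply/cvgrPdist_le => d' d'0.
  have [r' r'0 Hr'] := wave_weak p hl tphi d'0.
  near=> e; rewrite distrC.
  have ep : 0 < e by near: e; exact: nbhs_right_gt.
  have ee : e < e0 by near: e; exact: nbhs_right_lt.
  have er : e < r' by near: e; exact: nbhs_right_lt.
  have he := introT andP (conj ep ee); have [w1 w2 _ _] := HwU e he; have [m1 m2] := mass e he.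
  by apply: Hr' => //; rewrite r0//= (le_lt_trans (re e)).
Unshelve. all: by end_near. Qed.
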